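(* Let $E=\mathbf R^n\times(\mathbf R^n)^*$, let $m_1,m_2$ be order functions on $E\times E^*$ and, for $(z,z^* )\in E\times E^*$, define $$m_3(z,z^* )=\int_{\Sigma(z,z^* )}m_1(x,x^* )\,m_2(y,y^* )\,dx,$$ where $\Sigma(z,z^* )$ is the affine subspace of points $(x,x^*,y,y^* )\in(E\times E^* )^2$ satisfying $$\tfrac12Jx^*-x=\tfrac12Jz^*-z,\qquad \tfrac12Jy^*+y=\tfrac12Jz^*+z,\qquad x^*+y^*=z^*,$$ parametrized by $x\in E$. Assume that $m_3(z,z^* )$ is finite for at least one $(z,z^* )$ (then $m_3$ is a well-defined order function on $E\times E^*$). Then the composition map $$\mathcal S(E)\times\mathcal S(E)\ni(a_1,a_2)\mapsto a_1\#a_2\in\mathcal S(E)$$ has a bilinear extension $$\widetilde S(m_1)\times\widetilde S(m_2)\ni(a_1,a_2)\mapsto a_1\#a_2\in\widetilde S(m_3),$$ and there is a constant $C$ independent of $a_1,a_2$ such that $$\|a_1\#a_2\|_{\widetilde S(m_3)}\le C\,\|a_1\|_{\widetilde S(m_1)}\|a_2\|_{\widetilde S(m_2)}.$$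
   Context: An order function on a finite dimensional real vector space $V$ is a function $m:V\to]0,\infty[$ for which there are $C_0>0$, $N_0\ge1$ with $m(\rho)\le C_0\langle\rho-\mu\rangle^{N_0}m(\mu)$ for all $\rho,\mu\in V$, where $\langle\rho\rangle=(1+|\rho|^2)^{1/2}$. A lattice in $V$ is the set of integer combinations of a basis. $J:E^*\to E$ maps a linear form $\ell$ on $E$ to its Hamilton field: with coordinates $(x,\xi)$ on $E$, $J\ell=(\ell'_\xi,-\ell'_x)$. Weyl composition: for $a,b\in\mathcal S(E)$, $a\#b=\big(e^{\frac i2\sigma(D_x,D_y)}a(x)b(y)\big)_{y=x}$, where (writing $(x,\xi),(y,\eta)$ for $x,y\in E$) $\sigma(D_{x,\xi},D_{y,\eta})=D_\xi\cdot D_y-D_x\cdot D_\eta$; equivalently $(a\#b)^w=a^w\circ b^w$. Symbol space: for a symbol $b$ on $E\times E^*$ its Weyl quantization is $b^wu(x)=(2\pi)^{-2n}\iint e^{i(x-y)\cdot\theta}b(\frac{x+y}2,\theta)u(y)\,dy\,d\theta$, acting on functions on $E$ (and similarly on $\mathbf R^n$, with $(2\pi)^{-n}$, for symbols on $E$). Fix a lattice $\Gamma\subset E\times E^*$ and $\chi\in\mathcal S(E\times E^* )$ with $\sum_{\gamma\in\Gamma}\chi_\gamma=1$, $\chi_\gamma(\rho)=\chi(\rho-\gamma)$. Then $\widetilde S(m)$ is the set of $a\in\mathcal S'(E)$ with $\|\chi_\gamma^wa\|_{L^2(E)}\le C\,m(\gamma)$ for all $\gamma\in\Gamma$ and some $C$;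 $\|a\|_{\widetilde S(m)}$ is the smallest such $C$. *)

(* Defs.v *)
From HB Require Import structures.
From mathcomp Require Import all_boot all_order all_algebra.
From mathcomp Require Import all_classical all_reals all_analysis.
Set Implicit Arguments.
Unset Strict Implicit.
Unset Printing Implicit Defensive.
Import Order.TTheory GRing.Theory Num.Theory.
Import numFieldNormedType.Exports.
From mathcomp Require Import complex lra.
Local Open Scope classical_set_scope.
Local Open Scope ring_scope.

(* Row vectors carry the sigma-algebra generated by the coordinates, as the
   library does for tuples. *)
Section measurable_rV.
Context {d} {T : sigmaRingType d} (n : nat).
Let coord (i : 'I_n) (v : 'rV[T]_n) : T := v ord0 i.
Let rV_set0 : g_sigma_preimage coord set0.
Proof. exact: sigma_algebra0. Qed.
Let rV_setC A : g_sigma_preimage coord A -> g_sigma_preimage coord (~` A).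
Proof. exact: sigma_algebraC. Qed.
Let rV_bigcup (F : _^nat) : (forall i, g_sigma_preimage coord (F i)) ->
  g_sigma_preimage coord (\bigcup_i (F i)).
Proof. exact: sigma_algebra_bigcup. Qed.
HB.instance Definition _ := @isMeasurable.Build (measure_tuple_display d)
  'rV[T]_n (g_sigma_preimage coord) rV_set0 rV_setC rV_bigcup.
End measurable_rV.

Lemma measurable_coord d (T : sigmaRingType d) n (i : 'I_n) :
  measurable_fun [set: 'rV[T]_n] (fun v : 'rV[T]_n => v ord0 i).
Proof.
move=> _ Y mY; rewrite setTI; apply: sub_sigma_algebra => /=.
rewrite -bigcup_seq/=; exists i => /=; first by rewrite mem_index_enum.
by exists Y => //; rewrite setTI.
Qed.

Lemma measurable_fun_rV d d' (T1 : measurableType d) (T2 : measurableType d')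
    n (f : T1 -> 'rV[T2]_n) :
  (forall i, measurable_fun [set: T1] (fun x => f x ord0 i)) ->
  measurable_fun [set: T1] f.
Proof.
move=> mf _ A mA; rewrite setTI.
suff : preimage_set_system setT f
    (g_sigma_preimage (fun (i : 'I_n) (v : 'rV[T2]_n) => v ord0 i))
    `<=` measurable.
  by apply; exists A => //; rewrite setTI.
rewrite -g_sigma_preimage_comp; apply: smallest_sub.
  exact: sigma_algebra_measurable.
move=> B; rewrite -bigcup_seq => -[i _ [C mC <-]].
exact: mf.
Qed.

(* Lebesgue measure on R^k, by recursion on k: the image of the product measure
   on R * R^k under rV_cons; on R^0 it is the unit mass at the only point. *)
Section lebesgue_rV.
Variable R : realType.

Definition rV_cons k (p : R * 'rV[R]_k) : 'rV[R]_k.+1 := row_mx p.1%:M p.2.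

Definition rV_uncons k (v : 'rV[R]_k.+1) : R * 'rV[R]_k :=
  (v ord0 ord0, \row_j v ord0 (lift ord0 j)).

Lemma rV_consK k : cancel (@rV_cons k) (@rV_uncons k).
Proof.
move=> [x v]; congr pair; first by rewrite /rV_cons mxE; case: splitP => // j _; rewrite [j]ord1 mxE eqxx mulr1n.
apply/rowP => j; rewrite !mxE; case: splitP => [i|i] /= ij.
  by case: i ij => -[].
by congr (v _ _); apply/val_inj; case: ij.
Qed.

Lemma measurable_rV_cons k : measurable_fun setT (@rV_cons k).
Proof.
apply: measurable_fun_rV => i; rewrite /rV_cons.
case: (split_ordP (m := 1) i) => j ->.
  rewrite [X in measurable_fun _ X](_ : _ = fst); first exact: measurable_fst.
  by apply/funext => p; rewrite (row_mxEl p.1%:M) [j]ord1 mxE eqxx mulr1n.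
rewrite [X in measurable_fun _ X](_ : _ = fun p : R * 'rV[R]_k => p.2 ord0 j).
  exact: (measurableT_comp (measurable_coord (T := R) j) measurable_snd).
by apply/funext => p; rewrite (row_mxEr p.1%:M).
Qed.

Lemma measurable_rV_uncons k : measurable_fun setT (@rV_uncons k).
Proof.
apply/measurable_fun_pairP; split; first exact: measurable_coord.
apply: measurable_fun_rV => i.
under eq_fun do rewrite /= mxE.
exact: measurable_coord.
Qed.

Section succ.
Variables (k : nat) (mu : {sigma_finite_measure set 'rV[R]_k -> \bar R}).

Definition lebesgue_rV_succ :=
  pushforward (@lebesgue_measure R \x mu)%E (@rV_cons k).

Let mcons A : measurable A -> measurable (@rV_cons k @^-1` A).
Proof. by move=> mA; rewrite -[X in measurable X]setTI; exact: measurable_rV_cons. Qed.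

Let succ0 : lebesgue_rV_succ set0 = 0%E.
Proof. by rewrite /lebesgue_rV_succ /pushforward preimage_set0 measure0. Qed.

Let succ_ge0 A : (0 <= lebesgue_rV_succ A)%E.
Proof.
rewrite /lebesgue_rV_succ /pushforward.
exact: (@measure_ge0 _ _ _ (@lebesgue_measure R \x mu)%E).
Qed.

Let succ_sigma_additive : semi_sigma_additive lebesgue_rV_succ.
Proof.
move=> F mF tF mUF; rewrite /lebesgue_rV_succ /pushforward preimage_bigcup.
apply: measure_semi_sigma_additive => [i||]; first exact: mcons.
- apply/trivIsetP => /= i j _ _ ij; rewrite -preimage_setI.
  by move/trivIsetP : tF => /(_ _ _ _ _ ij) ->//; rewrite preimage_set0.
- by rewrite -preimage_bigcup; exact: mcons.
Qed.

HB.instance Definition _ := isMeasure.Build _ _ _ lebesgue_rV_succ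
  succ0 succ_ge0 succ_sigma_additive.

Let sigma_finite_succ : sigma_finite setT lebesgue_rV_succ.
Proof.
have /sigma_finiteP[F [TF ndF Foo]] :=
  sigma_finiteT [the {sigma_finite_measure set _ -> \bar R} of @lebesgue_measure R].
have /sigma_finiteP[G [TG ndG Goo]] := sigma_finiteT mu.
exists (fun i => @rV_uncons k @^-1` (F i `*` G i)).
  rewrite -preimage_bigcup; apply/seteqP; split => // v _.
  have : (\bigcup_i F i) (rV_uncons v).1 by rewrite -TF.
  have : (\bigcup_i G i) (rV_uncons v).2 by rewrite -TG.
  move=> [i _ Gi] [j _ Fj]; exists (maxn i j) => //; split.
    by move: Fj; exact/subsetPset/ndF/leq_maxr.
  by move: Gi; exact/subsetPset/ndG/leq_maxl.
move=> i; have [mF Fi] := Foo i; have [mG Gi] := Goo i; split.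
  by rewrite -[X in measurable X]setTI; apply: measurable_rV_uncons => //; exact: measurableX.
rewrite /lebesgue_rV_succ /pushforward -comp_preimage.
rewrite (_ : _ \o _ = id) ?preimage_id; last first.
  by apply/funext => p /=; rewrite rV_consK.
by rewrite product_measure1E// lte_mul_pinfty// ge0_fin_numE.
Qed.

HB.instance Definition _ :=
  Measure_isSigmaFinite.Build _ _ _ lebesgue_rV_succ sigma_finite_succ.

End succ.

Fixpoint lebesgue_rV k : {sigma_finite_measure set 'rV[R]_k -> \bar R} :=
  if k is k'.+1 then lebesgue_rV_succ (lebesgue_rV k')
  else @dirac _ 'rV[R]_0 0 R.

End lebesgue_rV.

Local Open Scope complex_scope.
Section complex_analysis.
Variable R : realType.
Local Notation C := R[i].

(* exp(i t) *)
Definition expi (t : R) : C := cos t +i* sin t.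

Definition dotv k (x y : 'rV[R]_k) : R := \sum_i x ord0 i * y ord0 i.

Definition japanese k (x : 'rV[R]_k) : R := Num.sqrt (1 + dotv x x).

Definition cintegral k (f : 'rV[R]_k -> C) : C :=
  (\int[lebesgue_rV R k]_x Re (f x)) +i* (\int[lebesgue_rV R k]_x Im (f x)).

Definition partial k (i : 'I_k) (f : 'rV[R]_k -> C) (x : 'rV[R]_k) : C :=
  ('D_(delta_mx ord0 i) (fun y => Re (f y)) x)
  +i* ('D_(delta_mx ord0 i) (fun y => Im (f y)) x).

Definition partials k (s : seq 'I_k) (f : 'rV[R]_k -> C) : 'rV[R]_k -> C :=
  foldr (@partial k) f s.

(* Real and imaginary parts of every iterated partial derivative are
   (Frechet) differentiable, which amounts to C^oo. *)
Definition smooth k (f : 'rV[R]_k -> C) : Prop :=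
  forall (s : seq 'I_k) (x : 'rV[R]_k),
    differentiable (fun y => Re (partials s f y)) x /\
    differentiable (fun y => Im (partials s f y)) x.

Definition is_schwartz k (f : 'rV[R]_k -> C) : Prop :=
  smooth f /\
  forall (s : seq 'I_k) (N : nat), exists M : R,
    forall x, japanese x ^+ N * Normc.normc (partials s f x) <= M.

Definition schwartz_pred k : {pred 'rV[R]_k -> C} :=
  [pred f | `[< is_schwartz f >]].

Lemma Re_linear (c u v : C) :
  Re (c *: u + v) = Re c * Re u - Im c * Im u + Re v.
Proof. by case: c u v => [? ?] [? ?] [? ?]. Qed.

Lemma Im_linear (c u v : C) :
  Im (c *: u + v) = Re c * Im u + Im c * Re u + Im v.
Proof. by case: c u v => [? ?] [? ?] [? ?]. Qed.

Lemma partials_linear k (c : C) (f g : 'rV[R]_k -> C) s :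
  smooth f -> smooth g ->
  partials s (c *: f + g) = c *: partials s f + partials s g.
Proof.
move=> sf sg; elim: s => [//|i s IH] /=; rewrite {}IH; apply/funext => x.
have [fr fi] := sf s x; have [gr gi] := sg s x.
move: fr fi gr gi => /diff_derivable fr /diff_derivable fi.
move=> /diff_derivable gr /diff_derivable gi.
have ReE : (fun y => Re ((c *: partials s f + partials s g) y)) =
    (Re c *: (fun y => Re (partials s f y)) -
     Im c *: (fun y => Im (partials s f y))) + (fun y => Re (partials s g y)).
  by apply/funext => y; rewrite Re_linear.
have ImE : (fun y => Im ((c *: partials s f + partials s g) y)) =
    (Re c *: (fun y => Im (partials s f y)) +
     Im c *: (fun y => Re (partials s f y))) + (fun y => Im (partials s g y)).
  by apply/funext => y; rewrite Im_linear.
rewrite /partial ReE ImE !fctE /partial.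
rewrite deriveD//; last by apply: derivableB; exact: derivableZ.
rewrite deriveB; [|exact: derivableZ..].
rewrite deriveD//; last by apply: derivableD; exact: derivableZ.
rewrite deriveD; [|exact: derivableZ..].
rewrite !deriveZ//.
by case: c {ReE ImE} => a b.
Qed.

Lemma smooth_linear k (c : C) (f g : 'rV[R]_k -> C) :
  smooth f -> smooth g -> smooth (c *: f + g).
Proof.
move=> sf sg s x; rewrite partials_linear//.
have [fr fi] := sf s x; have [gr gi] := sg s x.
have ReE : (fun y => Re ((c *: partials s f + partials s g) y)) =
    (Re c *: (fun y => Re (partials s f y)) -
     Im c *: (fun y => Im (partials s f y))) + (fun y => Re (partials s g y)).
  by apply/funext => y; rewrite Re_linear.
have ImE : (fun y => Im ((c *: partials s f + partials s g) y)) =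
    (Re c *: (fun y => Im (partials s f y)) +
     Im c *: (fun y => Re (partials s f y))) + (fun y => Im (partials s g y)).
  by apply/funext => y; rewrite Im_linear.
rewrite ReE ImE; split; apply: differentiableD => //.
  by apply: differentiableB; exact: differentiableZ.
by apply: differentiableD; exact: differentiableZ.
Qed.

Lemma is_schwartz0 k : is_schwartz (0 : 'rV[R]_k -> C).
Proof.
have p0 s : partials s (0 : 'rV[R]_k -> C) = 0.
  elim: s => [//|i s IH] /=; rewrite IH; apply/funext => x.
  by rewrite /partial !derive_cst.
split=> [s x|s N].
  by rewrite p0; split; exact: differentiable_cst.
by exists 0 => x; rewrite p0 [Normc.normc _]Normc.normc0 mulr0.
Qed.

Lemma schwartz_submod k : submod_closed (@schwartz_pred k).
Proof.
split=> [|c f g]; first by apply/asboolP; exact: is_schwartz0.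
rewrite !inE => -[sf bf] [sg bg]; split; first exact: smooth_linear.
move=> s N; have [A fA] := bf s N; have [B gB] := bg s N.
exists (Normc.normc c * A + B) => x; rewrite partials_linear//.
have jN : 0 <= japanese x ^+ N by rewrite exprn_ge0// sqrtr_ge0.
apply: (le_trans (ler_wpM2l jN (le_normcD _ _))).
rewrite mulrDr lerD// Normc.normcM mulrCA ler_wpM2l//.
by case: c {f g sf bf sg bg fA gB} => a b; exact: sqrtr_ge0.
Qed.
HB.instance Definition _ k := GRing.isSubmodClosed.Build C ('rV[R]_k -> C)
  (@schwartz_pred k) (@schwartz_submod k).

Record schwartz k := Schwartz {
  schwartz_fun :> 'rV[R]_k -> C;
  schwartz_funP : schwartz_fun \in @schwartz_pred k }.

HB.instance Definition _ k := [isSub for @schwartz_fun k].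
HB.instance Definition _ k := [Choice of schwartz k by <:].
HB.instance Definition _ k := [SubChoice_isSubLmodule of schwartz k by <:].

Definition schwartz_norm k (N : nat) (f : 'rV[R]_k -> C) : R :=
  sup [set r | exists (s : seq 'I_k) x, (size s <= N)%N /\
                 r = japanese x ^+ N * Normc.normc (partials s f x)].

(* Elements of S'(R^k) are the u : schwartz k -> C such that tempered u. *)
Definition tempered k (u : schwartz k -> C) : Prop :=
  scalar u /\
  exists (N : nat) (M : R), forall f, Normc.normc (u f) <= M * schwartz_norm N f.

(* The embedding of functions into distributions. *)
Definition distr_of k (f : 'rV[R]_k -> C) : schwartz k -> C :=
  fun phi => cintegral (fun x => f x * phi x).

Definition fourier k (f : 'rV[R]_k -> C) (xi : 'rV[R]_k) : C :=
  cintegral (fun x => expi (- dotv x xi) * f x).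

Definition inv_fourier k (g : 'rV[R]_k -> C) (x : 'rV[R]_k) : C :=
  ((2 * pi) ^- k)%:C * cintegral (fun xi => expi (dotv x xi) * g xi).

(* p(D) with D = -i d/dx *)
Definition fourier_multiplier k (p : 'rV[R]_k -> C) (f : 'rV[R]_k -> C) :=
  inv_fourier (fun xi => p xi * fourier f xi).

(* On covectors; symplectic (D_x, D_xi) (D_y, D_eta) reads
   D_xi.D_y - D_x.D_eta. *)
Definition symplectic n (X Y : 'rV[R]_(n + n)) : R :=
  dotv (rsubmx X) (lsubmx Y) - dotv (lsubmx X) (rsubmx Y).

(* exp((i/2) sigma(D_x, D_y)) acts on (x, y) |-> a(x) b(y) as a Fourier
   multiplier on E * E, followed by restriction to the diagonal. *)
Definition weyl_comp n (a b : 'rV[R]_(n + n) -> C) (X : 'rV[R]_(n + n)) : C :=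
  fourier_multiplier
    (fun Z : 'rV[R]_((n + n) + (n + n)) =>
       expi (2^-1 * symplectic (lsubmx Z) (rsubmx Z)))
    (fun Z => a (lsubmx Z) * b (rsubmx Z)) (row_mx X X).

(* Distribution kernel of b^w, b being a symbol on R^k and its dual. *)
Definition weyl_kernel k (b : 'rV[R]_(k + k) -> C) (x y : 'rV[R]_k) : C :=
  ((2 * pi) ^- k)%:C *
  cintegral (fun theta : 'rV[R]_k =>
    expi (dotv (x - y) theta) * b (row_mx (2^-1 *: (x + y)) theta)).

(* For b in S, weyl_kernel b x is in S, and b^w u, for u a tempered
   distribution, is the function whose value at x is the pairing of u with
   weyl_kernel b x; for u = distr_of f this is the usual double integral. The
   default 0 of insubd is thus never reached. *)
Definition weyl_quant k (b : 'rV[R]_(k + k) -> C) (u : schwartz k -> C)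
    (x : 'rV[R]_k) : C :=
  u (insubd (0 : schwartz k) (weyl_kernel b x)).

Definition L2norm k (f : 'rV[R]_k -> C) : \bar R :=
  Lnorm (lebesgue_rV R k) 2%:E (fun x => (Normc.normc (f x))%:E).

Definition order_function k (m : 'rV[R]_k -> R) : Prop :=
  (forall rho, 0 < m rho) /\
  exists C0 N0 : R, [/\ 0 < C0, 1 <= N0 &
    forall rho mu, m rho <= C0 * japanese (rho - mu) `^ N0 * m mu].

(* The rows of b form the basis. *)
Definition is_lattice k (G : set 'rV[R]_k) : Prop :=
  exists2 b : 'M[R]_k, row_free b &
    G = [set v | exists z : 'rV[int]_k, v = map_mx intr z *m b].

(* Unconditional summation. *)
Definition has_sum (I : choiceType) (D : set I) (f : I -> C) (l : C) : Prop :=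
  forall e : R, 0 < e -> exists A : set I,
    [/\ finite_set A, A `<=` D & forall B, finite_set B -> A `<=` B ->
      B `<=` D -> Normc.normc (\sum_(i \in B) f i - l) < e].

Section symbol_space.
Variables (k : nat) (G : set 'rV[R]_(k + k)) (chi : 'rV[R]_(k + k) -> C).

Definition Stilde_bound (m : 'rV[R]_(k + k) -> R) (a : schwartz k -> C) (M : R) :=
  forall g, G g ->
    (L2norm (weyl_quant (fun rho => chi (rho - g)) a) <= (M * m g)%:E)%E.

Definition Stilde (m : 'rV[R]_(k + k) -> R) : set (schwartz k -> C) :=
  [set a | tempered a /\ exists M, Stilde_bound m a M].

Definition Stilde_norm (m : 'rV[R]_(k + k) -> R) (a : schwartz k -> C) : R :=
  inf [set M | Stilde_bound m a M].

End symbol_space.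

(* J from E^* to E. A linear form on E is identified with the row of its
   coefficients (l'_x, l'_xi), so that the pairing is dotv. *)
Definition hamilton n (l : 'rV[R]_(n + n)) : 'rV[R]_(n + n) :=
  row_mx (rsubmx l) (- lsubmx l).

Lemma hamiltonK n (l : 'rV[R]_(n + n)) : hamilton (hamilton l) = - l.
Proof. by rewrite /hamilton row_mxKl row_mxKr -opp_row_mx hsubmxK. Qed.

Lemma hamiltonD n (l l' : 'rV[R]_(n + n)) :
  hamilton (l + l') = hamilton l + hamilton l'.
Proof. by rewrite /hamilton add_row_mx !linearD. Qed.

Lemma hamiltonZ n (c : R) (l : 'rV[R]_(n + n)) :
  hamilton (c *: l) = c *: hamilton l.
Proof. by rewrite /hamilton scale_row_mx !linearZ /= scalerN. Qed.

Lemma hamiltonN n (l : 'rV[R]_(n + n)) : hamilton (- l) = - hamilton l.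
Proof. by rewrite -scaleN1r hamiltonZ scaleN1r. Qed.

Section Sigma.
Variable n : nat.
Local Notation E := 'rV[R]_(n + n).

Definition Sigma (z zs : E) (x xs y ys : E) : Prop :=
  [/\ 2^-1 *: hamilton xs - x = 2^-1 *: hamilton zs - z,
      2^-1 *: hamilton ys + y = 2^-1 *: hamilton zs + z &
      xs + ys = zs].

(* The triple (xs, y, ys) of the point of Sigma z zs lying over x; it exists and
   is unique by Sigma_atE. *)
Definition Sigma_at (z zs x : E) : E * E * E :=
  get [set p : E * E * E | Sigma z zs x p.1.1 p.1.2 p.2].

Lemma SigmaP z zs x xs y ys : Sigma z zs x xs y ys <->
  [/\ xs = zs - 2 *: hamilton (x - z), y = x + 2^-1 *: hamilton zs &
      ys = 2 *: hamilton (x - z)].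
Proof.
split=> [[e1 e2 e3]|[-> -> ->]].
  have exs : hamilton xs = 2 *: (x - z) + hamilton zs.
    move: e1; move: (hamilton xs) (hamilton zs) => u v /rowP e1.
    by apply/rowP => i; move: (e1 i); rewrite !mxE; lra.
  have {e1}exs : xs = zs - 2 *: hamilton (x - z).
    apply: oppr_inj; rewrite -[LHS]hamiltonK exs [LHS]hamiltonD hamiltonZ hamiltonK.
    by rewrite opprB.
  have eys : ys = 2 *: hamilton (x - z).
    by rewrite -[LHS](addKr xs) e3 exs opprB addrNK.
  split=> //; move: e2; rewrite eys hamiltonZ hamiltonK.
  move: (hamilton zs) => v /rowP e2.
  by apply/rowP => i; move: (e2 i); rewrite !mxE; lra.
have := hamiltonK (x - z); move: (hamilton (x - z)) => w ew.
rewrite /Sigma hamiltonD hamiltonN !hamiltonZ ew; move: (hamilton zs) => v.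
by split; [| |by rewrite subrK]; apply/rowP => i; rewrite !mxE; lra.
Qed.

Lemma Sigma_atE z zs x : Sigma_at z zs x =
  (zs - 2 *: hamilton (x - z), x + 2^-1 *: hamilton zs, 2 *: hamilton (x - z)).
Proof.
rewrite /Sigma_at; apply: get_unique => /=; first exact/SigmaP.
by move=> [[xs y] ys] /= /SigmaP[-> -> ->].
Qed.

(* The integral of a nonnegative function is the supremum of the integrals of
   the simple functions below it, so this makes sense even if m1 or m2 is not
   measurable (order functions need not be). *)
Definition m3 (m1 m2 : 'rV[R]_((n + n) + (n + n)) -> R)
    (w : 'rV[R]_((n + n) + (n + n))) : \bar R :=
  (\int[lebesgue_rV R (n + n)]_x
    let: (xs, y, ys) := Sigma_at (lsubmx w) (rsubmx w) x in
    (m1 (row_mx x xs) * m2 (row_mx y ys))%:E)%E.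

End Sigma.
End complex_analysis.

(* Main.v *)
Require Import Defs.
From HB Require Import structures.
From mathcomp Require Import all_boot all_order all_algebra.
From mathcomp Require Import all_classical all_reals all_analysis.
From mathcomp Require Import measurable_realfun.
From mathcomp Require Import ring lra zify.
Set Implicit Arguments.
Unset Strict Implicit.
Unset Printing Implicit Defensive.
Import Order.TTheory GRing.Theory Num.Theory.
Import numFieldNormedType.Exports.
From mathcomp Require Import complex.
Local Open Scope classical_set_scope.
Local Open Scope ring_scope.

(** The idea is to decompose distributions into Gaussian atoms, the functions
    exp(i x.xi) exp(- |x - p|^2) centred at the points (p, xi) of phase space.

    A tempered distribution a is determined by its coefficients along the atoms:
    tempered_coef expresses a f as the integral over phase space of the short-time
    Fourier transform of f times coef a. On Schwartz functions this is an inversion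
    formula; it passes to a because its Riemann sums converge in every seminorm.

    Membership in the symbol space is a bound on the coefficients. The matrix of the
    operator with Weyl symbol chi (. - gam) between two atoms is explicit
    (weyl_matrixE): it is a value of the short-time Fourier transform of chi, so it
    decays rapidly in the distance of the two centres and in their distance to gam.
    As the translates of chi add up to 1, the localized operators add up to the
    identity up to a constant, and the coefficient of a at a point is the sum over
    the lattice of the coefficients of the localized pieces of a (coef_sum_cvg).
    The piece at gam is bounded by |a| m(gam) through its square integral norm,
    which is good near the point; far from it the decay of the matrix bounds the
    piece by a small multiple of the supremum of |coef a| / m, which is absorbed.
    Hence
    |coef a| <= C |a| m (coef_bound). Conversely, bounds on how a distribution is
    composed of atoms bound its localized pieces, because the operator localized
    at gam maps the atom at z to a function of size <z - gam>^(-M) concentrated over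
    gam (weyl_atom_bound).

    The composition of two atoms is a Gaussian integral (weyl_map_atom): with
    q1 = p1 + J xi2 / 2 and q2 = p2 - J xi1 / 2 it is, up to a phase, the atom
    centred at ((q1 + q2) / 2, xi1 + xi2 + J (q1 - q2)), multiplied by
    exp(- |q1 - q2|^2 / 4). So the extension is defined (compose) by integrating the
    coefficients of the two factors against the compositions of the atoms. For
    Schwartz functions it gives the composition back (compose_schwartz): paired with
    a test function, the composition is a tempered distribution of the tensor
    product of the factors, to which tempered_coef applies.

    The estimate follows by taking absolute values. In the coordinates z, zs, the
    difference d = q2 - q1 and the position x of the first atom, the pairs of atoms
    with d = 0 that compose to the atom at (z, zs) are the points of Sigma z zs;
    hence the integral in x is at most a power of <d> times m3 at (z, zs), and the
    integrals in d and (z, zs) converge, by the Gaussian and by the decay away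
    from gam (composition_weight). Order functions need not be measurable, so m1 and
    m2 enter only through comparisons of integrals (le_integral_scale). *)

(** * Measurability and Tonelli on row vectors *)
Section measurability.
Variable R : realType.
Implicit Types a b k : nat.

Lemma measurable_row_mx d (T : measurableType d) a b (f : T -> 'rV[R]_a)
    (g : T -> 'rV[R]_b) :
  measurable_fun setT f -> measurable_fun setT g ->
  measurable_fun setT (fun x => row_mx (f x) (g x)).
Proof.
move=> mf mg; apply: measurable_fun_rV => i.
case: (split_ordP i) => j ->.
  under eq_fun do rewrite row_mxEl.
  exact: (measurableT_comp (measurable_coord j) mf).
under eq_fun do rewrite row_mxEr.
exact: (measurableT_comp (measurable_coord j) mg).
Qed.

Lemma measurable_coord_comp d (T : measurableType d) k (f : T -> 'rV[R]_k) i :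
  measurable_fun setT f -> measurable_fun setT (fun x => f x ord0 i).
Proof. by move=> mf; exact: (measurableT_comp (measurable_coord i) mf). Qed.

Lemma measurable_lsubmx d (T : measurableType d) a b (f : T -> 'rV[R]_(a + b)) :
  measurable_fun setT f -> measurable_fun setT (fun x => lsubmx (f x)).
Proof.
move=> mf; apply: measurable_fun_rV => i; under eq_fun do rewrite mxE.
exact: measurable_coord_comp.
Qed.

Lemma measurable_rsubmx d (T : measurableType d) a b (f : T -> 'rV[R]_(a + b)) :
  measurable_fun setT f -> measurable_fun setT (fun x => rsubmx (f x)).
Proof.
move=> mf; apply: measurable_fun_rV => i; under eq_fun do rewrite mxE.
exact: measurable_coord_comp.
Qed.

Lemma measurable_rVD d (T : measurableType d) k (f g : T -> 'rV[R]_k) :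
  measurable_fun setT f -> measurable_fun setT g ->
  measurable_fun setT (fun x => f x + g x).
Proof.
move=> mf mg; apply: measurable_fun_rV => i; under eq_fun do rewrite mxE.
by apply: measurable_funD; exact: measurable_coord_comp.
Qed.

Lemma measurable_rVZ d (T : measurableType d) k c (f : T -> 'rV[R]_k) :
  measurable_fun setT f -> measurable_fun setT (fun x => c *: f x).
Proof.
move=> mf; apply: measurable_fun_rV => i; under eq_fun do rewrite mxE.
by apply: measurable_funM => //; exact: measurable_coord_comp.
Qed.

Lemma measurable_rVN d (T : measurableType d) k (f : T -> 'rV[R]_k) :
  measurable_fun setT f -> measurable_fun setT (fun x => - f x).
Proof.
move=> mf; under eq_fun do rewrite -scaleN1r; exact: measurable_rVZ.
Qed.

Lemma measurable_hamilton d (T : measurableType d) k (f : T -> 'rV[R]_(k + k)) :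
  measurable_fun setT f -> measurable_fun setT (fun x => hamilton (f x)).
Proof.
move=> mf; apply: measurable_row_mx; first exact: measurable_rsubmx.
by apply: measurable_rVN; exact: measurable_lsubmx.
Qed.

Lemma measurable_dotv d (T : measurableType d) k (f g : T -> 'rV[R]_k) :
  measurable_fun setT f -> measurable_fun setT g ->
  measurable_fun setT (fun x => dotv (f x) (g x)).
Proof.
move=> mf mg; apply: measurable_sum => i.
by apply: measurable_funM; exact: measurable_coord_comp.
Qed.

Definition cell k (j : nat) (x : 'rV[R]_k) : 'rV[int]_k :=
  \row_i Num.floor (j%:R * x ord0 i).

Definition corner k (j : nat) (z : 'rV[int]_k) : 'rV[R]_k :=
  \row_i ((z ord0 i)%:~R / j%:R).

Lemma measurable_cell k j (z : 'rV[int]_k) :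
  measurable [set x : 'rV[R]_k | cell j x = z].
Proof.
rewrite (_ : [set x | _] = \bigcap_(i in [set: 'I_k])
    [set x : 'rV[R]_k | Num.floor (j%:R * x ord0 i) = z ord0 i]); last first.
  apply/seteqP; split=> x /=; first by move=> <- i _ /=; rewrite mxE.
  by move=> H; apply/rowP => i; rewrite mxE; exact: H.
apply: fin_bigcap_measurable => // i _.
rewrite (_ : [set x | _] = (fun x : 'rV[R]_k => j%:R * x ord0 i) @^-1`
   `[(z ord0 i)%:~R, (z ord0 i + 1)%:~R[).
  rewrite -[X in measurable X]setTI.
  apply: (measurable_funM (measurable_cst _) (measurable_coord i)) => //.
apply/seteqP; split=> x /=; rewrite in_itv /=.
  by move=> <-; rewrite floor_le floorD1_gt.
by move=> H; apply/eqP; rewrite floor_eq.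
Qed.

(** There are countably many cells, and a function of the label is constant on each. *)
Lemma measurable_comp_cell d (T : measurableType d) k j (h : 'rV[int]_k -> T) :
  measurable_fun setT (fun x : 'rV[R]_k => h (cell j x)).
Proof.
move=> _ Y mY; rewrite setTI.
rewrite (_ : _ @^-1` _ =
    \bigcup_z if `[< Y (h z) >] then [set x : 'rV[R]_k | cell j x = z] else set0).
  apply: countable_bigcupT_measurable => [|z]; first exact: countableP.
  by case: ifP => _ //; exact: measurable_cell.
apply/seteqP; split=> x /=.
  by move=> Yx; exists (cell j x) => //; case: asboolP.
by move=> [z _]; case: asboolP => // Yz /= ->.
Qed.

Lemma corner_cell_dist k j (x : 'rV[R]_k) :
  `|x - corner j.+1 (cell j.+1 x)| <= j.+1%:R^-1.
Proof.
have j0 : (0 : R) < j.+1%:R by [].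
rewrite [leLHS]mx_normrE; apply: bigmax_le => [|i _]; first by rewrite invr_ge0 ltW.
rewrite !mxE (ord1 i.1); set t := x ord0 i.2.
have fl := floor_le (j.+1%:R * t); have := floorD1_gt (j.+1%:R * t).
rewrite intrD => fu.
rewrite (_ : t - _ = (j.+1%:R * t - (Num.floor (j.+1%:R * t))%:~R) / j.+1%:R).
  rewrite ger0_norm ?divr_ge0 ?subr_ge0 //.
  by rewrite ler_pdivrMr // mulVf ?gt_eqF // lerBlDl ltW.
by field.
Qed.

(** The sigma-algebra is generated by the coordinates and not by the open sets, so
    a continuous function is approached by its values at the corners of the grid. *)
Lemma continuous_rV_measurable k (f : 'rV[R]_k -> R) :
  continuous f -> measurable_fun setT f.
Proof.
move=> cf; apply: (@measurable_fun_cvg _ _ R setT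
  (fun j (x : 'rV[R]_k) => f (corner j.+1 (cell j.+1 x))) f) => //.
  move=> j; exact: (measurable_comp_cell j.+1 (fun z => f (corner j.+1 z))).
move=> x _; apply: continuous_cvg; first exact: cf.
apply/cvgrPdist_le => e e0; near=> j.
apply: (le_trans (corner_cell_dist j x)).
apply: ltW; near: j; exact: (near_infty_natSinv_lt (PosNum e0)).
Unshelve. all: by end_near. Qed.

Local Open Scope ereal_scope.

Lemma row_mx_rV_cons a b (t : R) (x : 'rV[R]_a) (y : 'rV[R]_b) :
  row_mx (rV_cons (t, x)) y = rV_cons (t, row_mx x y) :> 'rV[R]_(a.+1 + b).
Proof.
rewrite /rV_cons /=; apply/rowP => i.
rewrite mxE [RHS]mxE; case: splitP => j ij.
  rewrite mxE; case: splitP => l jl; case: splitP => m im.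
  - by rewrite [l]ord1 [m]ord1 !mxE.
  - by move: (ltn_ord l); rewrite -jl -ij im.
  - by move: (ltn_ord m); rewrite -im ij jl.
  - rewrite mxE; case: splitP => q mq; last first.
      by move: im (ltn_ord l); rewrite ij jl mq => /addnI ->; rewrite ltnNge leq_addr.
    by congr (x _ _); apply/val_inj; apply/eqP; rewrite /= -mq -(eqn_add2l 1) -im ij jl.
case: splitP => m im.
  by move: (ltn_ord m); rewrite -im ij.
rewrite mxE; case: splitP => q mq.
  by move: im (ltn_ord q); rewrite ij -mq => /(@addnI 1%N (a + j)%N m) <-; rewrite ltnNge leq_addr.
congr (y _ _); apply/val_inj; move: im; rewrite ij mq.
by move=> /(@addnI 1%N (a + j)%N (a + q)%N) /addnI.
Qed.

Lemma measurable_tonelli_inner a b (f : 'rV[R]_(a + b) -> \bar R) :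
  measurable_fun setT f -> (forall z, 0 <= f z) ->
  measurable_fun setT
    (fun x : 'rV[R]_a => \int[lebesgue_rV R b]_y f (row_mx x y)).
Proof.
move=> mf f0.
apply: (measurable_fun_fubini_tonelli_F (m2 := lebesgue_rV R b)
   (fun p : 'rV[R]_a * 'rV[R]_b => f (row_mx p.1 p.2))) => //.
apply: (measurableT_comp mf).
apply: measurable_row_mx; [exact: measurable_fst|exact: measurable_snd].
Qed.

(** By induction on the first block: the measure is built by adding one coordinate
    at a time in front. *)
Lemma tonelli_row_mx a b (f : 'rV[R]_(a + b) -> \bar R) :
  measurable_fun setT f -> (forall z, 0 <= f z) ->
  \int[lebesgue_rV R (a + b)]_z f z =
  \int[lebesgue_rV R a]_x \int[lebesgue_rV R b]_y f (row_mx x y).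
Proof.
elim: a f => [|a IH] f mf f0.
  rewrite [X in \int[X]__ _ = _]/= integral_dirac //; last first.
    exact: measurable_tonelli_inner.
  rewrite diracT mul1e; apply: eq_integral => y _; congr (f _).
  apply/rowP => i; rewrite mxE; case: splitP => [[]|] // j ij.
  by congr (y _ _); apply/val_inj.
have mcons n : measurable_fun setT (@rV_cons R n) by exact: measurable_rV_cons.
have mFx := measurable_tonelli_inner mf f0.
rewrite [X in \int[X]__ _ = _]/= /lebesgue_rV_succ.
rewrite ge0_integral_pushforward //; last exact: mcons.
rewrite preimage_setT.
rewrite [X in _ = \int[X]__ _]/= /lebesgue_rV_succ.
rewrite ge0_integral_pushforward //;
  [|exact: mcons|by move=> x _; exact: integral_ge0].
rewrite preimage_setT.
rewrite (fubini_tonelli1 (m1 := @lebesgue_measure R) (m2 := lebesgue_rV R (a + b))) //=;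
  last exact: (measurableT_comp mf (mcons _)).
rewrite (fubini_tonelli1 (m1 := @lebesgue_measure R) (m2 := lebesgue_rV R a)) //=;
  [|exact: (measurableT_comp mFx (mcons _))|by move=> x; exact: integral_ge0].
apply: eq_integral => t _; rewrite /fubini_F /=.
rewrite IH //; last first.
  apply: (measurableT_comp mf); apply: (measurableT_comp (mcons _)).
  exact: measurable_pair1.
apply: eq_integral => x _; apply: eq_integral => y _.
by rewrite -row_mx_rV_cons.
Qed.

Lemma tonelli_swap a b (f : 'rV[R]_a -> 'rV[R]_b -> \bar R) :
  measurable_fun setT (fun z : 'rV[R]_(a + b) => f (lsubmx z) (rsubmx z)) ->
  (forall x y, 0 <= f x y) ->
  \int[lebesgue_rV R a]_x \int[lebesgue_rV R b]_y f x y =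
  \int[lebesgue_rV R b]_y \int[lebesgue_rV R a]_x f x y.
Proof.
move=> mf f0.
apply: (fubini_tonelli (m1 := lebesgue_rV R a) (m2 := lebesgue_rV R b)
  (fun p => f p.1 p.2)) => //.
rewrite [X in measurable_fun _ X](_ : _ =
    (fun z : 'rV[R]_(a + b) => f (lsubmx z) (rsubmx z)) \o
    (fun p : 'rV[R]_a * 'rV[R]_b => row_mx p.1 p.2)); last first.
  by apply/funext => p /=; rewrite row_mxKl row_mxKr.
apply: (measurableT_comp mf).
apply: measurable_row_mx; [exact: measurable_fst|exact: measurable_snd].
Qed.

Lemma tonelli a b (f : 'rV[R]_a -> 'rV[R]_b -> \bar R) :
  measurable_fun setT (fun z : 'rV[R]_(a + b) => f (lsubmx z) (rsubmx z)) ->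
  (forall x y, 0 <= f x y) ->
  \int[lebesgue_rV R (a + b)]_z f (lsubmx z) (rsubmx z) =
  \int[lebesgue_rV R a]_x \int[lebesgue_rV R b]_y f x y.
Proof.
move=> mf f0; rewrite tonelli_row_mx //.
by apply: eq_integral => x _; apply: eq_integral => y _; rewrite row_mxKl row_mxKr.
Qed.

Import HBNNSimple.

(** Order functions need not be measurable, hence this comparison: it follows
    from the definition of the integral as a supremum over simple functions. *)
Lemma le_integral_scale d (T : measurableType d) (mu : {measure set T -> \bar R})
    (f g : T -> \bar R) (c : R) : (0 < c)%R ->
  (forall x, 0 <= f x) -> (forall x, f x <= c%:E * g x) ->
  \int[mu]_x f x <= c%:E * \int[mu]_x g x.
Proof.
move=> c0 f0 fg.
have g0 x : 0 <= g x.
  by have := le_trans (f0 x) (fg x); rewrite pmule_rge0.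
rewrite !ge0_integralTE //; apply: ge_ereal_sup => _ [h hf <-].
have ci0 : (0 <= c^-1)%R by rewrite invr_ge0 ltW.
rewrite -[leLHS]mul1e -(@mulfV _ c) ?gt_eqF // EFinM -muleA lee_pmul2l //.
rewrite -(sintegralrM mu c^-1 h).
have -> : (cst c^-1 \* h)%R = scale_nnsfun h ci0 by [].
apply: ereal_sup_ubound => /=.
exists (scale_nnsfun h ci0) => // x /=.
rewrite -(@lee_pmul2l _ c%:E) //; apply: le_trans (fg x).
by apply: le_trans (hf x); rewrite -EFinM lee_fin /= mulrA mulfV ?gt_eqF ?mul1r.
Qed.

End measurability.

(** * Linear changes of variables *)
Section linear_change_of_variables.
Variable R : realType.
Local Open Scope ereal_scope.

Lemma integral_affine (c t : R) (f : R -> \bar R) : c != 0%R ->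
  measurable_fun setT f -> (forall x, 0 <= f x) ->
  \int[@lebesgue_measure R]_x f (c * x + t)%R =
  (`|c|^-1)%:E * \int[@lebesgue_measure R]_x f x.
Proof.
move=> c0 mf f0; pose T (x : R) : R := (c * x + t)%R.
have mT : measurable_fun setT (T : measurableTypeR R -> measurableTypeR R).
  by apply: measurable_funD => //; exact: mulrl_measurable.
pose nu := measure_function_pushforward__canonical__measure_function_Measure
  (@lebesgue_measure R) mT.
have cp : (0 < `|c|)%R by rewrite normr_gt0.
pose sc : {nonneg R} := NngNum (ltW cp).
have key (a b : R) : mscale sc nu `]a, b]%classic = @lebesgue_measure R `]a, b]%classic.
  have [cl|cg|/eqP] := ltgtP c 0%R; last by rewrite (negbTE c0).
    rewrite (_ : mscale sc nu _ = `|c|%:E * @lebesgue_measure R `[((b - t) / c)%R, ((a - t) / c)%R[%classic).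
      rewrite !lebesgue_measure_itv /= !lte_fin ltr_ndivrMr // mulfVK //.
      rewrite ltrD2r; case: ifP => ab; last by rewrite mule0.
      by rewrite -EFinB -EFinM ltr0_norm //; congr (_%:E); field.
    rewrite /mscale; congr (_ * _); rewrite /nu /= /pushforward /T; congr (lebesgue_measure _).
    apply/seteqP; split=> x /=; rewrite !in_itv /=.
      by rewrite ler_ndivrMr // ltr_ndivlMr // lerBrDr ltrBlDr mulrC andbC.
    by rewrite ler_ndivrMr // ltr_ndivlMr // lerBrDr ltrBlDr mulrC andbC.
  rewrite (_ : mscale sc nu _ = `|c|%:E * @lebesgue_measure R `]((a - t) / c)%R, ((b - t) / c)%R]%classic).
    rewrite !lebesgue_measure_itv /= !lte_fin ltr_pdivrMr // mulfVK //.
    rewrite ltrD2r; case: ifP => ab; last by rewrite mule0.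
    by rewrite -EFinB -EFinM gtr0_norm //; congr (_%:E); field.
  rewrite /mscale; congr (_ * _); rewrite /nu /= /pushforward /T; congr (lebesgue_measure _).
    apply/seteqP; split=> x /=; rewrite !in_itv /=.
    by rewrite ltr_pdivrMr // ler_pdivlMr // lerBrDr ltrBlDr mulrC.
  by rewrite ltr_pdivrMr // ler_pdivlMr // lerBrDr ltrBlDr mulrC.
have nuE A : measurable A -> @lebesgue_measure R A = mscale sc nu A.
  by apply: lebesgue_measure_unique => _ [[a b]] _ <-; exact/esym/key.
rewrite [X in _ = _ * X](_ : _ = \int[mscale sc nu]_x f x); last first.
  by apply: eq_measure_integral => A mA _; exact: nuE.
rewrite ge0_integral_mscale // muleA -EFinM mulVf ?gt_eqF // mul1e.
by rewrite [RHS]ge0_integral_pushforward // preimage_setT.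
Qed.

Lemma integral_rVS k (f : 'rV[R]_k.+1 -> \bar R) :
  measurable_fun setT f -> (forall x, 0 <= f x) ->
  \int[lebesgue_rV R k.+1]_x f x =
  \int[@lebesgue_measure R]_t \int[lebesgue_rV R k]_x f (rV_cons (t, x)).
Proof.
move=> mf f0; have mcons : measurable_fun setT (@rV_cons R k) by exact: measurable_rV_cons.
rewrite [X in \int[X]__ _ = _]/= /lebesgue_rV_succ.
rewrite ge0_integral_pushforward //.
rewrite preimage_setT.
by rewrite (fubini_tonelli1 (m1 := @lebesgue_measure R) (m2 := lebesgue_rV R k)) //=;
  exact: (measurableT_comp mf mcons).
Qed.

Lemma measurable_rVS_inner k (f : 'rV[R]_k.+1 -> \bar R) :
  measurable_fun setT f -> (forall x, 0 <= f x) ->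
  measurable_fun setT
    (fun t : R => \int[lebesgue_rV R k]_x f (rV_cons (t, x))).
Proof.
move=> mf f0; apply: (measurable_fun_fubini_tonelli_F (m2 := lebesgue_rV R k)
   (fun p => f (rV_cons p))) => //.
by apply: (measurableT_comp mf); exact: measurable_rV_cons.
Qed.

Lemma measurable_rV_cons_pair k (t : R) :
  measurable_fun setT (fun y : 'rV[R]_k => rV_cons (t, y)).
Proof.
have mcons : measurable_fun setT (@rV_cons R k) by exact: measurable_rV_cons.
by apply: (measurableT_comp mcons); exact: measurable_pair1.
Qed.

Lemma rV_unconsK k (v : 'rV[R]_k.+1) : rV_cons (rV_uncons v) = v.
Proof.
rewrite /rV_cons /rV_uncons /=; apply/rowP => i; rewrite mxE; case: splitP => j ij.
  by rewrite [j]ord1 mxE eqxx mulr1n; congr (v _ _); apply/val_inj; rewrite /= ij [j]ord1.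
by rewrite mxE; congr (v _ _); apply/val_inj; rewrite /= ij.
Qed.

Lemma rV_cons_affine k (c t a : R) (x v : 'rV[R]_k) :
  (c *: rV_cons (t, x) + rV_cons (a, v) = rV_cons (c * t + a, c *: x + v))%R.
Proof.
rewrite /rV_cons /=; apply/rowP => i; rewrite !mxE; case: splitP => j _; rewrite !mxE //.
by rewrite mulrnAr mulrnDl.
Qed.

Lemma integral_rV_affine k (c : R) (v : 'rV[R]_k) (f : 'rV[R]_k -> \bar R) :
  c != 0%R -> measurable_fun setT f -> (forall x, 0 <= f x) ->
  \int[lebesgue_rV R k]_x f (c *: x + v)%R =
  ((`|c|^-1) ^+ k)%:E * \int[lebesgue_rV R k]_x f x.
Proof.
move=> c0; elim: k v f => [|k IH] v f mf f0.
  by rewrite expr0 mul1e; apply: eq_integral => x _; rewrite !thinmx0.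
have mfa : measurable_fun [set: 'rV[R]_k.+1] (fun x : 'rV[R]_k.+1 => f (c *: x + v)%R).
  apply: (measurableT_comp mf); apply: measurable_rVD => //.
  exact: measurable_rVZ.
rewrite (integral_rVS mfa) // (integral_rVS mf) //.
rewrite -[v]rV_unconsK; case: (rV_uncons v) => a w.
pose F t := \int[lebesgue_rV R k]_x f (rV_cons (t, x)).
have mF : measurable_fun setT F by exact: measurable_rVS_inner.
have F0 t : 0 <= F t by apply: integral_ge0.
have r0 : (0 <= `|c|^-1 ^+ k)%R by rewrite exprn_ge0 // invr_ge0.
transitivity (\int[@lebesgue_measure R]_t ((`|c|^-1 ^+ k)%:E * F (c * t + a)%R)).
  apply: eq_integral => t _; rewrite -(IH w (fun y => f (rV_cons (c * t + a, y)%R))) //.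
    by apply: eq_integral => x _; rewrite rV_cons_affine.
  exact: (measurableT_comp mf (measurable_rV_cons_pair _)).
have mFa : measurable_fun [set: R] (fun t : R => F (c * t + a)%R).
  apply: (measurableT_comp mF).
  by apply: measurable_funD => //; exact: mulrl_measurable.
rewrite (@ge0_integralZl_EFin _ _ _ (@lebesgue_measure R) _ measurableT
  (fun t => F (c * t + a)%R) (fun t _ => F0 _) mFa _ r0).
by rewrite (integral_affine a c0 mF F0) muleA -EFinM -exprSr.
Qed.

Lemma integral_rV_translate k (v : 'rV[R]_k) (f : 'rV[R]_k -> \bar R) :
  measurable_fun setT f -> (forall x, 0 <= f x) ->
  \int[lebesgue_rV R k]_x f (x + v)%R = \int[lebesgue_rV R k]_x f x.
Proof.
move=> mf f0; have := integral_rV_affine v (oner_neq0 R) mf f0.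
rewrite normr1 invr1 expr1n mul1e => <-.
by apply: eq_integral => x _; rewrite scale1r.
Qed.

(** The Hamilton map exchanges the two halves up to a sign. *)
Lemma integral_rV_hamilton k (f : 'rV[R]_(k + k) -> \bar R) :
  measurable_fun setT f -> (forall x, 0 <= f x) ->
  \int[lebesgue_rV R (k + k)]_x f (hamilton x) = \int[lebesgue_rV R (k + k)]_x f x.
Proof.
move=> mf f0.
have mg (a b : nat) d (T : measurableType d) (F : T -> 'rV[R]_a) (G : T -> 'rV[R]_b)
    (h : 'rV[R]_(a + b) -> \bar R) :
    measurable_fun setT h -> measurable_fun setT F -> measurable_fun setT G ->
    measurable_fun setT (fun t => h (row_mx (F t) (G t))).
  by move=> mh mF mG; apply: (measurableT_comp mh); exact: measurable_row_mx.
have mr : measurable_fun setT (fun z : 'rV[R]_(k + k) => rsubmx z).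
  exact: measurable_rsubmx.
have ml : measurable_fun setT (fun z : 'rV[R]_(k + k) => lsubmx z).
  exact: measurable_lsubmx.
rewrite /hamilton (tonelli (f := fun x y => f (row_mx y (- x)%R))) //; last first.
  by apply: mg => //; exact: measurable_rVN.
rewrite tonelli_swap //; last first.
  by apply: mg => //; exact: measurable_rVN.
rewrite [RHS](tonelli_row_mx mf f0); apply: eq_integral => x _.
have := @integral_rV_affine k (-1) 0 (fun y => f (row_mx x y)).
rewrite normrN1 invr1 expr1n mul1e => <- //; last first.
  by apply: mg.
by apply: eq_integral => y _; rewrite scaleN1r addr0.
Qed.

Lemma integral_rV_gt0 k (f : 'rV[R]_k -> \bar R) :
  measurable_fun setT f -> (forall x, 0 < f x) ->
  0 < \int[lebesgue_rV R k]_x f x.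
Proof.
elim: k f => [|k IH] f mf f0.
  by rewrite [X in \int[X]__ _]/= integral_dirac // diracT mul1e.
have f0' x : 0 <= f x by exact: ltW.
rewrite integral_rVS //.
have F0 t : 0 < \int[lebesgue_rV R k]_x f (rV_cons (t, x)).
  apply: IH => //; apply: (measurableT_comp mf).
  exact: measurable_rV_cons_pair.
have mF := measurable_rVS_inner mf f0'.
rewrite lt0e integral_ge0 ?andbT //; last by move=> t _; exact: ltW.
apply/eqP => I0.
have : ae_eq (@lebesgue_measure R) setT
    (fun t => \int[lebesgue_rV R k]_x f (rV_cons (t, x))) (cst 0).
  apply/ae_eq_integral_abs => //; rewrite -[RHS]I0; apply: eq_integral => t _.
  by rewrite gee0_abs // ltW.
move=> [N [mN N0 /(_ _ _) sub]].
have NT : N = setT.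
  apply/seteqP; split => // t _; apply: sub => /= /(_ I) e.
  by have := F0 t; rewrite e ltxx.
have := lebesgue_measure_itv (`]-oo, +oo[ : interval R); rewrite set_itvNyy -NT N0 /=.
by [].
Qed.

End linear_change_of_variables.

(** * The Japanese bracket *)
Section bracket.
Variable R : realType.
Local Notation jb := (@japanese R _).
Implicit Types k n : nat.

Lemma dotvv_ge0 k (x : 'rV[R]_k) : 0 <= dotv x x.
Proof. by apply: sumr_ge0 => i _; rewrite -expr2 sqr_ge0. Qed.

Lemma dotvC k (x y : 'rV[R]_k) : dotv x y = dotv y x.
Proof. by apply: eq_bigr => i _; rewrite mulrC. Qed.

Lemma dotvDl k (x y z : 'rV[R]_k) : dotv (x + y) z = dotv x z + dotv y z.
Proof. by rewrite -big_split; apply: eq_bigr => i _; rewrite /= mxE mulrDl. Qed.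

Lemma dotvZl k c (x z : 'rV[R]_k) : dotv (c *: x) z = c * dotv x z.
Proof. by rewrite /dotv mulr_sumr; apply: eq_bigr => i _; rewrite mxE mulrA. Qed.

Lemma dotvNl k (x z : 'rV[R]_k) : dotv (- x) z = - dotv x z.
Proof. by rewrite -scaleN1r dotvZl mulN1r. Qed.

Lemma dotvDr k (x y z : 'rV[R]_k) : dotv x (y + z) = dotv x y + dotv x z.
Proof. by rewrite dotvC dotvDl !(dotvC _ x). Qed.

Lemma dotvZr k c (x z : 'rV[R]_k) : dotv x (c *: z) = c * dotv x z.
Proof. by rewrite dotvC dotvZl dotvC. Qed.

Lemma dotvNr k (x z : 'rV[R]_k) : dotv x (- z) = - dotv x z.
Proof. by rewrite dotvC dotvNl dotvC. Qed.

Lemma dotv0r k (x : 'rV[R]_k) : dotv x 0 = 0.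
Proof. by rewrite -[0](scale0r (0 : 'rV[R]_k)) dotvZr mul0r. Qed.

Lemma dotv0l k (x : 'rV[R]_k) : dotv 0 x = 0.
Proof. by rewrite dotvC dotv0r. Qed.

Definition dotvE := (dotvDl, dotvDr, dotvNl, dotvNr, dotvZl, dotvZr).

Lemma dotv_row a b (x x' : 'rV[R]_a) (y y' : 'rV[R]_b) :
  dotv (row_mx x y) (row_mx x' y') = dotv x x' + dotv y y'.
Proof.
rewrite /dotv big_split_ord /=; congr (_ + _); apply: eq_bigr => i _.
  by rewrite !row_mxEl.
by rewrite !row_mxEr.
Qed.

Lemma dotv_split a b (x y : 'rV[R]_(a + b)) :
  dotv x y = dotv (lsubmx x) (lsubmx y) + dotv (rsubmx x) (rsubmx y).
Proof. by rewrite -dotv_row !hsubmxK. Qed.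

Lemma dotv_delta k (x : 'rV[R]_k) i : dotv x (delta_mx ord0 i) = x ord0 i.
Proof.
rewrite /dotv (bigD1 i) //= big1 ?addr0 ?mxE ?eqxx ?mulr1 // => j ji.
by rewrite mxE eqxx (negbTE ji) mulr0.
Qed.

Lemma dotv_hamilton k (x y : 'rV[R]_(k + k)) :
  dotv (hamilton x) (hamilton y) = dotv x y.
Proof. by rewrite /hamilton dotv_row dotvNl dotvNr opprK [RHS]dotv_split addrC. Qed.

Lemma dotv_hamiltonl k (x y : 'rV[R]_(k + k)) :
  dotv (hamilton x) y = - dotv x (hamilton y).
Proof. by rewrite -[LHS]dotv_hamilton hamiltonK dotvNl. Qed.

Lemma japanese_sqr k (x : 'rV[R]_k) : jb x ^+ 2 = 1 + dotv x x.
Proof. by rewrite sqr_sqrtr // addr_ge0 // dotvv_ge0. Qed.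

Lemma japanese_ge1 k (x : 'rV[R]_k) : 1 <= jb x.
Proof. by rewrite -[leLHS]sqrtr1 ler_sqrt ?lerDl ?dotvv_ge0 // addr_ge0 // dotvv_ge0. Qed.

Lemma japanese_gt0 k (x : 'rV[R]_k) : 0 < jb x.
Proof. exact: lt_le_trans (japanese_ge1 x). Qed.

Lemma japanese_ge0 k (x : 'rV[R]_k) : 0 <= jb x.
Proof. exact: ltW (japanese_gt0 x). Qed.

Lemma japaneseX_gt0 k (x : 'rV[R]_k) N : 0 < jb x ^+ N.
Proof. by rewrite exprn_gt0 // japanese_gt0. Qed.

Lemma japaneseX_ge0 k (x : 'rV[R]_k) N : 0 <= jb x ^+ N.
Proof. by rewrite exprn_ge0 // japanese_ge0. Qed.

Lemma japaneseX_ge1 k (x : 'rV[R]_k) N : 1 <= jb x ^+ N.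
Proof. by rewrite exprn_ege1 // japanese_ge1. Qed.

Lemma japanese_leX k (x : 'rV[R]_k) M N : (M <= N)%N -> jb x ^+ M <= jb x ^+ N.
Proof. by move=> MN; apply: ler_weXn2l => //; exact: japanese_ge1. Qed.

Lemma le_japanese k l (x : 'rV[R]_k) (y : 'rV[R]_l) :
  dotv x x <= dotv y y -> jb x <= jb y.
Proof. by move=> xy; rewrite ler_sqrt ?lerD2l // addr_ge0 // dotvv_ge0. Qed.

Lemma japaneseN k (x : 'rV[R]_k) : jb (- x) = jb x.
Proof. by rewrite /japanese dotvNl dotvNr opprK. Qed.

Lemma japanese_hamilton k (x : 'rV[R]_(k + k)) : jb (hamilton x) = jb x.
Proof. by rewrite /japanese dotv_hamilton. Qed.

(** Peetre's inequality. *)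
Lemma japaneseD k (x y : 'rV[R]_k) : jb (x + y) <= 2 * jb x * jb y.
Proof.
have p0 : 0 <= 2 * jb x * jb y by rewrite !mulr_ge0 // japanese_ge0.
rewrite -(ler_pXn2r (ltn0Sn 1)) ?nnegrE ?japanese_ge0 // !exprMn !japanese_sqr.
have h : dotv (x + y) (x + y) <= 2 * dotv x x + 2 * dotv y y.
  rewrite /dotv !mulr_sumr -big_split; apply: ler_sum => i _ /=; rewrite !mxE.
  by have := sqr_ge0 (x ord0 i - y ord0 i); nra.
by have := dotvv_ge0 x; have := dotvv_ge0 y; nra.
Qed.

Lemma japaneseB k (x y : 'rV[R]_k) : jb (x - y) <= 2 * jb x * jb y.
Proof. by rewrite -(japaneseN y); exact: japaneseD. Qed.

Lemma japanese_trans k (x y : 'rV[R]_k) : jb x <= 2 * jb (x - y) * jb y.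
Proof. by rewrite -[X in jb X <= _](subrK y); exact: japaneseD. Qed.

Lemma dotvv_coord k (x : 'rV[R]_k) i : x ord0 i ^+ 2 <= dotv x x.
Proof.
rewrite /dotv (bigD1 i) //= expr2 lerDl; apply: sumr_ge0 => j _.
by rewrite -expr2 sqr_ge0.
Qed.

Lemma japanese_coord k (x : 'rV[R]_k) i : `|x ord0 i| <= jb x.
Proof.
rewrite -(ler_pXn2r (ltn0Sn 1)) ?nnegrE ?japanese_ge0 // japanese_sqr.
by rewrite real_normK ?num_real // (le_trans (dotvv_coord x i)) // lerDr.
Qed.

Lemma rV_norm_le k (x : 'rV[R]_k) e :
  0 <= e -> (forall i, `|x ord0 i| <= e) -> `|x| <= e.
Proof.
move=> e0 xe; rewrite [leLHS]mx_normrE; apply: bigmax_le => // i _.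
by rewrite (ord1 i.1).
Qed.

Lemma norm_le_japanese k (x : 'rV[R]_k) : `|x| <= jb x.
Proof. by apply: rV_norm_le => [|i]; [exact: japanese_ge0|exact: japanese_coord]. Qed.

Lemma coord_le_norm k (x : 'rV[R]_k) i : `|x ord0 i| <= `|x|.
Proof. by rewrite [leRHS]mx_normrE; apply: (le_bigmax _ _ (ord0, i)). Qed.

Lemma japanese_row a b (x : 'rV[R]_a) (y : 'rV[R]_b) :
  jb (row_mx x y) <= jb x * jb y.
Proof.
have p0 : 0 <= jb x * jb y by rewrite !mulr_ge0 // japanese_ge0.
rewrite -(ler_pXn2r (ltn0Sn 1)) ?nnegrE ?japanese_ge0 // !exprMn !japanese_sqr dotv_row.
by have := dotvv_ge0 x; have := dotvv_ge0 y; nra.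
Qed.

Lemma japanese_rowl a b (x : 'rV[R]_a) (y : 'rV[R]_b) : jb x <= jb (row_mx x y).
Proof. by apply: le_japanese; rewrite dotv_row lerDl dotvv_ge0. Qed.

Lemma japanese_rowr a b (x : 'rV[R]_a) (y : 'rV[R]_b) : jb y <= jb (row_mx x y).
Proof. by apply: le_japanese; rewrite dotv_row lerDr dotvv_ge0. Qed.

Lemma japanese_lsubmx a b (z : 'rV[R]_(a + b)) : jb (lsubmx z) <= jb z.
Proof. by rewrite -[X in _ <= jb X]hsubmxK japanese_rowl. Qed.

Lemma japanese_rsubmx a b (z : 'rV[R]_(a + b)) : jb (rsubmx z) <= jb z.
Proof. by rewrite -[X in _ <= jb X]hsubmxK japanese_rowr. Qed.

Lemma japaneseZ k c (x : 'rV[R]_k) : jb (c *: x) <= (1 + `|c|) * jb x.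
Proof.
have c0 := normr_ge0 c.
have p0 : 0 <= (1 + `|c|) * jb x by rewrite mulr_ge0 ?addr_ge0 ?japanese_ge0.
rewrite -(ler_pXn2r (ltn0Sn 1)) ?nnegrE ?japanese_ge0 // !exprMn !japanese_sqr.
rewrite dotvZl dotvZr mulrA -expr2 -(real_normK (num_real c)).
by have := dotvv_ge0 x; nra.
Qed.

(** So an inverse power of the bracket is below a product of integrable functions of
    one variable. *)
Lemma japanese_prod k (x : 'rV[R]_k) :
  \prod_i (1 + x ord0 i ^+ 2) <= jb x ^+ (k + k).
Proof.
rewrite addnn -mul2n exprM japanese_sqr.
have -> : (1 + dotv x x) ^+ k = \prod_(i < k) (1 + dotv x x).
  by rewrite prodr_const card_ord.
apply: ler_prod => i _; rewrite addr_ge0 ?sqr_ge0 //=.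
by rewrite lerD2l dotvv_coord.
Qed.

Lemma measurable_japanese d (T : measurableType d) k (f : T -> 'rV[R]_k) :
  measurable_fun setT f -> measurable_fun setT (fun x => jb (f x)).
Proof.
move=> mf; have ms : measurable_fun setT (@Num.sqrt R).
  by apply: continuous_measurable_fun; exact: sqrt_continuous.
have md : measurable_fun setT (fun x => 1 + dotv (f x) (f x)).
  by apply: measurable_funD => //; exact: measurable_dotv.
exact: (measurableT_comp ms md).
Qed.

Lemma powR_japanese k (x : 'rV[R]_k) (N0 : R) N :
  N0 <= N%:R -> jb x `^ N0 <= jb x ^+ N.
Proof.
move=> N0N; rewrite -powR_mulrn ?japanese_ge0 //.
by rewrite ler_powR // japanese_ge1.
Qed.

Lemma integral_oneDsqr_lty :
  (\int[@lebesgue_measure R]_t ((1 + t ^+ 2)^-1)%:E < +oo)%E.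
Proof.
have -> : (fun t : R => ((1 + t ^+ 2)^-1)%:E) = (fun t => (oneDsqr t)^-1%:E).
  by apply/funext => t.
rewrite (ge0_symfun_integralT (f := fun t : R => (oneDsqr t)^-1)).
- rewrite (_ : [set x | _] = `[0, +oo[%classic); last first.
    by apply/seteqP; split => x/=; rewrite in_itv/= andbT.
  by rewrite integral0y_oneDsqr -EFinM ltry.
- by move=> x; rewrite invr_ge0 (le_trans ler01) // oneDsqr_ge1.
- exact: continuous_oneDsqrV.
- by move=> x /=; rewrite /oneDsqr sqrrN.
Qed.

Lemma integral_prod_lty k :
  (\int[lebesgue_rV R k]_x (\prod_i (1 + x ord0 i ^+ 2)^-1)%:E < +oo)%E.
Proof.
have s0 (t : R) : 0 <= (1 + t ^+ 2)^-1 by rewrite invr_ge0 addr_ge0 // sqr_ge0.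
have p0 n (x : 'rV[R]_n) : 0 <= \prod_i (1 + x ord0 i ^+ 2)^-1.
  by apply: prodr_ge0.
have ms : measurable_fun setT (fun t : R => ((1 + t ^+ 2)^-1)).
  by apply: continuous_measurable_fun; exact: continuous_oneDsqrV.
have mp n : measurable_fun setT (fun x : 'rV[R]_n => \prod_i (1 + x ord0 i ^+ 2)^-1).
  by apply: measurable_prod => i _; exact: (measurableT_comp ms (measurable_coord i)).
elim: k => [|k IH].
  rewrite [X in (\int[X]__ _)%E]/= integral_dirac //; last by apply/measurable_EFinP; exact: mp.
  by rewrite diracT mul1e ltry.
rewrite integral_rVS; [|by apply/measurable_EFinP; exact: mp|by move=> x; rewrite lee_fin].
pose I := (\int[lebesgue_rV R k]_x (\prod_i (1 + x ord0 i ^+ 2)^-1)%:E)%E.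
have I0 : (0 <= I)%E by apply: integral_ge0 => x _; rewrite lee_fin.
have fI : I \is a fin_num by rewrite ge0_fin_numE.
have mI : measurable_fun setT (fun x : 'rV[R]_k => (\prod_i (1 + x ord0 i ^+ 2)^-1)%:E).
  by apply/measurable_EFinP; exact: mp.
have q0 : forall x : 'rV[R]_k, setT x -> (0 <= (\prod_i (1 + x ord0 i ^+ 2)^-1)%:E)%E.
  by move=> x _; rewrite lee_fin.
rewrite (_ : (\int[_]_t _)%E =
    (\int[@lebesgue_measure R]_t (((1 + t ^+ 2)^-1)%:E * I))%E); last first.
  apply: eq_integral => t _; rewrite /I.
  rewrite -(ge0_integralZl_EFin _ measurableT q0 mI (s0 t)).
  apply: eq_integral => x _; rewrite -EFinM; congr (_%:E).
  rewrite big_ord_recl /=; have := rV_consK (t, x); rewrite /rV_uncons => -[-> /rowP e].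
  by congr (_ * _); apply: eq_bigr => i _; rewrite -e mxE.
have ms' : measurable_fun setT (fun t : R => ((1 + t ^+ 2)^-1)%:E).
  exact/measurable_EFinP.
have s0' : forall t : R, setT t -> (0 <= ((1 + t ^+ 2)^-1)%:E)%E.
  by move=> t _; rewrite lee_fin.
have /= -> := ge0_integralZr (@lebesgue_measure R) measurableT ms' s0' I0.
have J0 : (0 <= \int[@lebesgue_measure R]_t ((1 + t ^+ 2)^-1)%:E)%E.
  exact: integral_ge0.
apply: lte_mul_pinfty => //; rewrite ge0_fin_numE //.
exact: integral_oneDsqr_lty.
Qed.

Lemma integral_japanese_lty k N : (k + k <= N)%N ->
  (\int[lebesgue_rV R k]_x (jb x ^- N)%:E < +oo)%E.
Proof.
move=> kN; apply: le_lt_trans (integral_prod_lty k).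
rewrite -[leRHS]mul1e; apply: (@le_integral_scale _ _ _ _ _ _ 1) => //.
  by move=> x; rewrite lee_fin invr_ge0 japaneseX_ge0.
move=> x; rewrite mul1e lee_fin prodfV lef_pV2 ?posrE ?japaneseX_gt0 //.
  exact: le_trans (japanese_prod x) (japanese_leX _ kN).
by apply: prodr_gt0 => i _; rewrite ltr_pwDl // sqr_ge0.
Qed.

Definition japanese_mass k : R := fine (\int[lebesgue_rV R k]_x (jb x ^- (k + k))%:E)%E.

Lemma japanese_mass_ge0 k : 0 <= japanese_mass k.
Proof.
apply: fine_ge0; apply: integral_ge0 => x _.
by rewrite lee_fin invr_ge0 japaneseX_ge0.
Qed.

Lemma integral_japanese_le k N : (k + k <= N)%N ->
  (\int[lebesgue_rV R k]_x (jb x ^- N)%:E <= (japanese_mass k)%:E)%E.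
Proof.
move=> kN; rewrite /japanese_mass fineK; last first.
  rewrite ge0_fin_numE ?integral_japanese_lty //.
  by apply: integral_ge0 => x _; rewrite lee_fin invr_ge0 japaneseX_ge0.
rewrite -[leRHS]mul1e; apply: (@le_integral_scale _ _ _ _ _ _ 1) => //.
  by move=> x; rewrite lee_fin invr_ge0 japaneseX_ge0.
by move=> x; rewrite mul1e lee_fin lef_pV2 ?posrE ?japaneseX_gt0 // japanese_leX.
Qed.

(** The form in which integrability is used below: rapid decay. *)
Lemma integral_decay_le k (g : 'rV[R]_k -> R) C :
  (forall x, 0 <= g x) -> (forall x, jb x ^+ (k + k) * g x <= C) ->
  (\int[lebesgue_rV R k]_x (g x)%:E <= (C * japanese_mass k)%:E)%E.
Proof.
move=> g0 gC; have C0 : 0 <= C.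
  by apply: (le_trans _ (gC 0)); rewrite mulr_ge0 // japaneseX_ge0.
have C1 : 0 < C + 1 by rewrite ltr_wpDl.
suff H e : 0 < e -> (\int[lebesgue_rV R k]_x (g x)%:E <= ((C + e) * japanese_mass k)%:E)%E.
  apply/lee_addgt0Pr => e e0.
  have j1 : 0 < japanese_mass k + 1 by rewrite ltr_wpDl // japanese_mass_ge0.
  apply: (le_trans (H (e / (japanese_mass k + 1)) (divr_gt0 e0 j1))).
  rewrite -EFinD lee_fin mulrDl lerD2l mulrAC ler_pdivrMr // ler_wpM2l ?(ltW e0) //.
  by rewrite lerDl.
move=> e0; rewrite EFinM; have Ce : 0 < C + e by rewrite ltr_wpDl.
apply: (@le_trans _ _ ((C + e)%:E * \int[lebesgue_rV R k]_x (jb x ^- (k + k))%:E)%E).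
  apply: le_integral_scale => // x; rewrite -EFinM lee_fin.
  by rewrite ler_pdivlMr ?japaneseX_gt0 // mulrC (le_trans (gC x)) // lerDl ltW.
apply: lee_wpmul2l; first by rewrite lee_fin ltW.
exact: integral_japanese_le.
Qed.

End bracket.

Local Open Scope complex_scope.

(** * Rearrangements of products *)

(** Each is the last step of an estimate or of an identity below: a product of
    bounds or of phases, regrouped. *)
Section rearrangements.
Variable R : realType.

(** The usual way of distributing a power of a bracket by the inequality of
    Peetre. *)
Lemma expr_le_mul3 (a b c d : R) n : 0 <= a -> a <= b * c * d -> a ^+ n <= b ^+ n * c ^+ n * d ^+ n.
Proof. by move=> a0 h; rewrite -2!exprMn lerXn2r ?nnegrE // (le_trans a0). Qed.

Lemma ler_mul_kernel (x t y c w u v : R) : 0 <= x -> 0 <= w -> 0 <= u -> 0 <= v ->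
  t <= c * x * y -> x * t * (w * u * v) <= c * w * (y * u) * (x * x * v).
Proof.
move=> x0 w0 u0 v0 h; rewrite [leLHS](_ : _ = (x * (w * u * v)) * t); last by ring.
rewrite [leRHS](_ : _ = (x * (w * u * v)) * (c * x * y)); last by ring.
by rewrite ler_wpM2l ?mulr_ge0.
Qed.

Lemma ler_mul4 (c w u v w' u' v' : R) : 0 <= c -> 0 <= w -> 0 <= u -> 0 <= v ->
  w <= w' -> u <= u' -> v <= v' -> c * w * u * v <= c * w' * u' * v'.
Proof.
move=> c0 w0 u0 v0 hw hu hv; apply: ler_pM => //; first by rewrite !mulr_ge0.
by apply: ler_pM => //; [rewrite mulr_ge0|rewrite ler_wpM2l].
Qed.

Lemma ler_mul_split (t y b g h d c : R) : 0 <= t -> 0 <= y -> 0 <= b -> 0 <= g -> 0 <= h ->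
  t * h <= d -> y * b <= c -> g <= 1 -> t * y * (b * g * h) <= d * c.
Proof.
move=> t0 y0 b0 g0 h0 td yc g1; rewrite [leLHS](_ : _ = (t * h) * (y * b * g)); last by ring.
apply: ler_pM => //; rewrite ?mulr_ge0 //; apply: le_trans yc.
by rewrite ler_piMr ?mulr_ge0.
Qed.

Lemma ler_mul_diagonal (e D G Y K V c : R) : 0 <= e -> 0 <= D -> 0 <= K -> 0 <= V ->
  G <= e * Y * D -> Y * (D * D) * V <= c -> G * D * (K * V) <= e * K * c.
Proof.
move=> e0 D0 K0 V0 h1 h2; apply: (@le_trans _ _ (e * Y * D * D * (K * V))).
  by rewrite ler_wpM2r ?mulr_ge0 // ler_wpM2r.
rewrite [leLHS](_ : _ = e * K * (Y * (D * D) * V)); last by ring.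
by rewrite ler_wpM2l ?mulr_ge0.
Qed.

Lemma ler_mul_offdiagonal (Z Zp G M q Z' G' A D : R) : 0 <= Z -> 0 <= Zp -> 0 <= G -> 0 <= M -> 0 <= q ->
  G <= G' -> Z * Zp <= Z' -> A <= q * Zp -> G' * Z' * M <= D -> Z * (M * A) * G <= D * q.
Proof.
move=> Z0 Zp0 G0 M0 q0 e1 e2 hA h3.
apply: (@le_trans _ _ (Z * (M * (q * Zp)) * G)); first by rewrite ler_wpM2r // ler_wpM2l // ler_wpM2l.
rewrite [leLHS](_ : _ = G * (Z * Zp) * M * q); last by ring.
rewrite ler_wpM2r //; apply: le_trans h3; rewrite ler_wpM2r //.
by apply: ler_pM => //; exact: mulr_ge0.
Qed.

Lemma ler_mul_weights (a1 a2 G W L1 L2 C D m1 m2 : R) : (0 <= a1 -> 0 <= a2 -> 0 <= G -> 0 <= W ->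
  a1 <= L1 * m1 -> a2 <= L2 * (C * D * m2) ->
  a1 * a2 * G * W <= L1 * L2 * C * D * G * W * (m1 * m2))%R.
Proof.
move=> a10 a20 G0 W0 h1 h2.
rewrite [leRHS](_ : _ = (L1 * m1) * (L2 * (C * D * m2)) * G * W)%R; last by ring.
by rewrite ler_wpM2r // ler_wpM2r //; apply: ler_pM.
Qed.

Lemma ler_mul_quotient (w g W u v U V D : R) : 0 <= w -> 0 <= g -> 0 <= W -> 0 < u -> 0 < v ->
  u <= U -> v <= V -> V * U * W <= D -> w * g * W <= w * D * u^-1 * (g * v^-1).
Proof.
move=> w0 g0 W0 u0 v0 uU vV h.
rewrite [leRHS](_ : _ = w * g * (D / (u * v))); last by field; rewrite !gt_eqF.
apply: ler_wpM2l; first exact: mulr_ge0.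
rewrite ler_pdivlMr ?mulr_gt0 //; apply: le_trans h; rewrite mulrC.
by apply: ler_wpM2r => //; rewrite mulrC; apply: ler_pM => //; exact: ltW.
Qed.

Lemma mul_weights_collect (L1 L2 C2 d1 g e d2 C3 m V W : R) : (0 < V -> 0 < W ->
  L1 * L2 * C2 * d1 * g * (e * d2 * (V * W)^-1) * (C3 * V * m) =
  C2 * C3 * e * L1 * L2 * m * W^-1 * (d1 * d2 * g))%R.
Proof. by move=> V0 W0; field; rewrite !gt_eqF. Qed.

Lemma leq_add_mid n P d : (d + P <= n + P + d)%N.
Proof. by lia. Qed.

Lemma mulc_shuffle4 (u v s q : R[i]) : s * q * u * v = u * v * (s * q).
Proof. ring. Qed.

Lemma mulc_shuffle_shift (a b c d z e f : R[i]) : a * b * d = e * f -> a * (b * (c * (d * z))) = c * e * (f * z).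
Proof. by move=> h; rewrite -[RHS]mulrA (mulrA e) -h; ring. Qed.

Lemma mulc_shuffle_phase (e1 b g2 gm e2 e3 gh : R[i]) :
  e1 * b * g2 * (gm * (e2 * e3 * gh)) = gm * e3 * (b * (e1 * e2 * (g2 * gh))).
Proof. ring. Qed.

Lemma mulc_shuffle_atom (c e G f u v h z x y : R[i]) : e * f = h * x -> u * v = y * z ->
  (c * e) * (G * f * (u * v)) = c * G * h * z * (x * y).
Proof.
move=> h1 h2; transitivity (c * G * (e * f) * (u * v)); first ring.
by rewrite h1 h2; ring.
Qed.

Lemma mulc_cancel (e e' I c h : R[i]) : e * e' = 1 -> e * (I * (c * (e' * h))) = c * (h * I).
Proof. by move=> ee; rewrite -[RHS]mul1r -ee; ring. Qed.

End rearrangements.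

(** * Integrals of complex functions *)
Section complex_norm.
Variable R : realType.
Implicit Types z w : R[i].
Local Notation N := (@Normc.normc R).

Lemma ReD z w : Re (z + w) = Re z + Re w. Proof. by case: z w => [? ?] [? ?]; done. Qed.
Lemma ImD z w : Im (z + w) = Im z + Im w. Proof. by case: z w => [? ?] [? ?]. Qed.
Lemma ReN z : Re (- z) = - Re z. Proof. by case: z. Qed.
Lemma ImN z : Im (- z) = - Im z. Proof. by case: z. Qed.
Lemma ReM z w : Re (z * w) = Re z * Re w - Im z * Im w.
Proof. by case: z w => [? ?] [? ?]. Qed.
Lemma ImM z w : Im (z * w) = Re z * Im w + Im z * Re w.
Proof. by case: z w => [? ?] [? ?]. Qed.
Lemma complexP z w : Re z = Re w -> Im z = Im w -> z = w.
Proof. by case: z w => [? ?] [? ?] /= -> ->. Qed.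
Lemma Re_sum I (s : seq I) (P : pred I) (F : I -> R[i]) :
  Re (\sum_(i <- s | P i) F i) = \sum_(i <- s | P i) Re (F i).
Proof. by elim/big_ind2 : _ => // x1 x2 y1 y2 <- <-; rewrite ReD. Qed.
Lemma Im_sum I (s : seq I) (P : pred I) (F : I -> R[i]) :
  Im (\sum_(i <- s | P i) F i) = \sum_(i <- s | P i) Im (F i).
Proof. by elim/big_ind2 : _ => // x1 x2 y1 y2 <- <-; rewrite ImD. Qed.

Lemma normcE z : N z = Num.sqrt (Re z ^+ 2 + Im z ^+ 2). Proof. by case: z. Qed.
Lemma normc_ge0 z : 0 <= N z. Proof. by case: z => a b; exact: sqrtr_ge0. Qed.
Lemma normc_Re z : `|Re z| <= N z.
Proof. by rewrite normcE -sqrtr_sqr ler_sqrt ?lerDl ?sqr_ge0 // addr_ge0 // sqr_ge0. Qed.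
Lemma normc_Im z : `|Im z| <= N z.
Proof. by rewrite normcE -sqrtr_sqr ler_sqrt ?lerDr ?sqr_ge0 // addr_ge0 // sqr_ge0. Qed.
Lemma normc_le z : N z <= `|Re z| + `|Im z|.
Proof.
rewrite normcE -[leRHS]ger0_norm ?addr_ge0 // -sqrtr_sqr.
have h : Re z ^+ 2 + Im z ^+ 2 <= (`|Re z| + `|Im z|) ^+ 2.
  rewrite -(real_normK (num_real (Re z))) -(real_normK (num_real (Im z))).
  by have := normr_ge0 (Re z); have := normr_ge0 (Im z); nra.
by rewrite ler_sqrt // sqr_ge0.
Qed.
Lemma normcR (a : R) : N a%:C = `|a|.
Proof. by rewrite normcE /= expr0n addr0 sqrtr_sqr. Qed.
Lemma normc_expi t : N (expi t) = 1.
Proof. by rewrite /expi /= cos2Dsin2 sqrtr1. Qed.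
Lemma normcX z n : N (z ^+ n) = N z ^+ n.
Proof. by elim: n => [|n IH]; rewrite ?expr0 ?Normc.normc1 // !exprS Normc.normcM IH. Qed.
Lemma normcB z w : N (z - w) <= N z + N w.
Proof. by rewrite -(normcN w); exact: le_normcD. Qed.
Lemma normc_sum I (s : seq I) (P : pred I) (F : I -> R[i]) :
  N (\sum_(i <- s | P i) F i) <= \sum_(i <- s | P i) N (F i).
Proof.
elim/big_ind2 : _ => [|x1 x2 y1 y2 h1 h2|//]; first by rewrite Normc.normc0.
by apply: (le_trans (le_normcD _ _)); exact: lerD.
Qed.
Lemma normc_gt0 z : z != 0 -> 0 < N z.
Proof.
move=> z0; rewrite lt_neqAle normc_ge0 andbT eq_sym.
by apply: contra z0 => /eqP/Normc.eq0_normc ->.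
Qed.

Lemma expiD s t : expi (s + t) = expi s * expi t :> R[i].
Proof. by apply: complexP; rewrite ?ReM ?ImM /= ?cosD ?sinD; ring. Qed.
Lemma expi0 : expi 0 = 1 :> R[i].
Proof. by rewrite /expi cos0 sin0. Qed.
Lemma expiN t : expi (- t) * expi t = 1 :> R[i].
Proof. by rewrite -expiD addNr expi0. Qed.
End complex_norm.

Section complex_measurable.
Variable R : realType.
Context d (T : measurableType d).
Implicit Types f g : T -> R[i].

Definition cmeas f := measurable_fun setT (fun x => Re (f x)) /\
  measurable_fun setT (fun x => Im (f x)).

Lemma cmeas_cst c : cmeas (fun=> c). Proof. by split; exact: measurable_cst. Qed.

Lemma cmeasD f g : cmeas f -> cmeas g -> cmeas (fun x => f x + g x).
Proof.
move=> [fr fi] [gr gi]; split.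
  by under eq_fun do rewrite ReD; exact: measurable_funD.
by under eq_fun do rewrite ImD; exact: measurable_funD.
Qed.

Lemma cmeasN f : cmeas f -> cmeas (fun x => - f x).
Proof.
move=> [fr fi]; split.
  by under eq_fun do rewrite ReN; exact: measurable_funN.
by under eq_fun do rewrite ImN; exact: measurable_funN.
Qed.

Lemma cmeasB f g : cmeas f -> cmeas g -> cmeas (fun x => f x - g x).
Proof. by move=> mf mg; apply: cmeasD => //; exact: cmeasN. Qed.

Lemma cmeasM f g : cmeas f -> cmeas g -> cmeas (fun x => f x * g x).
Proof.
move=> [fr fi] [gr gi]; split.
  under eq_fun do rewrite ReM.
  by apply: measurable_funB; exact: measurable_funM.
under eq_fun do rewrite ImM.
by apply: measurable_funD; exact: measurable_funM.
Qed.

Lemma cmeas_sum I (s : seq I) (F : I -> T -> R[i]) :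
  (forall i, cmeas (F i)) -> cmeas (fun x => \sum_(i <- s) F i x).
Proof.
move=> mF; elim: s => [|i s IH].
  by under eq_fun do rewrite big_nil; exact: cmeas_cst.
by under eq_fun do rewrite big_cons; exact: cmeasD.
Qed.

Lemma cmeas_real (g : T -> R) : measurable_fun setT g -> cmeas (fun x => (g x)%:C).
Proof. by move=> mg; split => //; exact: measurable_cst. Qed.

Lemma cmeas_expi (g : T -> R) : measurable_fun setT g -> cmeas (fun x => expi (g x)).
Proof.
move=> mg; split => /=; apply: (measurableT_comp _ mg).
  by apply: continuous_measurable_fun; exact: continuous_cos.
by apply: continuous_measurable_fun; exact: continuous_sin.
Qed.

Lemma measurable_normc f : cmeas f -> measurable_fun setT (fun x => Normc.normc (f x)).
Proof.
move=> [fr fi]; under eq_fun do rewrite normcE.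
have ms : measurable_fun setT (@Num.sqrt R).
  by apply: continuous_measurable_fun; exact: sqrt_continuous.
have mq : measurable_fun setT (fun x => Re (f x) ^+ 2 + Im (f x) ^+ 2).
  by apply: measurable_funD; exact: measurable_funX.
exact: (measurableT_comp ms mq).
Qed.

End complex_measurable.

Lemma cmeas_comp (R : realType) d d' (T : measurableType d) (T' : measurableType d')
  (f : T' -> R[i]) (g : T -> T') :
  cmeas f -> measurable_fun setT g -> cmeas (fun x => f (g x)).
Proof. by move=> [fr fi] mg; split; [exact: (measurableT_comp fr mg)|exact: (measurableT_comp fi mg)]. Qed.

Section cintegral.
Variable R : realType.
Local Notation N := (@Normc.normc R).
Local Notation mu := (lebesgue_rV R).

Definition cintegrable k (f : 'rV[R]_k -> R[i]) :=
  cmeas f /\ (\int[mu k]_x (N (f x))%:E < +oo)%E.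

Lemma le_integral_nonneg k (f g : 'rV[R]_k -> R) :
  (forall x, 0 <= f x <= g x) ->
  (\int[mu k]_x (f x)%:E <= \int[mu k]_x (g x)%:E)%E.
Proof.
move=> fg; rewrite -[leRHS]mul1e; apply: (@le_integral_scale _ _ _ _ _ _ 1) => //.
  by move=> x; rewrite lee_fin; case/andP: (fg x).
by move=> x; rewrite mul1e lee_fin; case/andP: (fg x).
Qed.

Lemma cintegrable_le k (f : 'rV[R]_k -> R[i]) (g : 'rV[R]_k -> R) :
  cmeas f -> (forall x, N (f x) <= g x) ->
  (\int[mu k]_x (g x)%:E < +oo)%E -> cintegrable f.
Proof.
move=> mf fg gI; split => //; apply: le_lt_trans gI.
by apply: le_integral_nonneg => x; rewrite normc_ge0 fg.
Qed.

Lemma cintegrable_Re k (f : 'rV[R]_k -> R[i]) :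
  cintegrable f -> (mu k).-integrable setT (fun x => (Re (f x))%:E).
Proof.
move=> [[fr fi] fI]; apply/integrableP; split; first exact/measurable_EFinP.
apply: le_lt_trans fI; apply: le_integral_nonneg => x.
by rewrite normr_ge0 normc_Re.
Qed.

Lemma cintegrable_Im k (f : 'rV[R]_k -> R[i]) :
  cintegrable f -> (mu k).-integrable setT (fun x => (Im (f x))%:E).
Proof.
move=> [[fr fi] fI]; apply/integrableP; split; first exact/measurable_EFinP.
apply: le_lt_trans fI; apply: le_integral_nonneg => x.
by rewrite normr_ge0 normc_Im.
Qed.

Lemma cintegrableD k (f g : 'rV[R]_k -> R[i]) :
  cintegrable f -> cintegrable g -> cintegrable (fun x => f x + g x).
Proof.
move=> [mf fI] [mg gI]; apply: (@cintegrable_le _ _ (fun x => N (f x) + N (g x))).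
- exact: cmeasD.
- by move=> x; exact: le_normcD.
- under eq_integral do rewrite EFinD.
  rewrite ge0_integralD //=; first by rewrite lte_add_pinfty.
  + by move=> x _; rewrite lee_fin normc_ge0.
  + by apply/measurable_EFinP; exact: measurable_normc.
  + by move=> x _; rewrite lee_fin normc_ge0.
  + by apply/measurable_EFinP; exact: measurable_normc.
Qed.

Lemma cintegrableZ k c (f : 'rV[R]_k -> R[i]) :
  cintegrable f -> cintegrable (fun x => c * f x).
Proof.
move=> [mf fI]; apply: (@cintegrable_le _ _ (fun x => N c * N (f x))).
- by apply: cmeasM => //; exact: cmeas_cst.
- by move=> x; rewrite Normc.normcM.
- under eq_integral do rewrite EFinM.
  rewrite ge0_integralZl_EFin //=.
  + by rewrite lte_mul_pinfty // lee_fin normc_ge0.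
  + by move=> x _; rewrite lee_fin normc_ge0.
  + by apply/measurable_EFinP; exact: measurable_normc.
  + exact: normc_ge0.
Qed.

Lemma eq_cintegral k (f g : 'rV[R]_k -> R[i]) :
  f =1 g -> cintegral f = cintegral g.
Proof. by move=> fg; congr cintegral; apply/funext. Qed.

Lemma cintegral0 k : cintegral (fun _ : 'rV[R]_k => 0) = 0.
Proof. by rewrite /cintegral /= /Rintegral integral0. Qed.

Lemma cintegralD k (f g : 'rV[R]_k -> R[i]) : cintegrable f -> cintegrable g ->
  cintegral (fun x => f x + g x) = cintegral f + cintegral g.
Proof.
move=> fI gI; apply: complexP; rewrite ?ReD ?ImD /=.
  under eq_Rintegral do rewrite ReD.
  by rewrite RintegralD //; exact: cintegrable_Re.
under eq_Rintegral do rewrite ImD.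
by rewrite RintegralD //; exact: cintegrable_Im.
Qed.

Lemma cintegralZ k c (f : 'rV[R]_k -> R[i]) : cintegrable f ->
  cintegral (fun x => c * f x) = c * cintegral f.
Proof.
move=> fI; have fr := cintegrable_Re fI; have fi := cintegrable_Im fI.
have zr (r : R) (u : 'rV[R]_k -> R) : (mu k).-integrable setT (fun x => (u x)%:E) ->
    (mu k).-integrable setT (fun x => (r * u x)%:E).
  by move=> uI; under eq_fun do rewrite EFinM; exact: integrableZl.
apply: complexP; rewrite ?ReM ?ImM /=.
  under eq_Rintegral do rewrite ReM.
  by rewrite RintegralB ?RintegralZl //; exact: zr.
under eq_Rintegral do rewrite ImM.
by rewrite RintegralD ?RintegralZl //; exact: zr.
Qed.

Lemma cintegralN k (f : 'rV[R]_k -> R[i]) : cintegrable f ->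
  cintegral (fun x => - f x) = - cintegral f.
Proof.
move=> fI; rewrite -mulN1r -cintegralZ //; apply: eq_cintegral => x.
by rewrite mulN1r.
Qed.

Lemma cintegrableN k (f : 'rV[R]_k -> R[i]) :
  cintegrable f -> cintegrable (fun x => - f x).
Proof.
move=> fI; have := cintegrableZ (-1) fI; congr cintegrable.
by apply/funext => x; rewrite mulN1r.
Qed.

Lemma cintegralB k (f g : 'rV[R]_k -> R[i]) : cintegrable f -> cintegrable g ->
  cintegral (fun x => f x - g x) = cintegral f - cintegral g.
Proof. by move=> fI gI; rewrite cintegralD ?cintegralN //; exact: cintegrableN. Qed.

Lemma cintegrable0 k : cintegrable (fun _ : 'rV[R]_k => 0).
Proof.
split; first exact: cmeas_cst.
by under eq_integral do rewrite Normc.normc0; rewrite integral0 ltry.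
Qed.

Lemma cintegrable_sum k I (s : seq I) (F : I -> 'rV[R]_k -> R[i]) :
  (forall i, cintegrable (F i)) -> cintegrable (fun x => \sum_(i <- s) F i x).
Proof.
move=> FI; elim: s => [|i s IH].
  by under eq_fun do rewrite big_nil; exact: cintegrable0.
by under eq_fun do rewrite big_cons; exact: cintegrableD.
Qed.

Lemma cintegral_sum k I (s : seq I) (F : I -> 'rV[R]_k -> R[i]) :
  (forall i, cintegrable (F i)) ->
  cintegral (fun x => \sum_(i <- s) F i x) = \sum_(i <- s) cintegral (F i).
Proof.
move=> FI; elim: s => [|i s IH].
  rewrite big_nil -[RHS](cintegral0 k); apply: eq_cintegral => x.
  by rewrite big_nil.
rewrite big_cons -IH -cintegralD //; last exact: cintegrable_sum.
by apply: eq_cintegral => x; rewrite big_cons.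
Qed.

(** The factor 2 comes from treating real and imaginary parts separately. *)
Lemma normc_cintegral_le k (f : 'rV[R]_k -> R[i]) (g : 'rV[R]_k -> R) B :
  cmeas f -> (forall x, N (f x) <= g x) ->
  (\int[mu k]_x (g x)%:E <= B%:E)%E -> N (cintegral f) <= 2 * B.
Proof.
move=> mf fg gB; have [mr mi] := mf.
have fI : cintegrable f.
  by apply: (cintegrable_le mf fg); exact: le_lt_trans gB (ltry _).
have part (u : 'rV[R]_k -> R) : (mu k).-integrable setT (fun x => (u x)%:E) ->
    (forall x, `|u x| <= N (f x)) -> `|\int[mu k]_x u x| <= B.
  move=> uI uf; apply: (le_trans (le_normr_Rintegral measurableT uI)).
  rewrite -lee_fin; apply: le_trans gB; rewrite /Rintegral fineK.
    by apply: le_integral_nonneg => x; rewrite normr_ge0 (le_trans (uf x)).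
  rewrite ge0_fin_numE; last by apply: integral_ge0 => x _; rewrite lee_fin.
  by case/integrableP : uI.
apply: (le_trans (normc_le _)); rewrite mulr_natl mulr2n; apply: lerD => /=.
  by apply: part => [|x]; [exact: cintegrable_Re|exact: normc_Re].
by apply: part => [|x]; [exact: cintegrable_Im|exact: normc_Im].
Qed.

Lemma cintegrable_decay k (f : 'rV[R]_k -> R[i]) C :
  cmeas f -> (forall x, japanese x ^+ (k + k) * N (f x) <= C) -> cintegrable f.
Proof.
move=> mf fC; split=> //; apply: le_lt_trans (ltry (C * japanese_mass R k)).
by apply: integral_decay_le => // x; exact: normc_ge0.
Qed.

Lemma cintegral_decay k (f : 'rV[R]_k -> R[i]) C :
  cmeas f -> (forall x, japanese x ^+ (k + k) * N (f x) <= C) ->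
  N (cintegral f) <= 2 * (C * japanese_mass R k).
Proof.
move=> mf fC; apply: (@normc_cintegral_le _ _ (fun x => N (f x))) => //.
by apply: integral_decay_le => // x; exact: normc_ge0.
Qed.

(** An identity between integrals of nonnegative functions extends to signed and
    complex functions, since both sides are computed from positive and negative
    parts. *)
Lemma Rintegral_transfer d1 d2 (T1 : measurableType d1) (T2 : measurableType d2)
    (m1 : {measure set T1 -> \bar R}) (m2 : {measure set T2 -> \bar R})
    (phi : T1 -> T2) (r : R) (u : T2 -> R) : 0 <= r ->
  (forall f : T2 -> \bar R, measurable_fun setT f -> (forall x, (0 <= f x)%E) ->
     (\int[m1]_x f (phi x) = r%:E * \int[m2]_x f x)%E) ->
  measurable_fun setT u -> \int[m1]_x u (phi x) = r * \int[m2]_x u x.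
Proof.
move=> r0 H mu'; have mE : measurable_fun setT (EFin \o u) by exact/measurable_EFinP.
rewrite /Rintegral [in LHS]integralE [in RHS]integralE.
have pE : (\int[m1]_x (fun x => (u (phi x))%:E)^\+ x =
    r%:E * \int[m2]_x (fun x => (u x)%:E)^\+ x)%E.
  rewrite -(H (funepos (fun x => (u x)%:E))) //; last exact: measurable_funepos.
  by apply: eq_integral => x _; rewrite !funeposE.
have nE : (\int[m1]_x (fun x => (u (phi x))%:E)^\- x =
    r%:E * \int[m2]_x (fun x => (u x)%:E)^\- x)%E.
  rewrite -(H (funeneg (fun x => (u x)%:E))) //; last exact: measurable_funeneg.
  by apply: eq_integral => x _; rewrite !funenegE.
rewrite pE nE.
have : (0 <= \int[m2]_x (fun x => (u x)%:E)^\+ x)%E by apply: integral_ge0.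
have : (0 <= \int[m2]_x (fun x => (u x)%:E)^\- x)%E by apply: integral_ge0.
move: r0; rewrite le_eqVlt => /orP[/eqP <-|r0]; first by rewrite !mul0e sube0 mul0r.
case: (integral _ _ _) => [a| |] //; case: (integral _ _ _) => [b| |] //= _ _.
- by rewrite mulrBr.
- by rewrite gt0_muley ?lte_fin //= mulr0.
- by rewrite gt0_muley ?lte_fin //= mulr0.
- by rewrite gt0_muley ?lte_fin //= mulr0.
Qed.

Lemma cintegral_transfer k l (phi : 'rV[R]_k -> 'rV[R]_l) (r : R) (f : 'rV[R]_l -> R[i]) :
  0 <= r ->
  (forall g : 'rV[R]_l -> \bar R, measurable_fun setT g -> (forall x, (0 <= g x)%E) ->
     (\int[mu k]_x g (phi x) = r%:E * \int[mu l]_x g x)%E) ->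
  cmeas f -> cintegral (fun x => f (phi x)) = r%:C * cintegral f.
Proof.
move=> r0 H [fr fi]; apply: complexP; rewrite ?ReM ?ImM /= ?mul0r ?addr0 ?subr0.
  exact: (Rintegral_transfer r0 H fr).
exact: (Rintegral_transfer r0 H fi).
Qed.

Lemma cintegral_affine k (c : R) (v : 'rV[R]_k) (f : 'rV[R]_k -> R[i]) :
  c != 0 -> cmeas f ->
  cintegral (fun x => f (c *: x + v)) = (`|c|^-1 ^+ k)%:C * cintegral f.
Proof.
move=> c0 mf; apply: (cintegral_transfer (phi := fun x => c *: x + v)) => //.
by move=> g mg g0; exact: integral_rV_affine.
Qed.

Lemma cintegral_translate k (v : 'rV[R]_k) (f : 'rV[R]_k -> R[i]) :
  cmeas f -> cintegral (fun x => f (x + v)) = cintegral f.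
Proof.
move=> mf; rewrite -[RHS]mul1r.
apply: (cintegral_transfer (phi := fun x => x + v) ler01) => // g mg g0.
by rewrite mul1e; exact: integral_rV_translate.
Qed.

Lemma cintegral_reflect k (v : 'rV[R]_k) (f : 'rV[R]_k -> R[i]) :
  cmeas f -> cintegral (fun x => f (v - x)) = cintegral f.
Proof.
move=> mf; have := @cintegral_affine k (-1) v f; rewrite oppr_eq0 oner_eq0 => /(_ isT mf).
rewrite normrN1 invr1 expr1n mul1r => <-.
by apply: eq_cintegral => x; rewrite scaleN1r addrC.
Qed.

Lemma cintegrable_translate k (v : 'rV[R]_k) (f : 'rV[R]_k -> R[i]) :
  cintegrable f -> cintegrable (fun x => f (x + v)).
Proof.
move=> [mf fI]; split.
  by apply: cmeas_comp => //; apply: measurable_rVD.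
rewrite (@integral_rV_translate _ _ v (fun x => (N (f x))%:E)) //.
  by apply/measurable_EFinP; exact: measurable_normc.
by move=> x; rewrite lee_fin normc_ge0.
Qed.

End cintegral.

(** * Fubini and dominated convergence *)
Section fubini.
Variable R : realType.
Local Notation N := (@Normc.normc R).
Local Notation mu := (lebesgue_rV R).
Local Notation jb := (@japanese R _).

Lemma cmeas_row a b (f : 'rV[R]_a -> 'rV[R]_b -> R[i]) :
  cmeas (fun z : 'rV[R]_(a + b) => f (lsubmx z) (rsubmx z)) ->
  cmeas (fun p : 'rV[R]_a * 'rV[R]_b => f p.1 p.2).
Proof.
move=> mf; rewrite (_ : (fun p => _) = (fun p : 'rV[R]_a * 'rV[R]_b =>
    (fun z : 'rV[R]_(a + b) => f (lsubmx z) (rsubmx z)) (row_mx p.1 p.2))).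
  apply: (cmeas_comp (g := fun p => row_mx p.1 p.2) mf).
  by apply: measurable_row_mx; [exact: measurable_fst|exact: measurable_snd].
by apply/funext => p; rewrite row_mxKl row_mxKr.
Qed.

Lemma cmeas_slice a b (f : 'rV[R]_a -> 'rV[R]_b -> R[i]) x :
  cmeas (fun z : 'rV[R]_(a + b) => f (lsubmx z) (rsubmx z)) -> cmeas (f x).
Proof.
move=> mf; rewrite (_ : f x = (fun y : 'rV[R]_b =>
    (fun z : 'rV[R]_(a + b) => f (lsubmx z) (rsubmx z)) (row_mx x y))).
  apply: (cmeas_comp (g := fun y => row_mx x y) mf).
  by apply: measurable_row_mx; [exact: measurable_cst|exact: measurable_id].
by apply/funext => p; rewrite row_mxKl row_mxKr.
Qed.

Lemma cmeas_swap a b (f : 'rV[R]_a -> 'rV[R]_b -> R[i]) :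
  cmeas (fun z : 'rV[R]_(a + b) => f (lsubmx z) (rsubmx z)) ->
  cmeas (fun z : 'rV[R]_(b + a) => f (rsubmx z) (lsubmx z)).
Proof.
move=> mf; rewrite (_ : (fun z : 'rV[R]_(b + a) => _) = (fun z : 'rV[R]_(b + a) =>
    (fun z : 'rV[R]_(a + b) => f (lsubmx z) (rsubmx z)) (row_mx (rsubmx z) (lsubmx z)))).
  apply: (cmeas_comp (g := fun z => row_mx (rsubmx z) (lsubmx z)) mf).
  by apply: measurable_row_mx; [exact: measurable_rsubmx|exact: measurable_lsubmx].
by apply/funext => p; rewrite row_mxKl row_mxKr.
Qed.

Lemma cmeas_cintegral a b (f : 'rV[R]_a -> 'rV[R]_b -> R[i]) :
  cmeas (fun z : 'rV[R]_(a + b) => f (lsubmx z) (rsubmx z)) ->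
  cmeas (fun x => cintegral (f x)).
Proof.
move=> /cmeas_row[mr mi].
have H (u : 'rV[R]_a -> 'rV[R]_b -> R) :
    measurable_fun setT (fun p : 'rV[R]_a * 'rV[R]_b => u p.1 p.2) ->
    measurable_fun setT (fun x => \int[mu b]_y u x y).
  move=> mw; have mE : measurable_fun setT
    (fun p : 'rV[R]_a * 'rV[R]_b => (u p.1 p.2)%:E) by exact/measurable_EFinP.
  have mp := measurable_fun_fubini_tonelli_F (m2 := mu b) _ (measurable_funepos mE)
    (fun p => funepos_ge0 _ p).
  have mn := measurable_fun_fubini_tonelli_F (m2 := mu b) _ (measurable_funeneg mE)
    (fun p => funeneg_ge0 _ p).
  rewrite /Rintegral (_ : (fun x => _) = fun x => fine (fubini_F (mu b)
    (funepos (fun p : 'rV[R]_a * 'rV[R]_b => (u p.1 p.2)%:E)) x -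
    fubini_F (mu b)
    (funeneg (fun p : 'rV[R]_a * 'rV[R]_b => (u p.1 p.2)%:E)) x)%E).
    apply: (@measurableT_comp _ _ _ _ _ _ (@fine R)); first exact: fine_measurable.
    exact: emeasurable_funB.
  apply/funext => x; rewrite integralE; congr (fine (_ - _)%E).
    by apply: eq_integral => y _; rewrite !funeposE.
  by apply: eq_integral => y _; rewrite !funenegE.
by split; [exact: (H (fun x y => Re (f x y)) mr)|exact: (H (fun x y => Im (f x y)) mi)].
Qed.

Variables (a b : nat) (f : 'rV[R]_a -> 'rV[R]_b -> R[i]) (C : R).
Hypothesis mf : cmeas (fun z : 'rV[R]_(a + b) => f (lsubmx z) (rsubmx z)).
Hypothesis fC : forall x y, jb x ^+ (a + a) * jb y ^+ (b + b) * N (f x y) <= C.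

Lemma fubini_slice x : cintegrable (f x).
Proof.
apply: (@cintegrable_decay _ _ _ C); first exact: cmeas_slice.
move=> y; apply: le_trans (fC x y); rewrite -mulrA ler_peMl ?japaneseX_ge1 //.
by rewrite mulr_ge0 ?normc_ge0 // japaneseX_ge0.
Qed.

Lemma fubini_inner_decay x : jb x ^+ (a + a) * N (cintegral (f x)) <= 2 * (C * japanese_mass R b).
Proof.
rewrite -ler_pdivlMl ?japaneseX_gt0 // mulrCA mulrA mulrA -mulrA.
rewrite (_ : _ * _ = 2 * ((jb x ^- (a + a) * C) * japanese_mass R b)); last by ring.
apply: cintegral_decay; first exact: cmeas_slice.
move=> y; rewrite ler_pdivlMl ?japaneseX_gt0 // mulrA; exact: fC.
Qed.

Let integrable_part (u : R[i] -> R) : (forall z, `|u z| <= N z) ->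
  measurable_fun setT (fun p : 'rV[R]_a * 'rV[R]_b => u (f p.1 p.2)) ->
  (mu a \x mu b)%E.-integrable setT (fun p => (u (f p.1 p.2))%:E).
Proof.
move=> uN mw; apply/integrable12ltyP; first exact/measurable_EFinP.
apply: (@le_lt_trans _ _ (\int[mu a]_x (jb x ^- (a + a) * (C * japanese_mass R b))%:E)%E).
  have C0 : 0 <= C.
    by apply: le_trans (fC 0 0); rewrite !mulr_ge0 ?normc_ge0 ?japaneseX_ge0.
  have c1 : (0 < (1 : R)) by [].
  rewrite -[leRHS]mul1e; apply: (le_integral_scale _ c1) => x.
    exact: integral_ge0.
  rewrite mul1e mulrA; apply: le_trans (integral_decay_le (g := fun y => N (f x y)) _ _).
  - by apply: le_integral_nonneg => y; rewrite normr_ge0 uN.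
  - by move=> y; exact: normc_ge0.
  - by move=> y; rewrite ler_pdivlMl ?japaneseX_gt0 // mulrA; exact: fC.
apply: le_lt_trans (ltry ((C * japanese_mass R b) * japanese_mass R a)).
have C0 : 0 <= C.
  by apply: le_trans (fC 0 0); rewrite !mulr_ge0 ?normc_ge0 ?japaneseX_ge0.
apply: integral_decay_le => x.
  by rewrite !mulr_ge0 ?japanese_mass_ge0 // invr_ge0 japaneseX_ge0.
by rewrite mulrA mulfV ?mul1r // gt_eqF // japaneseX_gt0.
Qed.

Let Rfubini (u : R[i] -> R) : (forall z, `|u z| <= N z) ->
  measurable_fun setT (fun z : 'rV[R]_(a + b) => u (f (lsubmx z) (rsubmx z))) ->
  measurable_fun setT (fun p : 'rV[R]_a * 'rV[R]_b => u (f p.1 p.2)) ->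
  (forall x, (mu b).-integrable setT (fun y => (u (f x y))%:E)) ->
  (forall y, (mu a).-integrable setT (fun x => (u (f x y))%:E)) ->
  \int[mu (a + b)]_z u (f (lsubmx z) (rsubmx z)) = \int[mu a]_x \int[mu b]_y u (f x y)
  /\ \int[mu a]_x \int[mu b]_y u (f x y) = \int[mu b]_y \int[mu a]_x u (f x y).
Proof.
move=> uN mz mw ix iy; have pI := integrable_part uN mw.
have e1 : \int[mu a]_x \int[mu b]_y u (f x y) =
    fine (\int[(mu a \x mu b)%E]_p (u (f p.1 p.2))%:E)%E.
  rewrite /Rintegral; congr fine; rewrite -integral12_prod_meas1 //.
  by apply: eq_integral => x _; rewrite /fubini_F fineK // integrable_fin_num.
split; last first.
  rewrite e1 /Rintegral; congr fine; rewrite -integral21_prod_meas1 //.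
  by apply: eq_integral => y _; rewrite /fubini_G fineK // integrable_fin_num.
rewrite e1 -[LHS]mul1r -(Rintegral_transfer (m1 := (mu a \x mu b)%E)
  (phi := fun p : 'rV[R]_a * 'rV[R]_b => row_mx p.1 p.2) (r := 1)) //.
  by apply: eq_Rintegral => p _; rewrite row_mxKl row_mxKr.
move=> g mg g0; rewrite mul1e (tonelli_row_mx mg g0).
rewrite (fubini_tonelli1 (m1 := mu a) (m2 := mu b)
  (fun p : 'rV[R]_a * 'rV[R]_b => g (row_mx p.1 p.2))) //.
apply: (measurableT_comp mg).
by apply: measurable_row_mx; [exact: measurable_fst|exact: measurable_snd].
Qed.

Lemma fubini_slicer y : cintegrable (fun x => f x y).
Proof.
apply: (@cintegrable_decay _ _ _ C).
  exact: (@cmeas_slice _ _ (fun y x => f x y) y (cmeas_swap mf)).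
move=> x; apply: le_trans (fC x y); rewrite mulrAC ler_peMr ?japaneseX_ge1 //.
by rewrite mulr_ge0 ?normc_ge0 // japaneseX_ge0.
Qed.

Lemma cfubini : cintegral (fun z : 'rV[R]_(a + b) => f (lsubmx z) (rsubmx z)) =
  cintegral (fun x => cintegral (f x)).
Proof.
have [mr mi] := cmeas_row mf; have [mzr mzi] := mf.
apply: complexP => /=.
  have [-> _] := Rfubini (@normc_Re R) mzr mr
    (fun x => cintegrable_Re (fubini_slice x)) (fun y => cintegrable_Re (fubini_slicer y)).
  by [].
have [-> _] := Rfubini (@normc_Im R) mzi mi
    (fun x => cintegrable_Im (fubini_slice x)) (fun y => cintegrable_Im (fubini_slicer y)).
by [].
Qed.

Lemma cfubini_swap : cintegral (fun x => cintegral (f x)) =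
  cintegral (fun y => cintegral (fun x => f x y)).
Proof.
have [mr mi] := cmeas_row mf; have [mzr mzi] := mf.
apply: complexP => /=.
  have [_ ->] := Rfubini (@normc_Re R) mzr mr
    (fun x => cintegrable_Re (fubini_slice x)) (fun y => cintegrable_Re (fubini_slicer y)).
  by [].
have [_ ->] := Rfubini (@normc_Im R) mzi mi
    (fun x => cintegrable_Im (fubini_slice x)) (fun y => cintegrable_Im (fubini_slicer y)).
by [].
Qed.

End fubini.

Section dominated_convergence.
Variable R : realType.
Local Notation N := (@Normc.normc R).
Local Notation mu := (lebesgue_rV R).

Lemma cintegral_dominated k (F : nat -> 'rV[R]_k -> R[i]) (f : 'rV[R]_k -> R[i])
    (g : 'rV[R]_k -> R) :
  (forall j, cmeas (F j)) -> cmeas f -> (forall j x, N (F j x) <= g x) ->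
  measurable_fun setT g -> (\int[mu k]_x (g x)%:E < +oo)%E ->
  (forall x, N (F j x - f x) @[j --> \oo] --> 0) ->
  N (cintegral (F j) - cintegral f) @[j --> \oo] --> 0.
Proof.
move=> mF mf Fg mg gI cv.
have g0 x : 0 <= g x by apply: le_trans (Fg 0%N x); exact: normc_ge0.
have fg x : N (f x) <= g x.
  have c : (g x + N (F j x - f x)) @[j --> \oo] --> g x.
    by rewrite -[X in _ --> X]addr0; apply: cvgD; [exact: cvg_cst|exact: cv].
  rewrite -(cvg_lim _ c) //; apply: limr_ge; first by apply/cvg_ex; exists (g x).
  near=> j; apply: (le_trans _ (lerD (Fg j x) (lexx _))).
  rewrite -[X in N X <= _](opprK (f x)) normcN.
  rewrite [X in N X <= _](_ : - f x = - F j x + (F j x - f x)); last by ring.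
  by apply: (le_trans (le_normcD _ _)); rewrite normcN.
have mh j : measurable_fun setT (fun x => N (F j x - f x)).
  by apply: measurable_normc; exact: cmeasB.
have h2 j x : N (F j x - f x) <= 2 * g x.
  by apply: (le_trans (normcB _ _)); rewrite mulr_natl mulr2n lerD.
have g2I : (mu k).-integrable setT (fun x => (2 * g x)%:E).
  under eq_fun do rewrite EFinM; apply: integrableZl => //.
  apply/integrableP; split; first exact/measurable_EFinP.
  by under eq_integral do rewrite gee0_abs ?lee_fin //.
have := @dominated_cvg _ _ R (mu k) setT measurableT
  (fun j x => (N (F j x - f x))%:E) (fun=> 0%E) (fun x => (2 * g x)%:E).
rewrite integral0 => /(_ _ _ _ g2I) H.
have {}H : (\int[mu k]_x (N (F j x - f x))%:E)%E @[j --> \oo] --> 0%E.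
  apply: H.
  - by move=> j; exact/measurable_EFinP.
  - by move=> x _; apply/cvg_EFin; [exact: nearW|exact: cv].
  - by [].
  - by move=> j x _; rewrite gee0_abs lee_fin ?normc_ge0.
have fI : cintegrable f by exact: cintegrable_le mf fg gI.
have FI j : cintegrable (F j) by exact: cintegrable_le (mF j) (Fg j) gI.
have If j : (\int[mu k]_x (N (F j x - f x))%:E)%E \is a fin_num.
  rewrite ge0_fin_numE; last by apply: integral_ge0 => x _; rewrite lee_fin normc_ge0.
  apply: (@le_lt_trans _ _ (\int[mu k]_x (2 * g x)%:E)%E).
    by apply: le_integral_nonneg => x; rewrite normc_ge0 h2.
  have /integrableP[_] := g2I; apply: le_lt_trans; apply: le_integral_nonneg => x.
  by rewrite ler_norm mulr_ge0.
apply: (@squeeze_cvgr _ _ _ _ (cst 0)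
  (fun j => 2 * fine (\int[mu k]_x (N (F j x - f x))%:E)%E)).
- apply: nearW => j; apply/andP; split; first exact: normc_ge0.
  rewrite -cintegralB //.
  apply: (@normc_cintegral_le _ _ _ (fun x => N (F j x - f x))) => //.
    exact: cmeasB.
  by rewrite fineK.
- exact: cvg_cst.
- rewrite -[X in _ --> X](mulr0 2); apply: cvgM; first exact: cvg_cst.
  exact: (fine_cvg H).
Unshelve. all: by end_near. Qed.

End dominated_convergence.

(** * Partial derivatives *)
Section real_calculus.
Variable R : realType.
Implicit Types k : nat.

Lemma derive_coords k (f : 'rV[R]_k -> R) y w : differentiable f y ->
  'D_w f y = \sum_j w ord0 j * 'D_(delta_mx ord0 j) f y.
Proof.
move=> df; rewrite deriveE // {1}[w]row_sum_delta linear_sum /=.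
by apply: eq_bigr => j _; rewrite linearZ /= deriveE.
Qed.

Lemma differentiable_affine k l (M : 'M[R]_(k, l)) (c : 'rV[R]_l) (x : 'rV[R]_k) :
  differentiable (fun y : 'rV[R]_k => y *m M + c) x.
Proof.
have -> : (fun y : 'rV[R]_k => y *m M + c) =
    (\sum_(i < k) (fun y : 'rV[R]_k => y ord0 i *: row i M)) + cst c.
  apply/funext => y; rewrite !fctE fct_sumE; congr (_ + _).
  by rewrite mulmx_sum_row.
apply: differentiableD; last exact: differentiable_cst.
apply: differentiable_sum => i; apply: differentiableZl.
exact: differentiable_coord.
Qed.

Lemma derive_affine k l (M : 'M[R]_(k, l)) (c : 'rV[R]_l) (f : 'rV[R]_l -> R) x v :
  differentiable f (x *m M + c) ->
  differentiable (fun y => f (y *m M + c)) x /\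
  'D_v (fun y => f (y *m M + c)) x = 'D_(v *m M) f (x *m M + c).
Proof.
move=> df; have da := differentiable_affine M c x.
have dc : differentiable (f \o (fun y => y *m M + c)) x by exact: differentiable_comp.
split=> //; rewrite deriveE // (diff_comp da df) /= [RHS]deriveE //; congr ('d f _ _).
rewrite -deriveE //.
have cv : (h^-1 *: ((h *: v + x) *m M + c - (x *m M + c))) @[h --> 0^'] --> v *m M.
  apply: cvg_near_cst; near=> h.
  have h0 : h != 0 by near: h; exact: nbhs_dnbhs_neq.
  apply/eqP; rewrite mulmxDl -scalemxAl opprD addrACA subrr addr0 addrK scalerA.
  by rewrite mulVf // scale1r.
exact: cvg_lim cv.
Unshelve. all: by end_near. Qed.

Lemma derive_comp1 k (g : R -> R) (q : 'rV[R]_k -> R) x v :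
  derivable g (q x) 1 -> differentiable q x ->
  differentiable (fun y => g (q y)) x /\
  'D_v (fun y => g (q y)) x = derive1 g (q x) * 'D_v q x.
Proof.
move=> /derivable1_diffP dg dq.
have dc : differentiable (g \o q) x by exact: differentiable_comp.
split=> //; rewrite deriveE // (diff_comp dq dg) /= deriv1E; last exact/derivable1_diffP.
by rewrite -deriveE // [LHS]mulrC.
Qed.

Lemma derive_dotv k (w : 'rV[R]_k) (x v : 'rV[R]_k) :
  differentiable (fun y => dotv y w) x /\ 'D_v (fun y => dotv y w) x = dotv v w.
Proof.
have dd : differentiable (fun y : 'rV[R]_k => dotv y w) x.
  rewrite (_ : (fun y => _) = \sum_(i < k) (fun y : 'rV[R]_k => y ord0 i * w ord0 i)).
    apply: differentiable_sum => i; apply: differentiableM; first exact: differentiable_coord.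
    exact: differentiable_cst.
  by apply/funext => y; rewrite fct_sumE.
split=> //; rewrite /derive.
have cv : (h^-1 *: (dotv (h *: v + x) w - dotv x w)) @[h --> 0^'] --> dotv v w.
  apply: cvg_near_cst; near=> h.
  have h0 : h != 0 by near: h; exact: nbhs_dnbhs_neq.
  by apply/eqP; rewrite dotvDl dotvZl addrK /GRing.scale /= mulrA mulVf // mul1r.
exact: cvg_lim cv.
Unshelve. all: by end_near. Qed.

End real_calculus.

Section complex_calculus.
Variable R : realType.
Implicit Types k : nat.

Definition cdiff k (f : 'rV[R]_k -> R[i]) x :=
  differentiable (fun y => Re (f y)) x /\ differentiable (fun y => Im (f y)) x.

Lemma cdiff_cst k (c : R[i]) (x : 'rV[R]_k) : cdiff (fun=> c) x.
Proof. by split; exact: differentiable_cst. Qed.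

Lemma partial_cst k (c : R[i]) i (x : 'rV[R]_k) : partial i (fun=> c) x = 0.
Proof. by rewrite /partial !derive_cst. Qed.

Lemma cdiffD k (f g : 'rV[R]_k -> R[i]) x :
  cdiff f x -> cdiff g x -> cdiff (fun y => f y + g y) x.
Proof.
move=> [fr fi] [gr gi]; split.
  by under eq_fun do rewrite ReD; exact: differentiableD.
by under eq_fun do rewrite ImD; exact: differentiableD.
Qed.

Lemma partialD k i (f g : 'rV[R]_k -> R[i]) x : cdiff f x -> cdiff g x ->
  partial i (fun y => f y + g y) x = partial i f x + partial i g x.
Proof.
move=> [/diff_derivable fr /diff_derivable fi] [/diff_derivable gr /diff_derivable gi].
apply: complexP; rewrite ?ReD ?ImD /partial /=.
  by under eq_fun do rewrite ReD; rewrite deriveD.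
by under eq_fun do rewrite ImD; rewrite deriveD.
Qed.

Lemma cdiffM k (f g : 'rV[R]_k -> R[i]) x :
  cdiff f x -> cdiff g x -> cdiff (fun y => f y * g y) x.
Proof.
move=> [fr fi] [gr gi]; split.
  by under eq_fun do rewrite ReM; apply: differentiableB; exact: differentiableM.
by under eq_fun do rewrite ImM; apply: differentiableD; exact: differentiableM.
Qed.

Lemma partialM k i (f g : 'rV[R]_k -> R[i]) x : cdiff f x -> cdiff g x ->
  partial i (fun y => f y * g y) x = partial i f x * g x + f x * partial i g x.
Proof.
move=> [/diff_derivable fr /diff_derivable fi] [/diff_derivable gr /diff_derivable gi].
apply: complexP; rewrite ?ReD ?ImD ?ReM ?ImM /partial /=.
  under eq_fun do rewrite ReM.
  rewrite deriveB; [|exact: derivableM..].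
  by rewrite !deriveM // /GRing.scale /=; ring.
under eq_fun do rewrite ImM.
rewrite deriveD; [|exact: derivableM..].
by rewrite !deriveM // /GRing.scale /=; ring.
Qed.

Lemma cdiffZ k c (f : 'rV[R]_k -> R[i]) x : cdiff f x -> cdiff (fun y => c * f y) x.
Proof. by move=> df; apply: cdiffM => //; exact: cdiff_cst. Qed.

Lemma partialZ k i c (f : 'rV[R]_k -> R[i]) x : cdiff f x ->
  partial i (fun y => c * f y) x = c * partial i f x.
Proof. by move=> df; rewrite partialM ?partial_cst ?mul0r ?add0r //; exact: cdiff_cst. Qed.

Lemma cdiff_real k (q : 'rV[R]_k -> R) x : differentiable q x ->
  cdiff (fun y => (q y)%:C) x.
Proof. by move=> dq; split=> //; exact: differentiable_cst. Qed.

Lemma partial_real k i (q : 'rV[R]_k -> R) x :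
  partial i (fun y => (q y)%:C) x = ('D_(delta_mx ord0 i) q x)%:C.
Proof. by rewrite /partial /= derive_cst. Qed.

Lemma partial_expi k i (q : 'rV[R]_k -> R) x : differentiable q x ->
  cdiff (fun y => expi (q y)) x /\ partial i (fun y => expi (q y)) x =
  ('i * ('D_(delta_mx ord0 i) q x)%:C) * expi (q x).
Proof.
move=> dq; have dcos : derivable (@cos R) (q x) 1 by exact: ex_derive.
have dsin : derivable (@sin R) (q x) 1 by exact: ex_derive.
have [c1 c2] := derive_comp1 (delta_mx ord0 i) dcos dq.
have [s1 s2] := derive_comp1 (delta_mx ord0 i) dsin dq.
split; first by split.
rewrite /partial /= c2 s2 !derive1E !derive_val.
by apply: complexP; rewrite ?ReM ?ImM /=; ring.
Qed.

Lemma partial_affine k l i (M : 'M[R]_(k, l)) (c : 'rV[R]_l) (f : 'rV[R]_l -> R[i]) x :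
  cdiff f (x *m M + c) -> cdiff (fun y => f (y *m M + c)) x /\
  partial i (fun y => f (y *m M + c)) x =
  \sum_j (M i j)%:C * partial j f (x *m M + c).
Proof.
move=> [fr fi]; have [r1 r2] := derive_affine (delta_mx ord0 i) fr.
have [i1 i2] := derive_affine (delta_mx ord0 i) fi; split; first by split.
rewrite /partial r2 i2 derive_coords // derive_coords //.
have rE j : (delta_mx ord0 i *m M : 'rV[R]_l) ord0 j = M i j by rewrite -rowE mxE.
apply: complexP; rewrite ?Re_sum ?Im_sum /=; apply: eq_bigr => j _; rewrite rE.
  by rewrite ?ReM /= mul0r subr0.
by rewrite ?ImM /= mul0r addr0.
Qed.

End complex_calculus.

(** * Schwartz functions and multipliers *)
Section smooth_classes.
Variable R : realType.
Local Notation N := (@Normc.normc R).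
Local Notation jb := (@japanese R _).
Implicit Types k : nat.

Lemma cdiff_affine k l (M : 'M[R]_(k, l)) (c : 'rV[R]_l) (f : 'rV[R]_l -> R[i]) x :
  cdiff f (x *m M + c) -> cdiff (fun y => f (y *m M + c)) x.
Proof. by move=> [/(derive_affine 0)[? _] /(derive_affine 0)[? _]]. Qed.

Lemma cdiff_expi k (q : 'rV[R]_k -> R) x : differentiable q x ->
  cdiff (fun y => expi (q y)) x.
Proof.
move=> dq; have dcos : derivable (@cos R) (q x) 1 by exact: ex_derive.
have dsin : derivable (@sin R) (q x) 1 by exact: ex_derive.
by have [? _] := derive_comp1 0 dcos dq; have [? _] := derive_comp1 0 dsin dq.
Qed.

Definition rdecay k (f : 'rV[R]_k -> R[i]) :=
  forall n, exists C, forall x, jb x ^+ n * N (f x) <= C.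

Definition pbound k (f : 'rV[R]_k -> R[i]) :=
  exists n C, forall x, N (f x) <= C * jb x ^+ n.

(** Smooth functions all of whose derivatives satisfy a given bound: Schwartz
    functions for [rdecay], tempered multipliers for [pbound]. *)
Definition csmooth k (B : ('rV[R]_k -> R[i]) -> Prop) f :=
  smooth f /\ forall s, B (partials s f).

(** Schwartz's space O_M. *)
Definition multiplier k (f : 'rV[R]_k -> R[i]) := csmooth (@pbound k) f.

Definition lin_closed k (B : ('rV[R]_k -> R[i]) -> Prop) :=
  B (fun=> 0) /\ forall c f g, B f -> B g -> B (fun x => c * f x + g x).

Lemma rdecay_lin k : lin_closed (@rdecay k).
Proof.
split=> [n|c f g fB gB n]; first by exists 0 => x; rewrite Normc.normc0 mulr0.
have [A fA] := fB n; have [D gD] := gB n; exists (N c * A + D) => x.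
apply: (le_trans (ler_wpM2l (japaneseX_ge0 x n) (le_normcD _ _))).
by rewrite mulrDr lerD // Normc.normcM mulrCA ler_wpM2l // normc_ge0.
Qed.

Lemma pbound_lin k : lin_closed (@pbound k).
Proof.
split=> [|c f g [n [A fA]] [m [D gD]]].
  by exists 0%N, 0 => x; rewrite Normc.normc0 mul0r.
have A0 : 0 <= A.
  by have := le_trans (normc_ge0 _) (fA 0); rewrite pmulr_lge0 // japaneseX_gt0.
have D0 : 0 <= D.
  by have := le_trans (normc_ge0 _) (gD 0); rewrite pmulr_lge0 // japaneseX_gt0.
exists (n + m)%N, (N c * A + D) => x; apply: (le_trans (le_normcD _ _)).
rewrite mulrDl lerD // ?Normc.normcM -?mulrA.
  rewrite ler_wpM2l ?normc_ge0 // (le_trans (fA x)) // ler_wpM2l //.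
  by rewrite japanese_leX // leq_addr.
by rewrite (le_trans (gD x)) // ler_wpM2l // japanese_leX // leq_addl.
Qed.

Inductive cspan k (P : ('rV[R]_k -> R[i]) -> Prop) : ('rV[R]_k -> R[i]) -> Prop :=
| cspan0 : cspan P (fun=> 0)
| cspanS c f g : P f -> cspan P g -> cspan P (fun x => c * f x + g x).

Lemma cspan1 k (P : ('rV[R]_k -> R[i]) -> Prop) f : P f -> cspan P f.
Proof.
move=> Pf; rewrite (_ : f = fun x => 1 * f x + 0); first by apply: cspanS => //; exact: cspan0.
by apply/funext => x; rewrite mul1r addr0.
Qed.

Lemma cspan_lin k (P : ('rV[R]_k -> R[i]) -> Prop) : lin_closed (cspan P).
Proof.
split=> [|c f g fP gP]; first exact: cspan0.
elim: fP => [|d f' g' Pf' _ IH].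
  by under eq_fun do rewrite mulr0 add0r.
rewrite (_ : (fun x => _) = fun x => (c * d) * f' x + (c * g' x + g x)).
  exact: cspanS.
by apply/funext => x; ring.
Qed.

Lemma lin_closedD k (B : ('rV[R]_k -> R[i]) -> Prop) f g :
  lin_closed B -> B f -> B g -> B (fun x => f x + g x).
Proof.
move=> [_ lB] Bf Bg; have := lB 1 f g Bf Bg; congr B.
by apply/funext => x; rewrite mul1r.
Qed.

Lemma lin_closed_sum k (B : ('rV[R]_k -> R[i]) -> Prop) I (s : seq I) (c : I -> R[i]) F :
  lin_closed B -> (forall i, B (F i)) -> B (fun x => \sum_(i <- s) c i * F i x).
Proof.
move=> lB BF; elim: s => [|i s IH].
  by under eq_fun do rewrite big_nil; case: lB.
under eq_fun do rewrite big_cons.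
by case: lB => _; exact.
Qed.

(** Coinduction: to prove that a family consists of functions with all derivatives
    in a class, it suffices to differentiate once and land in its span. *)
Lemma csmooth_coind k (B P : ('rV[R]_k -> R[i]) -> Prop) : lin_closed B ->
  (forall f, P f -> [/\ forall x, cdiff f x, B f & forall i, cspan P (partial i f)]) ->
  forall f, cspan P f -> csmooth B f.
Proof.
move=> lB HP.
have sd f : cspan P f -> forall x, cdiff f x.
  elim=> [x|c g h Pg _ IH x]; first exact: cdiff_cst.
  by apply: cdiffD => //; apply: cdiffZ; have [] := HP g Pg.
have sB f : cspan P f -> B f.
  elim=> [|c g h Pg _ IH]; case: (lB) => // _; apply=> //.
  by have [] := HP g Pg.
have sp i f : cspan P f -> cspan P (partial i f).
  elim=> [|c g h Pg hP IH].
    rewrite (_ : partial i _ = fun=> 0); first exact: cspan0.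
    by apply/funext => x; rewrite partial_cst.
  have [dg _ Pd] := HP g Pg.
  rewrite (_ : partial i _ = fun x => c * partial i g x + partial i h x).
    by case: (cspan_lin P) => _; apply.
  apply/funext => x; rewrite partialD ?partialZ //; first exact: cdiffZ.
  exact: sd.
have sps s f : cspan P f -> cspan P (partials s f).
  by move=> Pf; elim: s => //= i s; exact: sp.
move=> f Pf; split=> [s x|s]; last exact/sB/sps.
exact: (sd _ (sps s f Pf) x).
Qed.

Lemma csmooth_cdiff k (B : ('rV[R]_k -> R[i]) -> Prop) f x : csmooth B f -> cdiff f x.
Proof. by move=> [sf _]; exact: (sf [::] x). Qed.

Lemma csmooth_bound k (B : ('rV[R]_k -> R[i]) -> Prop) f : csmooth B f -> B f.
Proof. by move=> [_ /(_ [::])]. Qed.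

Lemma csmooth_partial k (B : ('rV[R]_k -> R[i]) -> Prop) i f :
  csmooth B f -> csmooth B (partial i f).
Proof.
have e s : partials s (partial i f) = partials (rcons s i) f.
  by rewrite /partials foldr_rcons.
by move=> [sf Bf]; split=> [s x|s]; rewrite e.
Qed.

Lemma csmooth_lin k (B : ('rV[R]_k -> R[i]) -> Prop) : lin_closed B ->
  lin_closed (csmooth B).
Proof.
move=> lB; have H : forall f, cspan (csmooth B) f -> csmooth B f.
  apply: csmooth_coind => // f sf; split=> [x||i].
  - exact: csmooth_cdiff sf.
  - exact: csmooth_bound.
  - by apply: cspan1; exact: csmooth_partial.
split; first exact/H/cspan0.
by move=> c f g sf sg; apply/H/cspanS => //; exact: cspan1.
Qed.

Lemma csmooth_sub k (B B' : ('rV[R]_k -> R[i]) -> Prop) f :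
  (forall g, B g -> B' g) -> csmooth B f -> csmooth B' f.
Proof. by move=> BB' [sf Bf]; split=> // s; exact: BB'. Qed.

Definition affine_map k l (L : 'rV[R]_k -> 'rV[R]_l) :=
  exists (M : 'M[R]_(k, l)) (c : 'rV[R]_l), forall x, L x = x *m M + c.

Lemma affine_id k : affine_map (fun x : 'rV[R]_k => x).
Proof. by exists 1%:M, 0 => x; rewrite mulmx1 addr0. Qed.

Lemma affine_cst k l (c : 'rV[R]_l) : affine_map (fun _ : 'rV[R]_k => c).
Proof. by exists 0, c => x; rewrite mulmx0 add0r. Qed.

Lemma affineD k l (L L' : 'rV[R]_k -> 'rV[R]_l) :
  affine_map L -> affine_map L' -> affine_map (fun x => L x + L' x).
Proof.
move=> [M [c e]] [M' [c' e']]; exists (M + M'), (c + c') => x.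
by rewrite e e' mulmxDr addrACA.
Qed.

Lemma affineZ k l t (L : 'rV[R]_k -> 'rV[R]_l) :
  affine_map L -> affine_map (fun x => t *: L x).
Proof.
by move=> [M [c e]]; exists (t *: M), (t *: c) => x; rewrite e scalerDr scalemxAr.
Qed.

Lemma affineN k l (L : 'rV[R]_k -> 'rV[R]_l) :
  affine_map L -> affine_map (fun x => - L x).
Proof.
by move=> aL; have := affineZ (-1) aL; congr affine_map; apply/funext => x; rewrite scaleN1r.
Qed.

Lemma affine_row k a b (L : 'rV[R]_k -> 'rV[R]_a) (L' : 'rV[R]_k -> 'rV[R]_b) :
  affine_map L -> affine_map L' -> affine_map (fun x => row_mx (L x) (L' x)).
Proof.
move=> [M [c e]] [M' [c' e']]; exists (row_mx M M'), (row_mx c c') => x.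
by rewrite e e' mul_mx_row add_row_mx.
Qed.

Lemma affine_lsubmx k a b (L : 'rV[R]_k -> 'rV[R]_(a + b)) :
  affine_map L -> affine_map (fun x => lsubmx (L x)).
Proof.
move=> [M [c e]]; exists (lsubmx M), (lsubmx c) => x; rewrite e.
by rewrite -[in LHS](hsubmxK M) mul_mx_row -[in LHS](hsubmxK c) add_row_mx row_mxKl.
Qed.

Lemma affine_rsubmx k a b (L : 'rV[R]_k -> 'rV[R]_(a + b)) :
  affine_map L -> affine_map (fun x => rsubmx (L x)).
Proof.
move=> [M [c e]]; exists (rsubmx M), (rsubmx c) => x; rewrite e.
by rewrite -[in LHS](hsubmxK M) mul_mx_row -[in LHS](hsubmxK c) add_row_mx row_mxKr.
Qed.

Lemma affine_bound k l (L : 'rV[R]_k -> 'rV[R]_l) : affine_map L ->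
  exists2 C, 0 < C & forall x, jb (L x) <= C * jb x.
Proof.
move=> [M [c e]].
have H i : exists2 C, 0 < C & forall x : 'rV[R]_k, `|(x *m M) ord0 i| <= C * jb x.
  exists (1 + \sum_j `|M j i|).
    by rewrite ltr_pwDl // sumr_ge0.
  move=> x; rewrite mxE; apply: (le_trans (ler_norm_sum _ _ _)).
  apply: (@le_trans _ _ (\sum_j `|M j i| * jb x)).
    apply: ler_sum => j _; rewrite normrM mulrC ler_wpM2l //; exact: japanese_coord.
  by rewrite -mulr_suml ler_wpM2r ?japanese_ge0 // lerDr.
have [F F0 HF] : exists2 F : 'I_l -> R, (forall i, 0 < F i) &
    forall i x, `|(x *m M) ord0 i| <= F i * jb x.
  exists (fun i => sval (cid2 (H i))) => [i|i x]; by case: (cid2 (H i)) => ? /=.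
pose S := \sum_i F i ^+ 2.
have S0 : 0 <= S by apply: sumr_ge0 => i _; exact: sqr_ge0.
exists (2 * jb c * (1 + S)); first by rewrite !mulr_gt0 ?japanese_gt0 // ltr_pwDl.
move=> x; rewrite e; apply: (le_trans (japaneseD _ _)).
rewrite (_ : 2 * jb c * (1 + S) * jb x = 2 * ((1 + S) * jb x) * jb c); last by ring.
rewrite ler_wpM2r ?japanese_ge0 // ler_wpM2l //.
have p0 : 0 <= (1 + S) * jb x by rewrite mulr_ge0 ?addr_ge0 ?japanese_ge0.
rewrite -(ler_pXn2r (ltn0Sn 1)) ?nnegrE ?japanese_ge0 // exprMn japanese_sqr.
have h : dotv (x *m M) (x *m M) <= S * jb x ^+ 2.
  rewrite /S /dotv mulr_suml; apply: ler_sum => i _.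
  rewrite -expr2 -(real_normK (num_real _)) -exprMn ler_pXn2r ?nnegrE //.
  by rewrite mulr_ge0 ?japanese_ge0 // ltW.
have := japaneseX_ge1 x 2; nra.
Qed.

Lemma japaneseX_affine k l (L : 'rV[R]_k -> 'rV[R]_l) : affine_map L ->
  exists2 C, 0 < C & forall n x, jb (L x) ^+ n <= C ^+ n * jb x ^+ n.
Proof.
move=> /affine_bound[C C0 H]; exists C => // n x; rewrite -exprMn.
by apply: lerXn2r; rewrite ?nnegrE ?mulr_ge0 ?japanese_ge0 // ltW.
Qed.

Lemma csmooth_comp2 k a b (L1 : 'rV[R]_k -> 'rV[R]_a) (L2 : 'rV[R]_k -> 'rV[R]_b) B1 B2 B :
  affine_map L1 -> affine_map L2 -> lin_closed B ->
  (forall f g, B1 f -> B2 g -> B (fun x => f (L1 x) * g (L2 x))) ->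
  forall f g, csmooth B1 f -> csmooth B2 g -> csmooth B (fun x => f (L1 x) * g (L2 x)).
Proof.
move=> [M1 [c1 e1]] [M2 [c2 e2]] lB HB f g sf sg.
pose P (h : 'rV[R]_k -> R[i]) := exists f g, [/\ csmooth B1 f, csmooth B2 g &
  h = fun x => f (L1 x) * g (L2 x)].
apply: (@csmooth_coind _ _ P) => //; last by apply: cspan1; exists f, g.
move=> {f g sf sg} _ [f [g [sf sg ->]]]; split=> [x||i].
- apply: cdiffM.
    rewrite (_ : (fun y => _) = fun y => f (y *m M1 + c1)); last first.
      by apply/funext => y; rewrite e1.
    by apply: cdiff_affine; exact: csmooth_cdiff sf.
  rewrite (_ : (fun y => _) = fun y => g (y *m M2 + c2)); last first.
    by apply/funext => y; rewrite e2.
  by apply: cdiff_affine; exact: csmooth_cdiff sg.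
- by apply: HB; exact: csmooth_bound.
have d1 x : cdiff f (x *m M1 + c1) by exact: csmooth_cdiff sf.
have d2 x : cdiff g (x *m M2 + c2) by exact: csmooth_cdiff sg.
rewrite (_ : partial i _ = fun x =>
  \sum_j (M1 i j)%:C * (partial j f (L1 x) * g (L2 x)) +
  \sum_j (M2 i j)%:C * (f (L1 x) * partial j g (L2 x))).
  apply: lin_closedD; first exact: cspan_lin.
    apply: lin_closed_sum; first exact: cspan_lin.
    move=> j; apply: cspan1; exists (partial j f), g; split=> //; exact: csmooth_partial.
  apply: lin_closed_sum; first exact: cspan_lin.
  move=> j; apply: cspan1; exists f, (partial j g); split=> //; exact: csmooth_partial.
apply/funext => x.
have [a1 p1] := partial_affine i (d1 x); have [a2 p2] := partial_affine i (d2 x).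
rewrite (_ : (fun x => _) = fun x => f (x *m M1 + c1) * g (x *m M2 + c2)); last first.
  by apply/funext => y; rewrite e1 e2.
rewrite partialM // p1 p2 e1 e2 mulr_suml mulr_sumr; congr (_ + _).
  by apply: eq_bigr => j _; rewrite mulrA.
by apply: eq_bigr => j _; rewrite mulrCA.
Qed.

Lemma pbound_le k (f : 'rV[R]_k -> R[i]) : pbound f ->
  exists n C, 0 <= C /\ forall x, N (f x) <= C * jb x ^+ n.
Proof.
move=> [n [C fC]]; exists n, C; split => //.
by have := le_trans (normc_ge0 _) (fC 0); rewrite pmulr_lge0 // japaneseX_gt0.
Qed.

Lemma rdecay_pbound k (f : 'rV[R]_k -> R[i]) : rdecay f -> pbound f.
Proof.
by move=> /(_ 0%N)[C fC]; exists 0%N, C => x; have := fC x; rewrite !expr0 mul1r mulr1.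
Qed.

Lemma schwartz_multiplier k (f : 'rV[R]_k -> R[i]) : is_schwartz f -> multiplier f.
Proof. by apply: (@csmooth_sub _ (@rdecay k)) => g; exact: rdecay_pbound. Qed.

Lemma multiplier_comp2 k a b (L1 : 'rV[R]_k -> 'rV[R]_a) (L2 : 'rV[R]_k -> 'rV[R]_b) f g :
  affine_map L1 -> affine_map L2 -> multiplier f -> multiplier g ->
  multiplier (fun x => f (L1 x) * g (L2 x)).
Proof.
move=> a1 a2; apply: csmooth_comp2 => //; first exact: pbound_lin.
move=> {}f {}g /pbound_le[n [C [C0 fC]]] /pbound_le[m [D [D0 gD]]].
have [A A0 H1] := japaneseX_affine a1; have [A' A'0 H2] := japaneseX_affine a2.
exists (n + m)%N, (C * A ^+ n * (D * A' ^+ m)) => x; rewrite Normc.normcM exprD mulrACA.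
by rewrite ler_pM ?normc_ge0 // -mulrA;
  [apply: (le_trans (fC _))|apply: (le_trans (gD _))]; rewrite ler_wpM2l.
Qed.

Lemma multiplierM k (f g : 'rV[R]_k -> R[i]) :
  multiplier f -> multiplier g -> multiplier (fun x => f x * g x).
Proof. by apply: multiplier_comp2; exact: affine_id. Qed.

Lemma rdecayM k (f g : 'rV[R]_k -> R[i]) :
  pbound f -> rdecay g -> rdecay (fun x => f x * g x).
Proof.
move=> /pbound_le[n [C [C0 fC]]] gd m; have [D gD] := gd (n + m)%N.
exists (C * D) => x; rewrite Normc.normcM mulrCA.
apply: (le_trans (ler_wpM2r _ (fC x))).
  by rewrite mulr_ge0 ?normc_ge0 // japaneseX_ge0.
by rewrite -mulrA ler_wpM2l // mulrA -exprD.
Qed.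

Lemma schwartzM k (f g : 'rV[R]_k -> R[i]) :
  multiplier f -> is_schwartz g -> is_schwartz (fun x => f x * g x).
Proof.
apply: (@csmooth_comp2 k k k (fun x => x) (fun x => x) (@pbound k) (@rdecay k)
  (@rdecay k) (@affine_id k) (@affine_id k) (@rdecay_lin k)).
by move=> {}f {}g; exact: rdecayM.
Qed.

(** Tensor products and pull-backs by affine maps; the hypothesis says that the
    two maps together are proper. *)
Lemma schwartz_comp2 k a b (L1 : 'rV[R]_k -> 'rV[R]_a) (L2 : 'rV[R]_k -> 'rV[R]_b) f g q C :
  affine_map L1 -> affine_map L2 ->
  (forall x, jb x <= C * (jb (L1 x) * jb (L2 x)) ^+ q) ->
  is_schwartz f -> is_schwartz g -> is_schwartz (fun x => f (L1 x) * g (L2 x)).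
Proof.
move=> a1 a2 HL; have C0 : 0 <= C.
  have := le_trans (japanese_ge0 _) (HL 0); rewrite pmulr_lge0 //.
  by rewrite exprn_gt0 // mulr_gt0 // japanese_gt0.
apply: (@csmooth_comp2 k a b L1 L2 (@rdecay a) (@rdecay b) (@rdecay k)) => //.
  exact: rdecay_lin.
move=> {}f {}g fd gd n; have [A fA] := fd (q * n)%N; have [D gD] := gd (q * n)%N.
exists (C ^+ n * (A * D)) => x; rewrite Normc.normcM.
apply: (@le_trans _ _ ((C * (jb (L1 x) * jb (L2 x)) ^+ q) ^+ n * (N (f (L1 x)) * N (g (L2 x))))).
  rewrite ler_wpM2r ?mulr_ge0 ?normc_ge0 //.
  by apply: lerXn2r; rewrite ?nnegrE ?japanese_ge0 // mulr_ge0 // exprn_ge0 // mulr_ge0 // japanese_ge0.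
rewrite exprMn -exprM exprMn -mulrA ler_wpM2l ?exprn_ge0 // mulrACA.
by rewrite ler_pM // mulr_ge0 ?normc_ge0 // japaneseX_ge0.
Qed.

Lemma multiplier_cst k (c : R[i]) : multiplier (fun _ : 'rV[R]_k => c).
Proof.
pose P (h : 'rV[R]_k -> R[i]) := exists c, h = fun=> c.
apply: (@csmooth_coind _ _ P (@pbound_lin k)); last by apply: cspan1; exists c.
move=> _ [d ->]; split=> [x||i]; first exact: cdiff_cst.
  by exists 0%N, (N d) => x; rewrite expr0 mulr1.
by apply: cspan1; exists 0; apply/funext => x; rewrite partial_cst.
Qed.

Lemma schwartz_affine k a (L : 'rV[R]_k -> 'rV[R]_a) f q C :
  affine_map L -> (forall x, jb x <= C * jb (L x) ^+ q) ->
  is_schwartz f -> is_schwartz (fun x => f (L x)).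
Proof.
move=> aL HL sf; have C0 : 0 <= C.
  by have := le_trans (japanese_ge0 _) (HL 0); rewrite pmulr_lge0 // japaneseX_gt0.
have sub := @csmooth_comp2 k a a L L (@rdecay a) (@pbound a) (@rdecay k) aL aL
  (@rdecay_lin k) _ f (fun=> 1) sf (@multiplier_cst a 1).
rewrite (_ : (fun x => _) = fun x => f (L x) * 1); last first.
  by apply/funext => x; rewrite mulr1.
apply: sub => h g fd /pbound_le[m [D [D0 gD]]] n.
have [A fA] := fd (q * n + m)%N.
exists (C ^+ n * (A * D)) => x; rewrite Normc.normcM.
apply: (@le_trans _ _ ((C * jb (L x) ^+ q) ^+ n * (N (h (L x)) * (D * jb (L x) ^+ m)))).
  apply: ler_pM; rewrite ?japaneseX_ge0 ?mulr_ge0 ?normc_ge0 //.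
    by apply: lerXn2r; rewrite ?nnegrE ?japanese_ge0 // mulr_ge0 // japaneseX_ge0.
  by rewrite ler_wpM2l ?normc_ge0.
rewrite exprMn -exprM -mulrA ler_wpM2l ?exprn_ge0 //.
rewrite (_ : _ * _ = jb (L x) ^+ (q * n + m) * N (h (L x)) * D); last by rewrite exprD; ring.
by rewrite ler_wpM2r.
Qed.

Lemma schwartz_translate k (v : 'rV[R]_k) f :
  is_schwartz f -> is_schwartz (fun x => f (x + v)).
Proof.
apply: (@schwartz_affine _ _ (fun x => x + v) f 1 (2 * jb v)).
  by apply: affineD; [exact: affine_id|exact: affine_cst].
by move=> x; rewrite -[X in jb X <= _](addrK v) expr1 mulrAC; exact: japaneseB.
Qed.

Lemma multiplier_affine k a (L : 'rV[R]_k -> 'rV[R]_a) f :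
  affine_map L -> multiplier f -> multiplier (fun x => f (L x)).
Proof.
move=> aL mf; have := multiplier_comp2 aL aL mf (@multiplier_cst a 1); congr multiplier.
by apply/funext => x; rewrite mulr1.
Qed.

Lemma multiplier_coord k i : multiplier (fun x : 'rV[R]_k => (x ord0 i)%:C).
Proof.
pose P (h : 'rV[R]_k -> R[i]) := h = (fun x => (x ord0 i)%:C) \/ exists c, h = fun=> c.
apply: (@csmooth_coind _ _ P (@pbound_lin k)); last by apply: cspan1; left.
have dc (x : 'rV[R]_k) : differentiable (fun x : 'rV[R]_k => x ord0 i) x.
  exact: differentiable_coord.
move=> _ [->|[d ->]]; split=> [x||j].
- exact: cdiff_real.
- by exists 1%N, 1 => x; rewrite normcR mul1r expr1 japanese_coord.
- apply: cspan1; right; exists ((delta_mx ord0 j : 'rV[R]_k) ord0 i)%:C; apply/funext => x.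
  rewrite partial_real; congr _%:C.
  have [_ e] := derive_dotv (delta_mx ord0 i) x (delta_mx ord0 j).
  rewrite -[RHS]dotv_delta -e; congr ('D_ _ _ _); apply/funext => y.
  by rewrite dotv_delta.
- exact: cdiff_cst.
- by exists 0%N, (N d) => x; rewrite expr0 mulr1.
- by apply: cspan1; right; exists 0; apply/funext => x; rewrite partial_cst.
Qed.

Lemma multiplier_dotv k l (L L' : 'rV[R]_k -> 'rV[R]_l) :
  affine_map L -> affine_map L' -> multiplier (fun x => (dotv (L x) (L' x))%:C).
Proof.
move=> aL aL'.
rewrite (_ : (fun x => _) = fun x => \sum_i 1 * ((L x ord0 i)%:C * (L' x ord0 i)%:C)).
  apply: lin_closed_sum; first exact/csmooth_lin/pbound_lin.
  by move=> i; apply: multiplierM; apply: (multiplier_affine _ (@multiplier_coord l i)).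
apply/funext => x; rewrite /dotv rmorph_sum; apply: eq_bigr => i _.
by rewrite mul1r rmorphM.
Qed.

Lemma multiplier_real_differentiable k (q : 'rV[R]_k -> R) x :
  multiplier (fun x => (q x)%:C) -> differentiable q x.
Proof. by move=> /csmooth_cdiff - /(_ x)[]. Qed.

(** The derivatives stay in the span of the products of a multiplier and expi q. *)
Lemma multiplier_expi k (q : 'rV[R]_k -> R) :
  multiplier (fun x => (q x)%:C) -> multiplier (fun x => expi (q x)).
Proof.
move=> mq; have dq x : differentiable q x by exact: multiplier_real_differentiable.
pose P (h : 'rV[R]_k -> R[i]) := exists2 g, multiplier g & h = fun x => g x * expi (q x).
apply: (@csmooth_coind _ _ P (@pbound_lin k)); last first.
  apply: cspan1; exists (fun=> 1); first exact: multiplier_cst.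
  by apply/funext => x; rewrite mul1r.
move=> _ [g mg ->]; have dg x : cdiff g x by exact: csmooth_cdiff mg.
have de i x := partial_expi i (dq x).
split=> [x||i].
- by apply: cdiffM => //; exact: cdiff_expi.
- have [n [C gC]] := csmooth_bound mg; exists n, C => x.
  by rewrite Normc.normcM normc_expi mulr1.
- apply: cspan1; exists (fun x => partial i g x + g x * ('i * partial i (fun x => (q x)%:C) x)).
    apply: lin_closedD; [exact/csmooth_lin/pbound_lin|exact: csmooth_partial|].
    apply: multiplierM => //; apply: multiplierM; first exact: multiplier_cst.
    exact: csmooth_partial.
  apply/funext => x; have [d e] := de i x.
  by rewrite partialM // e partial_real; ring.
Qed.

Lemma csmooth_cmeas k (B : ('rV[R]_k -> R[i]) -> Prop) f : csmooth B f -> cmeas f.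
Proof.
move=> sf; split; apply: continuous_rV_measurable => x; apply: differentiable_continuous.
  by have [] := csmooth_cdiff x sf.
by have [] := csmooth_cdiff x sf.
Qed.

Lemma schwartz_cmeas k (f : 'rV[R]_k -> R[i]) : is_schwartz f -> cmeas f.
Proof. exact: (@csmooth_cmeas _ (@rdecay k)). Qed.

Lemma schwartz_bound k (f : 'rV[R]_k -> R[i]) n : is_schwartz f ->
  exists C, forall x, jb x ^+ n * N (f x) <= C.
Proof. by move=> sf; exact: (@csmooth_bound _ (@rdecay k) _ sf). Qed.

Lemma schwartz_cintegrable k (f : 'rV[R]_k -> R[i]) : is_schwartz f -> cintegrable f.
Proof.
move=> sf; have [C fC] := schwartz_bound (k + k) sf.
by apply: (cintegrable_decay (schwartz_cmeas sf) fC).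
Qed.

Definition gauss k (a : R) (x : 'rV[R]_k) : R := expR (- a * dotv x x).

Lemma gauss_decay k a n : 0 < a ->
  exists C, forall x : 'rV[R]_k, jb x ^+ n * gauss a x <= C.
Proof.
move=> a0; pose m := n.+1%:R : R; have m0 : 0 < m by rewrite ltr0n.
pose c := 1 + m / a; exists (c ^+ n.+1) => x.
have c1 : 1 <= c by rewrite lerDl divr_ge0 // ltW.
have r0 := dotvv_ge0 x; pose t := a * dotv x x / m.
have t0 : 0 <= t by rewrite !mulr_ge0 // ?invr_ge0 ltW.
have h : jb x ^+ 2 <= c * expR t.
  apply: (@le_trans _ _ (c * (1 + t))); last first.
    by rewrite ler_wpM2l ?expR_ge1Dx // (le_trans ler01).
  rewrite japanese_sqr /c /t mulrDl mul1r lerD ?lerDl //.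
  rewrite mulrDr mulr1 (_ : m / a * _ = dotv x x); first by rewrite lerDr divr_ge0 // ltW.
  by field; rewrite !gt_eqF.
have h2 : jb x ^+ n <= (c * expR t) ^+ n.+1.
  apply: (@le_trans _ _ ((jb x ^+ 2) ^+ n.+1)).
    by rewrite -exprM japanese_leX // mul2n -addnn addSn ltnW // leq_addr.
  by apply: lerXn2r; rewrite ?nnegrE ?japaneseX_ge0 // mulr_ge0 ?expR_ge0 // (le_trans ler01).
apply: (le_trans (ler_wpM2r (expR_ge0 _) h2)).
rewrite exprMn -expRM_natl -mulrA -expRD.
rewrite (_ : n.+1%:R * t + _ = 0) ?expR0 ?mulr1 // /t -/m.
by field; rewrite gt_eqF.
Qed.

Lemma schwartz_gauss k a : 0 < a -> is_schwartz (fun x : 'rV[R]_k => (gauss a x)%:C).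
Proof.
move=> a0; pose q (x : 'rV[R]_k) := - a * dotv x x.
have mq : multiplier (fun x => (q x)%:C).
  rewrite (_ : (fun x => _) = fun x => (- a)%:C * (dotv x x)%:C).
    apply: multiplierM; first exact: multiplier_cst.
    by apply: multiplier_dotv; exact: affine_id.
  by apply/funext => x; rewrite -rmorphM.
have dq x : differentiable q x by exact: multiplier_real_differentiable.
have dexp t : derivable (@expR R) t 1 by exact: ex_derive.
pose P (h : 'rV[R]_k -> R[i]) := exists2 g, multiplier g & h = fun x => g x * (gauss a x)%:C.
apply: (@csmooth_coind _ _ P (@rdecay_lin k)); last first.
  apply: cspan1; exists (fun=> 1); first exact: multiplier_cst.
  by apply/funext => x; rewrite mul1r.
have dG x : cdiff (fun y : 'rV[R]_k => (gauss a y)%:C) x.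
  by apply: cdiff_real; have [] := derive_comp1 0 (dexp (q x)) (dq x).
move=> _ [g mg ->]; have dg x : cdiff g x by exact: csmooth_cdiff mg.
split=> [x||i]; first exact: cdiffM.
  apply: rdecayM; first exact: csmooth_bound.
  move=> n; have [C H] := @gauss_decay k a n a0; exists C => x.
  by rewrite normcR ger0_norm ?expR_ge0.
apply: cspan1; exists (fun x => partial i g x + g x * partial i (fun x => (q x)%:C) x).
  apply: lin_closedD; [exact/csmooth_lin/pbound_lin|exact: csmooth_partial|].
  by apply: multiplierM => //; exact: csmooth_partial.
apply/funext => x; rewrite partialM // !partial_real.
have [_ ->] := derive_comp1 (delta_mx ord0 i) (dexp (q x)) (dq x).
by rewrite derive1E derive_val rmorphM /gauss -/(q x); ring.
Qed.

Lemma partial_gauss k a i (x : 'rV[R]_k) :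
  partial i (fun y => (gauss a y)%:C) x = (- (2 * a) * x ord0 i * gauss a x)%:C.
Proof.
pose q (x : 'rV[R]_k) := - a * dotv x x.
have mq : multiplier (fun x => (q x)%:C).
  rewrite (_ : (fun x => _) = fun x => (- a)%:C * (dotv x x)%:C).
    apply: multiplierM; first exact: multiplier_cst.
    by apply: multiplier_dotv; exact: affine_id.
  by apply/funext => y; rewrite -rmorphM.
have dq y : differentiable q y by exact: multiplier_real_differentiable.
have dexp t : derivable (@expR R) t 1 by exact: ex_derive.
rewrite partial_real; congr _%:C.
have [_ ->] := derive_comp1 (delta_mx ord0 i) (dexp (q x)) (dq x).
rewrite derive1E derive_val /gauss -/(q x) mulrC; congr (_ * _).
have cv : (h^-1 *: (q (h *: delta_mx ord0 i + x) - q x)) @[h --> 0^'] --> - (2 * a) * x ord0 i.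
  have e : - (2 * a) * x ord0 i = - (2 * a) * x ord0 i + - a * 0 by rewrite mulr0 addr0.
  rewrite e; apply: (@cvg_trans _ ((- (2 * a) * x ord0 i + - a * h) @[h --> 0^'])).
    apply: near_eq_cvg; near=> h.
    have h0 : h != 0 by near: h; exact: nbhs_dnbhs_neq.
    rewrite /q !dotvE (dotvC (delta_mx _ _) x) !dotv_delta mxE !eqxx /GRing.scale /=.
    by field.
  apply: cvgD; first exact: cvg_cst.
  by apply: cvgM; [exact: cvg_cst|exact: nbhs_dnbhs].
exact: cvg_lim cv.
Unshelve. all: by end_near. Qed.

End smooth_classes.

Ltac meas := repeat match goal with
  | |- cmeas (fun x => @?a x * @?b x) => apply: cmeasM
  | |- cmeas (fun x => @?a x + @?b x) => apply: cmeasD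
  | |- cmeas (fun x => - @?a x) => apply: cmeasN
  | |- cmeas (fun x => expi _) => apply: cmeas_expi
  | |- cmeas (fun x => real_complex _ _) => apply: cmeas_real
  | |- cmeas (fun x => ?c) => exact: cmeas_cst
  | H : cmeas ?f |- cmeas ?f => exact: H
  | H : cmeas ?f |- cmeas (fun x => ?f _) => apply: (cmeas_comp H)
  | H : is_schwartz ?f |- cmeas (fun x => ?f _) => apply: (cmeas_comp (schwartz_cmeas H))
  | H : is_schwartz ?f |- cmeas ?f => exact: (schwartz_cmeas H)
  | |- cmeas (fun x => schwartz_fun ?f _) => apply: (cmeas_comp (schwartz_cmeas (elimT (asboolP _) (schwartz_funP f))))
  | |- measurable_fun _ (fun x => x) => exact: measurable_id
  | |- measurable_fun _ (fun x => ?c) => exact: measurable_cst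
  | |- measurable_fun _ (fun x => dotv _ _) => apply: measurable_dotv
  | |- measurable_fun _ (fun x => japanese _) => apply: measurable_japanese
  | |- measurable_fun _ (fun x => row_mx _ _) => apply: measurable_row_mx
  | |- measurable_fun _ (fun x => lsubmx _) => apply: measurable_lsubmx
  | |- measurable_fun _ (fun x => rsubmx _) => apply: measurable_rsubmx
  | |- measurable_fun _ (fun x => hamilton _) => apply: measurable_hamilton
  | |- measurable_fun _ (fun x => (@?a x *: @?b x : 'rV[_]__)) => apply: measurable_rVZ
  | |- measurable_fun _ (fun x => (@?a x + @?b x : 'rV[_]__)) => apply: measurable_rVD
  | |- measurable_fun _ (fun x => (- @?a x : 'rV[_]__)) => apply: measurable_rVN
  | |- measurable_fun _ (fun x => @?a x + @?b x) => apply: measurable_funD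
  | |- measurable_fun _ (fun x => - @?a x) => apply: measurable_funN
  | |- measurable_fun _ (fun x => @?a x * @?b x) => apply: measurable_funM
  | |- measurable_fun _ (fun x => expR _) => apply: (measurableT_comp (@measurable_expR _))
  | |- measurable_fun _ (fun x => gauss _ _) => rewrite /gauss
  | |- measurable_fun _ (fun x => Normc.normc _) => apply: measurable_normc
  | |- measurable_fun _ (fun x => @?a x ^+ _) => apply: measurable_funX
  | H : measurable_fun _ ?f |- measurable_fun _ ?f => exact: H
  | |- measurable_fun _ lsubmx => apply: (measurable_lsubmx (f := fun t => t))
  | |- measurable_fun _ rsubmx => apply: (measurable_rsubmx (f := fun t => t))
  | |- measurable_fun _ (@hamilton _ _) => apply: (measurable_hamilton (f := fun t => t))
  | |- measurable_fun _ (@japanese _ _) => apply: (measurable_japanese (f := fun t => t))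
  | |- measurable_fun _ (dotv ?y) => apply: (measurable_dotv (f := fun=> y) (g := fun t => t))
  | |- measurable_fun _ (GRing.scale ?c) => apply: (measurable_rVZ c (f := fun t => t))
  | |- measurable_fun _ GRing.opp => apply: (measurable_rVN (f := fun t => t))
  | |- measurable_fun _ (gauss ?c) => rewrite /gauss
  | |- measurable_fun _ (row_mx ?y) =>
      apply: (measurable_row_mx (f := fun=> y) (g := fun t => t))
  | |- measurable_fun _ (GRing.add ?y) =>
      apply: (measurable_rVD (f := fun=> y) (g := fun t => t))
  | |- measurable_fun _ (fun x => fun_of_matrix _ ord0 _) => apply: measurable_coord_comp
  end.

(** * Taylor expansions and differentiation under the integral sign *)
Section taylor.
Variable R : realType.
Local Notation N := (@Normc.normc R).
Local Notation jb := (@japanese R _).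
Implicit Types k l : nat.

Definition dotvr k (w v : 'rV[R]_k) : R := dotv v w.

Lemma dotvr_is_linear k (w : 'rV[R]_k) : linear (dotvr w).
Proof. by move=> c x y; rewrite /dotvr dotvDl dotvZl. Qed.

HB.instance Definition _ k (w : 'rV[R]_k) :=
  GRing.isLinear.Build R 'rV[R]_k R _ (dotvr w) (@dotvr_is_linear k w).

(** A quadratic bound on the error of a linear approximation, in the form that
    survives integration in a parameter. *)
Lemma differentiable_quadratic k (f : 'rV[R]_k -> R) (x D : 'rV[R]_k) C :
  (forall v : 'rV[R]_k, `|v| <= 1 -> `|f (x + v) - f x - dotv v D| <= C * `|v| ^+ 2) ->
  differentiable f x /\ forall v, 'D_v f x = dotv v D.
Proof.
move=> H.
have C0 : 0 <= `|C| by [].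
have dfc : continuous (dotvr D).
  by move=> y; apply: differentiable_continuous; have [] := derive_dotv D y 0.
have n1 : \forall v \near (0 : 'rV[R]_k), `|v| <= 1 by exact: nbhs0_le.
have n2 (e : R) : 0 < e -> \forall v \near (0 : 'rV[R]_k), `|v| <= e / (`|C| + 1).
  by move=> e0; apply: nbhs0_le; rewrite divr_gt0 // ltr_wpDl.
have dxf : f \o shift x = cst (f x) + dotvr D +o_ (0 : 'rV[R]_k) id.
  apply/eqaddoP => _/posnumP[e]; near=> v.
  rewrite /= !fctE /= [v + x]addrC opprD addrA.
  have v1 : `|v| <= 1.
    by near: v; exact: n1.
  apply: (le_trans (H v v1)); rewrite expr2 mulrA ler_wpM2r //.
  apply: (@le_trans _ _ (`|C| * `|v|)); first by rewrite ler_wpM2r // ler_norm.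
  have ve : `|v| <= e%:num / (`|C| + 1).
    by near: v; exact: (n2 e%:num).
  apply: (@le_trans _ _ (`|C| * (e%:num / (`|C| + 1)))); first by rewrite ler_wpM2l.
  rewrite mulrCA ler_piMr // ler_pdivrMr ?ltr_wpDl // mul1r lerDl //.
have dE := diff_unique dfc dxf.
have df : differentiable f x.
  by apply/diff_locallyP; rewrite dE.
by split=> // v; rewrite deriveE // dE.
Unshelve. all: by end_near. Qed.

Lemma mean_value_rV k (u : 'rV[R]_k -> R) x v : (forall y, differentiable u y) ->
  exists2 s, 0 <= s <= 1 & u (x + v) - u x = 'D_v u (x + s *: v).
Proof.
move=> du; pose g (t : R) := u (x + t *: v).
have quot t : (fun h : R => h^-1 *: ((g \o shift t) (h *: (1 : R)) - g t)) =
    (fun h => h^-1 *: ((u \o shift (x + t *: v)) (h *: v) - u (x + t *: v))).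
  apply/funext => h; rewrite /g /=; congr (_ *: (u _ - _)).
  by rewrite [h *: 1]mulr1 scalerDl addrCA.
have dg (t : R) : is_derive t (1 : R) g ('D_v u (x + t *: v)).
  have dv : derivable u (x + t *: v) v by exact: diff_derivable.
  apply: DeriveDef; first by rewrite /derivable quot.
  by rewrite /derive quot.
have [|s s01] := @MVT_segment R g (fun t => 'D_v u (x + t *: v)) 0 1 ler01 (fun t _ => dg t).
  by apply: derivable_within_continuous => t _; have [] := dg t.
by rewrite /g scale1r scale0r addr0 subr0 mulr1 => e; exists s.
Qed.

Lemma japanese_small k (v : 'rV[R]_k) : `|v| <= 1 -> jb v <= 1 + k%:R.
Proof.
move=> v1; rewrite -(ler_pXn2r (ltn0Sn 1)) ?nnegrE ?japanese_ge0 ?addr_ge0 // japanese_sqr.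
have h : dotv v v <= k%:R.
  apply: (@le_trans _ _ (\sum_(i < k) 1)); last by rewrite sumr_const card_ord.
  apply: ler_sum => i _; rewrite -expr2 -(real_normK (num_real _)).
  by rewrite exprn_ile1 // (le_trans (coord_le_norm v i)).
by have k0 : (0 : R) <= k%:R by []; nra.
Qed.

Lemma finite_bound (I : finType) (T : Type) (P : I -> R -> T -> Prop) :
  (forall i (C D : R) t, P i C t -> C <= D -> P i D t) ->
  (forall i, exists C, forall t, P i C t) -> exists2 C, 0 <= C & forall i t, P i C t.
Proof.
move=> mono H; pose F i := sval (cid (H i)).
have HF i t : P i (F i) t by rewrite /F; case: cid.
exists (\sum_i `|F i|); first exact: sumr_ge0.
move=> i t; apply: mono (HF i t) _; apply: (le_trans (ler_norm _)).
by rewrite (bigD1 i) //= lerDl; exact: sumr_ge0.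
Qed.

Lemma schwartz_partials_bound k (f : 'rV[R]_k -> R[i]) n : is_schwartz f ->
  exists2 C, 0 <= C & forall j x, jb x ^+ n * N (partial j f x) <= C.
Proof.
move=> sf.
apply: (finite_bound (P := fun j C x => jb x ^+ n * N (partial j f x) <= C)).
  by move=> j C D x h CD; exact: le_trans CD.
by move=> j; apply: schwartz_bound; exact: (@csmooth_partial _ _ (@rdecay R k) j _ sf).
Qed.

Lemma schwartz_lipschitz k (f : 'rV[R]_k -> R[i]) n : is_schwartz f ->
  exists2 C, 0 <= C & forall x v, `|v| <= 1 -> jb x ^+ n * N (f (x + v) - f x) <= C * `|v|.
Proof.
move=> sf; have [C C0 HC] := schwartz_partials_bound n sf.
pose A := (2 * (1 + k%:R)) ^+ n * (k%:R * C).
have k0 : (0 : R) <= k%:R by [].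
have A0 : 0 <= A by rewrite !mulr_ge0 // exprn_ge0 // mulr_ge0 // addr_ge0.
exists (2 * A); first by rewrite mulr_ge0.
move=> x v v1.
have part (u : R[i] -> R) : (forall z, `|u z| <= N z) ->
    (forall y, differentiable (fun y => u (f y)) y) ->
    (forall j y, 'D_(delta_mx ord0 j) (fun y => u (f y)) y = u (partial j f y)) ->
    jb x ^+ n * `|u (f (x + v)) - u (f x)| <= A * `|v|.
  move=> uN du Du; have [s /andP[s0 s1] ->] := mean_value_rV x v du.
  rewrite derive_coords //; apply: (le_trans (ler_wpM2l (japaneseX_ge0 x n) (ler_norm_sum _ _ _))).
  have jx : jb x ^+ n <= (2 * (1 + k%:R)) ^+ n * jb (x + s *: v) ^+ n.
    rewrite -exprMn; apply: lerXn2r; rewrite ?nnegrE ?japanese_ge0 //.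
      by rewrite !mulr_ge0 ?addr_ge0 // japanese_ge0.
    rewrite -[X in jb X <= _](addrK (s *: v)).
    apply: (le_trans (japaneseB _ _)); rewrite -!mulrA ler_wpM2l //.
    rewrite mulrC ler_wpM2r ?japanese_ge0 //.
    by apply: japanese_small; rewrite normrZ ger0_norm // mulr_ile1.
  rewrite mulr_sumr /A mulrA -mulrA.
  apply: (@le_trans _ _ (\sum_(j < k) (2 * (1 + k%:R)) ^+ n * C * `|v|)).
    apply: ler_sum => j _; rewrite normrM Du mulrCA mulrC ler_pM //.
      by rewrite mulr_ge0 // japaneseX_ge0.
      apply: (le_trans (ler_wpM2l (japaneseX_ge0 x n) (uN _))).
      apply: (le_trans (ler_wpM2r (normc_ge0 _) jx)); rewrite -mulrA.
      by apply: ler_wpM2l; [rewrite exprn_ge0 // mulr_ge0 // addr_ge0|exact: HC].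
    exact: coord_le_norm.
  rewrite sumr_const card_ord -mulr_natl.
  by rewrite le_eqVlt; apply/orP; left; apply/eqP; ring.
have dR y : cdiff f y by exact: (@csmooth_cdiff _ _ (@rdecay R k)).
apply: (le_trans (ler_wpM2l (japaneseX_ge0 x n) (normc_le _))).
rewrite mulrDr ReD ReN ImD ImN -mulrA mulr_natl mulr2n; apply: lerD.
  by apply: part => [z|y|j y //]; [exact: normc_Re|have [] := dR y].
by apply: part => [z|y|j y //]; [exact: normc_Im|have [] := dR y].
Qed.

Lemma schwartz_lipschitz_global k (f : 'rV[R]_k -> R[i]) : is_schwartz f ->
  exists2 C, 0 <= C & forall x v, N (f (x + v) - f x) <= C * `|v|.
Proof.
move=> sf; have [C C0 HC] := schwartz_lipschitz 0 sf.
have [D HD] := schwartz_bound 0 sf.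
have D0 : 0 <= D by apply: le_trans (HD 0); rewrite expr0 mul1r normc_ge0.
exists (C + 2 * D) => [|x v]; first by rewrite addr_ge0 // mulr_ge0.
have [v1|v1] := leP `|v| 1.
  have := HC x v v1; rewrite expr0 mul1r => h; apply: (le_trans h).
  by rewrite ler_wpM2r // lerDl mulr_ge0.
apply: (le_trans (normcB _ _)).
have := HD (x + v); have := HD x; rewrite !expr0 !mul1r => h1 h2.
have h3 : C * `|v| >= 0 by rewrite mulr_ge0.
have h4 : D * 1 <= D * `|v| by rewrite ler_wpM2l // ltW.
by rewrite mulrDl; lra.
Qed.

(** The mean value theorem, applied twice along the segment. *)
Lemma schwartz_taylor k (f : 'rV[R]_k -> R[i]) n : is_schwartz f ->
  exists2 C, 0 <= C & forall x v, `|v| <= 1 ->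
  jb x ^+ n * N (f (x + v) - f x - \sum_j (v ord0 j)%:C * partial j f x) <= C * `|v| ^+ 2.
Proof.
move=> sf.
have [C C0 HC] : exists2 C, 0 <= C & forall (j : 'I_k) (xv : 'rV[R]_k * 'rV[R]_k),
    `|xv.2| <= 1 ->
    jb xv.1 ^+ n * N (partial j f (xv.1 + xv.2) - partial j f xv.1) <= C * `|xv.2|.
  apply: (finite_bound (P := fun j C (xv : 'rV[R]_k * 'rV[R]_k) => `|xv.2| <= 1 ->
    jb xv.1 ^+ n * N (partial j f (xv.1 + xv.2) - partial j f xv.1) <= C * `|xv.2|)).
    by move=> j C D xv h CD v1; apply: (le_trans (h v1)); rewrite ler_wpM2r.
  move=> j; have [C C0 H] := schwartz_lipschitz n (@csmooth_partial _ _ (@rdecay R k) j _ sf).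
  by exists C => -[x v] /=; exact: H.
have k0 : (0 : R) <= k%:R by [].
exists (2 * (k%:R * C)) => [|x v v1]; first by rewrite !mulr_ge0.
have part (u : R[i] -> R) : (forall z, `|u z| <= N z) ->
    (forall z w, u (z - w) = u z - u w) ->
    (forall y, differentiable (fun y => u (f y)) y) ->
    (forall j y, 'D_(delta_mx ord0 j) (fun y => u (f y)) y = u (partial j f y)) ->
    jb x ^+ n * `|u (f (x + v)) - u (f x) - \sum_j v ord0 j * u (partial j f x)| <= k%:R * C * `|v| ^+ 2.
  move=> uN uB du Du; have [s /andP[s0 s1] ->] := mean_value_rV x v du.
  rewrite derive_coords // -sumrB.
  apply: (le_trans (ler_wpM2l (japaneseX_ge0 x n) (ler_norm_sum _ _ _))); rewrite mulr_sumr.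
  apply: (@le_trans _ _ (\sum_(j < k) C * `|v| ^+ 2)); last first.
    by rewrite sumr_const card_ord -mulr_natl le_eqVlt; apply/orP; left; apply/eqP; ring.
  apply: ler_sum => j _; rewrite Du -mulrBr -uB normrM mulrCA.
  rewrite (_ : C * `|v| ^+ 2 = `|v| * (C * `|v|)); last by ring.
  apply: ler_pM => //; first by rewrite mulr_ge0 // japaneseX_ge0.
    exact: coord_le_norm.
  apply: (le_trans (ler_wpM2l (japaneseX_ge0 x n) (uN _))).
  have schwartz_chiv : `|s *: v| <= `|v| by rewrite normrZ ger0_norm // ler_piMl.
  apply: (le_trans (HC j (x, s *: v) (le_trans schwartz_chiv v1))) => /=.
  by rewrite ler_wpM2l.
have dR y : cdiff f y by exact: (@csmooth_cdiff _ _ (@rdecay R k)).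
apply: (le_trans (ler_wpM2l (japaneseX_ge0 x n) (normc_le _))).
rewrite mulrDr !ReD !ReN !ImD !ImN Re_sum Im_sum -mulrA mulr_natl mulr2n; apply: lerD.
  have -> : \sum_j Re ((v ord0 j)%:C * partial j f x) = \sum_j v ord0 j * Re (partial j f x).
    by apply: eq_bigr => j _; rewrite ReM /= mul0r subr0.
  apply: part => [z|z w|y|j y //]; [exact: normc_Re|by rewrite ReD ReN|by have [] := dR y].
have -> : \sum_j Im ((v ord0 j)%:C * partial j f x) = \sum_j v ord0 j * Im (partial j f x).
  by apply: eq_bigr => j _; rewrite ImM /= mul0r addr0.
apply: part => [z|z w|y|j y //]; [exact: normc_Im|by rewrite ImD ImN|by have [] := dR y].
Qed.

(** The Taylor remainder of order two is integrable uniformly, so that no limit has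
    to be exchanged with the integral. *)
Lemma partial_cintegral k l (F : 'rV[R]_k -> 'rV[R]_l -> R[i]) D y g B :
  (forall y, cintegrable (F y)) -> (forall j, cintegrable (D j)) ->
  (forall t, 0 <= g t) -> (\int[lebesgue_rV R l]_t (g t)%:E <= B%:E)%E ->
  (forall v t, `|v| <= 1 ->
    N (F (y + v) t - F y t - \sum_j (v ord0 j)%:C * D j t) <= `|v| ^+ 2 * g t) ->
  cdiff (fun y => cintegral (F y)) y /\
  forall j, partial j (fun y => cintegral (F y)) y = cintegral (D j).
Proof.
move=> FI DI g0 gB H.
have key (v : 'rV[R]_k) : `|v| <= 1 -> N (cintegral (F (y + v)) - cintegral (F y) -
    \sum_j (v ord0 j)%:C * cintegral (D j)) <= 2 * B * `|v| ^+ 2.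
  move=> v1; have sI j : cintegrable (fun t => (v ord0 j)%:C * D j t) by exact: cintegrableZ.
  have dI : cintegrable (fun t => F (y + v) t - F y t).
    by apply: cintegrableD => //; exact: cintegrableN.
  rewrite -cintegralB //.
  under eq_bigr do rewrite -cintegralZ //.
  rewrite -cintegral_sum // -cintegralB //; last exact: cintegrable_sum.
  have [->|v0] := eqVneq v 0.
    rewrite normr0 expr0n mulr0 (eq_cintegral (g := fun=> 0)) ?cintegral0 ?Normc.normc0 //.
    move=> t; rewrite addr0 subrr big1 ?subrr // => j _; by rewrite mxE mul0r.
  rewrite -mulrA; apply: (@normc_cintegral_le _ _ _ (fun t => `|v| ^+ 2 * g t)).
  - have [h _] : cintegrable (fun t => F (y + v) t - F y t - \sum_j (v ord0 j)%:C * D j t).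
      by apply: cintegrableD => //; apply: cintegrableN; exact: cintegrable_sum.
    exact: h.
  - by move=> t; exact: H.
  - have c0 : 0 < `|v| ^+ 2 by rewrite exprn_gt0 // normr_gt0.
    apply: (@le_trans _ _ ((`|v| ^+ 2)%:E * \int[lebesgue_rV R l]_t (g t)%:E)%E).
      by apply: le_integral_scale => // t; rewrite lee_fin mulr_ge0 // ltW.
    rewrite [X in (_ <= X%:E)%E]mulrC [X in (_ <= X)%E]EFinM; apply: lee_wpmul2l => //.
have part (u : R[i] -> R) : (forall z, `|u z| <= N z) ->
    (forall z w, u (z - w) = u z - u w) ->
    (forall (v : 'rV[R]_k), u (\sum_j (v ord0 j)%:C * cintegral (D j)) =
        \sum_j v ord0 j * u (cintegral (D j))) ->
    differentiable (fun y => u (cintegral (F y))) y /\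
    forall v, 'D_v (fun y => u (cintegral (F y))) y = dotv v (\row_j u (cintegral (D j))).
  move=> uN uB uS; apply: (@differentiable_quadratic _ _ _ _ (2 * B)) => v v1.
  apply: le_trans (key v v1); apply: le_trans (uN _); rewrite !uB uS.
  rewrite le_eqVlt; apply/orP; left; apply/eqP; congr (`|_ - _|).
  by apply: eq_bigr => j _; rewrite mxE.
have [r1 r2] : differentiable (fun y => Re (cintegral (F y))) y /\
    forall v, 'D_v (fun y => Re (cintegral (F y))) y = dotv v (\row_j Re (cintegral (D j))).
  apply: part => [z|z w|v]; [exact: normc_Re|by rewrite ReD ReN|rewrite Re_sum].
  by apply: eq_bigr => j _; rewrite ReM /= mul0r subr0.
have [i1 i2] : differentiable (fun y => Im (cintegral (F y))) y /\
    forall v, 'D_v (fun y => Im (cintegral (F y))) y = dotv v (\row_j Im (cintegral (D j))).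
  apply: part => [z|z w|v]; [exact: normc_Im|by rewrite ImD ImN|rewrite Im_sum].
  by apply: eq_bigr => j _; rewrite ImM /= mul0r addr0.
split; first by split.
move=> j; apply: complexP; rewrite /partial /=.
  by rewrite r2 dotvC dotv_delta mxE.
by rewrite i2 dotvC dotv_delta mxE.
Qed.

End taylor.

(** * Fourier inversion *)
Section fourier_analysis.
Variable R : realType.
Local Notation N := (@Normc.normc R).
Local Notation jb := (@japanese R _).
Implicit Types k l : nat.

(** By coinduction: functions of this form are closed under differentiation, which
    passes under the integral by partial_cintegral. *)
Lemma schwartz_integrate k l (F : 'rV[R]_(k + l) -> R[i]) : is_schwartz F ->
  is_schwartz (fun y : 'rV[R]_k => cintegral (fun t : 'rV[R]_l => F (row_mx y t))).
Proof.
move=> sF.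
pose P (h : 'rV[R]_k -> R[i]) := exists2 F : 'rV[R]_(k + l) -> R[i], is_schwartz F &
  h = fun y : 'rV[R]_k => cintegral (fun t : 'rV[R]_l => F (row_mx y t)).
apply: (@csmooth_coind _ _ (@rdecay R k) P (@rdecay_lin R k)); last by apply: cspan1; exists F.
move=> {F sF} _ [F sF ->].
have mF (G : 'rV[R]_(k + l) -> R[i]) (y : 'rV[R]_k) : is_schwartz G -> cmeas (fun t : 'rV[R]_l => G (row_mx y t)).
  by move=> sG; meas.
have dec (G : 'rV[R]_(k + l) -> R[i]) n : is_schwartz G -> exists C, forall (y : 'rV[R]_k) (t : 'rV[R]_l),
    jb t ^+ (l + l) * (jb y ^+ n * N (G (row_mx y t))) <= C.
  move=> sG; have [C HC] := schwartz_bound (l + l + n) sG; exists C => y t.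
  apply: le_trans (HC (row_mx y t)); rewrite mulrA ler_wpM2r ?normc_ge0 // [leRHS]exprD.
  by apply: ler_pM; rewrite ?japaneseX_ge0 //; apply: lerXn2r; rewrite ?nnegrE ?japanese_ge0 //;
    [exact: japanese_rowr|exact: japanese_rowl].
have FI (G : 'rV[R]_(k + l) -> R[i]) (y : 'rV[R]_k) : is_schwartz G ->
    cintegrable (fun t : 'rV[R]_l => G (row_mx y t)).
  move=> sG; have [C HC] := dec G 0%N sG; apply: (cintegrable_decay (mF _ _ sG) (C := C)) => t.
  by have := HC y t; rewrite expr0 mul1r.
have [C C0 HT] := schwartz_taylor (l + l) sF.
have pd y : cdiff (fun y : 'rV[R]_k => cintegral (fun t : 'rV[R]_l => F (row_mx y t))) y /\
    forall j, partial j (fun y : 'rV[R]_k => cintegral (fun t : 'rV[R]_l => F (row_mx y t))) y =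
     cintegral (fun t : 'rV[R]_l => partial (lshift l j) F (row_mx y t)).
  apply: (@partial_cintegral _ _ _ (fun y t => F (row_mx y t)) _ y (fun t => C * jb t ^- (l + l)) (C * japanese_mass R l)).
  - by move=> z; exact: FI.
  - by move=> j; apply: FI; exact: (@csmooth_partial _ _ (@rdecay R _)).
  - by move=> t; rewrite mulr_ge0 // invr_ge0 japaneseX_ge0.
  - apply: integral_decay_le => t; first by rewrite mulr_ge0 // invr_ge0 japaneseX_ge0.
    by rewrite mulrCA mulfV ?mulr1 // gt_eqF // japaneseX_gt0.
  - move=> v t v1; pose w : 'rV[R]_(k + l) := row_mx v 0.
    have wv : `|w| <= `|v|.
      apply: rV_norm_le => // i; rewrite /w; case: (split_ordP i) => j ->.
        by rewrite row_mxEl coord_le_norm.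
      by rewrite row_mxEr mxE normr0.
    have := HT (row_mx y t) w (le_trans wv v1).
    rewrite /w add_row_mx addr0 big_split_ord /=.
    rewrite [X in _ - (_ + X)]big1 ?addr0; last first.
      by move=> j _; rewrite row_mxEr mxE mul0r.
    under eq_bigr do rewrite row_mxEl.
    move=> h; rewrite mulrA ler_pdivlMr ?japaneseX_gt0 // mulrC.
    apply: le_trans (le_trans h _); last first.
      by rewrite mulrC ler_wpM2r //; apply: lerXn2r; rewrite ?nnegrE.
    rewrite ler_wpM2r ?normc_ge0 //; apply: lerXn2r; rewrite ?nnegrE ?japanese_ge0 //.
    exact: japanese_rowr.
split=> [y|n|j]; first by have [] := pd y.
  have [D HD] := dec F n sF; exists (2 * (D * japanese_mass R l)) => y.
  rewrite -[X in X * _]ger0_norm ?japaneseX_ge0 // -normcR -Normc.normcM -cintegralZ; last exact: FI.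
  apply: cintegral_decay => [|t].
    by meas.
  by rewrite Normc.normcM normcR ger0_norm ?japaneseX_ge0.
apply: cspan1; exists (partial (lshift l j) F); first exact: (@csmooth_partial _ _ (@rdecay R _)).
by apply/funext => y; have [_ ->] := pd y.
Qed.

Lemma normc_small_eq0 (z : R[i]) M :
  (forall t : R, 0 < t -> t <= 1 -> N z <= M * t) -> z = 0.
Proof.
move=> key; apply: Normc.eq0_normc; apply/eqP; rewrite eq_le normc_ge0 andbT.
have M0 : 0 <= M by have := key 1 ltr01 (lexx _); rewrite mulr1; apply: le_trans; exact: normc_ge0.
apply/ler_addgt0Pl => e e0; rewrite addr0.
pose t := Num.min 1 (e / (M + 1)).
have d0 : 0 < M + 1 by rewrite ltr_wpDl.
have t0 : 0 < t by rewrite lt_min ltr01 divr_gt0.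
have t1 : t <= 1 by rewrite ge_min lexx.
apply: (le_trans (key t t0 t1)).
apply: (@le_trans _ _ (M * (e / (M + 1)))).
  by rewrite ler_wpM2l // ge_min lexx orbT.
rewrite mulrA ler_pdivrMr // mulrC; apply: ler_wpM2l; first exact: ltW.
by rewrite lerDl.
Qed.

(** The integral of a derivative vanishes: this is translation invariance,
    differentiated. *)
Lemma cintegral_partial k (h : 'rV[R]_k -> R[i]) j : is_schwartz h ->
  cintegral (partial j h) = 0.
Proof.
move=> sh; have [C C0 HT] := schwartz_taylor (k + k) sh.
have sp : is_schwartz (partial j h) by exact: (@csmooth_partial _ _ (@rdecay R _)).
have hI := schwartz_cintegrable sh; have pI := schwartz_cintegrable sp.
have key t : 0 < t -> t <= 1 -> N (cintegral (partial j h)) <= 2 * (C * japanese_mass R k) * t.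
  move=> t0 t1; pose v : 'rV[R]_k := t *: delta_mx ord0 j.
  have vj i : v ord0 i = if i == j then t else 0.
    by rewrite /v !mxE eqxx /=; case: eqP => _; rewrite ?mulr1 ?mulr0.
  have vt : `|v| <= t.
    apply: rV_norm_le => [|i]; first exact: ltW.
    by rewrite vj; case: eqP => _; rewrite ?normr0 ?gtr0_norm //; exact: ltW.
  have tI := cintegrable_translate v hI.
  have e : cintegral (fun x => h (x + v) - h x - t%:C * partial j h x) =
      - (t%:C * cintegral (partial j h)).
    rewrite cintegralB; [|by apply: cintegrableD => //; exact: cintegrableN|exact: cintegrableZ].
    by rewrite cintegralB // cintegral_translate ?subrr ?sub0r ?cintegralZ //; exact: schwartz_cmeas.
  have : N (cintegral (fun x => h (x + v) - h x - t%:C * partial j h x)) <= 2 * (C * t ^+ 2 * japanese_mass R k).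
    apply: cintegral_decay => [|x]; first by meas.
    have := HT x v (le_trans vt t1).
    rewrite (bigD1 j) //= vj eqxx big1 ?addr0; last first.
      by move=> i /negbTE ij; rewrite vj ij mul0r.
    move=> h1; apply: (le_trans h1); rewrite ler_wpM2l //; apply: lerXn2r; rewrite ?nnegrE //.
    exact: ltW.
  rewrite e normcN Normc.normcM normcR gtr0_norm // -ler_pdivlMl // => h1.
  apply: (le_trans h1); rewrite le_eqVlt; apply/orP; left; apply/eqP.
  by field; rewrite gt_eqF.
apply: (@normc_small_eq0 _ (2 * (C * japanese_mass R k))) => //.
Qed.

Lemma multiplier_character k (w : 'rV[R]_k) : multiplier (fun x => expi (dotv x w)).
Proof.
apply: multiplier_expi; apply: multiplier_dotv; [exact: affine_id|exact: affine_cst].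
Qed.

Lemma partial_character k j (w x : 'rV[R]_k) :
  partial j (fun x => expi (dotv x w)) x = 'i * (w ord0 j)%:C * expi (dotv x w).
Proof.
have [d e] := derive_dotv w x (delta_mx ord0 j).
have [_ ->] := partial_expi j d; by rewrite e dotvC dotv_delta.
Qed.

Lemma schwartz_character k (w : 'rV[R]_k) f : is_schwartz f ->
  is_schwartz (fun x => expi (dotv x w) * f x).
Proof. by move=> sf; apply: schwartzM => //; exact: multiplier_character. Qed.

Lemma cintegral_character_partial k j (w : 'rV[R]_k) f : is_schwartz f ->
  cintegral (fun x => expi (dotv x w) * partial j f x) =
  - ('i * (w ord0 j)%:C * cintegral (fun x => expi (dotv x w) * f x)).
Proof.
move=> sf; have sp : is_schwartz (partial j f) by exact: (@csmooth_partial _ _ (@rdecay R _)).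
have I1 := schwartz_cintegrable (schwartz_character w sf).
have I2 := schwartz_cintegrable (schwartz_character w sp).
apply/eqP; rewrite -addr_eq0 -cintegralZ // -cintegralD //; last exact: cintegrableZ.
rewrite -[X in _ == X](cintegral_partial j (schwartz_character w sf)); apply/eqP.
apply: eq_cintegral => x; rewrite partialM.
- by rewrite partial_character; ring.
- exact: csmooth_cdiff (multiplier_character w).
- exact: (@csmooth_cdiff _ _ (@rdecay R _)).
Qed.

Lemma fourierE k (f : 'rV[R]_k -> R[i]) xi :
  fourier f xi = cintegral (fun x => expi (dotv x (- xi)) * f x).
Proof. by apply: eq_cintegral => x; rewrite dotvNr. Qed.

Lemma fourier_partial k j f (xi : 'rV[R]_k) : is_schwartz f ->
  fourier (partial j f) xi = 'i * (xi ord0 j)%:C * fourier f xi.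
Proof.
move=> sf; rewrite !fourierE cintegral_character_partial // mxE.
by rewrite rmorphN; ring.
Qed.

Lemma fourierD k (f g : 'rV[R]_k -> R[i]) xi : is_schwartz f -> is_schwartz g ->
  fourier (fun x => f x + g x) xi = fourier f xi + fourier g xi.
Proof.
move=> sf sg; rewrite !fourierE -cintegralD; last 2 first.
- exact/schwartz_cintegrable/schwartz_character.
- exact/schwartz_cintegrable/schwartz_character.
by apply: eq_cintegral => x; rewrite mulrDr.
Qed.

Lemma fourierZ k c (f : 'rV[R]_k -> R[i]) xi : is_schwartz f ->
  fourier (fun x => c * f x) xi = c * fourier f xi.
Proof.
move=> sf; rewrite !fourierE -cintegralZ; last exact/schwartz_cintegrable/schwartz_character.
by apply: eq_cintegral => x; rewrite mulrCA.
Qed.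

Lemma fourier_decay k f n : is_schwartz f ->
  exists C, forall xi : 'rV[R]_k, jb xi ^+ n * N (fourier f xi) <= C.
Proof.
move=> sf.
suff H m : forall f : 'rV[R]_k -> R[i], is_schwartz f ->
    exists C, forall xi : 'rV[R]_k, (jb xi ^+ 2) ^+ m * N (fourier f xi) <= C.
  have [C HC] := H n f sf; exists C => xi; apply: le_trans (HC xi).
  rewrite ler_wpM2r ?normc_ge0 // -exprM japanese_leX // mul2n -addnn leq_addr //.
elim: m => [|m IH] {sf} {}f sf.
  have [C HC] := schwartz_bound (k + k) sf; exists (2 * (C * japanese_mass R k)) => xi.
  rewrite expr0 mul1r fourierE; apply: cintegral_decay => [|x]; first by meas.
  by rewrite Normc.normcM normc_expi mul1r.
have sp j : is_schwartz (partial j (partial j f)).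
  by do 2 apply: (@csmooth_partial _ _ (@rdecay R _)).
have [S HS] : exists2 C, 0 <= C & forall j (xi : 'rV[R]_k),
    (jb xi ^+ 2) ^+ m * N (fourier (partial j (partial j f)) xi) <= C.
  apply: (finite_bound (P := fun j C (xi : 'rV[R]_k) =>
    (jb xi ^+ 2) ^+ m * N (fourier (partial j (partial j f)) xi) <= C)).
    by move=> j C D xi h CD; exact: le_trans CD.
  by move=> j; exact: IH.
move=> HC; have [D HD] := IH f sf; exists (D + k%:R * S) => xi.
have pE j : fourier (partial j (partial j f)) xi = - ((xi ord0 j)%:C ^+ 2 * fourier f xi).
  rewrite !fourier_partial //; last exact: (@csmooth_partial _ _ (@rdecay R _)).
  by rewrite (_ : _ * _ = 'i ^+ 2 * (xi ord0 j)%:C ^+ 2 * fourier f xi); [rewrite sqr_i; ring|ring].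
rewrite exprSr -mulrA [X in _ * (X * _)]japanese_sqr mulrDl mul1r mulrDr lerD //.
rewrite /dotv mulr_suml mulr_sumr.
apply: (@le_trans _ _ (\sum_(j < k) S)); last by rewrite sumr_const card_ord mulr_natl.
apply: ler_sum => j _; apply: le_trans (HC j xi).
by rewrite pE normcN Normc.normcM normcX normcR -normrX ger0_norm ?sqr_ge0 // expr2.
Qed.

Lemma normc_expi_taylor t : N (expi t - 1 - 'i * t%:C) <= 2 * t ^+ 2.
Proof.
have dsin (x : R) : is_derive x 1 (@sin R) (cos x) by exact: is_derive_sin.
have dcos (x : R) : is_derive x 1 (@cos R) (- sin x) by exact: is_derive_cos.
have mv (u du : R -> R) (x : R) : (forall y, is_derive y (1 : R) u (du y)) ->
    exists2 c, `|c| <= `|x| & u x - u 0 = du c * x.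
  move=> dr; have cu a b : {within `[a, b], continuous u}.
    by apply: derivable_within_continuous => y _; have [] := dr y.
  have [x0|x0] := leP 0 x.
    have [c] := MVT_segment x0 (fun y _ => dr y) (cu 0 x); rewrite in_itv /= => /andP[c0 cx].
    by rewrite subr0 => e; exists c => //; rewrite !ger0_norm.
  have [c] := MVT_segment (ltW x0) (fun y _ => dr y) (cu x 0); rewrite in_itv /= => /andP[c0 cx].
  rewrite sub0r => e; exists c; first by rewrite !ler0_norm ?lerN2 // ltW.
  by rewrite -opprB e mulrN opprK.
have s1 (x : R) : `|sin x| <= `|x|.
  have [c _] := mv _ _ x dsin; rewrite sin0 subr0 => ->.
  by rewrite normrM ler_piMl // ler_norml cos_geN1 cos_le1.
have c1 (x : R) : `|cos x - 1| <= `|x| ^+ 2.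
  have [c cx] := mv _ _ x dcos; rewrite cos0 => ->.
  by rewrite normrM normrN expr2 ler_wpM2r // (le_trans (s1 c)).
have c2 (x : R) : `|cos x - 1| <= `|x|.
  have [c cx] := mv _ _ x dcos; rewrite cos0 => ->.
  by rewrite normrM normrN ler_piMl // ler_norml sin_geN1 sin_le1.
have s2 (x : R) : `|sin x - x| <= `|x| ^+ 2.
  have [c cx] := mv _ _ x dsin; rewrite sin0 subr0 => ->.
  rewrite (_ : _ - _ = (cos c - 1) * x); last by ring.
  by rewrite normrM expr2 ler_wpM2r // (le_trans (c2 c)).
apply: (le_trans (normc_le _)); rewrite !ReD !ImD !ReN !ImN /=.
rewrite mulr_natl mulr2n -(real_normK (num_real t)); apply: lerD.
  by rewrite (_ : _ - _ = cos t - 1); [exact: c1|ring].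
by rewrite (_ : _ - _ = sin t - t); [exact: s2|ring].
Qed.

Lemma fourier_derivative k (f : 'rV[R]_k -> R[i]) xi : is_schwartz f ->
  cdiff (fourier f) xi /\ forall j, is_schwartz (fun x => (- 'i * (x ord0 j)%:C) * f x) /\
  partial j (fourier f) xi = fourier (fun x => (- 'i * (x ord0 j)%:C) * f x) xi.
Proof.
move=> sf.
have sx j : is_schwartz (fun x : 'rV[R]_k => (- 'i * (x ord0 j)%:C) * f x).
  apply: schwartzM => //; apply: multiplierM; first exact: multiplier_cst.
  exact: multiplier_coord.
have [C HC] := schwartz_bound (k + k + 4) sf.
have C0 : 0 <= C by apply: le_trans (HC 0); rewrite mulr_ge0 ?normc_ge0 ?japaneseX_ge0.
have k0 : (0 : R) <= k%:R by [].
suff [d p] : cdiff (fourier f) xi /\ forall j, partial j (fourier f) xi =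
    cintegral (fun x => expi (dotv x (- xi)) * ((- 'i * (x ord0 j)%:C) * f x)).
  by split=> // j; split=> //; rewrite p fourierE.
have -> : fourier f = fun xi => cintegral (fun x => expi (dotv x (- xi)) * f x).
  by apply/funext => z; rewrite fourierE.
apply: (@partial_cintegral _ _ _ (fun xi x => expi (dotv x (- xi)) * f x)
    (fun j x => expi (dotv x (- xi)) * ((- 'i * (x ord0 j)%:C) * f x)) xi
    (fun x => 2 * k%:R ^+ 2 * (jb x ^+ 2 * N (f x))) (2 * k%:R ^+ 2 * C * japanese_mass R k)).
- by move=> y; exact/schwartz_cintegrable/schwartz_character.
- by move=> j; exact/schwartz_cintegrable/schwartz_character.
- by move=> x; rewrite !mulr_ge0 ?normc_ge0 ?japaneseX_ge0 ?exprn_ge0 ?japanese_ge0.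
- apply: integral_decay_le => x.
    by rewrite !mulr_ge0 ?normc_ge0 ?japaneseX_ge0 ?exprn_ge0 ?japanese_ge0.
  rewrite mulrCA ler_wpM2l ?mulr_ge0 ?exprn_ge0 //; apply: le_trans (HC x).
  by rewrite mulrA -exprD ler_wpM2r ?normc_ge0 // japanese_leX // leq_add2l.
- move=> v x v1.
  rewrite (_ : _ - _ = expi (dotv x (- xi)) *
    ((expi (- dotv x v) - 1 - 'i * (- dotv x v)%:C) * f x)); last first.
    rewrite opprD dotvDr expiD.
    have -> : \sum_j (v ord0 j)%:C * (expi (dotv x (- xi)) * (- 'i * (x ord0 j)%:C * f x)) =
        expi (dotv x (- xi)) * ('i * (- dotv x v)%:C * f x).
      rewrite /dotv rmorphN rmorph_sum mulrN mulNr mulr_sumr mulr_suml mulrN mulr_sumr -sumrN.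
      by apply: eq_bigr => j _; rewrite rmorphM; ring.
    by rewrite [dotv x (- v)]dotvNr; ring.
  rewrite Normc.normcM normc_expi mul1r Normc.normcM.
  apply: (le_trans (ler_wpM2r (normc_ge0 _) (normc_expi_taylor _))).
  rewrite (_ : `|v| ^+ 2 * _ = 2 * (k%:R * jb x * `|v|) ^+ 2 * N (f x)); last by ring.
  rewrite ler_wpM2r ?normc_ge0 // ler_wpM2l // -(real_normK (num_real _)) normrN.
  apply: lerXn2r; rewrite ?nnegrE ?mulr_ge0 ?japanese_ge0 //.
  apply: (le_trans (ler_norm_sum _ _ _)).
  apply: (@le_trans _ _ (\sum_(j < k) jb x * `|v|)); last by rewrite sumr_const card_ord -mulrA mulr_natl.
  by apply: ler_sum => j _; rewrite normrM ler_pM //; [exact: japanese_coord|exact: coord_le_norm].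
Qed.

(** By coinduction: a derivative of a Fourier transform is the Fourier transform of
    a Schwartz function. *)
Lemma schwartz_fourier k (f : 'rV[R]_k -> R[i]) : is_schwartz f -> is_schwartz (fourier f).
Proof.
move=> sf.
pose P (h : 'rV[R]_k -> R[i]) := exists2 f, is_schwartz f & h = fourier f.
apply: (@csmooth_coind _ _ (@rdecay R k) P (@rdecay_lin R k)); last by apply: cspan1; exists f.
move=> {f sf} _ [f sf ->]; split=> [xi|n|j]; first by have [] := fourier_derivative xi sf.
  exact: fourier_decay.
apply: cspan1; exists (fun x : 'rV[R]_k => (- 'i * (x ord0 j)%:C) * f x).
  by have [_ /(_ j)[]] := fourier_derivative 0 sf.
by apply/funext => xi; have [_ /(_ j)[]] := fourier_derivative xi sf.
Qed.

Definition gauss_mass k a : R := \int[lebesgue_rV R k]_x gauss a x.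

Lemma measurable_gauss k a : measurable_fun setT (@gauss R k a).
Proof. by rewrite /gauss; meas. Qed.

Lemma cintegral_gauss k a :
  cintegral (fun x : 'rV[R]_k => (gauss a x)%:C) = (gauss_mass k a)%:C.
Proof. by rewrite /cintegral /= /Rintegral integral0. Qed.

Lemma gauss_mass_gt0 k a : 0 < a -> 0 < gauss_mass k a.
Proof.
move=> a0; rewrite /gauss_mass /Rintegral fine_gt0 //; apply/andP; split.
  apply: integral_rV_gt0; first by apply/measurable_EFinP; exact: measurable_gauss.
  by move=> x; rewrite lte_fin expR_gt0.
have [C HC] := @gauss_decay R k a (k + k) a0.
apply: le_lt_trans (ltry (C * japanese_mass R k)).
by apply: integral_decay_le => // x; exact: expR_ge0.
Qed.

Lemma partial0_cst k (h : 'rV[R]_k -> R[i]) x : (forall x, cdiff h x) ->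
  (forall j x, partial j h x = 0) -> h x = h 0.
Proof.
move=> dh ph.
have part (u : R[i] -> R) : u 0 = 0 -> (forall y, differentiable (fun y => u (h y)) y) ->
    (forall j y, 'D_(delta_mx ord0 j) (fun y => u (h y)) y = u (partial j h y)) ->
    u (h x) = u (h 0).
  move=> u0 du Du; have [s _] := mean_value_rV 0 x du.
  rewrite derive_coords // big1 => [|j _]; last by rewrite Du ph u0 mulr0.
  by rewrite add0r => /eqP; rewrite subr_eq0 => /eqP.
apply: complexP.
  by apply: part => [//|y|j y //]; have [] := dh y.
by apply: part => [//|y|j y //]; have [] := dh y.
Qed.

(** Both sides solve the same first-order linear system. *)
Lemma fourier_gauss k a (xi : 'rV[R]_k) : 0 < a ->
  fourier (fun x => (gauss a x)%:C) xi = (gauss_mass k a)%:C * (gauss (4 * a)^-1 xi)%:C.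
Proof.
move=> a0; pose G (x : 'rV[R]_k) : R[i] := (gauss a x)%:C.
have sG : is_schwartz G by exact: schwartz_gauss.
have sF := schwartz_fourier sG.
have dF x : cdiff (fourier G) x by exact: (@csmooth_cdiff _ _ (@rdecay R _)).
pose E (x : 'rV[R]_k) : R[i] := (gauss (- (4 * a)^-1) x)%:C.
have dE x : cdiff E x.
  apply: cdiff_real; rewrite /gauss.
  have dexp t : derivable (@expR R) t 1 by exact: ex_derive.
  have mq : multiplier (fun x : 'rV[R]_k => (- - (4 * a)^-1 * dotv x x)%:C).
    rewrite (_ : (fun x => _) = fun x => (- - (4 * a)^-1)%:C * (dotv x x)%:C).
      apply: multiplierM; first exact: multiplier_cst.
      by apply: multiplier_dotv; exact: affine_id.
    by apply/funext => y; rewrite -rmorphM.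
  by have [] := derive_comp1 0 (dexp _) (multiplier_real_differentiable x mq).
have cE x : (gauss (4 * a)^-1 x)%:C * E x = 1.
  by rewrite /E /gauss -rmorphM -expRD -mulrDl opprK addNr mul0r expR0.
have a20 : (2 * a)%:C != 0 :> R[i].
  by rewrite (inj_eq (@complexI R)) mulf_neq0 // gt_eqF.
have pF j x : partial j (fourier G) x = - ((2 * a)%:C^-1 * (x ord0 j)%:C) * fourier G x.
  have [_ /(_ j)[sj ->]] := fourier_derivative x sG.
  have e : (fun y : 'rV[R]_k => - 'i * (y ord0 j)%:C * G y) =
      (fun y => ('i * (2 * a)%:C^-1) * partial j G y).
    apply/funext => y; rewrite /G partial_gauss.
    rewrite (_ : (- (2 * a) * y ord0 j * gauss a y)%:C =
      - (2 * a)%:C * (y ord0 j)%:C * (gauss a y)%:C); first by move: (2 * a)%:C a20 => b b0; field.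
    by rewrite !rmorphM rmorphN rmorphM.
  have sp : is_schwartz (partial j G) by exact: (@csmooth_partial _ _ (@rdecay R _)).
  rewrite e (fourierZ _ _ sp) (fourier_partial _ _ sG).
  have mulii (I b c F : R[i]) : I ^+ 2 = -1 -> I * b * (I * c * F) = - (b * c) * F.
    by move=> e2; rewrite (_ : I * b * (I * c * F) = I ^+ 2 * (b * c * F)); [rewrite e2|]; ring.
  exact/mulii/sqr_i.
have h : fourier G xi * E xi = fourier G 0 * E 0.
  apply: (@partial0_cst _ (fun x => fourier G x * E x)) => [x|j x]; first exact: cdiffM.
  rewrite partialM // pF /E partial_gauss.
  rewrite (_ : - (2 * - (4 * a)^-1) * x ord0 j * gauss (- (4 * a)^-1) x =
    (2 * a)^-1 * x ord0 j * gauss (- (4 * a)^-1) x); last by field; rewrite gt_eqF.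
  have alg (b c F e : R[i]) : - (b * c) * F * e + F * (b * c * e) = 0 by ring.
  rewrite [X in _ + _ * X](_ : _ =
    (2 * a)%:C^-1 * (x ord0 j)%:C * (gauss (- (4 * a)^-1) x)%:C); first exact: alg.
  by rewrite [LHS]rmorphM [X in X * _ = _]rmorphM fmorphV.
have E0 : E 0 = 1 by rewrite /E /gauss dotv0r mulr0 expR0.
have F0 : fourier G 0 = (gauss_mass k a)%:C.
  rewrite fourierE -cintegral_gauss; apply: eq_cintegral => x.
  by rewrite oppr0 dotv0r expi0 mul1r.
rewrite -[LHS]mulr1 -(cE xi) mulrCA h E0 F0 mulr1 mulrC //.
Qed.

Lemma gauss_scale k a c (x : 'rV[R]_k) : gauss a (c *: x) = gauss (c ^+ 2 * a) x.
Proof. by rewrite /gauss dotvZl dotvZr; congr expR; ring. Qed.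

Lemma gauss_le1 k a (x : 'rV[R]_k) : 0 <= a -> gauss a x <= 1.
Proof.
by move=> a0; rewrite /gauss -expR0 ler_expR mulNr oppr_le0 mulr_ge0 // dotvv_ge0.
Qed.

Lemma gauss_ge0 k a (x : 'rV[R]_k) : 0 <= gauss a x.
Proof. exact: expR_ge0. Qed.

(** Equal to (2 pi)^k. *)
Definition fourier_const k : R := gauss_mass k (2^-1) ^+ 2.

(** Insert a Gaussian of width 1/e in the frequency integral and exchange the
    integrals: the transform of that Gaussian concentrates at 0 as e tends to 0, at
    a rate given by the Lipschitz constant of f. *)
Lemma fourier_inversion0 k (f : 'rV[R]_k -> R[i]) : is_schwartz f ->
  cintegral (fourier f) = (fourier_const k)%:C * f 0.
Proof.
move=> sf; have sF := schwartz_fourier sf; set g := gauss_mass k 2^-1.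
have h0 : (0 : R) < 2^-1 by rewrite invr_gt0.
have g0 : 0 < g by exact: gauss_mass_gt0.
pose G (x : 'rV[R]_k) : R[i] := (gauss 2^-1 x)%:C.
have sG : is_schwartz G by exact: schwartz_gauss.
have swap e : 0 < e -> cintegral (fun xi => fourier f xi * (gauss (e ^+ 2 * 2^-1) xi)%:C) =
    g%:C * cintegral (fun y => f (e *: y) * G y).
  move=> e0; set a := e ^+ 2 * 2^-1; have a0 : 0 < a by rewrite mulr_gt0 // exprn_gt0.
  have [Cf Hf] := schwartz_bound (k + k) sf; have [Cg Hg] := @gauss_decay R k a (k + k) a0.
  have mg := measurable_gauss (k := k) a.
  have mz : cmeas (fun z : 'rV[R]_(k + k) => expi (dotv (rsubmx z) (- lsubmx z)) * f (rsubmx z) *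
      (gauss a (lsubmx z))%:C) by meas.
  transitivity (cintegral (fun xi => cintegral (fun x =>
      expi (dotv x (- xi)) * f x * (gauss a xi)%:C))).
    apply: eq_cintegral => xi; rewrite fourierE mulrC -cintegralZ; last first.
      exact/schwartz_cintegrable/schwartz_character.
    by apply: eq_cintegral => x; rewrite mulrC.
  rewrite (@cfubini_swap _ _ _ (fun xi x => expi (dotv x (- xi)) * f x * (gauss a xi)%:C)
    (Cg * Cf) mz); last first.
    move=> xi x; rewrite !Normc.normcM normc_expi mul1r normcR ger0_norm ?gauss_ge0 //.
    rewrite (_ : _ * _ = (jb xi ^+ (k + k) * gauss a xi) * (jb x ^+ (k + k) * N (f x))); last by ring.
    by apply: ler_pM; rewrite ?mulr_ge0 ?gauss_ge0 ?normc_ge0 ?japaneseX_ge0.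
  transitivity (cintegral (fun x => (gauss_mass k a)%:C * (f x * (gauss (4 * a)^-1 x)%:C))).
    apply: eq_cintegral => x; rewrite mulrCA -fourier_gauss // fourierE -cintegralZ; last first.
      exact/schwartz_cintegrable/schwartz_character/schwartz_gauss.
    by apply: eq_cintegral => xi; rewrite dotvNr dotvC -dotvNr; ring.
  have sfg : is_schwartz (fun x => f x * (gauss (4 * a)^-1 x)%:C).
    apply: schwartzM; first exact: schwartz_multiplier.
    by apply: schwartz_gauss; rewrite invr_gt0 mulr_gt0.
  rewrite cintegralZ; last exact: schwartz_cintegrable.
  have en0 : e != 0 by rewrite gt_eqF.
  have A1 := cintegral_affine 0 en0 (schwartz_cmeas sG).
  have A2 := cintegral_affine 0 en0 (schwartz_cmeas sfg).
  have e1 : (gauss_mass k a)%:C = (`|e|^-1 ^+ k)%:C * g%:C.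
    rewrite -!cintegral_gauss -A1; apply: eq_cintegral => x.
    by rewrite addr0 /G gauss_scale.
  have e2 : cintegral (fun y => f (e *: y) * G y) =
      (`|e|^-1 ^+ k)%:C * cintegral (fun x => f x * (gauss (4 * a)^-1 x)%:C).
    have ea : e ^+ 2 * (4 * a)^-1 = 2^-1 by rewrite /a; field.
    by rewrite -A2; apply: eq_cintegral => x; rewrite addr0 gauss_scale ea.
  by rewrite e1 e2; ring.
have [C1 H1] := schwartz_bound (k + k + 2) sF.
have C10 : 0 <= C1 by apply: le_trans (H1 0); rewrite mulr_ge0 ?normc_ge0 ?japaneseX_ge0.
have [L L0 HL] := schwartz_lipschitz_global sf.
have [C2 H2] := @gauss_decay R k 2^-1 (k + k + 1) h0.
pose M := 2 * (C1 * japanese_mass R k) + g * (2 * (L * C2 * japanese_mass R k)).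
apply/eqP; rewrite -subr_eq0; apply/eqP; apply: (@normc_small_eq0 _ M) => e e0 e1.
have sFG : is_schwartz (fun xi => fourier f xi * (gauss (e ^+ 2 * 2^-1) xi)%:C).
  apply: schwartzM; first exact: schwartz_multiplier.
  by apply: schwartz_gauss; rewrite mulr_gt0 // exprn_gt0.
have sfe : is_schwartz (fun y => f (e *: y)).
  apply: (@schwartz_affine _ _ _ (fun x => e *: x) f 1 (1 + `|e^-1|)) => //.
    by apply: affineZ; exact: affine_id.
  move=> x; have xe : x = e^-1 *: (e *: x) by rewrite scalerA mulVf ?gt_eqF // scale1r.
  by rewrite expr1 [X in jb X <= _]xe; exact: japaneseZ.
have sfeG : is_schwartz (fun y => f (e *: y) * G y).
  by apply: schwartzM => //; exact: schwartz_multiplier.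
have d1 : N (cintegral (fourier f) - cintegral (fun xi => fourier f xi * (gauss (e ^+ 2 * 2^-1) xi)%:C))
    <= 2 * (e * C1 * japanese_mass R k).
  rewrite -cintegralB; [|exact: schwartz_cintegrable..].
  have mg := measurable_gauss (k := k) (e ^+ 2 * 2^-1).
  apply: cintegral_decay => [|xi]; first by meas.
  rewrite (_ : _ - _ = fourier f xi * (1 - gauss (e ^+ 2 * 2^-1) xi)%:C); last first.
    by rewrite rmorphB rmorph1; ring.
  rewrite Normc.normcM normcR ger0_norm ?subr_ge0 ?gauss_le1 //; last first.
    by rewrite mulr_ge0 ?exprn_ge0 // ltW.
  have hG : 1 - gauss (e ^+ 2 * 2^-1) xi <= e * jb xi ^+ 2.
    have h1 := expR_ge1Dx (- (e ^+ 2 * 2^-1) * dotv xi xi).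
    rewrite /gauss lerBlDr -lerBlDl; apply: le_trans h1.
    rewrite japanese_sqr; have d0 := dotvv_ge0 xi.
    have d1 : 0 <= e * (2 - e) * dotv xi xi by rewrite !mulr_ge0 ?subr_ge0 // ?ltW // (le_lt_trans e1) // ltr1n.
    rewrite -subr_ge0 (_ : _ - _ = e + e * (2 - e) * dotv xi xi / 2); last by field.
    by rewrite addr_ge0 ?divr_ge0 // ltW.
  have := H1 xi; rewrite exprD => h1.
  rewrite mulrCA; apply: (@le_trans _ _ (e * (jb xi ^+ (k + k) * jb xi ^+ 2 * N (fourier f xi)))); last first.
    by rewrite ler_wpM2l // ltW.
  rewrite (_ : e * _ = jb xi ^+ (k + k) * N (fourier f xi) * (e * jb xi ^+ 2)); last by ring.
  by rewrite mulrCA mulrA ler_wpM2l // mulr_ge0 ?normc_ge0 ?japaneseX_ge0.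
have d2 : N (cintegral (fun y => f (e *: y) * G y) - f 0 * g%:C) <= 2 * (L * e * C2 * japanese_mass R k).
  rewrite -cintegral_gauss -cintegralZ; last exact: schwartz_cintegrable.
  rewrite -cintegralB; [|exact: schwartz_cintegrable|exact/cintegrableZ/schwartz_cintegrable].
  have mg := measurable_gauss (k := k) 2^-1.
  apply: cintegral_decay => [|y].
    by apply: cmeasB; [exact: schwartz_cmeas|meas].
  rewrite -mulrBl Normc.normcM normcR ger0_norm ?gauss_ge0 //.
  have := HL 0 (e *: y); rewrite add0r normrZ gtr0_norm // => h1.
  have h2 : N (f (e *: y) - f 0) <= L * e * jb y.
    by apply: (le_trans h1); rewrite -mulrA !ler_wpM2l ?norm_le_japanese // ltW.
  apply: (@le_trans _ _ (L * e * (jb y ^+ (k + k + 1) * gauss 2^-1 y))); last first.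
    by rewrite -mulrA -[leRHS]mulrA !ler_wpM2l // ltW.
  rewrite (exprD _ (k + k) 1) expr1 (_ : L * e * _ = jb y ^+ (k + k) * (L * e * jb y * gauss 2^-1 y)); last by ring.
  by rewrite ler_wpM2l ?japaneseX_ge0 // ler_wpM2r ?gauss_ge0.
rewrite (_ : _ - _ = (cintegral (fourier f) - cintegral (fun xi => fourier f xi * (gauss (e ^+ 2 * 2^-1) xi)%:C))
  + g%:C * (cintegral (fun y => f (e *: y) * G y) - f 0 * g%:C)); last first.
  by rewrite swap // /fourier_const -/g rmorphXn; ring.
apply: (le_trans (le_normcD _ _)); rewrite Normc.normcM normcR gtr0_norm //.
rewrite /M mulrDl lerD //.
  by apply: (le_trans d1); rewrite le_eqVlt; apply/orP; left; apply/eqP; ring.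
rewrite -mulrA ler_wpM2l ?(ltW g0) //; apply: (le_trans d2).
by rewrite le_eqVlt; apply/orP; left; apply/eqP; ring.
Qed.

Lemma fourier_const_gt0 k : 0 < fourier_const k.
Proof. by rewrite exprn_gt0 // gauss_mass_gt0 // invr_gt0. Qed.

Lemma fourier_inversion k (f : 'rV[R]_k -> R[i]) x : is_schwartz f ->
  cintegral (fun xi => expi (dotv x xi) * fourier f xi) = (fourier_const k)%:C * f x.
Proof.
move=> sf; have sx := schwartz_translate x sf.
have := fourier_inversion0 sx; rewrite add0r => <-; apply: eq_cintegral => xi.
rewrite !fourierE -cintegralZ; last exact/schwartz_cintegrable/schwartz_character.
rewrite -(cintegral_translate x); last by apply: schwartz_cmeas; apply: schwartzM => //;
  [exact: multiplier_cst|exact: schwartz_character].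
apply: eq_cintegral => y; rewrite mulrA -expiD; congr (expi _ * _).
by rewrite dotvDl !dotvNr; ring.
Qed.

End fourier_analysis.

(** * Seminorms and the short-time Fourier transform *)
Section stft.
Variable R : realType.
Local Notation N := (@Normc.normc R).
Local Notation jb := (@japanese R _).
Implicit Types k : nat.

Lemma schwartz_normE k n (f : 'rV[R]_k -> R[i]) (s : seq 'I_k) x : is_schwartz f ->
  (size s <= n)%N -> jb x ^+ n * N (partials s f x) <= schwartz_norm n f.
Proof.
move=> [_ sf] sn; apply: ub_le_sup; last by exists s, x.
have [C HC] : exists C, forall t : {m : 'I_n.+1 & m.-tuple 'I_k}, forall x,
    jb x ^+ n * N (partials (tagged t) f x) <= C.
  have [//|m|C C0 HC] := @finite_bound R {m : 'I_n.+1 & m.-tuple 'I_k} 'rV[R]_k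
    (fun t C x => jb x ^+ n * N (partials (tagged t) f x) <= C).
  - by move=> t C D y h CD; exact: le_trans CD.
  - exact: sf.
  - by exists C.
exists C => _ [t [y [tn ->]]].
have tn' : (size t < n.+1)%N by [].
exact: (HC (existT (fun m : 'I_n.+1 => m.-tuple 'I_k) (Ordinal tn') (in_tuple t)) y).
Qed.

Lemma schwartz_norm_le k n (f : 'rV[R]_k -> R[i]) B :
  (forall s x, (size s <= n)%N -> jb x ^+ n * N (partials s f x) <= B) ->
  schwartz_norm n f <= B.
Proof.
move=> H; apply: ge_sup; first by exists (jb (0 : 'rV[R]_k) ^+ n * N (partials [::] f 0)), [::], 0.
by move=> _ [s [x [sn ->]]]; exact: H.
Qed.

Lemma schwartz_norm_ge0 k n (f : 'rV[R]_k -> R[i]) : is_schwartz f -> 0 <= schwartz_norm n f.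
Proof.
move=> sf; apply: le_trans (schwartz_normE (s := [::]) 0 sf (leq0n n)).
by rewrite mulr_ge0 ?normc_ge0 ?japaneseX_ge0.
Qed.

Lemma schwartz_norm_leq k m n (f : 'rV[R]_k -> R[i]) : is_schwartz f -> (m <= n)%N ->
  schwartz_norm m f <= schwartz_norm n f.
Proof.
move=> sf mn; apply: schwartz_norm_le => s x sm.
apply: le_trans (schwartz_normE x sf (leq_trans sm mn)).
by rewrite ler_wpM2r ?normc_ge0 // japanese_leX.
Qed.

Lemma partials_rcons k (f : 'rV[R]_k -> R[i]) s j :
  partials (rcons s j) f = partials s (partial j f).
Proof. by rewrite /partials foldr_rcons. Qed.

Lemma schwartz_partial k j (f : 'rV[R]_k -> R[i]) :
  is_schwartz f -> is_schwartz (partial j f).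
Proof. exact: (@csmooth_partial _ _ (@rdecay R _)). Qed.

Lemma schwartz_norm_partial k n j (f : 'rV[R]_k -> R[i]) : is_schwartz f ->
  schwartz_norm n (partial j f) <= schwartz_norm n.+1 f.
Proof.
move=> sf; apply: schwartz_norm_le => s x sn; rewrite -partials_rcons.
apply: le_trans (schwartz_normE (s := rcons s j) x sf _); last by rewrite size_rcons.
by rewrite ler_wpM2r ?normc_ge0 // japanese_leX.
Qed.

Lemma japanese_le_sum k (x : 'rV[R]_k) : jb x <= 1 + \sum_j `|x ord0 j|.
Proof.
have S0 : 0 <= \sum_j `|x ord0 j| by apply: sumr_ge0.
rewrite -ler_sqr ?nnegrE ?japanese_ge0 ?addr_ge0 // japanese_sqr sqrrD expr1n -addrA lerD2l.
apply: le_trans (_ : (\sum_j `|x ord0 j|) ^+ 2 <= _); last by rewrite lerDr mulrn_wge0 ?mulr_ge0.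
rewrite expr2 mulr_suml /dotv; apply: ler_sum => j _.
have -> : x ord0 j * x ord0 j = `|x ord0 j| * `|x ord0 j|.
  by rewrite -normrM ger0_norm // -expr2 sqr_ge0.
rewrite (bigD1 j) //= mulrDr lerDl.
by rewrite mulr_ge0 // sumr_ge0.
Qed.

Lemma normc_i : N 'i = 1.
Proof. by rewrite normcE /= expr0n expr1n add0r sqrtr1. Qed.

Lemma normc_expi_sub1 t : N (expi t - 1) <= 3 * `|t|.
Proof.
have [t1|t1] := leP `|t| 1; last first.
  apply: (le_trans (normcB _ _)); rewrite normc_expi (_ : N 1 = 1); last by rewrite normcE /= expr1n expr0n addr0 sqrtr1.
  by move: t1; lra.
rewrite -[X in N X](subrK ('i * t%:C)); apply: (le_trans (le_normcD _ _)).
rewrite Normc.normcM normc_i mul1r normcR.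
have := normc_expi_taylor t; rewrite -[t ^+ 2]ger0_norm ?sqr_ge0 // normrX => h.
have : `|t| ^+ 2 <= `|t| by rewrite expr2 ler_piMl.
lra.
Qed.

Definition atom k (phi : 'rV[R]_k -> R[i]) (p xi x : 'rV[R]_k) : R[i] :=
  expi (dotv x xi) * phi (x - p).

(** Transposed and not hermitian: no conjugate is taken on the window. *)
Definition stft k (phi f : 'rV[R]_k -> R[i]) (p xi : 'rV[R]_k) : R[i] :=
  cintegral (fun x => f x * atom phi p xi x).

Lemma schwartz_atom k (phi : 'rV[R]_k -> R[i]) p xi :
  is_schwartz phi -> is_schwartz (atom phi p xi).
Proof. by move=> sp; apply: schwartz_character; exact: schwartz_translate. Qed.

Lemma multiplier_translate k (phi : 'rV[R]_k -> R[i]) (p : 'rV[R]_k) :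
  multiplier phi -> multiplier (fun x => phi (x - p)).
Proof.
by apply: multiplier_affine; apply: affineD; [exact: affine_id|exact: affine_cst].
Qed.

Lemma multiplier_atom k (phi : 'rV[R]_k -> R[i]) p xi :
  multiplier phi -> multiplier (atom phi p xi).
Proof.
by move=> mp; apply: multiplierM; [exact: multiplier_character|exact: multiplier_translate].
Qed.

Lemma partial_translate k j (phi : 'rV[R]_k -> R[i]) (p x : 'rV[R]_k) :
  cdiff phi (x - p) -> partial j (fun y => phi (y - p)) x = partial j phi (x - p).
Proof.
move=> d; have := @partial_affine R k k j 1%:M (- p) phi x; rewrite mulmx1 => /(_ d)[_].
rewrite (bigD1 j) //= mxE eqxx mul1r big1 ?addr0 => [<-|i ij]; last first.
  by rewrite mxE eq_sym (negPf ij) mul0r.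
by congr (partial j _ x); apply/funext => y; rewrite mulmx1.
Qed.

Lemma partial_atom k j (phi : 'rV[R]_k -> R[i]) (p xi x : 'rV[R]_k) : multiplier phi ->
  partial j (atom phi p xi) x =
  'i * (xi ord0 j)%:C * atom phi p xi x + atom (partial j phi) p xi x.
Proof.
move=> mp; have dp y : cdiff phi y by exact: csmooth_cdiff mp.
rewrite /atom partialM.
- by rewrite partial_character partial_translate // mulrA.
- exact: csmooth_cdiff (multiplier_character xi).
- exact: csmooth_cdiff (multiplier_translate p mp).
Qed.

Lemma normc_atom k (phi : 'rV[R]_k -> R[i]) p xi x : N (atom phi p xi x) = N (phi (x - p)).
Proof. by rewrite Normc.normcM normc_expi mul1r. Qed.

Lemma schwartz_mul_atom k (phi f : 'rV[R]_k -> R[i]) p xi : multiplier phi ->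
  is_schwartz f -> is_schwartz (fun x => f x * atom phi p xi x).
Proof.
move=> mp sf; rewrite (_ : (fun x => _) = (fun x => atom phi p xi x * f x)).
  by apply: schwartzM => //; exact: multiplier_atom.
by apply/funext => x; rewrite mulrC.
Qed.

(** Integration by parts, moving a frequency onto the function and the window. *)
Lemma stft_frequency k j (phi f : 'rV[R]_k -> R[i]) (p xi : 'rV[R]_k) : multiplier phi ->
  is_schwartz f -> 'i * (xi ord0 j)%:C * stft phi f p xi =
  - (stft phi (partial j f) p xi + stft (partial j phi) f p xi).
Proof.
move=> mp sf; have mpp := csmooth_partial j mp; have spf := schwartz_partial j sf.
rewrite /stft -cintegralZ; last exact/schwartz_cintegrable/schwartz_mul_atom.
rewrite -cintegralD; [|exact/schwartz_cintegrable/schwartz_mul_atom..].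
apply/eqP; rewrite -addr_eq0 -cintegralD; last first.
- by apply: cintegrableD; exact/schwartz_cintegrable/schwartz_mul_atom.
- by apply: cintegrableZ; exact/schwartz_cintegrable/schwartz_mul_atom.
rewrite -[X in _ == X](cintegral_partial j (schwartz_mul_atom p xi mp sf)); apply/eqP.
apply: eq_cintegral => x; rewrite partialM; first by rewrite partial_atom //; ring.
- exact: (@csmooth_cdiff _ _ (@rdecay R _)).
- exact: csmooth_cdiff (multiplier_atom p xi mp).
Qed.

Definition window_decay k n (phi : 'rV[R]_k -> R[i]) := exists C, forall x, jb x ^+ n * N (phi x) <= C.

Lemma window_decay_multiplier k n (phi : 'rV[R]_k -> R[i]) :
  csmooth (@window_decay k n) phi -> multiplier phi.
Proof.
apply: csmooth_sub => {}phi [C HC]; exists 0%N, C => x; rewrite expr0 mulr1.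
by apply: le_trans (HC x); rewrite ler_peMl ?normc_ge0 ?japaneseX_ge1.
Qed.

Lemma schwartz_window_decay k n (phi : 'rV[R]_k -> R[i]) :
  is_schwartz phi -> csmooth (@window_decay k n) phi.
Proof. by apply: (@csmooth_sub _ _ (@rdecay R k)) => g; exact. Qed.

(** Decay of the transform in both variables, with constants that see the
    function only through a seminorm; windows which do not decay are allowed so
    that the Fourier transform itself is covered. *)
Lemma stft_bound k n m (phi : 'rV[R]_k -> R[i]) : csmooth (@window_decay k n) phi ->
  exists C q, 0 <= C /\ forall f p xi, is_schwartz f ->
  jb p ^+ n * jb xi ^+ m * N (stft phi f p xi) <= C * schwartz_norm q f.
Proof.
elim: m phi => [|m IH] phi wp; have mp := window_decay_multiplier wp.
  have [C HC] := csmooth_bound wp.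
  have C0 : 0 <= C by apply: le_trans (HC 0); rewrite mulr_ge0 ?normc_ge0 ?japaneseX_ge0.
  exists (2 * (2 ^+ n * C * japanese_mass R k)), (k + k + n)%N; split.
    by rewrite !mulr_ge0 ?japanese_mass_ge0 ?exprn_ge0.
  move=> f p xi sf; rewrite expr0 mulr1.
  have p0 := japaneseX_gt0 p n; rewrite mulrC -ler_pdivlMr //.
  rewrite (_ : _ / _ = 2 * ((2 ^+ n * C * schwartz_norm (k + k + n) f / jb p ^+ n) * japanese_mass R k)); last by ring.
  apply: cintegral_decay => [|x]; first exact: (schwartz_cmeas (schwartz_mul_atom p xi mp sf)).
  rewrite ler_pdivlMr // Normc.normcM normc_atom.
  have h1 := HC (x - p); have := @schwartz_normE k (k + k + n) f [::] x sf (leq0n _).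
  rewrite exprD /= => h2.
  have h3 : jb p ^+ n <= 2 ^+ n * jb x ^+ n * jb (x - p) ^+ n.
    apply: expr_le_mul3; first exact: japanese_ge0.
    by rewrite -[X in jb X <= _](subKr x); exact: japaneseB.
  set A := N (f x) in h2 *; set B := N (phi _) in h1 *.
  have A0 : 0 <= A by exact: normc_ge0. have B0 : 0 <= B by exact: normc_ge0.
  apply: (@le_trans _ _ (2 ^+ n * (jb x ^+ (k + k) * jb x ^+ n * A) * (jb (x - p) ^+ n * B))).
    rewrite [leRHS](_ : _ = (jb x ^+ (k + k) * (A * B)) * (2 ^+ n * jb x ^+ n * jb (x - p) ^+ n)); last by ring.
    by rewrite ler_wpM2l // !mulr_ge0 ?japaneseX_ge0.
  rewrite -[leRHS]mulrA [X in _ <= _ * X]mulrC [leRHS]mulrA.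
  by apply: ler_pM => //; rewrite ?ler_wpM2l ?mulr_ge0 ?exprn_ge0 ?japanese_ge0.
have [C0 [q0 [C00 H0]]] := IH phi wp.
have /choice[F HF] : forall j, exists Cq : R * nat, 0 <= Cq.1 /\ forall f p xi, is_schwartz f ->
    jb p ^+ n * jb xi ^+ m * N (stft (partial j phi) f p xi) <= Cq.1 * schwartz_norm Cq.2 f.
  by move=> j; have [C [q H]] := IH _ (csmooth_partial j wp); exists (C, q).
pose q := (q0.+1 + \sum_j (F j).2)%N.
exists (C0 + \sum_j (C0 + (F j).1)), q; split.
  by rewrite addr_ge0 // sumr_ge0 // => j _; rewrite addr_ge0 //; exact: (HF j).1.
move=> f p xi sf; set V := N (stft phi f p xi).
have V0 : 0 <= V by exact: normc_ge0.
have W0 : 0 <= jb p ^+ n * jb xi ^+ m by rewrite mulr_ge0 ?japaneseX_ge0.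
rewrite exprSr mulrA -mulrA; apply: (@le_trans _ _
  (jb p ^+ n * jb xi ^+ m * ((1 + \sum_j `|xi ord0 j|) * V))).
  by rewrite ler_wpM2l // ler_wpM2r // japanese_le_sum.
rewrite mulrDl mul1r mulrDr [leRHS]mulrDl lerD //.
  apply: le_trans (H0 f p xi sf) _; rewrite ler_wpM2l //.
  by apply: schwartz_norm_leq => //; apply: (leq_trans (leqnSn q0)); exact: leq_addr.
rewrite mulr_suml mulr_sumr [leRHS]mulr_suml; apply: ler_sum => j _.
have -> : `|xi ord0 j| * V = N ('i * (xi ord0 j)%:C * stft phi f p xi).
  by rewrite !Normc.normcM normcR normc_i mul1r.
rewrite stft_frequency // normcN.
apply: (le_trans (ler_wpM2l W0 (le_normcD _ _))); rewrite mulrDr [leRHS]mulrDl lerD //.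
  apply: (le_trans (H0 _ p xi (schwartz_partial j sf))); rewrite ler_wpM2l //.
  apply: (le_trans (schwartz_norm_partial q0 j sf)).
  by apply: schwartz_norm_leq => //; rewrite leq_addr.
apply: (le_trans ((HF j).2 f p xi sf)); rewrite ler_wpM2l //; first exact: (HF j).1.
apply: schwartz_norm_leq => //; rewrite /q (bigD1 j) //=.
by rewrite addnCA leq_addr.
Qed.

Lemma partials_atom_rcons k s j (phi : 'rV[R]_k -> R[i]) (p xi x : 'rV[R]_k) : is_schwartz phi ->
  partials (rcons s j) (atom phi p xi) x =
  'i * (xi ord0 j)%:C * partials s (atom phi p xi) x + partials s (atom (partial j phi) p xi) x.
Proof.
move=> sp; rewrite partials_rcons.
have -> : partial j (atom phi p xi) =
    ('i * (xi ord0 j)%:C) *: atom phi p xi + atom (partial j phi) p xi.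
  by apply/funext => y; rewrite partial_atom //; exact: schwartz_multiplier.
by rewrite partials_linear; [|exact: (schwartz_atom p xi sp).1
  |exact: (schwartz_atom p xi (schwartz_partial j sp)).1].
Qed.

(** By partials_atom_rcons a derivative of an atom is a combination of atoms with
    other windows and a factor xi. *)
Lemma partials_atom_bound k n s (phi : 'rV[R]_k -> R[i]) : is_schwartz phi ->
  exists C m, 0 <= C /\ forall p xi x,
  jb x ^+ n * N (partials s (atom phi p xi) x) <= C * (jb p * jb xi) ^+ m.
Proof.
elim/last_ind: s phi => [|s j IH] phi sp.
  have [C HC] := schwartz_bound n sp.
  have C0 : 0 <= C by apply: le_trans (HC 0); rewrite mulr_ge0 ?normc_ge0 ?japaneseX_ge0.
  exists (2 ^+ n * C), n; split; first by rewrite mulr_ge0 ?exprn_ge0.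
  move=> p xi x; rewrite /= normc_atom; have := HC (x - p) => h1.
  have h3 : jb x ^+ n <= 2 ^+ n * jb (x - p) ^+ n * (jb p * jb xi) ^+ n.
    apply: expr_le_mul3; first exact: japanese_ge0.
    apply: le_trans (japanese_trans x p) _; rewrite ler_wpM2l ?mulr_ge0 ?japanese_ge0 //.
    by rewrite ler_peMr ?japanese_ge0 ?japanese_ge1.
  apply: (le_trans (ler_wpM2r (normc_ge0 _) h3)).
  have : 0 <= (jb p * jb xi) ^+ n by rewrite exprn_ge0 ?mulr_ge0 ?japanese_ge0.
  move: ((jb p * jb xi) ^+ n) => G G0; rewrite (_ : _ * _ * _ * _ = 2 ^+ n * (jb (x - p) ^+ n * N (phi (x - p))) * G); last by ring.
  by rewrite ler_wpM2r // ler_wpM2l ?exprn_ge0.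
have [C1 [m1 [C10 H1]]] := IH _ sp.
have [C2 [m2 [C20 H2]]] := IH _ (schwartz_partial j sp).
exists (C1 + C2), (m1 + m2).+1; split; first by rewrite addr_ge0.
move=> p xi x; rewrite partials_atom_rcons //.
have g1 : 1 <= jb p * jb xi by rewrite -[1]mulr1 ler_pM ?japanese_ge1.
apply: (le_trans (ler_wpM2l (japaneseX_ge0 _ _) (le_normcD _ _))).
rewrite mulrDr [leRHS]mulrDl lerD //.
  rewrite Normc.normcM Normc.normcM normc_i mul1r normcR mulrCA.
  apply: (@le_trans _ _ (jb xi * (C1 * (jb p * jb xi) ^+ m1))).
    by apply: ler_pM; rewrite ?mulr_ge0 ?japaneseX_ge0 ?normc_ge0 ?japanese_coord.
  rewrite mulrCA ler_wpM2l //; apply: (@le_trans _ _ ((jb p * jb xi) ^+ m1.+1)).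
    rewrite exprS ler_wpM2r ?exprn_ge0 ?mulr_ge0 ?japanese_ge0 //.
    by rewrite ler_peMl ?japanese_ge0 ?japanese_ge1.
  by rewrite ler_weXn2l // ltnS leq_addr.
apply: (le_trans (H2 p xi x)); rewrite ler_wpM2l //.
by rewrite ler_weXn2l // ltnW // ltnS leq_addl.
Qed.

(** This lets Riemann sums replace an atom by the one at the corner of its cell,
    with an error that is small in every seminorm. *)
Lemma partials_atom_lipschitz k n s (phi : 'rV[R]_k -> R[i]) : is_schwartz phi ->
  exists C m, 0 <= C /\ forall p xi p' xi' x t, 0 <= t <= 1 ->
  `|p' - p| <= t -> `|xi' - xi| <= t ->
  jb x ^+ n * N (partials s (atom phi p' xi') x - partials s (atom phi p xi) x)
  <= C * t * (jb p * jb xi) ^+ m.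
Proof.
elim/last_ind: s phi => [|s j IH] phi sp.
  have [C1 C10 H1] := schwartz_lipschitz n sp.
  have [C2 HC2] := schwartz_bound (n + 1) sp.
  have C20 : 0 <= C2 by apply: le_trans (HC2 0); rewrite mulr_ge0 ?normc_ge0 ?japaneseX_ge0.
  exists (2 ^+ n * C1 + 2 ^+ n * 2 * 3 * k%:R * C2), n.+1; split.
    by rewrite addr_ge0 ?mulr_ge0 ?exprn_ge0.
  move=> p xi p' xi' x t /andP[t0 t1] pt xt; rewrite /= /atom.
  have px : jb x <= 2 * jb (x - p) * (jb p * jb xi).
    apply: le_trans (japanese_trans x p) _; rewrite ler_wpM2l ?mulr_ge0 ?japanese_ge0 //.
    by rewrite ler_peMr ?japanese_ge0 ?japanese_ge1.
  have g1 : 1 <= jb p * jb xi by rewrite -[1]mulr1 ler_pM ?japanese_ge1.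
  have h3 : jb x ^+ n <= 2 ^+ n * jb (x - p) ^+ n * (jb p * jb xi) ^+ n.
    by rewrite -!exprMn; apply: lerXn2r; rewrite ?nnegrE ?mulr_ge0 ?japanese_ge0.
  have [G HG] : exists G, G = jb p * jb xi by exists (jb p * jb xi).
  have G0 : 0 <= G by rewrite HG mulr_ge0 ?japanese_ge0.
  rewrite -HG in px g1 h3 *.
  have d1 : jb (x - p) ^+ n * N (phi (x - p') - phi (x - p)) <= C1 * t.
    have := H1 (x - p) (p - p'); rewrite addrA subrK distrC => /(_ (le_trans pt t1)) h.
    by apply: (le_trans h); rewrite ler_wpM2l.
  have d2 : N (expi (dotv x xi') - expi (dotv x xi)) <= 3 * k%:R * t * jb x.
    have e1 : expi (dotv x xi') - expi (dotv x xi) = expi (dotv x xi) * (expi (dotv x (xi' - xi)) - 1).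
      by rewrite mulrBr mulr1 -expiD dotvDr dotvNr; congr (expi _ - _); ring.
    have e2 : `|dotv x (xi' - xi)| <= k%:R * t * jb x.
      apply: (le_trans (ler_norm_sum _ _ _)).
      apply: (@le_trans _ _ (\sum_(i < k) (t * jb x))); last by rewrite sumr_const card_ord -[leLHS]mulr_natl mulrA.
      apply: ler_sum => i _; rewrite normrM mulrC; apply: ler_pM => //; last exact: japanese_coord.
      exact: le_trans (coord_le_norm _ _) xt.
    rewrite e1 Normc.normcM normc_expi mul1r; apply: (le_trans (normc_expi_sub1 _)).
    by rewrite -!mulrA ler_wpM2l // mulrA.
  rewrite [X in N X](_ : _ = expi (dotv x xi') * (phi (x - p') - phi (x - p)) +
    (expi (dotv x xi') - expi (dotv x xi)) * phi (x - p)); last by ring.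
  apply: (le_trans (ler_wpM2l (japaneseX_ge0 _ _) (le_normcD _ _))).
  rewrite !Normc.normcM normc_expi mul1r mulrDr !mulrDl lerD //.
    apply: (le_trans (ler_wpM2r (normc_ge0 _) h3)).
    rewrite mulrAC -(mulrA (2 ^+ n)).
    apply: ler_pM; rewrite ?mulr_ge0 ?exprn_ge0 ?normc_ge0 ?mulr_ge0 ?japanese_ge0 //.
      by rewrite -mulrA ler_wpM2l ?exprn_ge0.
    by rewrite ler_weXn2l.
  apply: (@le_trans _ _ (jb x ^+ n * (3 * k%:R * t * jb x * N (phi (x - p))))).
    by rewrite ler_wpM2l ?japaneseX_ge0 // ler_wpM2r ?normc_ge0.
  have := HC2 (x - p); rewrite exprD expr1 => h2.
  apply: (@le_trans _ _ (2 ^+ n * 2 * 3 * k%:R * (jb (x - p) ^+ n * jb (x - p) * N (phi (x - p))) * t * G ^+ n.+1)); last first.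
    rewrite ler_wpM2r ?exprn_ge0 ?mulr_ge0 ?japanese_ge0 // ler_wpM2r // ler_wpM2l //.

  rewrite (_ : jb x ^+ n * _ = (3 * k%:R * t * N (phi (x - p))) * (jb x ^+ n * jb x)); last by ring.
  rewrite exprS [leRHS](_ : _ = (3 * k%:R * t * N (phi (x - p))) *
    ((2 ^+ n * jb (x - p) ^+ n * G ^+ n) * (2 * jb (x - p) * G))); last by ring.
  rewrite ler_wpM2l ?mulr_ge0 ?normc_ge0 //.
  by apply: ler_pM; rewrite ?japaneseX_ge0 ?japanese_ge0.
have [C1 [m1 [C10 H1]]] := IH _ sp.
have [C2 [m2 [C20 H2]]] := IH _ (schwartz_partial j sp).
have [C3 [m3 [C30 H3]]] := partials_atom_bound n s sp.
have [K HK] : exists K : R, K = 2 * (1 + k%:R) by exists (2 * (1 + k%:R)).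
have K0 : 0 <= K by rewrite HK mulr_ge0 ?addr_ge0.
exists (K * C1 + C3 + C2), (m1 + m2 + m3).+1; split; first by rewrite !addr_ge0 ?mulr_ge0.
move=> p xi p' xi' x t t01 pt xt; have /andP[t0 t1] := t01.
have g1 : 1 <= jb p * jb xi by rewrite -[1]mulr1 ler_pM ?japanese_ge1.
rewrite !partials_atom_rcons //; set a' := partials s (atom phi p' xi') x; set a := partials s (atom phi p xi) x.
set b' := partials s _ x; set b := partials s _ x.
rewrite [X in N X](_ : _ = 'i * (xi' ord0 j)%:C * (a' - a) + 'i * (xi' ord0 j - xi ord0 j)%:C * a + (b' - b)); last first.
  by rewrite rmorphB /=; ring.
have xi'b : jb xi' <= K * jb xi.
  rewrite HK.
  apply: le_trans (japanese_trans xi' xi) _; rewrite ler_wpM2r ?japanese_ge0 // ler_wpM2l //.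
  by apply: japanese_small; exact: le_trans xt t1.
have xs : `|xi' ord0 j - xi ord0 j| <= t.
  by have := coord_le_norm (xi' - xi) j; rewrite !mxE => h; exact: le_trans xt.
have := H1 p xi p' xi' x t t01 pt xt; rewrite -/a' -/a => {}H1.
have := H2 p xi p' xi' x t t01 pt xt; rewrite -/b' -/b => {}H2.
have := H3 p xi x; rewrite -/a => {}H3.
apply: (le_trans (ler_wpM2l (japaneseX_ge0 _ _) (le_normcD _ _))).
rewrite mulrDr !mulrDl lerD //; last first.
  apply: (le_trans H2); rewrite ler_wpM2l ?mulr_ge0 // ler_weXn2l //.
  by rewrite ltnW // ltnS -addnA addnCA leq_addr.
apply: (le_trans (ler_wpM2l (japaneseX_ge0 _ _) (le_normcD _ _))).
rewrite !Normc.normcM normc_i !mul1r !normcR mulrDr lerD //; last first.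
  rewrite mulrCA; apply: (@le_trans _ _ (t * (C3 * (jb p * jb xi) ^+ m3))).
    by apply: ler_pM => //; rewrite mulr_ge0 ?normc_ge0 ?japaneseX_ge0.
  rewrite mulrA [t * _]mulrC ler_wpM2l ?mulr_ge0 // ler_weXn2l //.
  by rewrite ltnW // ltnS leq_addl.
rewrite mulrCA; apply: (@le_trans _ _ (K * jb xi * (C1 * t * (jb p * jb xi) ^+ m1))).
  apply: ler_pM; rewrite ?mulr_ge0 ?normc_ge0 ?japaneseX_ge0 //.
  by apply: le_trans xi'b; exact: japanese_coord.
rewrite [leLHS](_ : _ = K * C1 * t * (jb xi * (jb p * jb xi) ^+ m1)); last first.
  by move: (_ ^+ m1) => Gm; ring.
rewrite ler_wpM2l ?mulr_ge0 ?addr_ge0 //; apply: (@le_trans _ _ ((jb p * jb xi) ^+ m1.+1)).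
  rewrite exprS ler_wpM2r ?exprn_ge0 ?mulr_ge0 ?japanese_ge0 //.
  by rewrite ler_peMl ?japanese_ge0 ?japanese_ge1.
by rewrite ler_weXn2l // ltnS -addnA leq_addr.
Qed.

End stft.

(** * Inversion of the short-time Fourier transform *)
Section inversion.
Variable R : realType.
Local Notation N := (@Normc.normc R).
Local Notation jb := (@japanese R _).
Implicit Types k : nat.

Lemma cmeas_atom d (T : measurableType d) k (phi : 'rV[R]_k -> R[i]) (P Xi X : T -> 'rV[R]_k) :
  cmeas phi -> measurable_fun setT P -> measurable_fun setT Xi -> measurable_fun setT X ->
  cmeas (fun t => atom phi (P t) (Xi t) (X t)).
Proof. by move=> mphi mP mXi mX; rewrite /atom; meas. Qed.

Lemma cmeas_stft d (T : measurableType d) k (phi f : 'rV[R]_k -> R[i]) (P Xi : T -> 'rV[R]_k) :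
  cmeas phi -> cmeas f -> measurable_fun setT P -> measurable_fun setT Xi ->
  cmeas (fun t => stft phi f (P t) (Xi t)).
Proof.
move=> mphi mf mP mXi.
have h : cmeas (fun z : 'rV[R]_(k + k) => stft phi f (lsubmx z) (rsubmx z)).
  apply: (cmeas_cintegral (f := fun (z : 'rV[R]_(k + k)) x => f x * atom phi (lsubmx z) (rsubmx z) x)).
  by apply: cmeasM; [meas|apply: cmeas_atom => //; meas].
have e : (fun t => stft phi f (P t) (Xi t)) =
    (fun t => (fun z : 'rV[R]_(k + k) => stft phi f (lsubmx z) (rsubmx z)) (row_mx (P t) (Xi t))).
  by apply/funext => t; rewrite row_mxKl row_mxKr.
by rewrite e; apply: (cmeas_comp h); meas.
Qed.

Lemma cmeas_partials_atom d (T : measurableType d) k s (phi : 'rV[R]_k -> R[i])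
    (P Xi : T -> 'rV[R]_k) x :
  is_schwartz phi -> measurable_fun setT P -> measurable_fun setT Xi ->
  cmeas (fun t => partials s (atom phi (P t) (Xi t)) x).
Proof.
move=> + mP mXi; elim/last_ind: s phi => [|s j IH] phi sp.
  by apply: cmeas_atom => //; exact: schwartz_cmeas.
rewrite [X in cmeas X](_ : _ = fun t => 'i * (Xi t ord0 j)%:C * partials s (atom phi (P t) (Xi t)) x
  + partials s (atom (partial j phi) (P t) (Xi t)) x).
  apply: cmeasD; last by apply: IH; exact: schwartz_partial.
  by apply: cmeasM; [meas|exact: IH].
by apply/funext => t; rewrite partials_atom_rcons.
Qed.

Lemma japanese_prod_lr a b (z : 'rV[R]_(a + b)) : jb z <= jb (lsubmx z) * jb (rsubmx z).
Proof. by rewrite -{1}(hsubmxK z); exact: japanese_row. Qed.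

Definition stftz k (phi f : 'rV[R]_k -> R[i]) (z : 'rV[R]_(k + k)) : R[i] :=
  stft phi f (lsubmx z) (rsubmx z).

Lemma cmeas_stftz k (phi f : 'rV[R]_k -> R[i]) : is_schwartz phi -> is_schwartz f ->
  cmeas (stftz phi f).
Proof. by move=> sp sf; apply: cmeas_stft; [exact: schwartz_cmeas..|meas|meas]. Qed.

Lemma stftz_bound k n (phi : 'rV[R]_k -> R[i]) : is_schwartz phi ->
  exists C q, 0 <= C /\ forall f z, is_schwartz f ->
  jb z ^+ n * N (stftz phi f z) <= C * schwartz_norm q f.
Proof.
move=> sp; have [C [q [C0 H]]] := stft_bound n (schwartz_window_decay n sp).
exists C, q; split=> // f z sf; apply: le_trans (H f (lsubmx z) (rsubmx z) sf).
rewrite ler_wpM2r ?normc_ge0 // -exprMn lerXn2r ?nnegrE ?mulr_ge0 ?japanese_ge0 //.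
exact: japanese_prod_lr.
Qed.

Lemma rdecay_stftz k (phi f : 'rV[R]_k -> R[i]) : is_schwartz phi -> is_schwartz f ->
  rdecay (stftz phi f).
Proof.
move=> sp sf n; have [C [q [_ H]]] := stftz_bound n sp.
by exists (C * schwartz_norm q f) => z; exact: H.
Qed.

Lemma cintegrable_rdecay k (V H : 'rV[R]_k -> R[i]) : cmeas V -> cmeas H ->
  rdecay V -> pbound H -> cintegrable (fun z => V z * H z).
Proof.
move=> mV mH dV dH; have [C HC] := rdecayM dH dV (k + k).
by apply: (@cintegrable_decay _ _ _ C) => [|z]; [meas|rewrite [V z * _]mulrC].
Qed.

Definition atom_partial k s (phi : 'rV[R]_k -> R[i]) (x : 'rV[R]_k) (z : 'rV[R]_(k + k)) :=
  partials s (atom phi (lsubmx z) (- rsubmx z)) x.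

Lemma cmeas_atom_partial k s (phi : 'rV[R]_k -> R[i]) x : is_schwartz phi -> cmeas (atom_partial s phi x).
Proof. by move=> sp; apply: cmeas_partials_atom => //; meas. Qed.

Lemma pbound_atom_partial k n s (phi : 'rV[R]_k -> R[i]) : is_schwartz phi ->
  exists C m, 0 <= C /\ forall x z, jb x ^+ n * N (atom_partial s phi x z) <= C * jb z ^+ m.
Proof.
move=> sp; have [C [m [C0 H]]] := partials_atom_bound n s sp; exists C, (m + m)%N; split=> // x z.
apply: le_trans (H _ _ _) _; rewrite ler_wpM2l // exprMn exprD japaneseN.
by apply: ler_pM; rewrite ?japaneseX_ge0 // lerXn2r ?nnegrE ?japanese_ge0 //;
  [exact: japanese_lsubmx|exact: japanese_rsubmx].
Qed.

Lemma cintegrable_stftz_atom_partial k s (phi psi f : 'rV[R]_k -> R[i]) x :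
  is_schwartz phi -> is_schwartz psi -> is_schwartz f ->
  cintegrable (fun z => stftz phi f z * atom_partial s psi x z).
Proof.
move=> sp sq sf; apply: cintegrable_rdecay; [exact: cmeas_stftz|exact: cmeas_atom_partial|exact: rdecay_stftz|].
have [C [m [_ H]]] := pbound_atom_partial 0 s sq; exists m, C => z.
by have := H x z; rewrite expr0 mul1r.
Qed.

Lemma stft_fourier k (phi f : 'rV[R]_k -> R[i]) p xi :
  stft phi f p xi = fourier (fun x => f x * phi (x - p)) (- xi).
Proof. by rewrite fourierE opprK; apply: eq_cintegral => x; rewrite /atom mulrCA. Qed.

Definition pairing k (f g : 'rV[R]_k -> R[i]) := cintegral (fun x => f x * g x).

Lemma schwartz_mul k (f g : 'rV[R]_k -> R[i]) : is_schwartz f -> is_schwartz g ->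
  is_schwartz (fun x => f x * g x).
Proof. by move=> sf sg; apply: schwartzM => //; exact: schwartz_multiplier. Qed.

Lemma schwartz_reflect k (v : 'rV[R]_k) f :
  is_schwartz f -> is_schwartz (fun x => f (v - x)).
Proof.
apply: (@schwartz_affine _ _ _ (fun x => v - x) f 1 (2 * jb v)).
  by apply: affineD; [exact: affine_cst|apply: affineN; exact: affine_id].
by move=> x; rewrite -[X in jb X <= _](subKr v) expr1; exact: japaneseB.
Qed.

(** A Schwartz function is the superposition of atoms weighted by its
    transform: integrate in frequency first, by Fourier inversion. *)
Lemma stft_inversion k (phi psi f : 'rV[R]_k -> R[i]) x :
  is_schwartz phi -> is_schwartz psi -> is_schwartz f ->
  cintegral (fun z => stftz phi f z * atom_partial [::] psi x z) =
  (fourier_const R k)%:C * pairing psi phi * f x.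
Proof.
move=> sp sq sf; have mp := schwartz_multiplier sp.
have [C [q [C0 H]]] := stft_bound (k + k) (schwartz_window_decay (k + k) sp).
have [D [m [D0 HD]]] := partials_atom_bound 0 [::] sq.
have [E HE] := schwartz_bound 0 sq.
rewrite (@cfubini _ _ _ (fun p xi => stft phi f p xi * atom psi p (- xi) x)
  (C * schwartz_norm q f * E)); last first.
- move=> p xi; rewrite Normc.normcM mulrA; apply: ler_pM; rewrite ?normc_ge0 ?mulr_ge0 ?japaneseX_ge0 ?normc_ge0 //.
    exact: H.
  by rewrite normc_atom; have := HE (x - p); rewrite expr0 mul1r.
- by apply: cmeasM; [exact: cmeas_stftz|exact: (cmeas_atom_partial [::])].
transitivity (cintegral (fun p => (fourier_const R k)%:C * f x * (fun y => psi y * phi y) (x - p))).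
  apply: eq_cintegral => p; have sfp : is_schwartz (fun y => f y * phi (y - p)).
    by apply: schwartz_mul => //; exact: schwartz_translate.
  transitivity (psi (x - p) * cintegral (fun xi => (fun xi => expi (dotv xi x) * fourier (fun y => f y * phi (y - p)) xi) (0 - xi))).
    rewrite -cintegralZ.
      apply: eq_cintegral => xi; rewrite stft_fourier /atom sub0r (dotvC (- xi)); ring.
    exact: (schwartz_cintegrable (schwartz_reflect 0 (schwartz_character x (schwartz_fourier sfp)))).
  rewrite (cintegral_reflect 0 (f := fun xi => expi (dotv xi x) * fourier (fun y => f y * phi (y - p)) xi)); last first.
    by have sF := schwartz_fourier sfp; meas.
  under eq_cintegral do rewrite dotvC.
  by rewrite fourier_inversion //; ring.
have spq := schwartz_mul sq sp.
rewrite cintegralZ.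
  rewrite (cintegral_reflect x (f := fun y => psi y * phi y)); last exact: schwartz_cmeas.
  by rewrite /pairing; ring.
exact: (schwartz_cintegrable (schwartz_reflect x spq)).
Qed.

Lemma pairing_partial k j (f g : 'rV[R]_k -> R[i]) : is_schwartz f -> is_schwartz g ->
  pairing (partial j f) g + pairing f (partial j g) = 0.
Proof.
move=> sf sg; have sf' := schwartz_partial j sf; have sg' := schwartz_partial j sg.
rewrite /pairing -cintegralD; [|exact/schwartz_cintegrable/schwartz_mul..].
rewrite -(cintegral_partial j (schwartz_mul sf sg)); apply: eq_cintegral => x.
by rewrite partialM //; exact: (@csmooth_cdiff _ _ (@rdecay R _)).
Qed.

(** A derivative of an atom produces a frequency, which stft_frequency trades for
    derivatives of f and of the window phi; the terms in which a window is
    differentiated cancel by pairing_partial. *)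
Lemma stft_inversion_partials k s (phi psi f : 'rV[R]_k -> R[i]) x :
  is_schwartz phi -> is_schwartz psi -> is_schwartz f ->
  cintegral (fun z => stftz phi f z * atom_partial s psi x z) =
  (fourier_const R k)%:C * pairing psi phi * partials s f x.
Proof.
elim/last_ind: s phi psi f => [|s j IH] phi psi f sp sq sf; first exact: stft_inversion.
have sp' := schwartz_partial j sp; have sq' := schwartz_partial j sq.
have sf' := schwartz_partial j sf.
transitivity (cintegral (fun z => (stftz phi (partial j f) z * atom_partial s psi x z
    + stftz (partial j phi) f z * atom_partial s psi x z) + stftz phi f z * atom_partial s (partial j psi) x z)).
  apply: eq_cintegral => z; rewrite -[in RHS]mulrDl.
  have := stft_frequency j (lsubmx z) (rsubmx z) (schwartz_multiplier sp) sf.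
  rewrite -/(stftz _ _ _) -/(stftz _ _ _) -/(stftz _ _ _) => /(congr1 -%R); rewrite opprK => <-.
  by rewrite /atom_partial partials_atom_rcons // mxE rmorphN /=; ring.
rewrite !cintegralD; [|exact: cintegrable_stftz_atom_partial..|apply: cintegrableD; exact: cintegrable_stftz_atom_partial
  |exact: cintegrable_stftz_atom_partial].
rewrite !IH // partials_rcons.
have := pairing_partial j sq sp; rewrite addrC => /eqP; rewrite addr_eq0 => /eqP ->.
by ring.
Qed.

End inversion.

(** * Distributions as superpositions of atoms *)
Section boxes.
Variable R : realType.
Local Notation N := (@Normc.normc R).
Local Notation jb := (@japanese R _).
Implicit Types k : nat.

Definition box k m : seq 'rV[int]_k :=
  [seq \row_i ((t i)%:Z - m%:Z) | t : {ffun 'I_k -> 'I_(m + m).+1}].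

Lemma uniq_box k m : uniq (box k m).
Proof.
rewrite map_inj_uniq ?enum_uniq // => t t' /rowP e; apply/ffunP => i.
by have := e i; rewrite !mxE => /addIr[] /val_inj.
Qed.

Lemma mem_box k m (z : 'rV[int]_k) : (z \in box k m) = [forall i, `|z ord0 i| <= m%:Z].
Proof.
apply/mapP/forallP => [[t _ ->] i|H].
  by rewrite mxE ler_norml; have := ltn_ord (t i); move: (nat_of_ord _) => q; lia.
have b i : (absz (z ord0 i + m%:Z)%R < (m + m).+1)%N by have := H i; rewrite ler_norml; lia.
exists [ffun i => Ordinal (b i)]; first by rewrite mem_enum.
apply/rowP => i; have h0 : 0 <= z ord0 i + m%:Z by have := H i; rewrite ler_norml; lia.
by rewrite mxE ffunE /= gez0_abs // addrK.
Qed.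

Lemma cell_far k j (x : 'rV[R]_k) : cell j.+1 x \notin box k (j.+1 ^ 2) -> j.+1%:R <= jb x.
Proof.
rewrite mem_box negb_forall => /existsP; case=> i; rewrite mxE -ltNge => h.
apply: le_trans (japanese_coord x i); set t := x ord0 i in h *.
have j0 : 0 < j.+1%:R :> R by rewrite ltr0n.
have m2 : ((j.+1 ^ 2)%:Z)%:~R = j.+1%:R * j.+1%:R :> R by rewrite -pmulrn natrX expr2.
rewrite -(ler_pM2l j0) -{1}m2 -[in leRHS](gtr0_norm j0) -normrM ler_normr.
case: (leP 0 (Num.floor (j.+1%:R * t))) h => [h0|h0] h.
  have h1 : (j.+1 ^ 2)%:Z <= Num.floor (j.+1%:R * t) by move: h; rewrite ger0_norm // => /ltW.
  by apply/orP; left; apply: le_trans (Num.Theory.floor_le_tmp _); rewrite ler_int.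
have h1 : Num.floor (j.+1%:R * t) + 1 <= - (j.+1 ^ 2)%:Z by move: h; rewrite ltr0_norm //; lia.
apply/orP; right; rewrite lerNr; apply/ltW/(lt_le_trans (floorD1_gt _)).
by rewrite -mulrNz ler_int.
Qed.

Lemma cmeas_comp_cell k j (h : 'rV[int]_k -> R[i]) : cmeas (fun x : 'rV[R]_k => h (cell j x)).
Proof.
by split; [exact: (measurable_comp_cell _ (fun z => Re (h z)))
  |exact: (measurable_comp_cell _ (fun z => Im (h z)))].
Qed.

Definition cell_mass k j (V : 'rV[R]_k -> R[i]) (z : 'rV[int]_k) : R[i] :=
  cintegral (fun x => (cell j.+1 x == z)%:R * V x).

(** The grid of mesh 1/(j+1) fills the cube of radius j+1, whence the square. *)
Definition riemann_sum k j (V H : 'rV[R]_k -> R[i]) : R[i] :=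
  \sum_(z <- box k (j.+1 ^ 2)) cell_mass j V z * H (corner R j.+1 z).

(** Quantitative convergence of Riemann sums against a rapidly decreasing
    density; the error depends on H only through a Lipschitz bound. *)
Lemma riemann_sum_error k (V : 'rV[R]_k -> R[i]) m : cmeas V -> rdecay V ->
  exists2 K, 0 <= K & forall (H : 'rV[R]_k -> R[i]) C j, cmeas H -> 0 <= C ->
  (forall x, N (H x) <= C * jb x ^+ m) ->
  (forall x y t, 0 <= t <= 1 -> `|y - x| <= t -> N (H y - H x) <= C * t * jb x ^+ m) ->
  N (cintegral (fun x => V x * H x) - riemann_sum j V H) <= K * C / j.+1%:R.
Proof.
move=> mV dV; have [D HD] := dV (k + k + m.+1)%N.
have D0 : 0 <= D by apply: le_trans (HD 0); rewrite mulr_ge0 ?normc_ge0 ?japaneseX_ge0.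
exists (2 * (D * japanese_mass R k)); first by rewrite !mulr_ge0 ?japanese_mass_ge0.
move=> H C j mH C0 bH lH.
have IV z : cintegrable (fun x => (cell j.+1 x == z)%:R * V x).
  have mz : cmeas (fun x : 'rV[R]_k => (cell j.+1 x == z)%:R : R[i]).
    exact: (cmeas_comp_cell _ (fun z' => (z' == z)%:R)).
  apply: (@cintegrable_decay _ _ _ D) => [|x]; first exact: cmeasM.
  apply: le_trans (HD x); rewrite [jb x ^+ (_ + _.+1)]exprD -mulrA ler_wpM2l ?japaneseX_ge0 //.
  rewrite Normc.normcM; case: eqP => _; last first.
    by rewrite mulr0n Normc.normc0 mul0r mulr_ge0 ?japaneseX_ge0 ?normc_ge0.
  rewrite mulr1n (_ : N 1 = 1); last by rewrite normcE /= expr1n expr0n addr0 sqrtr1.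
  by rewrite mul1r ler_peMl ?normc_ge0 ?japaneseX_ge1.
pose Hj (x : 'rV[R]_k) := if cell j.+1 x \in box k (j.+1 ^ 2) then H (corner R j.+1 (cell j.+1 x)) else 0.
have mHj : cmeas Hj.
  exact: (cmeas_comp_cell _ (fun z => if z \in box k (j.+1 ^ 2) then H (corner R j.+1 z) else 0)).
have e1 : riemann_sum j V H = cintegral (fun x => V x * Hj x).
  transitivity (cintegral (fun x => \sum_(z <- box k (j.+1 ^ 2)) H (corner R j.+1 z) * ((cell j.+1 x == z)%:R * V x))).
    rewrite cintegral_sum; last by move=> z; exact: cintegrableZ.
    by apply: eq_bigr => z _; rewrite cintegralZ // mulrC.
  apply: eq_cintegral => x; rewrite /Hj; case: ifPn => hx; last first.
    rewrite mulr0 big_seq big1 // => z hz; case: eqP hx => [->|_ _]; first by rewrite hz.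
    by rewrite mul0r mulr0.
  rewrite (bigD1_seq _ hx (uniq_box k _)) /= eqxx mul1r big1 ?addr0; first by rewrite mulrC.
  by move=> z /negPf hz; rewrite eq_sym hz mul0r mulr0.
have dH x : N (H x - Hj x) <= C / j.+1%:R * jb x ^+ m.+1.
  have j0 : 0 < j.+1%:R :> R by rewrite ltr0n.
  rewrite /Hj; case: ifPn => hx.
    rewrite -normcN opprB; apply: (le_trans (lH x _ j.+1%:R^-1 _ _)).
    - by rewrite invr_ge0 ler0n invf_le1 // ler1n.
    - by rewrite distrC; exact: corner_cell_dist.
    - by rewrite ler_wpM2l ?japanese_leX // mulr_ge0 // invr_ge0.
  rewrite subr0; apply: le_trans (bH x) _; rewrite exprS.
  rewrite [leRHS](_ : _ = C * (jb x / j.+1%:R * jb x ^+ m)); last by ring.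
  by rewrite ler_wpM2l // ler_peMl ?japaneseX_ge0 // ler_pdivlMr // mul1r cell_far.
have IH : cintegrable (fun x => V x * H x).
  by apply: cintegrable_rdecay => //; exists m, C.
have IHj : cintegrable (fun x => V x * Hj x).
  have hpb : pbound (fun x => H x - Hj x) by exists m.+1, (C / j.+1%:R).
  have [C' [m' H']] : pbound (fun x => H x - (H x - Hj x)).
    exists (m + m.+1)%N, (C + C / j.+1%:R) => x; apply: (le_trans (normcB _ _)).
    rewrite mulrDl lerD //.
      by apply: (le_trans (bH x)); rewrite ler_wpM2l ?japanese_leX // leq_addr.
    by apply: (le_trans (dH x)); rewrite ler_wpM2l ?japanese_leX ?leq_addl // divr_ge0.
  by apply: cintegrable_rdecay => //; exists C', m' => x; have := H' x; rewrite subKr.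
rewrite e1 -cintegralB //.
rewrite (_ : _ * C / _ = 2 * (D * (C / j.+1%:R) * japanese_mass R k)); last by ring.
apply: cintegral_decay => [|x]; first by meas.
rewrite -mulrBr Normc.normcM.
have := HD x; rewrite exprD => h.
apply: (@le_trans _ _ (jb x ^+ (k + k) * jb x ^+ m.+1 * N (V x) * (C / j.+1%:R))); last first.
  by rewrite ler_wpM2r // divr_ge0.
rewrite (_ : jb x ^+ (k + k) * _ * _ * _ = jb x ^+ (k + k) * (N (V x) * (C / j.+1%:R * jb x ^+ m.+1))); last by ring.
by rewrite ler_wpM2l ?japaneseX_ge0 // ler_wpM2l ?normc_ge0.
Qed.

End boxes.

Section tempered_atoms.
Variable R : realType.
Local Notation N := (@Normc.normc R).
Local Notation jb := (@japanese R _).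
Implicit Types k : nat.

Definition to_schwartz k (f : 'rV[R]_k -> R[i]) : schwartz R k := insubd (0 : schwartz R k) f.

Lemma to_schwartzE k (f : 'rV[R]_k -> R[i]) : is_schwartz f -> to_schwartz f = f :> ('rV[R]_k -> R[i]).
Proof. by move=> sf; rewrite /to_schwartz -[LHS]/(val _) insubdK //; apply/asboolP. Qed.

Lemma is_schwartz_val k (f : schwartz R k) : is_schwartz f.
Proof. by have := schwartz_funP f => /asboolP. Qed.

Lemma to_schwartz_lin k c (f g : 'rV[R]_k -> R[i]) : is_schwartz f -> is_schwartz g ->
  is_schwartz (fun x => c * f x + g x) /\ to_schwartz (fun x => c * f x + g x) = c *: to_schwartz f + to_schwartz g.
Proof.
move=> sf sg; have sh : is_schwartz (fun x => c * f x + g x).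
  by have [_ H] := csmooth_lin (@rdecay_lin R k); exact: H.
by split=> //; apply/val_inj; rewrite linearP /= !to_schwartzE.
Qed.

Lemma to_schwartz_val k (f : schwartz R k) : to_schwartz f = f.
Proof. by apply/val_inj; rewrite /= -[LHS]/(to_schwartz _ : 'rV[R]_k -> R[i]) to_schwartzE //; exact: is_schwartz_val. Qed.

Definition gauss_window k (x : 'rV[R]_k) : R[i] := (gauss 1 x)%:C.

Lemma schwartz_gauss_window k : is_schwartz (@gauss_window k).
Proof. exact: schwartz_gauss. Qed.

(** The frequency is reversed because the pairing with atoms is bilinear: this is
    the coefficient that multiplies the atom at z when a is expanded. *)
Definition coef k (a : schwartz R k -> R[i]) (z : 'rV[R]_(k + k)) : R[i] :=
  a (to_schwartz (atom (@gauss_window k) (lsubmx z) (- rsubmx z))).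

Lemma finite_seq_bound k n (P : seq 'I_k -> R -> nat -> Prop) :
  (forall s C D m m', P s C m -> C <= D -> (m <= m')%N -> P s D m') ->
  (forall s, exists C m, 0 <= C /\ P s C m) ->
  exists C m, 0 <= C /\ forall s, (size s <= n)%N -> P s C m.
Proof.
move=> mono H; have /choice[F HF] : forall s, exists Cm : R * nat, 0 <= Cm.1 /\ P s Cm.1 Cm.2.
  by move=> s; have [C [m h]] := H s; exists (C, m).
pose I := {m : 'I_n.+1 & m.-tuple 'I_k}.
exists (\sum_(t : I) (F (tagged t)).1), (\sum_(t : I) (F (tagged t)).2)%N; split.
  by apply: sumr_ge0 => t _; exact: (HF _).1.
move=> s sn; have sn' : (size s < n.+1)%N by [].
pose t : I := existT (fun m : 'I_n.+1 => m.-tuple 'I_k) (Ordinal sn') (in_tuple s).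
apply: (mono _ _ _ _ _ (HF s).2).
  rewrite (bigD1 t) //= lerDl; apply: sumr_ge0 => i _; exact: (HF _).1.
by rewrite (bigD1 t) //= leq_addr.
Qed.

Lemma atom_partial_seq_bound k n (phi : 'rV[R]_k -> R[i]) : is_schwartz phi ->
  exists C m, 0 <= C /\ forall s, (size s <= n)%N -> forall x z,
    jb x ^+ n * N (atom_partial s phi x z) <= C * jb z ^+ m.
Proof.
move=> sp; apply: finite_seq_bound => [s C D m m' h CD mm x z|s]; last exact: pbound_atom_partial.
have C0 : 0 <= C.
  have := h x z; rewrite -ler_pdivrMr ?japaneseX_gt0 //; apply: le_trans.
  by rewrite !mulr_ge0 ?normc_ge0 ?japaneseX_ge0 // invr_ge0 japaneseX_ge0.
by apply: (le_trans (h x z)); apply: ler_pM; rewrite ?japaneseX_ge0 ?japanese_leX.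
Qed.

Lemma schwartz_norm_atom k n (phi : 'rV[R]_k -> R[i]) : is_schwartz phi ->
  exists C m, 0 <= C /\ forall z : 'rV[R]_(k + k),
  schwartz_norm n (atom phi (lsubmx z) (- rsubmx z)) <= C * jb z ^+ m.
Proof.
move=> /(atom_partial_seq_bound n)[C [m [C0 H]]].
by exists C, m; split=> // z; apply: schwartz_norm_le => s x sn; exact: H.
Qed.

Lemma schwartz_lin k c (f g : 'rV[R]_k -> R[i]) : is_schwartz f -> is_schwartz g ->
  is_schwartz (fun x => c * f x + g x).
Proof. by move=> sf sg; have [] := to_schwartz_lin c sf sg. Qed.

Lemma partials_lin k s c (f g : 'rV[R]_k -> R[i]) x : is_schwartz f -> is_schwartz g ->
  partials s (fun x => c * f x + g x) x = c * partials s f x + partials s g x.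
Proof.
move=> [sf _] [sg _]; have := partials_linear c s sf sg.
by move/(congr1 (fun h => h x)).
Qed.

Lemma schwartz_norm_atom_lipschitz k n (phi : 'rV[R]_k -> R[i]) : is_schwartz phi ->
  exists C m, 0 <= C /\ forall (z w : 'rV[R]_(k + k)) t, 0 <= t <= 1 -> `|w - z| <= t ->
  forall s x, (size s <= n)%N ->
  jb x ^+ n * N (atom_partial s phi x w - atom_partial s phi x z) <= C * t * jb z ^+ m.
Proof.
move=> sp; have [||C [m [C0 H]]] := @finite_seq_bound k n (fun s C m => 0 <= C /\ forall (z w : 'rV[R]_(k + k)) t, 0 <= t <= 1 -> `|w - z| <= t ->
    forall x, jb x ^+ n * N (atom_partial s phi x w - atom_partial s phi x z) <= C * t * jb z ^+ m).
- move=> s C D m m' [C0 h] CD mm; split; first exact: le_trans CD.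
  move=> z w t t01 zw x; apply: (le_trans (h z w t t01 zw x)).
  have /andP[t0 _] := t01.
  by apply: ler_pM; rewrite ?japaneseX_ge0 ?japanese_leX ?mulr_ge0 // ler_wpM2r.
- move=> s; have [C [m [C0 H]]] := partials_atom_lipschitz n s sp.
  exists C, (m + m)%N; split=> //; split=> // z w t t01 zw x; have /andP[t0 _] := t01.
  have d1 : `|lsubmx w - lsubmx z| <= t.
    rewrite -linearB; apply: rV_norm_le => // i; rewrite !mxE.
    by apply: le_trans zw; have := coord_le_norm (w - z) (lshift k i); rewrite !mxE.
  have d2 : `|- rsubmx w - - rsubmx z| <= t.
    rewrite -opprD normrN -linearB; apply: rV_norm_le => // i; rewrite !mxE.
    by apply: le_trans zw; have := coord_le_norm (w - z) (rshift k i); rewrite !mxE.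
  apply: (le_trans (H _ _ _ _ x t t01 d1 d2)); rewrite ler_wpM2l ?mulr_ge0 // exprMn exprD japaneseN.
  by apply: ler_pM; rewrite ?japaneseX_ge0 // lerXn2r ?nnegrE ?japanese_ge0 //;
    [exact: japanese_lsubmx|exact: japanese_rsubmx].
by exists C, m; split=> // z w t t01 zw s x sn; exact: (H s sn).2.
Qed.

Lemma schwartz_norm_atomB k n (phi : 'rV[R]_k -> R[i]) : is_schwartz phi ->
  exists C m, 0 <= C /\ forall (z w : 'rV[R]_(k + k)) t, 0 <= t <= 1 -> `|w - z| <= t ->
  schwartz_norm n (fun x => (- 1) * atom phi (lsubmx z) (- rsubmx z) x
    + atom phi (lsubmx w) (- rsubmx w) x) <= C * t * jb z ^+ m.
Proof.
move=> sp; have [C [m [C0 H]]] := schwartz_norm_atom_lipschitz n sp.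
exists C, m; split=> // z w t t01 zw; apply: schwartz_norm_le => s x sn.
rewrite partials_lin; [|exact: schwartz_atom..].
by rewrite mulN1r addrC; exact: H.
Qed.

Lemma temperedP k (a : schwartz R k -> R[i]) : tempered a ->
  exists n M, 0 <= M /\ forall f, N (a f) <= M * schwartz_norm n f.
Proof.
move=> [_ [n [M H]]]; exists n, `|M|; split=> // f; apply: (le_trans (H f)).
by rewrite ler_wpM2r ?ler_norm ?schwartz_norm_ge0 //; exact: is_schwartz_val.
Qed.

Lemma tempered_lin k (a : schwartz R k -> R[i]) c f g : tempered a -> is_schwartz f ->
  is_schwartz g -> a (to_schwartz (fun x => c * f x + g x)) = c * a (to_schwartz f) + a (to_schwartz g).
Proof. by move=> [la _] sf sg; rewrite (to_schwartz_lin c sf sg).2 la. Qed.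

Lemma coef_pbound k (a : schwartz R k -> R[i]) : tempered a ->
  exists C m, 0 <= C /\ forall z, N (coef a z) <= C * jb z ^+ m.
Proof.
move=> ta; have [n [M [M0 H]]] := temperedP ta.
have [C [m [C0 HC]]] := schwartz_norm_atom n (schwartz_gauss_window k).
exists (M * C), m; split; first exact: mulr_ge0.
move=> z; apply: (le_trans (H _)); rewrite -mulrA ler_wpM2l // to_schwartzE //.
by apply: schwartz_atom; exact: schwartz_gauss_window.
Qed.

Lemma coef_lipschitz k (a : schwartz R k -> R[i]) : tempered a ->
  exists C m, 0 <= C /\ forall z w t, 0 <= t <= 1 -> `|w - z| <= t ->
  N (coef a w - coef a z) <= C * t * jb z ^+ m.
Proof.
move=> ta; have [n [M [M0 H]]] := temperedP ta.
have [C [m [C0 HC]]] := schwartz_norm_atomB n (schwartz_gauss_window k).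
exists (M * C), m; split; first exact: mulr_ge0.
move=> z w t t01 zw.
have sz := schwartz_atom (lsubmx z) (- rsubmx z) (schwartz_gauss_window k).
have sw := schwartz_atom (lsubmx w) (- rsubmx w) (schwartz_gauss_window k).
have := tempered_lin (-1) ta sz sw; rewrite mulN1r addrC => e.
rewrite /coef -e; apply: (le_trans (H _)); rewrite -!mulrA ler_wpM2l // mulrA to_schwartzE; first exact: HC.
exact: schwartz_lin.
Qed.

Lemma lipschitz_measurable k (h : 'rV[R]_k -> R) C m : 0 <= C ->
  (forall z w t, 0 <= t <= 1 -> `|w - z| <= t -> `|h w - h z| <= C * t * jb z ^+ m) ->
  measurable_fun setT h.
Proof.
move=> C0 H; apply: continuous_rV_measurable => z.
have FF : Filter (nbhs z) := nbhs_filter z.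
apply/cvgrPdist_le => e e0.
pose t := Num.min 1 (e / (1 + C * jb z ^+ m)).
have D0 : 0 < 1 + C * jb z ^+ m by rewrite ltr_wpDr // mulr_ge0 ?japaneseX_ge0.
have t0 : 0 < t by rewrite lt_min ltr01 divr_gt0.
near=> w; rewrite distrC; apply: (le_trans (H z w t _ _)).
- by rewrite ltW // ge_min lexx.
- near: w; have := @nbhsx_ballx R _ z t t0; apply: filterS => w.
  by rewrite -ball_normE /= distrC => /ltW.
have : t <= e / (1 + C * jb z ^+ m) by rewrite ge_min lexx orbT.
rewrite ler_pdivlMr // => h1; apply: le_trans h1.
by rewrite mulrDr mulr1 -mulrA [C * _]mulrC -!mulrA [_ * C]mulrC lerDr ltW.
Unshelve. all: by end_near.
Qed.

Lemma cmeas_coef k (a : schwartz R k -> R[i]) : tempered a -> cmeas (coef a).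
Proof.
move=> /coef_lipschitz[C [m [C0 H]]]; split; apply: (lipschitz_measurable C0) => z w t t01 zw.
- by rewrite -ReN -ReD; apply: (le_trans (normc_Re _)); exact: H.
- by rewrite -ImN -ImD; apply: (le_trans (normc_Im _)); exact: H.
Qed.

Definition atom_const k : R := fourier_const R k * gauss_mass k 2%:R.

Lemma atom_const_gt0 k : 0 < atom_const k.
Proof. by rewrite mulr_gt0 ?fourier_const_gt0 ?gauss_mass_gt0. Qed.

Lemma pairing_gauss_window k : pairing (@gauss_window k) (@gauss_window k) = (gauss_mass k 2)%:C.
Proof.
rewrite -cintegral_gauss; apply: eq_cintegral => x.
rewrite /gauss_window -rmorphM /gauss -expRD; congr ((expR _)%:C); ring.
Qed.

Lemma sum_lin k (a : schwartz R k -> R[i]) I (r : seq I) (c : I -> R[i]) F : tempered a ->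
  (forall i, is_schwartz (F i)) ->
  [/\ is_schwartz (fun x => \sum_(i <- r) c i * F i x),
   forall s x, partials s (fun x => \sum_(i <- r) c i * F i x) x
     = \sum_(i <- r) c i * partials s (F i) x
   & a (to_schwartz (fun x => \sum_(i <- r) c i * F i x)) = \sum_(i <- r) c i * a (to_schwartz (F i))].
Proof.
move=> ta sF; elim: r => [|i r [IH1 IH2 IH3]].
  have e : (fun x => \sum_(i <- [::]) c i * F i x) = fun _ : 'rV[R]_k => 0.
    by apply/funext => x; rewrite big_nil.
  rewrite e; have s0 : is_schwartz (fun _ : 'rV[R]_k => 0 : R[i]) := is_schwartz0 R k.
  split=> // [s x|]; rewrite big_nil.
    have := partials_lin s (-1) x s0 s0.
    rewrite (_ : (fun x0 => _) = fun _ => 0); last by apply/funext => y; rewrite mulr0 addr0.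
    by rewrite mulN1r addNr.
  have := tempered_lin (-1) ta s0 s0.
  rewrite (_ : (fun x0 => _) = fun _ => 0); last by apply/funext => y; rewrite mulr0 addr0.
  by rewrite mulN1r addNr.
have e : (fun x => \sum_(j <- i :: r) c j * F j x) = fun x => c i * F i x + \sum_(j <- r) c j * F j x.
  by apply/funext => x; rewrite big_cons.
rewrite e; split=> [|s x|]; first exact: schwartz_lin.
- by rewrite partials_lin // IH2 big_cons.
- by rewrite tempered_lin // IH3 big_cons.
Qed.

(** A tempered distribution is determined by its coefficients along the atoms:
    the Riemann sums of the inversion formula converge in every seminorm. *)
Theorem tempered_coef k (a : schwartz R k -> R[i]) f : tempered a -> is_schwartz f ->
  cintegral (fun z => stftz (@gauss_window k) f z * coef a z) = (atom_const k)%:C * a (to_schwartz f).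
Proof.
move=> ta sf; have sg := schwartz_gauss_window k.
set V := stftz (@gauss_window k) f.
have mV : cmeas V by exact: cmeas_stftz.
have dV : rdecay V by exact: rdecay_stftz.
have [n [M [M0 HM]]] := temperedP ta.
have [C1 [m1 [C10 H1]]] := coef_pbound ta.
have [C2 [m2 [C20 H2]]] := coef_lipschitz ta.
have [C3 [m3 [C30 H3]]] := atom_partial_seq_bound n sg.
have [C4 [m4 [C40 H4]]] := schwartz_norm_atom_lipschitz n sg.
pose m := (m1 + m2 + m3 + m4)%N; pose C := C1 + C2 + C3 + C4.
have [K K0 HK] := riemann_sum_error m mV dV.
have up Ci mi Ct (z : 'rV[R]_(k + k)) : 0 <= Ci -> Ci <= Ct -> (mi <= m)%N -> Ci * jb z ^+ mi <= Ct * jb z ^+ m.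
  by move=> h0 h1 h2; apply: ler_pM; rewrite ?japaneseX_ge0 ?japanese_leX.
have [le1 le2 le3 le4] : [/\ C1 <= C, C2 <= C, C3 <= C & C4 <= C] by rewrite /C; split; lra.
have [ml1 ml2 ml3 ml4] : [/\ m1 <= m, m2 <= m, m3 <= m & m4 <= m]%N by rewrite /m; clear -m1 m2 m3 m4; split; lia.
have C0 : 0 <= C := le_trans C10 le1.
set I := cintegral _; apply/eqP; rewrite -subr_eq0; apply/eqP.
have key j : N (I - (atom_const k)%:C * a (to_schwartz f)) <= (K * C + M * (K * C)) / j.+1%:R.
  pose S x := riemann_sum j V (atom_partial [::] (@gauss_window k) x).
  have [sS pS aS] := @sum_lin k a _ (box (k + k) (j.+1 ^ 2)) (cell_mass j V)
    (fun z => atom (@gauss_window k) (lsubmx (corner R j.+1 z)) (- rsubmx (corner R j.+1 z))) ta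
    (fun z => schwartz_atom _ _ sg).
  have sfS := schwartz_lin (- (atom_const k)%:C) sf sS.
  have e : I - (atom_const k)%:C * a (to_schwartz f) = (I - riemann_sum j V (coef a))
      + a (to_schwartz (fun x => - (atom_const k)%:C * f x + S x)).
    rewrite tempered_lin // aS /riemann_sum /coef; ring.
  rewrite e; apply: (le_trans (le_normcD _ _)); rewrite mulrDl lerD //.
    apply: HK => //; first exact: cmeas_coef.
      by move=> x; apply: (le_trans (H1 x)); exact: up.
    move=> x y t t01 xy; have /andP[t0 _] := t01; apply: (le_trans (H2 x y t t01 xy)).
    by apply: up => //; rewrite ?mulr_ge0 // ler_wpM2r.
  apply: (le_trans (HM _)); rewrite -mulrA ler_wpM2l // to_schwartzE //.
  apply: schwartz_norm_le => s x sn; rewrite partials_lin // pS.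
  have -> : \sum_(z <- box (k + k) (j.+1 ^ 2)) cell_mass j V z *
      partials s (atom (@gauss_window k) (lsubmx (corner R j.+1 z)) (- rsubmx (corner R j.+1 z))) x =
      riemann_sum j V (atom_partial s (@gauss_window k) x) by [].
  have := stft_inversion_partials s x sg sg sf; rewrite pairing_gauss_window -rmorphM => e2.
  have J0 := japaneseX_ge0 x n.
  rewrite mulNr -e2 addrC -normcN opprB -(ger0_norm J0) -normcR -Normc.normcM mulrBr.
  rewrite -cintegralZ; last exact: cintegrable_stftz_atom_partial.
  rewrite /riemann_sum mulr_sumr.
  pose H z := (jb x ^+ n)%:C * atom_partial s (@gauss_window k) x z.
  rewrite [X in N X](_ : _ = cintegral (fun z => V z * H z) - riemann_sum j V H); last first.
    congr (_ - _); first by apply: eq_cintegral => z; rewrite /H mulrCA.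
    by apply: eq_bigr => z _; rewrite /H mulrCA.
  apply: HK => //.
  - by apply: cmeasM; [exact: cmeas_cst|exact: cmeas_atom_partial].
  - move=> z; rewrite /H Normc.normcM normcR ger0_norm //; apply: (le_trans (H3 s sn x z)); exact: up.
  - move=> z w t t01 zw; have /andP[t0 _] := t01.
    rewrite /H -mulrBr Normc.normcM normcR ger0_norm //; apply: (le_trans (H4 z w t t01 zw s x sn)).
    by apply: up => //; rewrite ?mulr_ge0 // ler_wpM2r.
apply: Normc.eq0_normc; apply/eqP; rewrite eq_le normc_ge0 andbT.
apply/ler_addgt0Pr => e e0; rewrite add0r.
have [j Hj] : exists j : nat, (K * C + M * (K * C)) / e < j%:R.
  by exists (Num.bound ((K * C + M * (K * C)) / e)); apply: archi_boundP; rewrite divr_ge0 ?(ltW e0) // addr_ge0 ?mulr_ge0.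
apply: (le_trans (key j)); rewrite ler_pdivrMr ?ltr0n // -ler_pdivrMl // mulrC.
by apply/ltW/(lt_le_trans Hj); rewrite ler_nat.
Qed.

End tempered_atoms.

(** * Weyl operators acting on atoms *)
Section weyl_atoms.
Variable R : realType.
Local Notation N := (@Normc.normc R).
Local Notation jb := (@japanese R _).
Implicit Types k : nat.

Lemma japanese_half k (x : 'rV[R]_k) : jb (2^-1 *: x) <= jb x.
Proof. by apply: le_japanese; rewrite !dotvE; have := dotvv_ge0 x; lra. Qed.

Lemma japanese_double k (x : 'rV[R]_k) : jb (2 *: x) <= 3 * jb x.
Proof. by have := japaneseZ 2 x; rewrite ger0_norm // (_ : 1 + 2 = 3) //; ring. Qed.

Lemma affine_opp_add k l (c : 'rV[R]_l) (L : 'rV[R]_k -> 'rV[R]_l) :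
  affine_map L -> affine_map (fun z => c - L z).
Proof. by move=> aL; apply: affineD; [exact: affine_cst|exact: affineN]. Qed.

Section kernel.
Variable k : nat.
Implicit Types b : 'rV[R]_(k + k) -> R[i].
Local Notation g := (@gauss_window R k).
Local Notation c0 := (((2 * pi : R) ^- k)%:C).

(** With x fixed the point ((x + y)/2, theta) determines (y, theta), so that the
    integrand is Schwartz in both before theta is integrated out. *)
Lemma schwartz_weyl_kernel b x : is_schwartz b -> is_schwartz (weyl_kernel b x).
Proof.
move=> sb; pose F (z : 'rV[R]_(k + k)) := expi (dotv (x - lsubmx z) (rsubmx z)) *
  b (row_mx (2^-1 *: (x + lsubmx z)) (rsubmx z)).
have al : affine_map (fun z : 'rV[R]_(k + k) => lsubmx z) by apply: affine_lsubmx; exact: affine_id.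
have ar : affine_map (fun z : 'rV[R]_(k + k) => rsubmx z) by apply: affine_rsubmx; exact: affine_id.
have sF : is_schwartz F.
  apply: schwartzM.
    by apply: multiplier_expi; apply: multiplier_dotv => //; exact: affine_opp_add.
  apply: (@schwartz_affine _ _ _ (fun z : 'rV[R]_(k + k) => row_mx (2^-1 *: (x + lsubmx z)) (rsubmx z)) b 2 (6 * jb x)) => //.
    by apply: affine_row => //; apply: affineZ; apply: affineD => //; exact: affine_cst.
  move=> z; set L := row_mx _ _.
  apply: (le_trans (japanese_prod_lr z)).
  have h1 : jb (rsubmx z) <= jb L by exact: japanese_rowr.
  have h2 : jb (lsubmx z) <= 6 * jb x * jb L.
    have e : lsubmx z = 2 *: (2^-1 *: (x + lsubmx z)) - x by rewrite scalerA divff // scale1r addrAC subrr add0r.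
    rewrite {1}e; apply: (le_trans (japaneseB _ _)).
    have h3 := japanese_double (2^-1 *: (x + lsubmx z)).
    have h4 : jb (2^-1 *: (x + lsubmx z)) <= jb L by exact: japanese_rowl.
    have x0 := japanese_ge0 x; rewrite mulrAC [leLHS](_ : _ = 2 * jb x * jb (2 *: (2^-1 *: (x + lsubmx z)))); last by ring.
    rewrite (_ : 6 * jb x * _ = 2 * jb x * (3 * jb L)); last by ring.
    by rewrite ler_wpM2l ?mulr_ge0 //; lra.
  by rewrite expr2 mulrA; apply: ler_pM; rewrite ?japanese_ge0.
have e : weyl_kernel b x = fun y => c0 * (cintegral (fun theta : 'rV[R]_k => F (row_mx y theta))).
  apply/funext => y; congr (_ * _); apply: eq_cintegral => t.
  by rewrite /F row_mxKl row_mxKr.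
by rewrite e; apply: schwartzM; [exact: multiplier_cst|exact: schwartz_integrate].
Qed.

Lemma cmeas_weyl_kernel d (T : measurableType d) b (X Y : T -> 'rV[R]_k) : is_schwartz b ->
  measurable_fun setT X -> measurable_fun setT Y ->
  cmeas (fun t => weyl_kernel b (X t) (Y t)).
Proof.
move=> sb mX mY.
have h : cmeas (fun z : 'rV[R]_(k + k) => weyl_kernel b (lsubmx z) (rsubmx z)).
  apply: cmeasM; first exact: cmeas_cst.
  apply: (cmeas_cintegral (f := fun (z : 'rV[R]_(k + k)) (t : 'rV[R]_k) =>
    expi (dotv (lsubmx z - rsubmx z) t) * b (row_mx (2^-1 *: (lsubmx z + rsubmx z)) t))).
  by meas.
have e : (fun t => weyl_kernel b (X t) (Y t)) =
    (fun t => (fun z : 'rV[R]_(k + k) => weyl_kernel b (lsubmx z) (rsubmx z)) (row_mx (X t) (Y t))).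
  by apply/funext => t; rewrite row_mxKl row_mxKr.
by rewrite e; apply: (cmeas_comp h); meas.
Qed.

Lemma weyl_kernel_bound b : is_schwartz b -> exists2 C, 0 <= C & forall x y, N (weyl_kernel b x y) <= C.
Proof.
move=> sb; have [C HC] := schwartz_bound (k + k) sb.
exists (N c0 * (2 * (C * japanese_mass R k))).
  apply: mulr_ge0; first exact: normc_ge0.
  rewrite !mulr_ge0 ?japanese_mass_ge0 //; apply: le_trans (HC 0).
  by rewrite mulr_ge0 ?normc_ge0 ?japaneseX_ge0.
move=> x y; rewrite Normc.normcM ler_wpM2l ?normc_ge0 //.
apply: cintegral_decay => [|t]; first by meas.
rewrite Normc.normcM normc_expi mul1r; apply: le_trans (HC (row_mx (2^-1 *: (x + y)) t)).
by rewrite ler_wpM2r ?normc_ge0 // lerXn2r ?nnegrE ?japanese_ge0 //; exact: japanese_rowr.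
Qed.

(** The transform integrates the kernel against the atom at z, so that this is the
    Weyl operator applied to that atom. *)
Definition weyl_atom b x (z : 'rV[R]_(k + k)) : R[i] := stftz g (weyl_kernel b x) z.

Definition weyl_matrix b (w z : 'rV[R]_(k + k)) : R[i] :=
  cintegral (fun x => weyl_atom b x z * atom g (lsubmx w) (rsubmx w) x).

Lemma gauss_parallelogram (u v : 'rV[R]_k) :
  gauss 1 u * gauss 1 v = gauss 2 (2^-1 *: (u + v)) * gauss 2^-1 (v - u).
Proof.
rewrite /gauss -!expRD !dotvE (dotvC v u); congr expR.
by field.
Qed.

Lemma fourier_gauss_shift a (q eta : 'rV[R]_k) : 0 < a ->
  cintegral (fun t => expi (dotv t eta) * (gauss a (t - q))%:C) =
  (gauss_mass k a)%:C * (expi (dotv q eta) * (gauss (4 * a)^-1 eta)%:C).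
Proof.
move=> a0; have mg := measurable_gauss (R := R) (k := k) a.
rewrite -(cintegral_translate q (f := fun t => expi (dotv t eta) * (gauss a (t - q))%:C)); last by meas.
transitivity (cintegral (fun x => expi (dotv q eta) * (expi (dotv x (- (- eta))) * (gauss a x)%:C))).
  by apply: eq_cintegral => x; rewrite addrK opprK dotvDl expiD mulrA [expi _ * expi _]mulrC.
rewrite cintegralZ; last exact/schwartz_cintegrable/schwartz_character/schwartz_gauss.
rewrite -fourierE fourier_gauss // mulrCA; congr (_ * (_ * _)).
by rewrite /gauss !dotvE opprK.
Qed.

Definition pair_window (Y : 'rV[R]_(k + k)) : R[i] := (gauss 2 (lsubmx Y))%:C * (gauss 2^-1 (rsubmx Y))%:C.

Lemma schwartz_tensor a c (f : 'rV[R]_a -> R[i]) (h : 'rV[R]_c -> R[i]) :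
  is_schwartz f -> is_schwartz h ->
  is_schwartz (fun Z : 'rV[R]_(a + c) => f (lsubmx Z) * h (rsubmx Z)).
Proof.
apply: (@schwartz_comp2 _ _ _ _ (fun Z : 'rV[R]_(a + c) => lsubmx Z) (fun Z => rsubmx Z) f h 1 1).
- by apply: affine_lsubmx; exact: affine_id.
- by apply: affine_rsubmx; exact: affine_id.
- by move=> x; rewrite expr1 mul1r; exact: japanese_prod_lr.
Qed.

Lemma schwartz_pair_window : is_schwartz pair_window.
Proof.
have s1 : is_schwartz (fun x : 'rV[R]_k => (gauss 2 x)%:C) by exact: schwartz_gauss.
have s2 : is_schwartz (fun x : 'rV[R]_k => (gauss 2^-1 x)%:C) by apply: schwartz_gauss; rewrite invr_gt0.
exact: (schwartz_tensor s1 s2).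
Qed.

Definition weyl_phase (w z : 'rV[R]_(k + k)) : R[i] :=
  expi (- dotv (lsubmx w - lsubmx z) (2^-1 *: (rsubmx z - rsubmx w))).

(** In the variables t = x - y and (x + y)/2 the Gaussians of the two atoms combine
    by gauss_parallelogram and the integral in t is explicit; what remains is the
    short-time Fourier transform of the symbol, at the midpoint of the two points
    and at their difference. *)
Lemma weyl_matrixE b w z : is_schwartz b -> weyl_matrix b w z =
  c0 * (gauss_mass k 2^-1)%:C * weyl_phase w z *
  stft pair_window b (row_mx (2^-1 *: (lsubmx z + lsubmx w)) (2^-1 *: (rsubmx z - rsubmx w)))
    (row_mx (rsubmx z + rsubmx w) (lsubmx w - lsubmx z)).
Proof.
move=> sb; have sg := schwartz_gauss_window R k.
set p := lsubmx z; set xi := rsubmx z; set p' := lsubmx w; set xi' := rsubmx w.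
have saz := schwartz_atom p xi sg; have saw := schwartz_atom p' xi' sg.
set az := atom g p xi; set aw := atom g p' xi'.
pose G x y := weyl_kernel b x y * az y * aw x.
have maz : cmeas az by exact: schwartz_cmeas.
have maw : cmeas aw by exact: schwartz_cmeas.
have mG d (T : measurableType d) (X Y : T -> 'rV[R]_k) : measurable_fun setT X -> measurable_fun setT Y ->
    cmeas (fun t => G (X t) (Y t)).
  move=> mX mY; rewrite /G; apply: cmeasM; last exact: (cmeas_comp maw).
  by apply: cmeasM; [exact: cmeas_weyl_kernel|exact: (cmeas_comp maz)].
pose Psi t (Y : 'rV[R]_(k + k)) := expi (dotv t (rsubmx Y)) * b Y * az (lsubmx Y - 2^-1 *: t) * aw (lsubmx Y + 2^-1 *: t).
have [Cw Cw0 HCw] := weyl_kernel_bound sb.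
have [Ca HCa] := schwartz_bound (4 * k) saz.
have [Cb HCb] := schwartz_bound (4 * k) saw.
have Ca0 : 0 <= Ca by apply: le_trans (HCa 0); rewrite mulr_ge0 ?normc_ge0 ?japaneseX_ge0.
have Cb0 : 0 <= Cb by apply: le_trans (HCb 0); rewrite mulr_ge0 ?normc_ge0 ?japaneseX_ge0.
transitivity (cintegral (fun x => cintegral (fun t => G x (x - t)))).
  apply: eq_cintegral => x; rewrite (cintegral_reflect x (f := G x)); last by apply: mG; meas.
  rewrite /weyl_atom /stftz /stft mulrC -cintegralZ.
    by apply: eq_cintegral => y; rewrite /G mulrC.
  exact: (schwartz_cintegrable (schwartz_mul (schwartz_weyl_kernel x sb) saz)).
have bG x t : jb x ^+ (k + k) * jb t ^+ (k + k) * N (G x (x - t)) <= 2 ^+ (k + k) * Cw * Ca * Cb.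
  rewrite /G; set y := x - t; have h3 := HCw x y.
  move: (weyl_kernel b x y) h3 => W h3; rewrite (Normc.normcM (W * az y)) (Normc.normcM W).
  have ht : jb t ^+ (k + k) <= 2 ^+ (k + k) * jb x ^+ (k + k) * jb y ^+ (k + k).
    by apply: expr_le_mul3; rewrite ?japanese_ge0 // -[X in jb X <= _](subKr x); exact: japaneseB.
  have h1 := HCa y; have h2 := HCb x.
  have e4 : (4 * k = k + k + (k + k))%N by lia.
  have h1' : jb y ^+ (k + k) * N (az y) <= Ca.
    by apply: le_trans h1; rewrite ler_wpM2r ?normc_ge0 // japanese_leX // e4 leq_addr.
  apply: (@le_trans _ _ (2 ^+ (k + k) * N W * (jb y ^+ (k + k) * N (az y)) * (jb x ^+ (4 * k) * N (aw x)))); last first.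
    have a0 : 0 <= jb y ^+ (k + k) * N (az y) by rewrite mulr_ge0 ?normc_ge0 ?japaneseX_ge0.
    have b0 : 0 <= jb x ^+ (4 * k) * N (aw x) by rewrite mulr_ge0 ?normc_ge0 ?japaneseX_ge0.
    exact: (ler_mul4 (exprn_ge0 (k + k) (ler0n R 2)) (normc_ge0 W) a0 b0 h3 h1' h2).
  rewrite e4 [jb x ^+ (k + k + _)]exprD.
  by apply: ler_mul_kernel; rewrite ?normc_ge0 ?japaneseX_ge0.
rewrite (@cfubini_swap _ _ _ (fun x t => G x (x - t)) _ _ bG); last by apply: mG; meas.
have mPsi : cmeas (fun v : 'rV[R]_(k + (k + k)) => Psi (lsubmx v) (rsubmx v)).
  rewrite /Psi; apply: cmeasM; last by apply: (cmeas_comp maw); meas.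
  by apply: cmeasM; [meas|apply: (cmeas_comp maz); meas].
have gE t (Y : 'rV[R]_(k + k)) : Psi t Y = expi (dotv (lsubmx Y) (xi + xi')) * b Y *
    (gauss 2 (lsubmx Y - 2^-1 *: (p + p')))%:C * (expi (dotv t (rsubmx Y - 2^-1 *: (xi - xi'))) * (gauss 2^-1 (t - (p' - p)))%:C).
  rewrite /Psi /az /aw /atom /gauss_window.
  set X := lsubmx Y; set th := rsubmx Y; set u := X - 2^-1 *: t - p; set v := X + 2^-1 *: t - p'.
  have e1 : 2^-1 *: (u + v) = X - 2^-1 *: (p + p').
    by rewrite /u /v; apply/rowP => i; rewrite !mxE; field.
  have e2 : v - u = t - (p' - p) by rewrite /u /v; apply/rowP => i; rewrite !mxE; field.
  have gp := gauss_parallelogram u v; rewrite e1 e2 in gp.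
  transitivity (expi (dotv t th) * expi (dotv (X - 2^-1 *: t) xi) * expi (dotv (X + 2^-1 *: t) xi') * b Y *
     ((gauss 1 u)%:C * (gauss 1 v)%:C)); first by ring.
  rewrite -[X in _ * X = _]rmorphM gp rmorphM -!expiD.
  transitivity (expi (dotv X (xi + xi')) * expi (dotv t (th - 2^-1 *: (xi - xi'))) * b Y *
    ((gauss 2 (X - 2^-1 *: (p + p')))%:C * (gauss 2^-1 (t - (p' - p)))%:C)); last by ring.
  rewrite -expiD; congr (expi _ * _ * _); rewrite !dotvE; ring.
have [Cc HCc] := schwartz_bound (k + k + (k + k)) sb.
have h2p : 0 < 2^-1 :> R by rewrite invr_gt0.
have [Cd HCd] := @schwartz_bound R k (fun t => (gauss 2^-1 (t - (p' - p)))%:C) (k + k)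
  (schwartz_translate (- (p' - p)) (schwartz_gauss k h2p)).
have bPsi t (Y : 'rV[R]_(k + k)) : jb t ^+ (k + k) * jb Y ^+ (k + k + (k + k)) * N (Psi t Y) <= Cd * Cc.
  rewrite gE !Normc.normcM !normc_expi !mul1r.
  have h1 := HCd t; have h2 := HCc Y.
  have h3 : N (gauss 2 (lsubmx Y - 2^-1 *: (p + p')))%:C <= 1.
    by rewrite normcR ger0_norm ?gauss_ge0 // gauss_le1.
  by apply: ler_mul_split h1 h2 h3; rewrite ?normc_ge0 ?japaneseX_ge0.
have iPsi t : cintegrable (Psi t).
  exact: (fubini_slice (f := Psi) mPsi bPsi t).
transitivity (cintegral (fun t => c0 * cintegral (Psi t))).
  apply: eq_cintegral => t.
  rewrite -(cintegral_translate (2^-1 *: t) (f := fun x => G x (x - t))); last by apply: mG; meas.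
  pose Q (X th : 'rV[R]_k) := Psi t (row_mx X th).
  have QE : cintegral (Psi t) = cintegral (fun X => cintegral (Q X)).
    have h : forall Y, Psi t Y = Q (lsubmx Y) (rsubmx Y) by move=> Y; rewrite /Q hsubmxK.
    rewrite (eq_cintegral h); apply: (@cfubini _ _ _ Q (Cd * Cc)).
      by apply: (cmeas_comp (cmeas_slice (f := Psi) t mPsi)); meas.
    move=> X th; apply: le_trans (bPsi t (row_mx X th)).
    rewrite ler_wpM2r ?normc_ge0 // -[leLHS]mul1r; apply: ler_pM; rewrite ?mulr_ge0 ?japaneseX_ge0 ?japaneseX_ge1 //.
    rewrite [leRHS]exprD; apply: ler_pM; rewrite ?japaneseX_ge0 // lerXn2r ?nnegrE ?japanese_ge0 //.
      exact: japanese_rowl.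
    exact: japanese_rowr.
  rewrite QE -cintegralZ; last first.
    apply: (@cintegrable_decay _ _ _ (2 * ((Cd * Cc) * japanese_mass R k))).
      by apply: (cmeas_cintegral (f := Q)); apply: (cmeas_comp (cmeas_slice (f := Psi) t mPsi)); meas.
    move=> X; apply: (@fubini_inner_decay _ _ _ Q (Cd * Cc)).
      by apply: (cmeas_comp (cmeas_slice (f := Psi) t mPsi)); meas.
    move=> {}X th; apply: le_trans (bPsi t (row_mx X th)).
    rewrite ler_wpM2r ?normc_ge0 // -[leLHS]mul1r; apply: ler_pM; rewrite ?mulr_ge0 ?japaneseX_ge0 ?japaneseX_ge1 //.
    rewrite [leRHS]exprD; apply: ler_pM; rewrite ?japaneseX_ge0 // lerXn2r ?nnegrE ?japanese_ge0 //.
      exact: japanese_rowl.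
    exact: japanese_rowr.
  apply: eq_cintegral => X; rewrite /G /weyl_kernel.
  have e1 : X + 2^-1 *: t - (X + 2^-1 *: t - t) = t by rewrite subKr.
  have e2 : 2^-1 *: (X + 2^-1 *: t + (X + 2^-1 *: t - t)) = X by apply/rowP => i; rewrite !mxE; field.
  have e3 : X + 2^-1 *: t - t = X - 2^-1 *: t by apply/rowP => i; rewrite !mxE; field.
  rewrite e1 e2 e3 -2!(mulrA c0); congr (_ * _); rewrite -(mulrA (cintegral _)) mulrC -cintegralZ.
    by apply: eq_cintegral => th; rewrite /Q /Psi row_mxKl row_mxKr; rewrite -mulc_shuffle4.
  have [D HD] := schwartz_bound (k + k) sb.
  apply: (@cintegrable_decay _ _ _ D) => [|th]; first by meas.
  rewrite Normc.normcM normc_expi mul1r; apply: le_trans (HD (row_mx X th)).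
  by rewrite ler_wpM2r ?normc_ge0 // lerXn2r ?nnegrE ?japanese_ge0 //; exact: japanese_rowr.
rewrite cintegralZ; last first.
  apply: (@cintegrable_decay _ _ _ (2 * ((Cd * Cc) * japanese_mass R (k + k)))).
    exact: (cmeas_cintegral (f := Psi)).
  by move=> t; apply: (@fubini_inner_decay _ _ _ Psi (Cd * Cc)).
rewrite (@cfubini_swap _ _ _ Psi _ mPsi bPsi) -!mulrA; congr (_ * _).
transitivity (cintegral (fun Y => ((gauss_mass k 2^-1)%:C * weyl_phase w z) * (b Y *
   atom pair_window (row_mx (2^-1 *: (p + p')) (2^-1 *: (xi - xi'))) (row_mx (xi + xi') (p' - p)) Y))).
  apply: eq_cintegral => Y; under eq_cintegral do rewrite gE.
  rewrite cintegralZ; last first.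
    exact: (schwartz_cintegrable (schwartz_character _ (schwartz_translate (- (p' - p)) (schwartz_gauss k h2p)))).
  rewrite fourier_gauss_shift // (_ : (4 * 2^-1)^-1 = 2^-1); last by field.
  have els (A B : 'rV[R]_k) : lsubmx (Y - row_mx A B) = lsubmx Y - A by rewrite linearB /= row_mxKl.
  have ers (A B : 'rV[R]_k) : rsubmx (Y - row_mx A B) = rsubmx Y - B by rewrite linearB /= row_mxKr.
  rewrite /atom /pair_window /weyl_phase dotv_split els ers !row_mxKl !row_mxKr -/p -/p' -/xi -/xi'.
  set u := 2^-1 *: (xi - xi'); rewrite (dotvDr (p' - p)) expiD expiD dotvNr (dotvC (p' - p) (rsubmx Y)).
  exact: mulc_shuffle_phase.
rewrite cintegralZ; first by rewrite -[LHS]mulrA.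
exact: (schwartz_cintegrable (schwartz_mul_atom _ _ (schwartz_multiplier schwartz_pair_window) sb)).
Qed.

End kernel.
End weyl_atoms.

(** * Localized operators are almost diagonal on atoms *)
Section kernel_bounds.
Variable R : realType.
Local Notation N := (@Normc.normc R).
Local Notation jb := (@japanese R _).
Variable k : nat.
Implicit Types b chi : 'rV[R]_(k + k) -> R[i].
Local Notation g := (@gauss_window R k).
Local Notation c0 := (((2 * pi : R) ^- k)%:C).

(** The reflection in frequency that exchanges the two kinds of atoms. *)
Definition flip (z : 'rV[R]_(k + k)) : 'rV[R]_(k + k) := row_mx (lsubmx z) (- rsubmx z).

Lemma flipK : involutive flip.
Proof. by move=> z; rewrite /flip row_mxKl row_mxKr opprK hsubmxK. Qed.

Lemma flipD z w : flip (z + w) = flip z + flip w.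
Proof. by rewrite /flip !linearD /= add_row_mx. Qed.

Lemma japanese_flip z : jb (flip z) = jb z.
Proof.
apply/eqP; rewrite eq_le; apply/andP; split; apply: le_japanese;
  by rewrite dotv_row [dotv z z]dotv_split dotvNl dotvNr opprK.
Qed.

(** Unlike the kernel alone, the integrand is Schwartz in all the variables (x, y,
    theta), because the atom confines y. *)
Lemma schwartz_weyl_atom b z : is_schwartz b -> is_schwartz (fun x => weyl_atom b x z).
Proof.
move=> sb; have sa := schwartz_atom (lsubmx z) (rsubmx z) (schwartz_gauss_window R k).
pose X (v : 'rV[R]_(k + (k + k))) := lsubmx v.
pose Y (v : 'rV[R]_(k + (k + k))) := lsubmx (rsubmx v).
pose T (v : 'rV[R]_(k + (k + k))) := rsubmx (rsubmx v).
have aX : affine_map X by apply: affine_lsubmx; exact: affine_id.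
have aY : affine_map Y by apply: affine_lsubmx; apply: affine_rsubmx; exact: affine_id.
have aT : affine_map T by apply: affine_rsubmx; apply: affine_rsubmx; exact: affine_id.
pose F v := expi (dotv (X v - Y v) (T v)) *
  (b (row_mx (2^-1 *: (X v + Y v)) (T v)) * atom g (lsubmx z) (rsubmx z) (Y v)).
have sF : is_schwartz F.
  apply: schwartzM.
    apply: multiplier_expi; apply: multiplier_dotv => //; apply: affineD => //; exact: affineN.
  apply: (@schwartz_comp2 _ _ _ _ (fun v => row_mx (2^-1 *: (X v + Y v)) (T v)) Y b _ 2 6) => //.
    by apply: affine_row => //; apply: affineZ; exact: affineD.
  move=> v; set L := row_mx _ _.
  have h0 : jb v <= jb (X v) * (jb (Y v) * jb (T v)).
    apply: (le_trans (japanese_prod_lr v)); rewrite ler_wpM2l ?japanese_ge0 //.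
    exact: japanese_prod_lr.
  have h1 : jb (T v) <= jb L by exact: japanese_rowr.
  have h2 : jb (X v) <= 6 * jb L * jb (Y v).
    have e : X v = 2 *: (2^-1 *: (X v + Y v)) - Y v by rewrite scalerA divff // scale1r addrK.
    rewrite {1}e; apply: (le_trans (japaneseB _ _)).
    rewrite ler_wpM2r ?japanese_ge0 //.
    have h3 := japanese_double (2^-1 *: (X v + Y v)).
    have h4 : jb (2^-1 *: (X v + Y v)) <= jb L by exact: japanese_rowl.
    by rewrite (_ : 6 = 2 * 3) -?mulrA ?ler_wpM2l //; [lra|ring].
  apply: (le_trans h0); move: (japanese_ge0 (X v)) (japanese_ge0 (Y v)) (japanese_ge0 (T v)) h1 h2.
  move: (jb (X v)) (jb (Y v)) (jb (T v)) (jb L) => x y t l x0 y0 t0 tl xl.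
  rewrite [leRHS](_ : _ = (6 * l * y) * (y * l)); last by ring.
  by apply: ler_pM => //; [rewrite mulr_ge0|rewrite ler_wpM2l].
have [C HC] := schwartz_bound (k + k + (k + k)) sF.
have e : (fun x => weyl_atom b x z) = fun x => c0 * cintegral (fun u => F (row_mx x u)).
  apply/funext => x; pose Q (y t : 'rV[R]_k) := F (row_mx x (row_mx y t)).
  have mF := schwartz_cmeas sF.
  have -> : cintegral (fun u => F (row_mx x u)) = cintegral (fun y => cintegral (Q y)).
    rewrite -(@cfubini _ _ _ Q C); first by apply: eq_cintegral => u; rewrite /Q hsubmxK.
      by rewrite /Q; apply: (cmeas_comp mF); meas.
    move=> y t; apply: le_trans (HC (row_mx x (row_mx y t))).
    rewrite ler_wpM2r ?normc_ge0 // [leRHS]exprD; apply: ler_pM; rewrite ?japaneseX_ge0 // lerXn2r ?nnegrE ?japanese_ge0 //.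
      by apply: le_trans (japanese_rowr _ _); exact: japanese_rowl.
    by apply: le_trans (japanese_rowr _ _); exact: japanese_rowr.
  have mQ : cmeas (fun u : 'rV[R]_(k + k) => Q (lsubmx u) (rsubmx u)).
    by rewrite /Q; apply: (cmeas_comp mF); meas.
  have bQ y t : jb y ^+ (k + k) * jb t ^+ (k + k) * N (Q y t) <= C.
    apply: le_trans (HC (row_mx x (row_mx y t))).
    rewrite ler_wpM2r ?normc_ge0 // [leRHS]exprD; apply: ler_pM; rewrite ?japaneseX_ge0 // lerXn2r ?nnegrE ?japanese_ge0 //.
      by apply: le_trans (japanese_rowr _ _); exact: japanese_rowl.
    by apply: le_trans (japanese_rowr _ _); exact: japanese_rowr.
  rewrite -cintegralZ; last first.
    apply: (@cintegrable_decay _ _ _ (2 * (C * japanese_mass R k))); first exact: (cmeas_cintegral mQ).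
    by move=> y; exact: (fubini_inner_decay mQ bQ).
  apply: eq_cintegral => y; rewrite /weyl_kernel -(mulrA c0); congr (_ * _).
  rewrite mulrC -cintegralZ.
    by apply: eq_cintegral => t; rewrite /Q /F /X /Y /T ?row_mxKr ?row_mxKl ?row_mxKr ?row_mxKl mulrCA [atom _ _ _ _ * _]mulrC.
  have [D HD] := schwartz_bound (k + k) sb.
  apply: (@cintegrable_decay _ _ _ D) => [|t]; first by meas.
  rewrite Normc.normcM normc_expi mul1r; apply: le_trans (HD (row_mx (2^-1 *: (x + y)) t)).
  by rewrite ler_wpM2r ?normc_ge0 // lerXn2r ?nnegrE ?japanese_ge0 //; exact: japanese_rowr.
by rewrite e; apply: schwartzM; [exact: multiplier_cst|exact: schwartz_integrate].
Qed.

Lemma cmeas_weyl_atom d (T : measurableType d) b (X : T -> 'rV[R]_k) (Z : T -> 'rV[R]_(k + k)) :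
  is_schwartz b -> measurable_fun setT X -> measurable_fun setT Z ->
  cmeas (fun t => weyl_atom b (X t) (Z t)).
Proof.
move=> sb mX mZ; have mg := schwartz_cmeas (schwartz_gauss_window R k).
have h : cmeas (fun v : 'rV[R]_(k + (k + k)) => weyl_atom b (lsubmx v) (rsubmx v)).
  apply: (cmeas_cintegral (f := fun (v : 'rV[R]_(k + (k + k))) (y : 'rV[R]_k) =>
    weyl_kernel b (lsubmx v) y * atom g (lsubmx (rsubmx v)) (rsubmx (rsubmx v)) y)).
  by apply: cmeasM; [apply: cmeas_weyl_kernel => //; meas|apply: cmeas_atom => //; meas].
have e : (fun t => weyl_atom b (X t) (Z t)) =
    (fun t => (fun v : 'rV[R]_(k + (k + k)) => weyl_atom b (lsubmx v) (rsubmx v)) (row_mx (X t) (Z t))).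
  by apply/funext => t; rewrite row_mxKl row_mxKr.
by rewrite e; apply: (cmeas_comp h); meas.
Qed.

Lemma cmeas_weyl_matrix d (T : measurableType d) b (W Z : T -> 'rV[R]_(k + k)) :
  is_schwartz b -> measurable_fun setT W -> measurable_fun setT Z ->
  cmeas (fun t => weyl_matrix b (W t) (Z t)).
Proof.
move=> sb mW mZ; have mg := schwartz_cmeas (schwartz_gauss_window R k).
have h : cmeas (fun v : 'rV[R]_((k + k) + (k + k)) => weyl_matrix b (lsubmx v) (rsubmx v)).
  apply: (cmeas_cintegral (f := fun (v : 'rV[R]_((k + k) + (k + k))) (x : 'rV[R]_k) =>
    weyl_atom b x (rsubmx v) * atom g (lsubmx (lsubmx v)) (rsubmx (lsubmx v)) x)).
  by apply: cmeasM; [apply: cmeas_weyl_atom => //; meas|apply: cmeas_atom => //; meas].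
have e : (fun t => weyl_matrix b (W t) (Z t)) =
    (fun t => (fun v : 'rV[R]_((k + k) + (k + k)) => weyl_matrix b (lsubmx v) (rsubmx v)) (row_mx (W t) (Z t))).
  by apply/funext => t; rewrite row_mxKl row_mxKr.
by rewrite e; apply: (cmeas_comp h); meas.
Qed.

Lemma weyl_atom_inversion b x z : is_schwartz b ->
  cintegral (fun w => weyl_matrix b w z * atom g (lsubmx w) (- rsubmx w) x) = (atom_const R k)%:C * weyl_atom b x z.
Proof.
move=> sb; have sg := schwartz_gauss_window R k.
have := stft_inversion x sg sg (schwartz_weyl_atom z sb).
by rewrite pairing_gauss_window -rmorphM => <-.
Qed.

Lemma japanese_offdiag w z :
  jb (row_mx (rsubmx z + rsubmx w) (lsubmx w - lsubmx z)) = jb (flip w - z).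
Proof.
have e : flip w - z = row_mx (lsubmx w - lsubmx z) (- (rsubmx z + rsubmx w)).
  by rewrite -{1}(hsubmxK z) /flip opp_row_mx add_row_mx opprD [- rsubmx w + _]addrC.
rewrite e; apply/eqP; rewrite eq_le; apply/andP; split; apply: le_japanese;
  rewrite !dotv_row dotvNl dotvNr opprK; lra.
Qed.

Lemma weyl_matrix_center w z gam : flip w - gam =
  (row_mx (2^-1 *: (lsubmx z + lsubmx w)) (2^-1 *: (rsubmx z - rsubmx w)) - gam) + 2^-1 *: (flip w - z).
Proof.
have e : flip w - z = row_mx (lsubmx w - lsubmx z) (- rsubmx w - rsubmx z).
  by rewrite -{1}(hsubmxK z) /flip opp_row_mx add_row_mx.
rewrite e scale_row_mx addrAC add_row_mx; congr (_ - _); rewrite /flip.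
by congr row_mx; apply/rowP => i; rewrite !mxE; field.
Qed.

Lemma schwartz_shift chi gam : is_schwartz chi -> is_schwartz (fun rho => chi (rho - gam)).
Proof. exact: schwartz_translate. Qed.

(** The matrix of the operator localized at gam is concentrated at gam and
    near the diagonal, uniformly in gam. *)
Lemma weyl_matrix_bound n chi : is_schwartz chi -> exists2 C, 0 <= C & forall gam w z,
  jb (flip w - gam) ^+ n * jb (flip w - z) ^+ n * N (weyl_matrix (fun rho => chi (rho - gam)) w z) <= C.
Proof.
move=> sc; have [C [q [C0 H]]] := stft_bound (n + n) (schwartz_window_decay n (schwartz_pair_window R k)).
pose K := N c0 * N (gauss_mass k 2^-1 : R)%:C; have K0 : 0 <= K by rewrite mulr_ge0 ?normc_ge0.
exists (2 ^+ n * K * (C * schwartz_norm q chi)).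
  exact: mulr_ge0 (mulr_ge0 (exprn_ge0 n (ler0n R 2)) K0) (mulr_ge0 C0 (schwartz_norm_ge0 q sc)).
move=> gam w z; rewrite weyl_matrixE; last exact: schwartz_shift.
set Y0 := row_mx (2^-1 *: _) _; set Z0 := row_mx (rsubmx z + _) _.
have e : N (stft (pair_window (R := R) (k := k)) (fun rho => chi (rho - gam)) Y0 Z0) = N (stft (pair_window (R := R) (k := k)) chi (Y0 - gam) Z0).
  rewrite /stft -(cintegral_translate gam (f := fun x => chi (x - gam) * atom (pair_window (R := R) (k := k)) Y0 Z0 x)); last first.
    by apply/schwartz_cmeas/schwartz_mul_atom; [exact/schwartz_multiplier/schwartz_pair_window|exact: schwartz_shift].
  rewrite -[RHS]mul1r -(normc_expi (dotv gam Z0)) -Normc.normcM -cintegralZ.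
    congr N; apply: eq_cintegral => x; rewrite addrK /atom dotvDl expiD opprB addrA; ring.
  by apply/schwartz_cintegrable/schwartz_mul_atom => //; exact/schwartz_multiplier/schwartz_pair_window.
rewrite !Normc.normcM e normc_expi mulr1 -/K; set V := N (stft _ _ _ _).
have V0 : 0 <= V by exact: normc_ge0.
have := H chi (Y0 - gam) Z0 sc; rewrite -/V (japanese_offdiag w z) exprD => h.
have h2 : jb (flip w - gam) ^+ n <= 2 ^+ n * jb (Y0 - gam) ^+ n * jb (flip w - z) ^+ n.
  apply: expr_le_mul3; first exact: japanese_ge0.
  rewrite (weyl_matrix_center w z gam) -/Y0; apply: (le_trans (japaneseD _ _)).
  by apply: ler_wpM2l; [exact: mulr_ge0 (ler0n R 2) (japanese_ge0 _)|exact: japanese_half].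
exact: (ler_mul_diagonal (exprn_ge0 n (ler0n R 2)) (japaneseX_ge0 _ _) K0 V0 h2 h).
Qed.

(** Applied to an atom, the operator localized at gam gives a function
    concentrated over gam, small if the atom is far from gam. *)
Lemma weyl_atom_bound n chi : is_schwartz chi -> exists2 C, 0 <= C & forall gam x z,
  jb (z - gam) ^+ n * jb (x - lsubmx gam) ^+ n * N (weyl_atom (fun rho => chi (rho - gam)) x z) <= C.
Proof.
move=> sc; set d := (k + k + (k + k))%N.
have [C C0 H] := weyl_matrix_bound (n + n + d) sc.
have [D HD] := gauss_decay k n (ltr01 : 0 < 1 :> R).
have D0 : 0 <= D by apply: le_trans (HD 0); rewrite mulr_ge0 ?gauss_ge0 ?japaneseX_ge0.
have i0 := atom_const_gt0 R k.
exists ((atom_const R k)^-1 * (2 * (2 ^+ n * 2 ^+ n * C * D * japanese_mass R (k + k)))).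
  by rewrite !mulr_ge0 ?exprn_ge0 ?japanese_mass_ge0 // invr_ge0 ltW.
move=> gam x z; have sb := schwartz_shift gam sc; set b := fun rho => chi (rho - gam).
set A := jb (z - gam) ^+ n; set B := jb (x - lsubmx gam) ^+ n.
have A0 : 0 <= A by exact: japaneseX_ge0. have B0 : 0 <= B by exact: japaneseX_ge0.
have -> : N (weyl_atom b x z) = (atom_const R k)^-1 * N ((atom_const R k)%:C * weyl_atom b x z).
  by rewrite Normc.normcM normcR gtr0_norm // mulrA mulVf ?mul1r ?gt_eqF.
rewrite mulrCA ler_wpM2l ?invr_ge0 ?(ltW i0) // -weyl_atom_inversion //.
pose f w := weyl_matrix b w z * atom g (lsubmx w) (- rsubmx w) x.
have mf : cmeas f.
  apply: cmeasM; first by apply: cmeas_weyl_matrix => //; meas.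
  by apply: cmeas_atom; [exact/schwartz_cmeas/schwartz_gauss_window|meas|meas|meas].
rewrite -(cintegral_translate (flip gam) mf) -[A * B]ger0_norm ?mulr_ge0 // -normcR -Normc.normcM.
have If : cintegrable (fun w => f (w + flip gam)).
  apply: (@cintegrable_decay _ _ _ C); first by apply: (cmeas_comp mf); meas.
  move=> w; have := H gam (w + flip gam) z; rewrite flipD flipK addrK japanese_flip.
  rewrite -/d Normc.normcM normc_atom => h; apply: le_trans h.
  have n1 : N (g (x - lsubmx (w + flip gam))) <= 1 by rewrite normcR ger0_norm ?gauss_ge0 // gauss_le1.
  rewrite -[leRHS]mulr1 mulrA; apply: ler_pM => //; rewrite ?mulr_ge0 ?normc_ge0 ?japaneseX_ge0 //.
  rewrite ler_wpM2r ?normc_ge0 // -[leLHS]mulr1; apply: ler_pM; rewrite ?japaneseX_ge0 ?japaneseX_ge1 //.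
  by rewrite japanese_leX // leq_addl.
rewrite -cintegralZ //; apply: cintegral_decay => [|w].
  by apply: cmeasM; [exact: cmeas_cst|apply: (cmeas_comp mf); meas].
rewrite Normc.normcM normcR ger0_norm ?mulr_ge0 // /f Normc.normcM normc_atom.
have := H gam (w + flip gam) z; set u := w + flip gam; rewrite flipD flipK addrK japanese_flip.
set M := N (weyl_matrix _ _ _); have M0 : 0 <= M by exact: normc_ge0.
have ng : N (g (x - lsubmx u)) = gauss 1 (x - lsubmx u) by rewrite normcR ger0_norm ?gauss_ge0.
rewrite ng; have := HD (x - lsubmx u); have := gauss_ge0 1 (x - lsubmx u).
move: (gauss 1 (x - lsubmx u)) => G G0 hG h.
set W := jb w; have W1 : 1 <= W by exact: japanese_ge1.
have eflip : flip w + gam - z = flip u - z by rewrite /u flipD flipK.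
rewrite eflip in h.
have hA : A <= 2 ^+ n * jb (flip u - z) ^+ n * W ^+ n.
  apply: expr_le_mul3; rewrite ?japanese_ge0 // /W.
  rewrite (_ : z - gam = - (flip u - z) + (flip u - gam)); last by rewrite opprB addrA subrK.
  apply: (le_trans (japaneseD _ _)); rewrite japaneseN /u flipD flipK addrK japanese_flip //.
have hB : B <= 2 ^+ n * jb (x - lsubmx u) ^+ n * W ^+ n.
  apply: expr_le_mul3; rewrite ?japanese_ge0 // /W.
  have -> : x - lsubmx gam = (x - lsubmx u) + lsubmx w.
    by rewrite /u linearD /= /flip row_mxKl opprD addrA addrAC subrK.
  apply: (le_trans (japaneseD _ _)); rewrite ler_wpM2l ?mulr_ge0 ?japanese_ge0 //.
  exact: japanese_lsubmx.
have e1 : jb (flip u - z) ^+ n <= jb (flip u - z) ^+ (n + n + d).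
  by rewrite japanese_leX // -addnA leq_addr.
move: (japaneseX_ge0 (flip u - z) n) (japaneseX_ge0 (x - lsubmx u) n) e1 h hA hB hG.
move: (jb (flip u - z) ^+ n) (jb (flip u - z) ^+ (n + n + d)) (jb (x - lsubmx u) ^+ n) => Z Z' X Z0 X0 ZZ h hA hB hG.
have W0 m : 0 <= W ^+ m by rewrite exprn_ge0 // (le_trans ler01).
apply: (@le_trans _ _ (W ^+ d * ((2 ^+ n * Z * W ^+ n) * (2 ^+ n * X * W ^+ n) * (M * G)))).
  rewrite ler_wpM2l // ler_wpM2r ?mulr_ge0 //; apply: ler_pM => //.
rewrite [leLHS](_ : _ = 2 ^+ n * 2 ^+ n * ((W ^+ n * W ^+ n * W ^+ d) * Z * M) * (X * G)); last by ring.
have c2 : 0 <= 2 ^+ n * 2 ^+ n :> R by rewrite mulr_ge0 ?exprn_ge0.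
have w3 : 0 <= W ^+ n * W ^+ n * W ^+ d * Z * M by rewrite !mulr_ge0.
apply: ler_pM hG; [exact: mulr_ge0|exact: mulr_ge0|].
apply: ler_wpM2l => //; apply: le_trans h; rewrite -!exprD.
by apply: ler_wpM2r => //; apply: ler_wpM2l.
Qed.

Lemma weyl_atom_bound0 n b : is_schwartz b -> exists2 C, 0 <= C & forall x z,
  jb z ^+ n * jb x ^+ n * N (weyl_atom b x z) <= C.
Proof.
move=> sb; have [C C0 H] := weyl_atom_bound n sb; exists C => // x z.
have l0 : lsubmx (0 : 'rV[R]_(k + k)) = 0 by exact: linear0.
have := H 0 x z; rewrite l0 !subr0 (_ : (fun rho => b (rho - 0)) = b) //.
by apply/funext => rho; rewrite subr0.
Qed.

(** The coefficients of a are tested against the transform of the kernel, which is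
    the operator applied to atoms. *)
Lemma weyl_quant_coef b a x : is_schwartz b -> tempered a ->
  (atom_const R k)%:C * weyl_quant b a x = cintegral (fun z => weyl_atom b x z * coef a z).
Proof. by move=> sb ta; rewrite -(tempered_coef ta (schwartz_weyl_kernel x sb)). Qed.

Lemma cmeas_weyl_quant b a : is_schwartz b -> tempered a -> cmeas (weyl_quant b a).
Proof.
move=> sb ta; have i0 := atom_const_gt0 R k.
have -> : weyl_quant b a = fun x => ((atom_const R k)^-1)%:C * cintegral (fun z => weyl_atom b x z * coef a z).
  by apply/funext => x; rewrite -weyl_quant_coef // mulrA -rmorphM mulVf ?gt_eqF // mul1r.
apply: cmeasM; first exact: cmeas_cst.
apply: (cmeas_cintegral (f := fun x z => weyl_atom b x z * coef a z)); apply: cmeasM.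
  by apply: cmeas_weyl_atom => //; meas.
by apply: (cmeas_comp (cmeas_coef ta)); meas.
Qed.

Lemma weyl_quant_atom b a w : is_schwartz b -> tempered a ->
  (atom_const R k)%:C * cintegral (fun x => weyl_quant b a x * atom g (lsubmx w) (rsubmx w) x) =
  cintegral (fun z => weyl_matrix b w z * coef a z).
Proof.
move=> sb ta; have sg := schwartz_gauss_window R k.
have [C1 [m [C10 H1]]] := coef_pbound ta.
set d := (k + k + (k + k))%N; have [C C0 H] := weyl_atom_bound0 (d + m) sb.
pose f x z := weyl_atom b x z * coef a z * atom g (lsubmx w) (rsubmx w) x.
have mf : cmeas (fun v : 'rV[R]_(k + (k + k)) => f (lsubmx v) (rsubmx v)).
  apply: cmeasM; last by apply: cmeas_atom; [exact: schwartz_cmeas|meas|meas|meas].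
  apply: cmeasM; first by apply: cmeas_weyl_atom => //; meas.
  by apply: (cmeas_comp (cmeas_coef ta)); meas.
have bf x z : jb x ^+ (k + k) * jb z ^+ (k + k + (k + k)) * N (f x z) <= C * C1.
  have := H x z; have := H1 z; rewrite /f (Normc.normcM (weyl_atom b x z * _)) (Normc.normcM (weyl_atom b x z)) normc_atom.
  have n1 : N (g (x - lsubmx w)) <= 1 by rewrite normcR ger0_norm ?gauss_ge0 // gauss_le1.
  have x1 : jb x ^+ (k + k) <= jb x ^+ (d + m) by rewrite japanese_leX //; exact: leq_trans (leq_addr _ _) (leq_addr _ _).
  rewrite -/d; move: (normc_ge0 (weyl_atom b x z)) (normc_ge0 (coef a z)) (normc_ge0 (g (x - lsubmx w))).
  move: (N _) (N _) (N _) n1 => A W G n1 W0 A0 G0 hA hW.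
  rewrite [X in X * _ * _ <= _]exprD in hW.
  move: (japaneseX_ge0 x (k + k)) (japaneseX_ge0 z d) (japaneseX_ge0 z m) x1 hA hW.
  move: (jb x ^+ (k + k)) (jb x ^+ (d + m)) (jb z ^+ d) (jb z ^+ m) => X X' Z Zm X0 Z0 Zm0 XX hA hW.
  apply: (@le_trans _ _ (X' * Z * (W * (C1 * Zm) * 1))).
    apply: ler_pM; rewrite ?mulr_ge0 //; first exact: ler_wpM2r.
    by apply: ler_pM => //; [exact: mulr_ge0|exact: (ler_wpM2l W0 hA)].
  by rewrite mulr1 (_ : _ * _ = Z * Zm * X' * W * C1) ?ler_wpM2r //; ring.
transitivity (cintegral (fun x => cintegral (f x))).
  have i0 := atom_const_gt0 R k.
  have mx x : cmeas (fun z => weyl_atom b x z * coef a z).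
    apply: cmeasM; first by apply: cmeas_weyl_atom => //; meas.
    exact: cmeas_coef.
  have e x : (atom_const R k)%:C * (weyl_quant b a x * atom g (lsubmx w) (rsubmx w) x) = cintegral (f x).
    rewrite mulrA weyl_quant_coef // mulrC -cintegralZ; first by apply: eq_cintegral => z; rewrite /f mulrC.
    apply: cintegrable_rdecay; [|exact: cmeas_coef| |by exists m, C1].
      by apply: cmeas_weyl_atom => //; meas.
    move=> q; have [C' C'0 H'] := weyl_atom_bound0 q sb; exists C' => z; apply: le_trans (H' x z).
    by rewrite ler_wpM2r ?normc_ge0 // ler_peMr ?japaneseX_ge0 ?japaneseX_ge1.
  have eI : (fun x => weyl_quant b a x * atom g (lsubmx w) (rsubmx w) x) =
      fun x => ((atom_const R k)^-1)%:C * cintegral (f x).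
    by apply/funext => x; rewrite -e mulrA -rmorphM mulVf ?gt_eqF // mul1r.
  rewrite -cintegralZ; first by apply: eq_cintegral.
  rewrite eI; apply: cintegrableZ.
  apply: (@cintegrable_decay _ _ _ (2 * (C * C1 * japanese_mass R (k + k)))); first exact: (cmeas_cintegral mf).
  by move=> x; exact: (fubini_inner_decay mf bf).
rewrite (cfubini_swap mf bf); apply: eq_cintegral => z; rewrite /weyl_matrix mulrC -cintegralZ.
  by apply: eq_cintegral => x; rewrite /f mulrAC mulrC.
apply/schwartz_cintegrable/schwartz_mul_atom; last exact: schwartz_weyl_atom.
exact: schwartz_multiplier.
Qed.

End kernel_bounds.

(** * Lattice sums *)
Section lattice_sums.
Variable R : realType.
Local Notation N := (@Normc.normc R).
Local Notation jb := (@japanese R _).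
Implicit Types k : nat.

Let u (s : R) : R := s / (1 + `|s|).

(** A summand with a bounded primitive s / (1 + |s|): the sums over translates of
    the integers are bounded uniformly in the translation. *)
Lemma inv_oneDsqr_telescope s : (1 + s ^+ 2)^-1 <= 4 * (u (s + 1) - u s).
Proof.
have q0 : 0 < 1 + s ^+ 2 by rewrite ltr_pwDl // sqr_ge0.
have main a b : 0 < a -> 0 < b -> a * b <= 4 * (1 + s ^+ 2) * (s + 1) * a - 4 * (1 + s ^+ 2) * s * b ->
    (1 + s ^+ 2)^-1 <= 4 * ((s + 1) / b - s / a).
  move=> a0 b0 h; rewrite -[X in X <= _]mul1r ler_pdivrMr //.
  rewrite (_ : _ * _ * _ = (4 * (1 + s ^+ 2) * (s + 1) * a - 4 * (1 + s ^+ 2) * s * b) / (a * b)); last first.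
    by field; rewrite !gt_eqF.
  by rewrite ler_pdivlMr ?mul1r // mulr_gt0.
rewrite /u; have [s0|s0] := leP 0 s.
  rewrite !ger0_norm ?addr_ge0 //; apply: main; rewrite ?ltr_pwDl ?addr_ge0 //.
  have := sqr_ge0 s; nra.
have [s1|s1] := leP (-1) s.
  rewrite (ltr0_norm s0) ger0_norm -?lerBlDr ?sub0r //; apply: main; [lra|lra|].
  have : 0 <= (1 + s) * (- s) by apply: mulr_ge0; lra.
  have := sqr_ge0 s; have := sqr_ge0 (s + 1); nra.
rewrite !ltr0_norm //; last lra.
apply: main; [lra|lra|]; have := sqr_ge0 s; nra.
Qed.

Lemma normr_u s : `|u s| <= 1.
Proof.
have p0 : 0 < 1 + `|s| by rewrite ltr_pwDl.
by rewrite /u normrM normfV (gtr0_norm p0) ler_pdivrMr // mul1r lerDr.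
Qed.

Lemma sum_inv_oneDsqr n (t : R) : \sum_(i < n) (1 + (t - i%:R) ^+ 2)^-1 <= 8.
Proof.
pose w i := u (i%:R - t).
apply: (@le_trans _ _ (\sum_(0 <= i < n) 4 * (w i.+1 - w i))).
  rewrite big_mkord; apply: ler_sum => i _.
  rewrite -sqrrN opprB; apply: le_trans (inv_oneDsqr_telescope _) _.
  by rewrite /w (_ : i.+1%:R - t = i%:R - t + 1) // -natr1; ring.
rewrite -mulr_sumr telescope_sumr //; have := normr_u (n%:R - t); have := normr_u (0%:R - t).
by rewrite -/(w n) -/(w 0%N) !ler_norml; lra.
Qed.

Lemma lattice_sum_unit k m (X : 'rV[R]_k) :
  \sum_(v <- box k m) (jb (X - map_mx intr v) ^- (k + k)) <= 8 ^+ k.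
Proof.
apply: (@le_trans _ _ (\sum_(v <- box k m) \prod_i (1 + (X ord0 i - (v ord0 i)%:~R) ^+ 2)^-1)).
  apply: ler_sum => v _; rewrite prodfV lef_pV2 ?posrE ?japaneseX_gt0 //; last first.
    by apply: prodr_gt0 => i _; rewrite ltr_pwDl // sqr_ge0.
  apply: le_trans (japanese_prod (X - map_mx intr v)).
  by rewrite le_eqVlt; apply/orP; left; apply/eqP/eq_bigr => i _; rewrite !mxE.
rewrite big_map big_enum /=.
rewrite [leLHS](_ : _ = \sum_(t : {ffun 'I_k -> 'I_(m + m).+1}) \prod_i (1 + (X ord0 i + m%:R - (t i)%:R) ^+ 2)^-1); last first.
  apply: eq_bigr => t _; apply: eq_bigr => i _; rewrite mxE.
  by congr ((1 + _ ^+ 2)^-1); rewrite rmorphB /= opprB addrA.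
rewrite -(bigA_distr_bigA (fun i (j : 'I_(m + m).+1) => (1 + (X ord0 i + m%:R - j%:R) ^+ 2)^-1)).
apply: (@le_trans _ _ (\prod_(i < k) 8)); last by rewrite prodr_const card_ord.
apply: ler_prod => i _; rewrite sum_inv_oneDsqr andbT.
by apply: sumr_ge0 => j _; rewrite invr_ge0 addr_ge0 // sqr_ge0.
Qed.

Definition latpt k (B : 'M[R]_k) (v : 'rV[int]_k) : 'rV[R]_k := map_mx intr v *m B.

(** The inverse of the basis matrix brings the lattice to the integers, where the
    sum over a box is dominated by a product of one-dimensional sums. *)
Lemma lattice_sum k (B : 'M[R]_k) : row_free B -> exists2 S, 0 <= S & forall m X,
  \sum_(v <- box k m) (jb (X - latpt B v) ^- (k + k)) <= S.
Proof.
move=> fB; have uB : B \in unitmx by rewrite -row_free_unit.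
have [C C0 H] : exists2 C, 0 < C & forall x, jb (x *m invmx B) <= C * jb x.
  by apply: affine_bound; exists (invmx B), 0 => x; rewrite addr0.
exists (C ^+ (k + k) * 8 ^+ k); first by rewrite mulr_ge0 ?exprn_ge0 // ltW.
move=> m X; apply: le_trans (_ : C ^+ (k + k) * \sum_(v <- box k m) (jb (X *m invmx B - map_mx intr v) ^- (k + k)) <= _); last first.
  by rewrite ler_wpM2l ?lattice_sum_unit // exprn_ge0 // ltW.
rewrite mulr_sumr; apply: ler_sum => v _.
have h := H (X - latpt B v); rewrite mulmxBl mulmxK // in h.
rewrite -ler_pdivrMl ?exprn_gt0 // -invfM lef_pV2 ?posrE ?mulr_gt0 ?exprn_gt0 ?japanese_gt0 //.
by rewrite -exprMn lerXn2r ?nnegrE ?mulr_ge0 ?japanese_ge0 // ltW.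
Qed.

Lemma latpt_inj k (B : 'M[R]_k) : row_free B -> injective (latpt B).
Proof.
move=> fB v w /(row_free_inj fB)/matrixP e; apply/rowP => i.
by have := e ord0 i; rewrite !mxE => /intr_inj.
Qed.

Lemma box_cover k (s : seq 'rV[int]_k) :
  exists j0, forall j, (j0 <= j)%N -> forall v, v \in s -> v \in box k j.
Proof.
exists (\sum_(v <- s) \sum_i absz (v ord0 i))%N => j hj v vs.
rewrite mem_box; apply/forallP => i.
have : (absz (v ord0 i) <= j)%N.
  apply: leq_trans hj; rewrite (big_rem v) //= (bigD1 i) //=; lia.
by rewrite -abszE lez_nat.
Qed.

(** Along cubes of indices, an unconditional sum over a lattice converges. *)
Lemma box_sum_cvg k (B : 'M[R]_k) (f : 'rV[R]_k -> R[i]) l : row_free B ->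
  has_sum [set v | exists z : 'rV[int]_k, v = map_mx intr z *m B] f l ->
  N (\sum_(v <- box k j) f (latpt B v) - l) @[j --> \oo] --> 0.
Proof.
move=> fB hs; apply/cvgrPdist_lt => e e0.
have [A [finA AG H]] := hs e e0.
have [s sA] : exists s : seq 'rV[int]_k, A `<=` [set` map (latpt B) s].
  move/finite_seqP : finA AG => [r ->] rG.
  have : forall g, g \in r -> exists z : 'rV[int]_k, g = latpt B z by move=> g gr; exact: (rG g gr).
  elim: r {rG} => [_|g r IH h]; first by exists [::].
  have [z ez] := h g (mem_head _ _).
  have [|s Hs] := IH; first by move=> g' g'r; apply: h; rewrite in_cons g'r orbT.
  exists (z :: s) => x /=; rewrite !in_cons => /orP[/eqP ->|xr]; first by rewrite ez eqxx.
  by apply/orP; right; exact: Hs.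
have [j0 Hj] := box_cover s.
near=> j; have jj : (j0 <= j)%N by near: j; exact: nbhs_infty_ge.
rewrite sub0r normrN ger0_norm ?normc_ge0 //.
have := H [set` map (latpt B) (box k j)]; rewrite -fsbig_seq; last first.
  by rewrite map_inj_uniq ?uniq_box //; exact: latpt_inj.
rewrite big_map; apply.
- exact: finite_seq.
- move=> x /sA /= /mapP[v vs ->]; apply: map_f; exact: Hj.
- by move=> x /= /mapP[v _ ->]; exists v.
Unshelve. all: by end_near. Qed.

End lattice_sums.

(** * Square integrable functions against atoms *)
Section L2.
Variable R : realType.
Local Notation N := (@Normc.normc R).
Local Notation jb := (@japanese R _).
Implicit Types k : nat.

Lemma L2norm_sqr k (f : 'rV[R]_k -> R[i]) :
  (L2norm f `^ 2 = \int[lebesgue_rV R k]_x ((N (f x)) ^+ 2)%:E)%E.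
Proof.
rewrite /L2norm poweR_Lnorm ?pnatr_eq0 //; apply: eq_integral => x _.
by rewrite gee0_abs ?lee_fin ?normc_ge0 // poweR_EFin powR_mulrn ?normc_ge0.
Qed.

Lemma L2norm_le k (f : 'rV[R]_k -> R[i]) A : 0 <= A ->
  (\int[lebesgue_rV R k]_x ((N (f x)) ^+ 2)%:E <= (A ^+ 2)%:E)%E -> (L2norm f <= A%:E)%E.
Proof.
move=> A0; rewrite -L2norm_sqr => h.
have sq (x : \bar R) : (0 <= x -> (x `^ 2) `^ 2^-1 = x)%E.
  by move=> x0; rewrite -poweRrM mulfV ?pnatr_eq0 // poweRe1.
have L0 : (0 <= L2norm f)%E by exact: Lnorm_ge0.
rewrite -(sq _ L0) -(sq A%:E) ?lee_fin //.
apply: gt0_ler_poweR; rewrite ?in_itv /= ?leey ?andbT ?poweR_ge0 ?invr_ge0 //.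
  by rewrite lee_fin powR_ge0.
by rewrite powR_mulrn.
Qed.

Lemma L2norm_ge k (f : 'rV[R]_k -> R[i]) A : 0 <= A -> (L2norm f <= A%:E)%E ->
  (\int[lebesgue_rV R k]_x ((N (f x)) ^+ 2)%:E <= (A ^+ 2)%:E)%E.
Proof.
move=> A0 h; rewrite -L2norm_sqr.
have -> : (A ^+ 2)%:E = (A%:E `^ 2)%E by rewrite poweR_EFin powR_mulrn.
by apply: gt0_ler_poweR => //; rewrite in_itv /= ?leey ?andbT ?lee_fin // Lnorm_ge0.
Qed.

(** Young's inequality |f| h <= (|f|^2 / A + A h^2) / 2 with A the norm. *)
Lemma L2norm_atom k : exists2 C, 0 <= C & forall (f : 'rV[R]_k -> R[i]) A p xi,
  cmeas f -> 0 < A -> (L2norm f <= A%:E)%E ->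
  N (cintegral (fun x => f x * atom (@gauss_window R k) p xi x)) <= C * A.
Proof.
have [D HD] := gauss_decay k (k + k) (ltr0n R 2 : 0 < 2%:R).
have D0 : 0 <= D by apply: le_trans (HD 0); rewrite mulr_ge0 ?gauss_ge0 ?japaneseX_ge0.
exists (1 + D * japanese_mass R k); first by rewrite addr_ge0 ?mulr_ge0 ?japanese_mass_ge0.
move=> f A p xi mf A0 hf.
pose h1 x := (2 * A)^-1 * N (f x) ^+ 2; pose h2 x := A / 2 * gauss 2 (x - p).
rewrite (_ : (1 + _) * A = 2 * ((2 * A)^-1 * A ^+ 2 + A / 2 * (D * japanese_mass R k))); last by field; rewrite gt_eqF.
have mh1 : measurable_fun setT h1 by rewrite /h1; meas.
have mh2 : measurable_fun setT h2 by rewrite /h2; meas.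
have c1 : 0 <= (2 * A)^-1 by rewrite invr_ge0 mulr_ge0 // ltW.
have c2 : 0 <= A / 2 by rewrite divr_ge0 // ltW.
apply: (@normc_cintegral_le _ _ _ (fun x => h1 x + h2 x)).
- by apply: cmeasM => //; apply: cmeas_atom; [exact/schwartz_cmeas/schwartz_gauss_window|meas|meas|meas].
- move=> x; rewrite Normc.normcM normc_atom /gauss_window normcR ger0_norm ?gauss_ge0 // /h1 /h2.
  have -> : gauss 2 (x - p) = gauss 1 (x - p) ^+ 2.
    by rewrite /gauss expr2 -expRD; congr expR; ring.
  move: (N (f x)) (gauss 1 (x - p)) => a b.
  rewrite -subr_ge0 (_ : _ - _ = (2 * A)^-1 * (a - A * b) ^+ 2); last by field; rewrite gt_eqF.
  by rewrite mulr_ge0 ?sqr_ge0.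
- under eq_integral do rewrite EFinD.
  rewrite ge0_integralD //=; last 4 first.
  + by move=> x _; rewrite lee_fin mulr_ge0 // sqr_ge0.
  + exact/measurable_EFinP.
  + by move=> x _; rewrite lee_fin mulr_ge0 // gauss_ge0.
  + exact/measurable_EFinP.
  rewrite EFinD; apply: leeD.
    rewrite /h1; under eq_integral do rewrite EFinM.
    rewrite ge0_integralZl_EFin //=.
    - by rewrite [X in (_ <= X)%E]EFinM lee_wpmul2l ?lee_fin // L2norm_ge // ltW.
    - by move=> x _; rewrite lee_fin sqr_ge0.
    - by apply/measurable_EFinP; meas.
  rewrite /h2; under eq_integral do rewrite EFinM.
  rewrite ge0_integralZl_EFin //=.
  - rewrite [X in (_ <= X)%E]EFinM lee_wpmul2l ?lee_fin //.
    rewrite (integral_rV_translate (- p) (f := fun x => (gauss 2 x)%:E)); last 2 first.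
    + by apply/measurable_EFinP; meas.
    + by move=> x; rewrite lee_fin gauss_ge0.
    by apply: integral_decay_le => x; [exact: gauss_ge0|exact: HD].
  - by move=> x _; rewrite lee_fin gauss_ge0.
  - by apply/measurable_EFinP; meas.
Qed.

End L2.

(** * Coefficients of elements of the symbol space *)
Section coef_estimate.
Variable R : realType.
Local Notation N := (@Normc.normc R).
Local Notation jb := (@japanese R _).
Lemma measurable_japaneseVX d' (T : measurableType d') l q (h : T -> 'rV[R]_l) : measurable_fun setT h ->
  measurable_fun setT (fun z => jb (h z) ^- q).
Proof.
move=> mh; have -> : (fun z => jb (h z) ^- q) = fun z => jb (h z) `^ (- q%:R).
  by apply/funext => z; rewrite powRN powR_mulrn ?japanese_ge0.
by apply: (measurableT_comp (measurable_powR _)); meas.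
Qed.

Variables (k : nat) (B : 'M[R]_(k + k)) (chi : 'rV[R]_(k + k) -> R[i]).
Hypothesis B_free : row_free B.
Hypothesis chi_schwartz : is_schwartz chi.
Hypothesis chi_sum : forall rho,
  has_sum [set v | exists z : 'rV[int]_(k + k), v = map_mx intr z *m B]
    (fun g => chi (rho - g)) 1.
Local Notation g := (@gauss_window R k).
Local Notation c0 := (((2 * pi : R) ^- k)%:C).
Local Notation d := (k + k + (k + k))%N.
Local Notation chiv v := (fun rho => chi (rho - latpt B v)).

Let schwartz_chiv v : is_schwartz (chiv v).
Proof. exact: schwartz_shift. Qed.

(** The decomposition of unity, seen by the operators: the localized operators
    add up to a multiple of the identity. *)
Lemma stft_pair_window_one (w z : 'rV[R]_(k + k)) :
  weyl_phase w z * stft (pair_window (R := R) (k := k)) (fun=> 1)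
    (row_mx (2^-1 *: (lsubmx z + lsubmx w)) (2^-1 *: (rsubmx z - rsubmx w)))
    (row_mx (rsubmx z + rsubmx w) (lsubmx w - lsubmx z)) =
  (gauss_mass k 2^-1)%:C * stftz g (atom g (lsubmx w) (rsubmx w)) z.
Proof.
set p := lsubmx z; set xi := rsubmx z; set p' := lsubmx w; set xi' := rsubmx w.
set P := 2^-1 *: (p + p'); set Xi := 2^-1 *: (xi - xi').
pose f (X : 'rV[R]_k) := expi (dotv X (xi + xi')) * (gauss 2 (X - P))%:C.
pose h (t : 'rV[R]_k) := expi (dotv t (p' - p)) * (gauss 2^-1 (t - Xi))%:C.
have h2p : 0 < 2^-1 :> R by rewrite invr_gt0.
have s2 : is_schwartz (fun x : 'rV[R]_k => (gauss 2 x)%:C) by exact: schwartz_gauss.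
have s2' : is_schwartz (fun x : 'rV[R]_k => (gauss 2^-1 x)%:C) by exact: schwartz_gauss.
have sf : is_schwartz f by apply: schwartz_character; exact: (schwartz_translate (- P) s2).
have sh : is_schwartz h by apply: schwartz_character; exact: (schwartz_translate (- Xi) s2').
have [C1 H1] := schwartz_bound (k + k) sf; have [C2 H2] := schwartz_bound (k + k) sh.
have -> : stft (pair_window (R := R) (k := k)) (fun=> 1) (row_mx P Xi) (row_mx (xi + xi') (p' - p)) =
    cintegral f * cintegral h.
  transitivity (cintegral (fun Y : 'rV[R]_(k + k) => f (lsubmx Y) * h (rsubmx Y))).
    apply: eq_cintegral => Y; rewrite mul1r /atom /pair_window /f /h dotv_split !row_mxKl !row_mxKr.
    have -> : lsubmx (Y - row_mx P Xi) = lsubmx Y - P by rewrite linearB /= row_mxKl.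
    have -> : rsubmx (Y - row_mx P Xi) = rsubmx Y - Xi by rewrite linearB /= row_mxKr.
    by rewrite expiD mulrACA.
  rewrite (@cfubini _ _ _ (fun x t => f x * h t) (C1 * C2)).
  - rewrite mulrC -cintegralZ; last exact: schwartz_cintegrable.
    apply: eq_cintegral => x; rewrite cintegralZ 1?mulrC //; exact: schwartz_cintegrable.
  - apply: cmeasM; first by apply: (cmeas_comp (schwartz_cmeas sf)); exact: (measurable_lsubmx (f := id)).
    by apply: (cmeas_comp (schwartz_cmeas sh)); exact: (measurable_rsubmx (f := id)).
  - move=> x t; rewrite (Normc.normcM (f x)) mulrACA; apply: ler_pM (H1 x) (H2 t);
      exact: mulr_ge0 (japaneseX_ge0 _ _) (normc_ge0 _).
transitivity (weyl_phase w z * (cintegral f *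
    ((gauss_mass k 2^-1)%:C * (expi (dotv Xi (p' - p)) * (gauss 2^-1 (p' - p))%:C)))).
  by congr (_ * (_ * _)); rewrite fourier_gauss_shift // (_ : (4 * 2^-1)^-1 = 2^-1); last by field.
have -> : stftz g (atom g p' xi') z = (gauss 2^-1 (p' - p))%:C * cintegral f.
  rewrite -cintegralZ; last exact: schwartz_cintegrable.
  apply: eq_cintegral => x; rewrite /atom /gauss_window -/p -/xi /f.
  have gp := gauss_parallelogram (x - p') (x - p).
  have e1 : 2^-1 *: (x - p' + (x - p)) = x - P by apply/rowP => i; rewrite !mxE; field.
  have e2 : x - p - (x - p') = p' - p by rewrite opprB addrC addrA subrK.
  rewrite e1 e2 in gp.
  transitivity (expi (dotv x xi') * expi (dotv x xi) * ((gauss 1 (x - p'))%:C * (gauss 1 (x - p))%:C)); first by rewrite mulrACA.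
  rewrite -[X in _ * X]rmorphM gp rmorphM -expiD -dotvDr [xi' + xi]addrC.
  by rewrite [RHS]mulrCA [X in _ * X = _]mulrC.
rewrite /weyl_phase -/p -/p' -/xi -/xi' -/Xi (dotvC Xi).
by apply: mulc_cancel; exact: expiN.
Qed.

Lemma sum_chi_bound n : exists2 C, 0 <= C & forall m (Y : 'rV[R]_(k + k)),
  \sum_(v <- box (k + k) m) (jb (Y - latpt B v) ^- (d + n)) <= C.
Proof.
have [S S0 HS] := lattice_sum B_free; exists S => // m Y; apply: le_trans (HS m Y).
apply: ler_sum => v _; rewrite lef_pV2 ?posrE ?japaneseX_gt0 //.
by rewrite japanese_leX // leq_addr.
Qed.

(** The matrix is linear in the symbol, by weyl_matrixE; the sums of the symbols
    stay bounded by lattice_sum, so dominated convergence applies. *)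
Lemma weyl_matrix_sum_cvg (w z : 'rV[R]_(k + k)) :
  N (\sum_(v <- box (k + k) j) weyl_matrix (chiv v) w z -
     c0 * (gauss_mass k 2^-1 ^+ 2)%:C * stftz g (atom g (lsubmx w) (rsubmx w)) z) @[j --> \oo] --> 0.
Proof.
have sH := schwartz_pair_window R k.
set Y0 := row_mx (2^-1 *: (lsubmx z + lsubmx w)) (2^-1 *: (rsubmx z - rsubmx w)).
set Z0 := row_mx (rsubmx z + rsubmx w) (lsubmx w - lsubmx z).
pose F j Y := (\sum_(v <- box (k + k) j) chi (Y - latpt B v)) * atom (pair_window (R := R) (k := k)) Y0 Z0 Y.
have sA := schwartz_atom Y0 Z0 sH.
have [S S0 HS] := sum_chi_bound 0; rewrite addn0 in HS.
have [C HC] := schwartz_bound d chi_schwartz.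
have C0 : 0 <= C by apply: le_trans (HC 0); rewrite mulr_ge0 ?normc_ge0 ?japaneseX_ge0.
have bF j Y : N (F j Y) <= C * S * N (atom (pair_window (R := R) (k := k)) Y0 Z0 Y).
  rewrite Normc.normcM ler_wpM2r ?normc_ge0 //; apply: (le_trans (normc_sum _ _ _)).
  apply: le_trans (ler_wpM2l C0 (HS j Y)); rewrite mulr_sumr; apply: ler_sum => v _.
  by rewrite ler_pdivlMr ?japaneseX_gt0 // mulrC.
have mF j : cmeas (F j).
  apply: cmeasM; last exact: schwartz_cmeas.
  by apply: cmeas_sum => v; apply: (schwartz_cmeas (schwartz_chiv v)).
have mA : measurable_fun setT (fun Y => C * S * N (atom (pair_window (R := R) (k := k)) Y0 Z0 Y)).
  by have mA := schwartz_cmeas sA; meas.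
have IA : (\int[lebesgue_rV R (k + k)]_Y (C * S * N (atom (pair_window (R := R) (k := k)) Y0 Z0 Y))%:E < +oo)%E.
  have [D HD] := schwartz_bound d sA.
  apply: (@le_lt_trans _ _ (C * S * D * japanese_mass R (k + k))%:E); last exact: ltry.
  apply: integral_decay_le => Y; first by rewrite !mulr_ge0 ?normc_ge0.
  by rewrite mulrCA ler_wpM2l ?mulr_ge0.
have h := cintegral_dominated mF (schwartz_cmeas sA) bF mA IA.
have cvgF : N (cintegral (F j) - cintegral (atom (pair_window (R := R) (k := k)) Y0 Z0)) @[j --> \oo] --> 0.
  apply: h => Y.
  have -> : (fun j => N (F j Y - atom (pair_window (R := R) (k := k)) Y0 Z0 Y)) =
     (fun j => N (\sum_(v <- box (k + k) j) chi (Y - latpt B v) - 1) * N (atom (pair_window (R := R) (k := k)) Y0 Z0 Y)).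
    by apply/funext => j; rewrite -Normc.normcM mulrBl mul1r.
  rewrite -[X in _ --> X](mul0r (N (atom (pair_window (R := R) (k := k)) Y0 Z0 Y))).
  by apply: cvgMl; exact: (box_sum_cvg B_free (chi_sum Y)).
pose K := c0 * (gauss_mass k 2^-1)%:C * weyl_phase w z.
have -> : (fun j => N (\sum_(v <- box (k + k) j) weyl_matrix (chiv v) w z -
     c0 * (gauss_mass k 2^-1 ^+ 2)%:C * stftz g (atom g (lsubmx w) (rsubmx w)) z)) =
   (fun j => N K * N (cintegral (F j) - cintegral (atom (pair_window (R := R) (k := k)) Y0 Z0))).
  apply/funext => j; rewrite -Normc.normcM mulrBr; congr (N (_ - _)).
    rewrite /F; transitivity (K * \sum_(v <- box (k + k) j) stft (pair_window (R := R) (k := k)) (chiv v) Y0 Z0).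
      by rewrite mulr_sumr; apply: eq_bigr => v _; rewrite weyl_matrixE.
    congr (_ * _); rewrite /stft -cintegral_sum.
      by apply: eq_cintegral => Y; rewrite mulr_suml.
    by move=> v; apply/schwartz_cintegrable/schwartz_mul.
  have := stft_pair_window_one w z; rewrite -/Y0 -/Z0 /stft.
  under eq_cintegral do rewrite mul1r.
  rewrite /K -(mulrA _ (weyl_phase w z)) => ->; rewrite expr2 rmorphM; ring.
rewrite -[X in _ --> X](mulr0 (N K)); exact: cvgMr.
Qed.

Definition unity_const : R[i] := c0 * (gauss_mass k 2^-1 ^+ 2)%:C.

Lemma unity_const_neq0 : 0 < N unity_const.
Proof.
apply: normc_gt0; rewrite /unity_const mulf_neq0 //.
  rewrite (_ : (0 : R[i]) = 0%:C) // (inj_eq (@complexI R)) invr_eq0 expf_neq0 // mulf_neq0 //.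
  by rewrite gt_eqF // pi_gt0.
by rewrite (_ : (0 : R[i]) = 0%:C) // (inj_eq (@complexI R)) expf_neq0 // gt_eqF // gauss_mass_gt0 // invr_gt0.
Qed.

Definition local_coef a v w := cintegral (fun x => weyl_quant (chiv v) a x * atom g (lsubmx w) (rsubmx w) x).

Lemma cintegrable_weyl_matrix_coef a v w : tempered a -> cintegrable (fun z => weyl_matrix (chiv v) w z * coef a z).
Proof.
move=> ta; have [C1 [m [C10 H1]]] := coef_pbound ta.
apply: cintegrable_rdecay; [by apply: cmeas_weyl_matrix => //; meas|exact: cmeas_coef| |by exists m, C1].
move=> n; have [C C0 H] := weyl_matrix_bound n chi_schwartz; exists (2 ^+ n * jb (flip w) ^+ n * C) => z.
have h := H (latpt B v) w z.
have h2 : jb z ^+ n <= 2 ^+ n * jb (flip w) ^+ n * jb (flip w - z) ^+ n.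
  by apply: expr_le_mul3; [exact: japanese_ge0|rewrite -[X in jb X <= _](subKr (flip w)); exact: japaneseB].
apply: (le_trans (ler_wpM2r (normc_ge0 _) h2)); rewrite -(mulrA (2 ^+ n * _)).
apply: ler_wpM2l; first by rewrite mulr_ge0 ?exprn_ge0 ?japanese_ge0.
apply: le_trans h; apply: ler_wpM2r; first exact: normc_ge0.
by apply: ler_peMl; [exact: japaneseX_ge0|exact: japaneseX_ge1].
Qed.

Lemma coef_sum_cvg a w : tempered a ->
  N (\sum_(v <- box (k + k) j) local_coef a v w - unity_const * coef a (flip w)) @[j --> \oo] --> 0.
Proof.
move=> ta; have [C1 [m [C10 H1]]] := coef_pbound ta.
have sg := schwartz_gauss_window R k; have saw := schwartz_atom (lsubmx w) (rsubmx w) sg.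
have i0 := atom_const_gt0 R k.
have [S S0 HS] := sum_chi_bound m.
have [C C0 HC] := weyl_matrix_bound (d + m) chi_schwartz.
pose F j z := (\sum_(v <- box (k + k) j) weyl_matrix (chiv v) w z) * coef a z.
pose f z := unity_const * stftz g (atom g (lsubmx w) (rsubmx w)) z * coef a z.
pose D := C * S * C1 * 2 ^+ m * jb (flip w) ^+ m.
have D0 : 0 <= D by rewrite !mulr_ge0 ?exprn_ge0 ?japanese_ge0.
have mF j : cmeas (F j).
  apply: cmeasM; last exact: cmeas_coef.
  by apply: cmeas_sum => v; apply: cmeas_weyl_matrix => //; meas.
have mf : cmeas f.
  by apply: cmeasM; [apply: cmeasM; [exact: cmeas_cst|exact: cmeas_stftz]|exact: cmeas_coef].
have bF j z : N (F j z) <= D * jb (z - flip w) ^- d.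
  have s1 : N (\sum_(v <- box (k + k) j) weyl_matrix (chiv v) w z) <= C * S * jb (flip w - z) ^- (d + m).
    apply: (le_trans (normc_sum _ _ _)).
    apply: (@le_trans _ _ (C * (\sum_(v <- box (k + k) j) jb (flip w - latpt B v) ^- (d + m)) * jb (flip w - z) ^- (d + m))).
      rewrite mulr_sumr mulr_suml; apply: ler_sum => v _.
      rewrite -mulrA -invfM ler_pdivlMr ?mulr_gt0 ?japaneseX_gt0 //.
      by rewrite mulrC; exact: HC.
    by rewrite ler_wpM2r ?invr_ge0 ?japaneseX_ge0 // ler_wpM2l.
  have s2 : N (coef a z) <= C1 * (2 ^+ m * jb (flip w - z) ^+ m * jb (flip w) ^+ m).
    apply: (le_trans (H1 z)); apply: ler_wpM2l => //; apply: expr_le_mul3; first exact: japanese_ge0.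
    by rewrite -[X in jb X <= _](subKr (flip w)) mulrAC; exact: japaneseB.
  rewrite Normc.normcM.
  apply: (@le_trans _ _ ((C * S * jb (flip w - z) ^- (d + m)) * (C1 * (2 ^+ m * jb (flip w - z) ^+ m * jb (flip w) ^+ m)))).
    by apply: ler_pM; rewrite ?normc_ge0.
  have -> : jb (z - flip w) = jb (flip w - z) by rewrite -japaneseN opprB.
  rewrite /D exprD; have := japaneseX_gt0 (flip w - z) d; have := japaneseX_gt0 (flip w - z) m.
  move: (jb (flip w - z) ^+ d) (jb (flip w - z) ^+ m) (jb (flip w) ^+ m) => U V W V0 U0.
  by rewrite le_eqVlt; apply/orP; left; apply/eqP; field; rewrite !gt_eqF.
have mD : measurable_fun setT (fun z : 'rV[R]_(k + k) => D * jb (z - flip w) ^- d).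
  apply: measurable_funM; first exact: measurable_cst.
  by apply: measurable_japaneseVX; meas.
have ID : (\int[lebesgue_rV R (k + k)]_z (D * jb (z - flip w) ^- d)%:E < +oo)%E.
  rewrite (integral_rV_translate (- flip w) (f := fun z => (D * jb z ^- d)%:E)).
  - apply: (@le_lt_trans _ _ (D * japanese_mass R (k + k))%:E); last exact: ltry.
    apply: integral_decay_le => z; first by rewrite mulr_ge0 ?invr_ge0 ?japaneseX_ge0.
    by rewrite mulrCA divff ?mulr1 // gt_eqF ?japaneseX_gt0.
  - apply/measurable_EFinP; apply: measurable_funM; first exact: measurable_cst.
    by apply: measurable_japaneseVX; meas.
  - by move=> z; rewrite lee_fin mulr_ge0 ?invr_ge0 ?japaneseX_ge0.
have h := cintegral_dominated mF mf bF mD ID.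
have cvgF : N (cintegral (F j) - cintegral f) @[j --> \oo] --> 0.
  apply: h => z.
  have -> : (fun j => N (F j z - f z)) = (fun j => N (\sum_(v <- box (k + k) j) weyl_matrix (chiv v) w z -
     c0 * (gauss_mass k 2^-1 ^+ 2)%:C * stftz g (atom g (lsubmx w) (rsubmx w)) z) * N (coef a z)).
    by apply/funext => j; rewrite -Normc.normcM mulrBl.
  by rewrite -[X in _ --> X](mul0r (N (coef a z))); apply: cvgMl; exact: weyl_matrix_sum_cvg.
have -> : (fun j => N (\sum_(v <- box (k + k) j) local_coef a v w - unity_const * coef a (flip w))) =
   (fun j => (atom_const R k)^-1 * N (cintegral (F j) - cintegral f)).
  apply/funext => j.
  have -> : cintegral (F j) = (atom_const R k)%:C * \sum_(v <- box (k + k) j) local_coef a v w.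
    rewrite mulr_sumr; transitivity (cintegral (fun z => \sum_(v <- box (k + k) j) weyl_matrix (chiv v) w z * coef a z)).
      by apply: eq_cintegral => z; rewrite /F mulr_suml.
    rewrite cintegral_sum; last by move=> v; exact: cintegrable_weyl_matrix_coef.
    by apply: eq_bigr => v _; rewrite /local_coef weyl_quant_atom.
  have -> : cintegral f = (atom_const R k)%:C * (unity_const * coef a (flip w)).
    rewrite mulrCA /coef /flip row_mxKl row_mxKr opprK -(tempered_coef ta saw) -cintegralZ.
      by apply: eq_cintegral => z; rewrite /f mulrA.
    apply: cintegrable_rdecay; [exact: cmeas_stftz|exact: cmeas_coef|exact: rdecay_stftz|].
    by exists m, C1.
  by rewrite -mulrBr Normc.normcM normcR gtr0_norm // mulrA mulVf ?mul1r // gt_eqF.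
rewrite -[X in _ --> X](mulr0 (atom_const R k)^-1); exact: cvgMr.
Qed.

End coef_estimate.

(** * Absorption *)
Section coef_bounds.
Variable R : realType.
Local Notation N := (@Normc.normc R).
Local Notation jb := (@japanese R _).

(** Order functions with their constants as parameters, so that the bounds below
    are visibly uniform in the weight. *)
Definition moderate l (C : R) P (w : 'rV[R]_l -> R) :=
  (forall x, 0 < w x) /\ forall x y, w x <= C * jb (x - y) ^+ P * w y.

Lemma order_moderate l (m : 'rV[R]_l -> R) : order_function m ->
  exists C P, 0 <= C /\ moderate C P m.
Proof.
move=> [m0 [C [N0 [C0 N1 H]]]]; exists C, (Num.bound N0); split; first exact: ltW.
split=> // x y; apply: (le_trans (H x y)); rewrite ler_wpM2r ?(ltW (m0 y)) //.
apply: ler_wpM2l; first exact: ltW.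
by apply: powR_japanese; apply/ltW/archi_boundP; exact: le_trans N1.
Qed.

Lemma normc_lim_le (S : nat -> R[i]) l b :
  N (S j - l) @[j --> \oo] --> 0 -> (forall j, N (S j) <= b) -> N l <= b.
Proof.
move=> cv Sb; apply/ler_addgt0Pr => e e0.
have /cvgrPdist_lt /(_ e e0) [j _ /(_ j (leqnn j))] := cv.
rewrite /= sub0r normrN ger0_norm ?normc_ge0 // => h.
rewrite -(subKr (S j) l); apply: (le_trans (normcB _ _)); apply: lerD => //.
exact: ltW.
Qed.

Variables (k : nat) (B : 'M[R]_(k + k)) (chi : 'rV[R]_(k + k) -> R[i]).
Hypothesis B_free : row_free B.
Hypothesis chi_schwartz : is_schwartz chi.
Hypothesis chi_sum : forall rho,
  has_sum [set v | exists z : 'rV[int]_(k + k), v = map_mx intr z *m B]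
    (fun g => chi (rho - g)) 1.
Local Notation g := (@gauss_window R k).
Local Notation d := (k + k + (k + k))%N.
Local Notation chiv v := (fun rho => chi (rho - latpt B v)).
Local Notation local_coef := (local_coef B chi).

Lemma local_coef_near : exists2 C, 0 <= C & forall a v w A, tempered a -> 0 < A ->
  (L2norm (weyl_quant (chiv v) a) <= A%:E)%E -> N (local_coef a v w) <= C * A.
Proof.
have [C C0 H] := L2norm_atom R k; exists C => // a v w A ta A0 h.
by apply: H => //; apply: cmeas_weyl_quant => //; exact: schwartz_shift.
Qed.

Lemma local_coef_far n C P : 0 <= C -> exists2 C', 0 <= C' & forall a w Q, tempered a ->
  moderate C P w -> 0 <= Q -> (forall z, N (coef a z) <= Q * w z) ->
  forall v rho, N (local_coef a v (flip rho)) <= C' * Q * w rho * jb (rho - latpt B v) ^- n.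
Proof.
move=> C0; have [D D0 HD] := weyl_matrix_bound (n + P + d) chi_schwartz.
have i0 := atom_const_gt0 R k.
exists ((atom_const R k)^-1 * (2 * (D * C * japanese_mass R (k + k)))).
  by rewrite !mulr_ge0 ?japanese_mass_ge0 // invr_ge0 ltW.
move=> a w Q ta [w0 Hw] Q0 HQ v rho; set gam := latpt B v.
have -> : N (local_coef a v (flip rho)) = (atom_const R k)^-1 * N ((atom_const R k)%:C * local_coef a v (flip rho)).
  by rewrite Normc.normcM normcR gtr0_norm // mulrA mulVf ?mul1r ?gt_eqF.
rewrite -4!mulrA ler_wpM2l ?invr_ge0 ?(ltW i0) // weyl_quant_atom //; last exact: schwartz_shift.
pose f z := weyl_matrix (chiv v) (flip rho) z * coef a z.
have mf : cmeas f.
  by apply: cmeasM; [apply: cmeas_weyl_matrix; [exact: schwartz_shift|meas|meas]|exact: cmeas_coef].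
rewrite -(cintegral_translate rho mf).
rewrite [leRHS](_ : _ = 2 * (D * (Q * C * w rho * jb (rho - gam) ^- n) * japanese_mass R (k + k))); last by ring.
apply: cintegral_decay => [|z]; first by apply: (cmeas_comp mf); meas.
rewrite /f Normc.normcM; have := HD gam (flip rho) (z + rho).
have := HQ (z + rho); have := Hw (z + rho) rho.
rewrite flipK addrK opprD addrCA subrr addr0 japaneseN.
move: (N (weyl_matrix _ _ _)) (normc_ge0 (weyl_matrix (chiv v) (flip rho) (z + rho))) => M M0.
move: (N (coef _ _)) (normc_ge0 (coef a (z + rho))) => A A0 h1 h2 h3.
have G0 := japaneseX_gt0 (rho - gam) n.
rewrite -(ler_pM2r G0) [leRHS](_ : _ = D * (Q * C * w rho)); last first.
  by field; rewrite gt_eqF.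
have e1 : jb (rho - gam) ^+ n <= jb (rho - gam) ^+ (n + P + d) by rewrite japanese_leX // -addnA leq_addr.
have e2 : jb z ^+ d * jb z ^+ P <= jb z ^+ (n + P + d).
  by rewrite -exprD japanese_leX // leq_add_mid.
have hA : A <= Q * C * w rho * jb z ^+ P.
  apply: (le_trans h2); rewrite -!mulrA ler_wpM2l //; apply: (le_trans h1).
  by rewrite -mulrA ler_wpM2l // mulrC.
have q0 : 0 <= Q * C * w rho by rewrite !mulr_ge0 // ltW.
exact: ler_mul_offdiagonal (japaneseX_ge0 z d) (japaneseX_ge0 z P) (ltW G0) M0 q0 e1 e2 hA h3.
Qed.

(** Far from the point the localized pieces are controlled by the coefficients
    themselves, with a small factor; near it, by their square integral norms. *)
Lemma coef_absorb C P : 0 <= C -> exists2 C', 0 <= C' & forall w a L Q, moderate C P w ->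
  tempered a -> 0 < L -> 0 <= Q ->
  (forall v, (L2norm (weyl_quant (chiv v) a) <= (L * w (latpt B v))%:E)%E) ->
  (forall z, N (coef a z) <= Q * w z) ->
  forall z, N (coef a z) <= (C' * L + Q / 2) * w z.
Proof.
move=> C0; have [C1 C10 H1] := local_coef_near.
have [C2 C20 H2] := local_coef_far d.+1 P C0.
have [S S0 HS] := lattice_sum B_free.
have K0 := unity_const_neq0 R k; set K := N (unity_const R k) in K0.
(* T separates near from far: beyond it the pieces cost at most half of Q. *)
pose T := 2 * C2 * S / K + 1.
have T0 : 0 < T by rewrite ltr_wpDl // divr_ge0 ?mulr_ge0 // ltW.
have T1 : C2 * S / (T * K) <= 2^-1.
  rewrite ler_pdivrMr ?mulr_gt0 // /T mulrA mulrDr mulr1 mulrDl.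
  rewrite (_ : 2^-1 * (2 * C2 * S / K) * K = C2 * S); last by field; rewrite gt_eqF.
  by rewrite lerDl mulr_ge0 ?invr_ge0 // ltW.
exists (C1 * C * T ^+ (P + d) * S / K).
  by rewrite !mulr_ge0 ?exprn_ge0 ?invr_ge0 // ltW.
move=> w a L Q mw ta L0 Q0 hL hQ rho; have [w0 Hw] := mw.
have key j : N (\sum_(v <- box (k + k) j) local_coef a v (flip rho)) <=
    (C1 * C * L * T ^+ (P + d) + C2 * Q / T) * w rho * S.
  apply: (le_trans (normc_sum _ _ _)).
  apply: (@le_trans _ _ ((C1 * C * L * T ^+ (P + d) + C2 * Q / T) * w rho *
    \sum_(v <- box (k + k) j) jb (rho - latpt B v) ^- d)); last first.
    apply: ler_wpM2l => //; apply: mulr_ge0; last exact: ltW.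
    by apply: addr_ge0; rewrite !mulr_ge0 ?exprn_ge0 ?invr_ge0 // ltW.
  rewrite mulr_sumr; apply: ler_sum => v _; set s := jb (rho - latpt B v).
  have s0 : 0 < s by exact: japanese_gt0.
  have n1 : N (local_coef a v (flip rho)) <= C1 * (L * (C * s ^+ P * w rho)).
    apply: (le_trans (H1 a v (flip rho) _ ta (mulr_gt0 L0 (w0 _)) (hL v))).
    rewrite ler_wpM2l // ler_wpM2l ?(ltW L0) //; apply: (le_trans (Hw _ rho)).
    by rewrite /s -japaneseN opprB.
  have n2 := H2 a w Q ta mw Q0 hQ v rho; rewrite -/s in n2.
  have wr := w0 rho; move: (N (local_coef _ _ _)) (w rho) wr n1 n2 => X W W0 n1 n2.
  rewrite ler_pdivlMr ?exprn_gt0 //.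
  have q1 : 0 <= C2 * Q / T * W by rewrite !mulr_ge0 ?invr_ge0 // ltW.
  have q2 : 0 <= C1 * C * L * W by rewrite !mulr_ge0 // ltW.
  have [sT|Ts] := leP s T.
    apply: (@le_trans _ _ (C1 * C * L * T ^+ (P + d) * W)); last first.
      by rewrite [leRHS]mulrDl lerDl.
    apply: (le_trans (ler_wpM2r (exprn_ge0 d (ltW s0)) n1)).
    rewrite [leLHS](_ : _ = C1 * C * L * W * (s ^+ P * s ^+ d)); last by ring.
    rewrite [leRHS](_ : _ = C1 * C * L * W * T ^+ (P + d)); last by ring.
    by rewrite ler_wpM2l // -exprD lerXn2r // ?nnegrE ltW.
  apply: (@le_trans _ _ (C2 * Q / T * W)); last first.
    rewrite [leRHS]mulrDl lerDr.
    rewrite (_ : _ * _ * W = C1 * C * L * W * T ^+ (P + d)); last by ring.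
    by rewrite mulr_ge0 // exprn_ge0 // ltW.
  apply: (le_trans (ler_wpM2r (exprn_ge0 d (ltW s0)) n2)).
  rewrite exprS [leLHS](_ : _ = C2 * Q * W * s^-1); last by field; rewrite ?expf_neq0 ?gt_eqF.
  rewrite [leRHS](_ : _ = C2 * Q * W * T^-1); last by ring.
  by rewrite ler_wpM2l ?mulr_ge0 ?(ltW W0) // lef_pV2 ?posrE // ltW.
have := normc_lim_le (coef_sum_cvg B_free chi_schwartz chi_sum (flip rho) ta) key.
rewrite flipK Normc.normcM -/K mulrC -ler_pdivlMr // => h; apply: (le_trans h).
rewrite [leLHS](_ : _ = (C1 * C * T ^+ (P + d) * S / K * L + Q * (C2 * S / (T * K))) * w rho); last first.
  by field; rewrite !gt_eqF.
by rewrite ler_wpM2r ?(ltW (w0 rho)) // lerD2l ler_wpM2l.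
Qed.

(** The a priori constant is halved by each application of coef_absorb. *)
Lemma coef_absorbed C P : 0 <= C -> exists2 C', 0 <= C' & forall w a L Q, moderate C P w ->
  tempered a -> 0 < L -> 0 <= Q ->
  (forall v, (L2norm (weyl_quant (chiv v) a) <= (L * w (latpt B v))%:E)%E) ->
  (forall z, N (coef a z) <= Q * w z) ->
  forall z, N (coef a z) <= C' * L * w z.
Proof.
move=> C0; have [D D0 H] := coef_absorb P C0.
exists (2 * D); first exact: mulr_ge0.
move=> w a L Q mw ta L0 Q0 hL hQ.
have it n z : N (coef a z) <= (2 * D * L + Q / 2 ^+ n) * w z.
  elim: n z => [|n IH] z.
    apply: (le_trans (hQ z)); rewrite expr0 divr1 ler_wpM2r ?(ltW (mw.1 z)) // lerDr.
    by rewrite !mulr_ge0 // ltW.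
  have q0 : 0 <= 2 * D * L + Q / 2 ^+ n.
    by rewrite addr_ge0 ?divr_ge0 ?exprn_ge0 // !mulr_ge0 // ltW.
  apply: (le_trans (H w a L _ mw ta L0 q0 hL IH z)).
  rewrite le_eqVlt; apply/orP; left; apply/eqP; rewrite exprS; field.
  by rewrite expf_neq0.
move=> z; have wz := mw.1 z; rewrite -ler_pdivrMr //; apply/ler_addgt0Pr => e e0.
pose n := Num.bound (Q / e).
have hn : Q / e < n%:R by apply: archi_boundP; rewrite divr_ge0 // ltW.
have := it n z; rewrite -ler_pdivrMr // => h; apply: (le_trans h); rewrite lerD2l.
rewrite ler_pdivrMr ?exprn_gt0 // -ler_pdivrMl // mulrC; apply/ltW/(lt_trans hn).
by rewrite -natrX ltr_nat ltn_expl.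
Qed.

(** The coefficients of an element of the symbol space are bounded by its
    norm times the weight. A weight growing away from a given point first shows,
    with a bad constant, that the quotient is bounded at all. *)
Theorem coef_bound C P (m : 'rV[R]_(k + k) -> R) : 0 <= C -> moderate C P m ->
  exists2 C', 0 <= C' & forall a L, tempered a -> 0 < L ->
  (forall v, (L2norm (weyl_quant (chiv v) a) <= (L * m (latpt B v))%:E)%E) ->
  forall z, N (coef a z) <= C' * L * m z.
Proof.
move=> C0 mm; have [m0 Hm] := mm; have [D D0 H] := coef_absorbed P C0.
exists D => // a L ta L0 hL.
have [Ca [q [Ca0 Ha]]] := coef_pbound ta.
have C20 : 0 <= C * 2 ^+ (q + P) by rewrite mulr_ge0 ?exprn_ge0.
have [D' D'0 H'] := coef_absorbed (P + (q + P)) C20.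
apply: (H m a L (D' * L)) => //; first by rewrite mulr_ge0 // ltW.
(* At r0 itself this weight is m r0, and it dominates any polynomial bound. *)
move=> r0; pose w r := m r * jb (r - r0) ^+ (q + P).
have w0 r : 0 < w r by rewrite mulr_gt0 ?japaneseX_gt0.
have mw : moderate (C * 2 ^+ (q + P)) (P + (q + P)) w.
  split=> // x y; rewrite /w.
  have h : jb (x - r0) ^+ (q + P) <= 2 ^+ (q + P) * jb (x - y) ^+ (q + P) * jb (y - r0) ^+ (q + P).
    apply: expr_le_mul3; first exact: japanese_ge0.
    by have -> : x - r0 = (x - y) + (y - r0); [rewrite addrA subrK|exact: japaneseD].
  apply: (le_trans (ler_pM (ltW (m0 x)) (japaneseX_ge0 _ _) (Hm x y) h)).
  rewrite (exprD _ P (q + P)) le_eqVlt; apply/orP; left; apply/eqP.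
  move: (jb (x - y) ^+ (q + P)) (jb (x - y) ^+ P) (jb (y - r0) ^+ (q + P)) (2 ^+ (q + P)) => e1 e2 e3 e4; ring.
have hLw v : (L2norm (weyl_quant (chiv v) a) <= (L * w (latpt B v))%:E)%E.
  apply: (le_trans (hL v)); rewrite lee_fin ler_wpM2l ?(ltW L0) //.
  by rewrite /w ler_peMr ?japaneseX_ge1 // ltW.
pose Q := Ca * 2 ^+ q * jb r0 ^+ q * C / m r0.
have Q0 : 0 <= Q by rewrite !mulr_ge0 ?exprn_ge0 ?japanese_ge0 ?invr_ge0 // ltW.
have hQ z : N (coef a z) <= Q * w z.
  apply: (le_trans (Ha z)).
  have h1 : jb z ^+ q <= 2 ^+ q * jb (z - r0) ^+ q * jb r0 ^+ q.
    by apply: expr_le_mul3; [exact: japanese_ge0|exact: japanese_trans].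
  have h2 := Hm r0 z; rewrite -japaneseN opprB in h2.
  apply: (le_trans (ler_wpM2l Ca0 h1)); rewrite /Q /w exprD.
  have [mz mr] := (m0 z, m0 r0).
  rewrite [leRHS](_ : _ = Ca * (2 ^+ q * jb (z - r0) ^+ q * jb r0 ^+ q) * (C * jb (z - r0) ^+ P * m z / m r0)); last by ring.
  rewrite ler_peMr //; last by rewrite ler_pdivlMr // mul1r.
  by rewrite !mulr_ge0 ?exprn_ge0 ?japanese_ge0.
have := H' w a L Q mw ta L0 Q0 hLw hQ r0; rewrite /w subrr.
rewrite (_ : jb (0 : 'rV[R]_(k + k)) = 1) ?expr1n ?mulr1 //.
by rewrite /japanese dotv0l addr0 sqrtr1.
Qed.

End coef_bounds.

(** * Weyl composition of atoms *)
Section weyl_composition.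
Variable R : realType.
Local Notation N := (@Normc.normc R).
Local Notation jb := (@japanese R _).
Variable n : nat.
Local Notation k := (n + n)%N.
Local Notation g := (@gauss_window R k).
Local Notation J := (@hamilton R n).

Lemma symplecticE (x y : 'rV[R]_k) : symplectic x y = dotv (J x) y.
Proof. by rewrite /symplectic [RHS]dotv_split /hamilton row_mxKl row_mxKr dotvNl. Qed.

Lemma dotv_hamilton_self (x : 'rV[R]_k) : dotv (J x) x = 0.
Proof. by have := dotv_hamiltonl x x; rewrite (dotvC x) => e; lra. Qed.

Lemma affine_hamilton l (L : 'rV[R]_l -> 'rV[R]_k) : affine_map L -> affine_map (fun x => J (L x)).
Proof.
by move=> aL; rewrite /hamilton; apply: affine_row; [exact: affine_rsubmx|apply: affineN; exact: affine_lsubmx].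
Qed.

Definition weyl_symbol (Z : 'rV[R]_(k + k)) : R[i] := expi (2^-1 * symplectic (lsubmx Z) (rsubmx Z)).

(** The composition as a linear map on functions on E * E; by definition
    weyl_comp a b is its value at the tensor product of a and b. *)
Definition weyl_map (F : 'rV[R]_(k + k) -> R[i]) (X : 'rV[R]_k) : R[i] :=
  fourier_multiplier weyl_symbol F (row_mx X X).

Lemma multiplier_weyl_symbol : multiplier weyl_symbol.
Proof.
have al : affine_map (fun Z : 'rV[R]_(k + k) => lsubmx Z) by apply: affine_lsubmx; exact: affine_id.
have ar : affine_map (fun Z : 'rV[R]_(k + k) => rsubmx Z) by apply: affine_rsubmx; exact: affine_id.
have -> : weyl_symbol = fun Z => expi (dotv (2^-1 *: J (lsubmx Z)) (rsubmx Z)).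
  by apply/funext => Z; rewrite /weyl_symbol symplecticE dotvZl.
apply: multiplier_expi; apply: multiplier_dotv => //; apply: affineZ; exact: affine_hamilton.
Qed.

Lemma weyl_mapE F X : weyl_map F X =
  ((2 * pi) ^- (k + k))%:C * fourier (fun Z => weyl_symbol Z * fourier F Z) (- row_mx X X).
Proof.
by congr (_ * _); rewrite fourierE; apply: eq_cintegral => Z; rewrite opprK dotvC.
Qed.

Lemma schwartz_weyl_symbol F : is_schwartz F -> is_schwartz (fun Z => weyl_symbol Z * fourier F Z).
Proof. by move=> sF; apply: schwartzM; [exact: multiplier_weyl_symbol|exact: schwartz_fourier]. Qed.

Lemma schwartz_weyl_map F : is_schwartz F -> is_schwartz (weyl_map F).
Proof.
move=> sF; have -> : weyl_map F = fun X => ((2 * pi) ^- (k + k))%:C *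
    fourier (fun Z => weyl_symbol Z * fourier F Z) (- row_mx X X).
  by apply/funext => X; exact: weyl_mapE.
apply: schwartzM; first exact: multiplier_cst.
apply: (@schwartz_affine _ _ _ (fun X : 'rV[R]_k => - row_mx X X) _ 1 1).
- by apply: affineN; apply: affine_row; exact: affine_id.
- by move=> X; rewrite expr1 mul1r japaneseN; exact: japanese_rowl.
- exact/schwartz_fourier/schwartz_weyl_symbol.
Qed.

Lemma weyl_map_lin c F G X : is_schwartz F -> is_schwartz G ->
  weyl_map (fun x => c * F x + G x) X = c * weyl_map F X + weyl_map G X.
Proof.
move=> sF sG; have scF : is_schwartz (fun x => c * F x) by apply: schwartzM => //; exact: multiplier_cst.
rewrite !weyl_mapE mulrCA -mulrDr; congr (_ * _).
have sF' := schwartz_weyl_symbol sF; have sG' := schwartz_weyl_symbol sG.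
have scF' : is_schwartz (fun Z => c * (weyl_symbol Z * fourier F Z)).
  by apply: schwartzM => //; exact: multiplier_cst.
rewrite -fourierZ // -fourierD //; congr (fourier _ _); apply/funext => Z.
by rewrite fourierD // fourierZ // mulrDr mulrCA.
Qed.

Lemma csmooth_window_decay_one l : csmooth (@window_decay R l 0) (fun=> 1).
Proof.
have [s1 _] : multiplier (fun _ : 'rV[R]_l => 1 : R[i]) by exact: multiplier_cst.
split=> // s.
have [c e] : exists c, partials s (fun _ : 'rV[R]_l => 1) = fun=> c.
  elim: s => [|j s [c e]]; first by exists 1.
  by exists 0; rewrite /= e; apply/funext => x; rewrite partial_cst.
by exists (N c) => x; rewrite e expr0 mul1r.
Qed.

(** This is stft_bound for the window 1. *)
Lemma fourier_bound l m : exists C q, 0 <= C /\ forall (f : 'rV[R]_l -> R[i]) xi, is_schwartz f ->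
  jb xi ^+ m * N (fourier f xi) <= C * schwartz_norm q f.
Proof.
have [C [q [C0 H]]] := stft_bound m (csmooth_window_decay_one l); exists C, q; split=> // f xi sf.
have := H f 0 (- xi) sf; rewrite expr0 mul1r japaneseN stft_fourier opprK.
by under [X in fourier X]eq_fun do rewrite mulr1.
Qed.

(** The composition paired with a fixed test function is a tempered distribution
    on E * E, so it is determined by its values on atoms. *)
Definition weyl_dual (f : 'rV[R]_k -> R[i]) (F : schwartz R (k + k)) : R[i] :=
  cintegral (fun X => weyl_map F X * f X).

Lemma tempered_weyl_dual f : is_schwartz f -> tempered (weyl_dual f).
Proof.
move=> sf; split.
  move=> c F G; have sF := is_schwartz_val F; have sG := is_schwartz_val G.
  have sf1 := schwartz_mul (schwartz_weyl_map sF) sf.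
  have sf2 := schwartz_mul (schwartz_weyl_map sG) sf.
  rewrite /weyl_dual -cintegralZ; last exact: schwartz_cintegrable.
  rewrite -cintegralD; [|exact/cintegrableZ/schwartz_cintegrable|exact: schwartz_cintegrable].
  apply: eq_cintegral => X.
  have -> : (schwartz_fun (c *: F + G)) = fun x => c * F x + G x.
    by have [sm e] := to_schwartz_lin c sF sG; rewrite !to_schwartz_val in e; rewrite -e to_schwartzE.
  by rewrite weyl_map_lin // mulrDl mulrA.
have [C [q [C0 H]]] := fourier_bound (k + k) (k + k + (k + k)).
have [D HD] := schwartz_bound (k + k) sf.
set c1 := ((2 * pi) ^- (k + k))%:C : R[i].
exists q, (2 * (N c1 * (2 * (C * japanese_mass R (k + k))) * D * japanese_mass R k)) => F.
have sF := is_schwartz_val F.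
rewrite [leRHS](_ : _ = 2 * ((N c1 * (2 * (C * schwartz_norm q F * japanese_mass R (k + k))) * D) * japanese_mass R k)); last by ring.
have mW := schwartz_cmeas (schwartz_weyl_map sF).
apply: cintegral_decay => [|X]; first by apply: cmeasM => //; exact: schwartz_cmeas.
rewrite Normc.normcM mulrCA; apply: ler_pM; rewrite ?mulr_ge0 ?japaneseX_ge0 ?normc_ge0 //.
rewrite weyl_mapE Normc.normcM; apply: ler_wpM2l; first exact: normc_ge0.
rewrite fourierE; have sw := schwartz_weyl_symbol sF.
apply: cintegral_decay => [|Z].
  exact: (schwartz_cmeas (schwartz_character _ sw)).
rewrite (Normc.normcM (expi _)) normc_expi mul1r (Normc.normcM (weyl_symbol Z)) normc_expi mul1r.
exact: H.
Qed.

Section atoms.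
Variables (p1 p2 eta1 eta2 : 'rV[R]_k).
Let q1 := p1 + 2^-1 *: J eta2.
Let q2 := p2 - 2^-1 *: J eta1.
Local Notation c2 := (((2 * pi) ^- (k + k))%:C : R[i]).

Definition weyl_const : R[i] := ((2 * pi) ^- (k + k))%:C *
  ((gauss_mass (k + k) 1)%:C * ((gauss_mass k 4^-1)%:C * (gauss_mass k 2^-1)%:C)).

Lemma gauss_row a l m (x : 'rV[R]_l) (y : 'rV[R]_m) : gauss a (row_mx x y) = gauss a x * gauss a y.
Proof. by rewrite /gauss dotv_row mulrDr expRD. Qed.

Let s4 : is_schwartz (fun x : 'rV[R]_k => (gauss 4^-1 x)%:C).
Proof. exact: schwartz_gauss. Qed.

(** The integral in the second block is a Gaussian Fourier transform, and so is
    then the one in the first. *)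
Lemma gauss_symplectic (u v : 'rV[R]_k) :
  cintegral (fun Z : 'rV[R]_(k + k) => expi (dotv (lsubmx Z) u + dotv (rsubmx Z) v
    + 2^-1 * dotv (J (lsubmx Z)) (rsubmx Z)) * (gauss 4^-1 Z)%:C) =
  (gauss_mass k 4^-1)%:C * (gauss_mass k 2^-1)%:C * expi (dotv (J v) u) *
    ((gauss 2^-1 u)%:C * (gauss 2^-1 v)%:C).
Proof.
have h4 : 0 < 4^-1 :> R by rewrite invr_gt0.
have h2 : 0 < 2^-1 :> R by rewrite invr_gt0.
pose f (x y : 'rV[R]_k) := expi (dotv x u + dotv y v + 2^-1 * dotv (J x) y) *
  ((gauss 4^-1 x)%:C * (gauss 4^-1 y)%:C).
have [C HC] := gauss_decay k (k + k) h4.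
transitivity (cintegral (fun Z : 'rV[R]_(k + k) => f (lsubmx Z) (rsubmx Z))).
  by apply: eq_cintegral => Z; rewrite /f -rmorphM -gauss_row hsubmxK.
rewrite (@cfubini _ _ _ f (C * C)).
- transitivity (cintegral (fun x => (gauss_mass k 4^-1)%:C * (gauss 2^-1 v)%:C *
      (expi (dotv x u) * (gauss 2^-1 (x - J v))%:C))).
    apply: eq_cintegral => x.
    transitivity (cintegral (fun y => expi (dotv x u) * (gauss 4^-1 x)%:C *
        (expi (dotv y (v + 2^-1 *: J x)) * (gauss 4^-1 (y - 0))%:C))).
      apply: eq_cintegral => y; rewrite subr0 /f -addrA expiD dotvDr dotvZr (dotvC y (J x)); ring.
    have sT : is_schwartz (fun y : 'rV[R]_k => (gauss 4^-1 (y - 0))%:C).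
      exact: (schwartz_translate (- 0) s4).
    rewrite cintegralZ; last exact: (schwartz_cintegrable (schwartz_character _ sT)).
    rewrite (fourier_gauss_shift 0 _ h4) dotv0l expi0 mul1r.
    have -> : (4 * 4^-1)^-1 = 1 :> R by rewrite divff // invr1.
    have e : gauss 4^-1 x * gauss 1 (v + 2^-1 *: J x) = gauss 2^-1 v * gauss 2^-1 (x - J v).
      rewrite /gauss -!expRD; congr expR; rewrite !dotvE !dotv_hamilton (dotvC x (J v)).
      rewrite (dotvC (J x) v) -(dotv_hamilton v) ; have := dotv_hamiltonl v x.
      rewrite (dotv_hamilton v) => ->; by field.
    transitivity ((gauss_mass k 4^-1)%:C * expi (dotv x u) * (gauss 4^-1 x * gauss 1 (v + 2^-1 *: J x))%:C).
      by rewrite rmorphM; ring.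
    by rewrite e rmorphM; ring.
  have sT : is_schwartz (fun y : 'rV[R]_k => (gauss 2^-1 (y - J v))%:C).
    exact: (schwartz_translate (- J v) (schwartz_gauss k h2)).
  rewrite cintegralZ; last exact: (schwartz_cintegrable (schwartz_character _ sT)).
  rewrite (fourier_gauss_shift (J v) _ h2); have -> : (4 * 2^-1)^-1 = 2^-1 :> R by field.
  by ring.
- by rewrite /f; meas.
- move=> x y; rewrite /f (Normc.normcM (expi _)) normc_expi mul1r (Normc.normcM (real_complex _ _)).
  rewrite !normcR !(ger0_norm (gauss_ge0 _ _)) mulrACA.
  by apply: ler_pM (HC x) (HC y); exact: mulr_ge0 (japaneseX_ge0 _ _) (gauss_ge0 _ _).
Qed.

(** The composition of two atoms is again an atom, up to a phase and a factor
    that decays with the distance between the shifted centres. *)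
Lemma weyl_map_atom X : weyl_map (atom (@gauss_window R (k + k)) (row_mx p1 p2) (row_mx eta1 eta2)) X =
  weyl_const * expi (2^-1 * dotv (J eta1) eta2 + dotv (J q2) q1) * (gauss 4^-1 (q1 - q2))%:C *
  atom g (2^-1 *: (q1 + q2)) (eta1 + eta2 + J (q1 - q2)) X.
Proof.
set P := row_mx p1 p2; set H := row_mx eta1 eta2.
have fE Z : fourier (atom (@gauss_window R (k + k)) P H) Z =
    (gauss_mass (k + k) 1)%:C * (expi (dotv P (H - Z)) * (gauss 4^-1 (H - Z))%:C).
  rewrite (_ : 4^-1 = (4 * 1)^-1); last by rewrite mulr1.
  rewrite -(fourier_gauss_shift P _ ltr01) fourierE; apply: eq_cintegral => x.
  by rewrite /atom mulrA -expiD -dotvDr addrC.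
rewrite /weyl_map /fourier_multiplier /inv_fourier /weyl_const -3!(mulrA c2); congr (_ * _).
have sw := schwartz_weyl_symbol (schwartz_atom P H (schwartz_gauss_window R (k + k))).
have mI : cmeas (fun Z => expi (dotv (row_mx X X) Z) * (weyl_symbol Z * fourier (atom (@gauss_window R (k + k)) P H) Z)).
  by apply: cmeasM; [meas|exact: schwartz_cmeas].
rewrite -(cintegral_translate H mI).
set u := X - q1; set v := X - q2.
transitivity (cintegral (fun Z : 'rV[R]_(k + k) => ((gauss_mass (k + k) 1)%:C *
   expi (dotv X (eta1 + eta2) + 2^-1 * dotv (J eta1) eta2)) *
   (expi (dotv (lsubmx Z) u + dotv (rsubmx Z) v
    + 2^-1 * dotv (J (lsubmx Z)) (rsubmx Z)) * (gauss 4^-1 Z)%:C))).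
  apply: eq_cintegral => Z; rewrite fE.
  have -> : H - (Z + H) = - Z by rewrite opprD addrCA subrr addr0.
  have -> : gauss 4^-1 (- Z) = gauss 4^-1 Z by rewrite /gauss dotvNl dotvNr opprK.
  rewrite /weyl_symbol symplecticE.
  have -> : lsubmx (Z + H) = lsubmx Z + eta1 by rewrite linearD /= /H row_mxKl.
  have -> : rsubmx (Z + H) = rsubmx Z + eta2 by rewrite linearD /= /H row_mxKr.
  have -> : dotv (row_mx X X) (Z + H) = dotv X (lsubmx Z) + dotv X (rsubmx Z) + dotv X (eta1 + eta2).
    by rewrite dotvDr dotv_split row_mxKl row_mxKr /H dotv_row dotvDr.
  have -> : dotv P (- Z) = - dotv p1 (lsubmx Z) - dotv p2 (rsubmx Z).
    by rewrite dotvNr dotv_split /P row_mxKl row_mxKr opprD.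
  have e : dotv X (lsubmx Z) + dotv X (rsubmx Z) + dotv X (eta1 + eta2) +
      2^-1 * dotv (J (lsubmx Z + eta1)) (rsubmx Z + eta2) + (- dotv p1 (lsubmx Z) - dotv p2 (rsubmx Z)) =
      (dotv X (eta1 + eta2) + 2^-1 * dotv (J eta1) eta2) +
      (dotv (lsubmx Z) u + dotv (rsubmx Z) v + 2^-1 * dotv (J (lsubmx Z)) (rsubmx Z)).
    rewrite /u /v /q1 /q2 hamiltonD !dotvE.
    rewrite !(dotvC X) (dotvC p1) (dotvC p2) (dotv_hamiltonl (lsubmx Z)) (dotvC (J eta1) (rsubmx Z)).
    rewrite (dotv_hamiltonl (lsubmx Z) eta2).
    by field.
  by apply: mulc_shuffle_shift; rewrite -!expiD e.
have h4 : 0 < 4^-1 :> R by rewrite invr_gt0.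
have [C HC] := gauss_decay (k + k) (k + k + (k + k)) h4.
rewrite cintegralZ; last first.
  apply: (@cintegrable_decay _ _ _ C) => [|Z]; first by meas.
  by rewrite Normc.normcM normc_expi mul1r normcR ger0_norm ?gauss_ge0.
rewrite gauss_symplectic /atom; apply: mulc_shuffle_atom.
  rewrite -!expiD; congr expi.
  rewrite /u /v; move: q1 q2 => r1 r2; rewrite !hamiltonD !hamiltonN !dotvE.
  rewrite (dotv_hamilton_self X) (dotv_hamiltonl X r1) (dotvC X (J r2)); ring.
rewrite -!rmorphM; congr (_%:C); rewrite /gauss_window /gauss -!expRD; congr expR.
rewrite /u /v; move: q1 q2 => r1 r2; rewrite !dotvE !(dotvC r1 X) !(dotvC r2 X) (dotvC r2 r1); by field.
Qed.

Lemma coef_weyl_dual f : is_schwartz f ->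
  coef (weyl_dual f) (row_mx (row_mx p1 p2) (- row_mx eta1 eta2)) =
  weyl_const * expi (2^-1 * dotv (J eta1) eta2 + dotv (J q2) q1) * (gauss 4^-1 (q1 - q2))%:C *
  stft g f (2^-1 *: (q1 + q2)) (eta1 + eta2 + J (q1 - q2)).
Proof.
move=> sf; have sg := schwartz_gauss_window R k.
rewrite /coef row_mxKl row_mxKr opprK /weyl_dual to_schwartzE; last exact/schwartz_atom/schwartz_gauss_window.
rewrite -cintegralZ; last exact/schwartz_cintegrable/(schwartz_mul_atom _ _ (schwartz_multiplier sg) sf).
by apply: eq_cintegral => X; rewrite weyl_map_atom -mulrA [atom _ _ _ _ * _]mulrC.
Qed.

End atoms.
End weyl_composition.

(** * The weight m3 *)
Section phase_space.
Variable R : realType.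
Local Notation N := (@Normc.normc R).
Local Notation jb := (@japanese R _).
Local Notation mu := (lebesgue_rV R).
Variable n : nat.
Local Notation k := (n + n)%N.
Local Notation J := (@hamilton R n).
Local Open Scope ereal_scope.

Lemma japanese0 l : jb (0%R : 'rV[R]_l) = 1%R.
Proof. by rewrite /japanese dotv0l addr0 sqrtr1. Qed.

Lemma moderate_ge1 l C P (w : 'rV[R]_l -> R) : moderate C P w -> (1 <= C)%R.
Proof.
move=> [w0 Hw]; have := Hw 0%R 0%R; rewrite subrr japanese0 expr1n mulr1.
by rewrite -ler_pdivrMr // divff ?gt_eqF.
Qed.

Lemma le_integral_nm d (T : measurableType d) (nu : {measure set T -> \bar R}) (f h : T -> \bar R) :
  (forall x, 0 <= f x) -> (forall x, f x <= h x) -> \int[nu]_x f x <= \int[nu]_x h x.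
Proof.
move=> f0 fh; rewrite -[leRHS]mul1e; apply: le_integral_scale => // x.
by rewrite mul1e.
Qed.

(** The opposite frequencies of two atoms, the first at position x, that compose to
    an atom centred at v when the second position is the one given by Sigma. *)
Definition shear (x : 'rV[R]_k) (v : 'rV[R]_(k + k)) : 'rV[R]_(k + k) :=
  row_mx (2 *: J (x - lsubmx v) - rsubmx v)%R (- (2 *: J (x - lsubmx v)))%R.

Lemma integral_shear x (g : 'rV[R]_(k + k) -> \bar R) : measurable_fun setT g ->
  (forall v, 0 <= g v) ->
  \int[mu (k + k)]_v g v = (2 ^+ k)%:E * \int[mu (k + k)]_v g (shear x v).
Proof.
move=> mg g0; pose A (z : 'rV[R]_k) := (2 *: J (x - z))%R.
pose G (y : 'rV[R]_k) := \int[mu k]_t g (row_mx t y).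
have mA : measurable_fun setT A by rewrite /A; meas.
have G0 y : 0 <= G y by apply: integral_ge0 => t _.
have mG : measurable_fun setT G.
  have := @measurable_tonelli_inner R k k (fun v => g (row_mx (rsubmx v) (lsubmx v))).
  rewrite (_ : (fun y => _) = G); last first.
    by apply/funext => y; apply: eq_integral => t _; rewrite row_mxKl row_mxKr.
  by apply=> //; apply: (measurableT_comp mg); meas.
have e1 : \int[mu (k + k)]_v g v = \int[mu k]_y G y.
  rewrite tonelli_row_mx // (tonelli_swap (f := fun t y => g (row_mx t y))) //.
  by apply: (measurableT_comp mg); meas.
have e2 : \int[mu (k + k)]_v g (shear x v) = \int[mu k]_z G (- A z)%R.
  have ms : measurable_fun setT (fun v => g (shear x v)).
    by apply: (measurableT_comp mg); rewrite /shear; meas.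
  have tt := @tonelli_row_mx R k k (fun v => g (shear x v)) ms (fun v => g0 (shear x v)).
  rewrite tt.
  apply: eq_integral => z _.
  transitivity (\int[mu k]_t (fun y => g (row_mx y (- A z))) ((-1) *: t + A z)%R).
    by apply: eq_integral => t _; rewrite /shear row_mxKl row_mxKr scaleN1r addrC.
  have mgz : measurable_fun setT (fun y : 'rV[R]_k => g (row_mx y (- A z)%R)) by apply: (measurableT_comp mg); meas.
  have n1 : (-1 != 0 :> R)%R by rewrite oppr_eq0 oner_eq0.
  have ta := @integral_rV_affine R k (-1)%R (A z) (fun y => g (row_mx y (- A z)%R)) n1 mgz (fun y => g0 _).
  by rewrite ta normrN1 invr1 expr1n mul1e.
have e3 : \int[mu k]_z G (- A z)%R = (`|2|^-1 ^+ k)%:E * \int[mu k]_y G y.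
  transitivity (\int[mu k]_z (fun y => G (2 *: y + (- (2 *: J x)))%R) (J z)).
    apply: eq_integral => z _ /=; congr G.
    by rewrite /A hamiltonD hamiltonN scalerBr opprB.
  have mGv : measurable_fun setT (fun y : 'rV[R]_k => G (2 *: y + (- (2 *: J x)))%R) by apply: (measurableT_comp mG); meas.
  have th := @integral_rV_hamilton R n (fun y : 'rV[R]_k => G (2 *: y + (- (2 *: J x)))%R) mGv (fun y => G0 _).
  have n2 : (2 != 0 :> R)%R by [].
  have ta := @integral_rV_affine R k 2 (- (2 *: J x))%R G n2 mG G0.
  by rewrite th ta.
rewrite e1 e2 e3 muleA -EFinM ger0_norm // -exprMn divff ?expr1n ?mul1e //.
Qed.

(** Each inner variable is introduced by an affine change of variables with
    constant Jacobian, in the coordinates in which the fibres d = 0 are Sigma. *)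
Lemma phase_space_change (f : 'rV[R]_((k + k) + (k + k)) -> \bar R) :
  measurable_fun setT f -> (forall z, 0 <= f z) ->
  \int[mu (k + k + (k + k))]_z f z = (2 ^+ k)%:E *
  \int[mu (k + k)]_v \int[mu k]_d \int[mu k]_x
    f (row_mx (row_mx x (d + (x + 2^-1 *: J (rsubmx v)))%R) (shear x v)).
Proof.
move=> mf f0; rewrite tonelli_row_mx //.
pose F (P v : 'rV[R]_(k + k)) := f (row_mx P (shear (lsubmx P) v)).
have mF : measurable_fun setT (fun z : 'rV[R]_((k + k) + (k + k)) => F (lsubmx z) (rsubmx z)).
  by apply: (measurableT_comp mf); rewrite /shear; meas.
have F0 P v : 0 <= F P v by exact: f0.
transitivity (\int[mu (k + k)]_P ((2 ^+ k)%:E * \int[mu (k + k)]_v F P v)).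
  apply: eq_integral => P _; rewrite (integral_shear (lsubmx P)) //.
  by apply: (measurableT_comp mf); meas.
rewrite ge0_integralZl //=; last 2 first.
- have mI := measurable_tonelli_inner mF (fun z => F0 (lsubmx z) (rsubmx z)).
  have eI : (fun P => \int[mu (k + k)]_v F (lsubmx (row_mx P v)) (rsubmx (row_mx P v))) =
      (fun P => \int[mu (k + k)]_v F P v).
    by apply/funext => P; apply: eq_integral => v _; rewrite row_mxKl row_mxKr.
  by rewrite -eI.
- by move=> P _; apply: integral_ge0 => v _.
congr (_ * _); rewrite (tonelli_swap mF) //; apply: eq_integral => v _.
have mFv : measurable_fun setT (fun P => F P v).
  by apply: (measurableT_comp mf); rewrite /shear; meas.
have t2 := @tonelli_row_mx R k k (fun P => F P v) mFv (fun P => F0 P v); rewrite t2.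
pose h (x d : 'rV[R]_k) := F (row_mx x (d + (x + 2^-1 *: J (rsubmx v)))%R) v.
have mh : measurable_fun setT (fun z : 'rV[R]_(k + k) => h (lsubmx z) (rsubmx z)).
  by apply: (measurableT_comp mFv); meas.
transitivity (\int[mu k]_x \int[mu k]_d h x d).
  apply: eq_integral => x _.
  rewrite -(integral_rV_translate (x + 2^-1 *: J (rsubmx v))%R (f := fun y => F (row_mx x y) v)) //.
  by apply: (measurableT_comp mFv); meas.
have ts := @tonelli_swap R k k h mh (fun x d => F0 _ v).
apply: (etrans ts); apply: eq_integral => d _; apply: eq_integral => x _.
by rewrite /h /F row_mxKl.
Qed.

Section weight.
Variables m1 m2 : 'rV[R]_(k + k) -> R.
Variables (C1 C2 : R) (P1 P2 : nat).
Hypothesis C1_ge0 : (0 <= C1)%R.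
Hypothesis C2_ge0 : (0 <= C2)%R.
Hypothesis mod1 : moderate C1 P1 m1.
Hypothesis mod2 : moderate C2 P2 m2.
Local Notation M3 := (m3 (R := R) (n := n) m1 m2).

(** The integrand of m3, with the equations of Sigma solved for the covectors and
    for y. *)
Definition sigma_weight (v : 'rV[R]_(k + k)) (x : 'rV[R]_k) : R :=
  (m1 (row_mx x (rsubmx v - 2 *: J (x - lsubmx v))) *
   m2 (row_mx (x + 2^-1 *: J (rsubmx v)) (2 *: J (x - lsubmx v))))%R.

Lemma m3E v : M3 v = \int[mu k]_x (sigma_weight v x)%:E.
Proof. by apply: eq_integral => x _; rewrite Sigma_atE. Qed.

Lemma sigma_weight_gt0 v x : (0 < sigma_weight v x)%R.
Proof. by rewrite mulr_gt0 // ?mod1.1 ?mod2.1. Qed.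

Lemma sigma_weight_moderate : exists C P, (0 < C)%R /\ forall v w x,
  (sigma_weight v x <= C * jb (v - w) ^+ P * sigma_weight w x)%R.
Proof.
have al : affine_map (fun Z : 'rV[R]_(k + k) => lsubmx Z) by apply: affine_lsubmx; exact: affine_id.
have ar : affine_map (fun Z : 'rV[R]_(k + k) => rsubmx Z) by apply: affine_rsubmx; exact: affine_id.
have [A A0 HA] : exists2 A, (0 < A)%R & forall u : 'rV[R]_(k + k),
    (jb (row_mx (0%R : 'rV[R]_k) (rsubmx u + 2 *: J (lsubmx u))) <= A * jb u)%R.
  by apply: affine_bound; apply: affine_row; [exact: affine_cst|
    apply: affineD => //; apply: affineZ; exact: affine_hamilton].
have [B B0 HB] : exists2 B, (0 < B)%R & forall u : 'rV[R]_(k + k),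
    (jb (row_mx (2^-1 *: J (rsubmx u)) (- (2 *: J (lsubmx u)))) <= B * jb u)%R.
  by apply: affine_bound; apply: affine_row; [|apply: affineN]; apply: affineZ; exact: affine_hamilton.
exists (C1 * A ^+ P1 * (C2 * B ^+ P2) + 1)%R, (P1 + P2)%N.
have c0 : (0 <= C1 * A ^+ P1 * (C2 * B ^+ P2))%R by rewrite !mulr_ge0 ?exprn_ge0 // ltW.
split; first by rewrite ltr_wpDl.
move=> v w x; set u := (v - w)%R.
have h1 : (m1 (row_mx x (rsubmx v - 2 *: J (x - lsubmx v))) <=
    C1 * (A * jb u) ^+ P1 * m1 (row_mx x (rsubmx w - 2 *: J (x - lsubmx w))))%R.
  apply: (le_trans (mod1.2 _ (row_mx x (rsubmx w - 2 *: J (x - lsubmx w))))).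
  rewrite ler_wpM2r ?(ltW (mod1.1 _)) // ler_wpM2l // lerXn2r ?nnegrE ?mulr_ge0 ?japanese_ge0 ?(ltW A0) //.
  apply: le_trans (HA u); rewrite opp_row_mx add_row_mx subrr.
  rewrite (_ : (_ - _ - (_ - _))%R = (rsubmx u + 2 *: J (lsubmx u))%R) //.
  rewrite /u !linearB /= !hamiltonD !hamiltonN; move: (J x) (J (lsubmx v)) (J (lsubmx w)) => a b c.
  by apply/rowP => i; rewrite !mxE; ring.
have h2 : (m2 (row_mx (x + 2^-1 *: J (rsubmx v)) (2 *: J (x - lsubmx v))) <=
    C2 * (B * jb u) ^+ P2 * m2 (row_mx (x + 2^-1 *: J (rsubmx w)) (2 *: J (x - lsubmx w))))%R.
  apply: (le_trans (mod2.2 _ (row_mx (x + 2^-1 *: J (rsubmx w)) (2 *: J (x - lsubmx w))))).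
  rewrite ler_wpM2r ?(ltW (mod2.1 _)) // ler_wpM2l // lerXn2r ?nnegrE ?mulr_ge0 ?japanese_ge0 ?(ltW B0) //.
  apply: le_trans (HB u); rewrite opp_row_mx add_row_mx.
  rewrite (_ : (x + _ - (x + _))%R = (2^-1 *: J (rsubmx u))%R); last first.
    rewrite /u linearB /= hamiltonD hamiltonN; move: (J (rsubmx v)) (J (rsubmx w)) => a b.
    by apply/rowP => i; rewrite !mxE; ring.
  rewrite (_ : (2 *: _ - 2 *: _)%R = (- (2 *: J (lsubmx u)))%R) //.
  rewrite /u linearB /= !hamiltonD !hamiltonN; move: (J x) (J (lsubmx v)) (J (lsubmx w)) => a b c.
  by apply/rowP => i; rewrite !mxE; ring.
apply: (le_trans (ler_pM (ltW (mod1.1 _)) (ltW (mod2.1 _)) h1 h2)).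
rewrite -/(sigma_weight w x) mulrACA ler_wpM2r ?(ltW (sigma_weight_gt0 _ _)) //.
rewrite !exprMn exprD [leLHS](_ : _ = C1 * A ^+ P1 * (C2 * B ^+ P2) * (jb u ^+ P1 * jb u ^+ P2))%R; last by ring.
by rewrite ler_wpM2r ?mulr_ge0 ?japaneseX_ge0 // lerDl.
Qed.

(** Moving the base point moves the two points of Sigma over a given x by a linear
    function of the displacement, so the integrands compare pointwise; the weights
    may fail to be measurable, and le_integral_scale is what is left to conclude. *)
Lemma m3_moderate_ereal : exists C P, (0 < C)%R /\ forall v w,
  M3 v <= (C * jb (v - w) ^+ P)%:E * M3 w.
Proof.
have [C [P [C0 H]]] := sigma_weight_moderate; exists C, P; split=> // v w.
rewrite !m3E; apply: le_integral_scale.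
- by rewrite mulr_gt0 ?japaneseX_gt0.
- by move=> x; rewrite lee_fin ltW // sigma_weight_gt0.
- by move=> x; rewrite -EFinM lee_fin.
Qed.

Lemma m3_gt0 v : 0 < M3 v.
Proof.
have p1 := mod1.1; have p2 := mod2.1.
have low l (m : 'rV[R]_l -> R) C P r : moderate C P m -> (0 <= C)%R -> (m 0%R / (C + 1) * jb r ^- P <= m r)%R.
  move=> [m0 Hm] c0; have c1 : (0 < C + 1)%R by rewrite ltr_wpDl.
  rewrite ler_pdivrMr ?japaneseX_gt0 // ler_pdivrMr //; apply: (le_trans (Hm 0%R r)).
  rewrite sub0r japaneseN (_ : (m r * _ * _ = C * jb r ^+ P * m r + jb r ^+ P * m r)%R); last by ring.
  by rewrite lerDl mulr_ge0 ?japaneseX_ge0 // ltW.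
pose L1 x := row_mx x (rsubmx v - 2 *: J (x - lsubmx v))%R.
pose L2 x := row_mx (x + 2^-1 *: J (rsubmx v))%R (2 *: J (x - lsubmx v))%R.
pose f x := ((m1 0 / (C1 + 1) * jb (L1 x) ^- P1) * (m2 0 / (C2 + 1) * jb (L2 x) ^- P2))%R.
have c1 : (0 < m1 0 / (C1 + 1))%R by rewrite divr_gt0 // ltr_wpDl.
have c2 : (0 < m2 0 / (C2 + 1))%R by rewrite divr_gt0 // ltr_wpDl.
have f0 x : (0 < f x)%R.
  by apply: mulr_gt0; apply: mulr_gt0 => //; rewrite invr_gt0 japaneseX_gt0.
have mf : measurable_fun setT f.
  have mL1 : measurable_fun setT L1 by rewrite /L1; meas.
  have mL2 : measurable_fun setT L2 by rewrite /L2; meas.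
  by apply: measurable_funM; apply: measurable_funM; try exact: measurable_cst; exact: measurable_japaneseVX.
rewrite m3E; apply: (@lt_le_trans _ _ (\int[mu k]_x (f x)%:E)).
  by apply: integral_rV_gt0; [exact/measurable_EFinP|move=> x; rewrite lte_fin].
apply: le_integral_nonneg => x; rewrite (ltW (f0 x)) /=.
have l1 := low _ m1 C1 P1 (L1 x) mod1 C1_ge0; have l2 := low _ m2 C2 P2 (L2 x) mod2 C2_ge0.
have j1 : (0 <= m1 0 / (C1 + 1) * jb (L1 x) ^- P1)%R by apply: mulr_ge0; [exact: ltW|rewrite invr_ge0 japaneseX_ge0].
have j2 : (0 <= m2 0 / (C2 + 1) * jb (L2 x) ^- P2)%R by apply: mulr_ge0; [exact: ltW|rewrite invr_ge0 japaneseX_ge0].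
exact: ler_pM j1 j2 l1 l2.
Qed.

Hypothesis m3_fin : exists w, M3 w < +oo.

Lemma m3_lty v : M3 v < +oo.
Proof.
have [w Hw] := m3_fin; have [C [P [C0 H]]] := m3_moderate_ereal.
apply: (le_lt_trans (H v w)); rewrite -(@fineK _ (M3 w)); first by rewrite -EFinM ltry.
by rewrite ge0_fin_numE // ltW // m3_gt0.
Qed.

Lemma m3_fine v : M3 v = (fine (M3 v))%:E.
Proof. by rewrite fineK // ge0_fin_numE ?m3_lty // ltW // m3_gt0. Qed.

Lemma m3_moderate : exists C P, (0 < C)%R /\ moderate C P (fun v => fine (M3 v)).
Proof.
have [C [P [C0 H]]] := m3_moderate_ereal; exists C, P; split=> //; split=> [v|v w].
  by rewrite fine_gt0 // m3_gt0 m3_lty.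
by have := H v w; rewrite (m3_fine v) (m3_fine w) -EFinM lee_fin.
Qed.

Lemma m3_order : order_function (fun v => fine (M3 v)).
Proof.
have [C [P [C0 [m0 H]]]] := m3_moderate; split=> //; exists C, P.+1%:R; split=> //.
  by rewrite ler1n.
move=> v w; apply: (le_trans (H v w)); rewrite ler_wpM2r ?(ltW (m0 _)) // ler_wpM2l ?(ltW C0) //.
by rewrite powR_mulrn ?japanese_ge0 // japanese_leX.
Qed.

(** The weight of the composition: the integrand is the bound of the composition
    of the atoms at the points (p1, -xi1) and (p2, -xi2), seen from gam. *)
Lemma composition_weight : exists C M, (0 <= C)%R /\
  forall (a1 a2 : 'rV[R]_(k + k) -> R) L1 L2 gam,
  measurable_fun setT a1 -> measurable_fun setT a2 -> (0 < L1)%R -> (0 < L2)%R ->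
  (forall z, 0 <= a1 z <= L1 * m1 z)%R -> (forall z, 0 <= a2 z <= L2 * m2 z)%R ->
  \int[mu (k + k + (k + k))]_z
    (let p1 := lsubmx (lsubmx z) in let p2 := rsubmx (lsubmx z) in
     let e1 := (- lsubmx (rsubmx z))%R in let e2 := (- rsubmx (rsubmx z))%R in
     let q1 := (p1 + 2^-1 *: J e2)%R in let q2 := (p2 - 2^-1 *: J e1)%R in
     (a1 (row_mx p1 e1) * a2 (row_mx p2 e2) * gauss 4^-1 (q1 - q2) *
      jb (row_mx (2^-1 *: (q1 + q2)) (e1 + e2 + J (q1 - q2)) - gam) ^- M)%:E)
  <= (C * L1 * L2 * fine (M3 gam))%:E.
Proof.
have [C3 [P3 [C30 [m30 H3]]]] := m3_moderate.
(* The first part of M pays for moving m3 to gam, the second is integrable. *)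
set D0 := (k + k + (k + k))%N; set M := (P3 + D0)%N.
have h4 : (0 < 4^-1 :> R)%R by rewrite invr_gt0.
have [Cg HCg] := gauss_decay k (P2 + (M + M) + (k + k)) h4.
have Cg0 : (0 <= Cg)%R by apply: le_trans (HCg 0%R); rewrite mulr_ge0 ?gauss_ge0 ?japaneseX_ge0.
exists (2 ^+ k * (C2 * C3 * 2 ^+ M * Cg * japanese_mass R k * japanese_mass R (k + k)))%R, M.
split; first by rewrite !mulr_ge0 ?exprn_ge0 ?japanese_mass_ge0 // ltW.
move=> a1 a2 L1 L2 gam ma1 ma2 L10 L20 b1 b2.
have a1p z : (0 <= a1 z)%R by have /andP[] := b1 z.
have a2p z : (0 <= a2 z)%R by have /andP[] := b2 z.
rewrite phase_space_change; last 2 first.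
- apply/measurable_EFinP; apply: measurable_funM; last by apply: measurable_japaneseVX; meas.
  apply: measurable_funM; last by meas.
  by apply: measurable_funM; [apply: (measurableT_comp ma1)|apply: (measurableT_comp ma2)]; meas.
- move=> z; rewrite lee_fin !mulr_ge0 ?invr_ge0 ?gauss_ge0 ?japaneseX_ge0 ?a1p ?a2p //.
rewrite [X in _ <= X](_ : _ = (2 ^+ k)%:E * (C2 * C3 * 2 ^+ M * Cg * L1 * L2 * fine (M3 gam) * japanese_mass R k * japanese_mass R (k + k))%:E); last first.
  by rewrite -EFinM; congr (_%:E); ring.
apply: lee_wpmul2l; first by rewrite lee_fin exprn_ge0.
pose K := (C2 * C3 * 2 ^+ M * L1 * L2 * fine (M3 gam))%R.
have K0 : (0 <= K)%R by rewrite !mulr_ge0 ?exprn_ge0 // ?ltW.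
pose w3 (v : 'rV[R]_(k + k)) d := row_mx (lsubmx v + 2^-1 *: d)%R (rsubmx v - J d)%R.
have inner v d : \int[mu k]_x
    (let z := row_mx (row_mx x (d + (x + 2^-1 *: J (rsubmx v)))%R) (shear x v) in
     let p1 := lsubmx (lsubmx z) in let p2 := rsubmx (lsubmx z) in
     let e1 := (- lsubmx (rsubmx z))%R in let e2 := (- rsubmx (rsubmx z))%R in
     let q1 := (p1 + 2^-1 *: J e2)%R in let q2 := (p2 - 2^-1 *: J e1)%R in
     (a1 (row_mx p1 e1) * a2 (row_mx p2 e2) * gauss 4^-1 (q1 - q2) *
      jb (row_mx (2^-1 *: (q1 + q2)) (e1 + e2 + J (q1 - q2)) - gam) ^- M)%:E)
    <= (K * jb (v - gam) ^- D0 * (jb d ^+ (P2 + (M + M)) * gauss 4^-1 d))%:E.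
  (* For d = 0 the two points lie on Sigma; in general d costs a power of its
     bracket, which the Gaussian absorbs. *)
  pose c := (L1 * L2 * C2 * jb d ^+ P2 * gauss 4^-1 d * jb (w3 v d - gam) ^- M)%R.
  have c0 : (0 < c)%R by rewrite !mulr_gt0 ?invr_gt0 ?expR_gt0 ?japaneseX_gt0 // (lt_le_trans ltr01) // (moderate_ge1 mod2).
  apply: (@le_trans _ _ (c%:E * M3 v)).
    rewrite m3E; apply: le_integral_scale => // x.
      rewrite lee_fin !mulr_ge0 ?invr_ge0 ?gauss_ge0 ?japaneseX_ge0 ?a1p ?a2p //.
    rewrite -EFinM lee_fin /= /shear !(row_mxKl, row_mxKr) !opprK.
    set A := (2 *: J (x - lsubmx v))%R; set y := (x + 2^-1 *: J (rsubmx v))%R.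
    have JA : J A = (- (2 *: (x - lsubmx v)))%R by rewrite /A hamiltonZ hamiltonK scalerN.
    have eq1 : (x + 2^-1 *: J A)%R = lsubmx v.
      by rewrite JA scalerN scalerA mulVf // scale1r opprB addrC subrK.
    have eq2 : (d + y - 2^-1 *: J (rsubmx v - A))%R = (lsubmx v + d)%R.
      rewrite hamiltonD hamiltonN JA opprK /y; move: (J (rsubmx v)) => u.
      by apply/rowP => i; rewrite !mxE; field.
    have eE : (- (A - rsubmx v) = rsubmx v - A)%R by rewrite opprB.
    rewrite eE eq1 eq2.
    have eq3 : (lsubmx v - (lsubmx v + d))%R = (- d)%R by rewrite opprD addrA subrr add0r.
    have eq4 : (2^-1 *: (lsubmx v + (lsubmx v + d)))%R = (lsubmx v + 2^-1 *: d)%R.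
      by apply/rowP => i; rewrite !mxE; field.
    rewrite eq3 eq4 subrK hamiltonN -/(w3 v d).
    have -> : gauss 4^-1 (- d)%R = gauss 4^-1 d by rewrite /gauss dotvNl dotvNr opprK.
    have /andP[a10 h1] := b1 (row_mx x (rsubmx v - A))%R.
    have /andP[a20 h2] := b2 (row_mx (d + y) A)%R.
    have h2' : (a2 (row_mx (d + y) A) <= L2 * (C2 * jb d ^+ P2 * m2 (row_mx y A)))%R.
      apply: (le_trans h2); rewrite ler_wpM2l ?(ltW L20) //; apply: (le_trans (mod2.2 _ (row_mx y A))).
      rewrite opp_row_mx add_row_mx addrK subrr ler_wpM2r ?(ltW (mod2.1 _)) // ler_wpM2l //.
      rewrite lerXn2r ?nnegrE ?japanese_ge0 //; apply: le_japanese.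
      by rewrite dotv_row dotv0l addr0.
    have -> : sigma_weight v x = (m1 (row_mx x (rsubmx v - A)) * m2 (row_mx y A))%R by [].
    apply: ler_mul_weights h2' => //; first exact: gauss_ge0.
    by rewrite invr_ge0 japaneseX_ge0.
  rewrite (m3_fine v) -EFinM lee_fin.
  set U := jb (v - gam)%R; have U0 : (0 < U)%R by exact: japanese_gt0.
  have W0 := japaneseX_gt0 (w3 v d - gam)%R M.
  have hW : (jb (w3 v d - gam) ^- M <= 2 ^+ M * jb d ^+ (M + M) * U ^- M)%R.
    rewrite ler_pdivlMr ?exprn_gt0 // mulrC ler_pdivrMr //.
    have : (U ^+ M <= 2 ^+ M * jb (w3 v d - gam) ^+ M * (jb d * jb d) ^+ M)%R.
      apply: expr_le_mul3; first exact: ltW.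
      rewrite /U (_ : (v - gam)%R = ((w3 v d - gam) - row_mx (2^-1 *: d) (- J d))%R); last first.
        by rewrite [RHS]addrAC; congr (_ - _)%R; rewrite /w3 (opp_row_mx (2^-1 *: d)%R (- J d)%R) add_row_mx addrK opprK subrK hsubmxK.
      apply: (le_trans (japaneseB _ _)); apply: ler_wpM2l; first exact: mulr_ge0 (ler0n R 2) (japanese_ge0 _).
      apply: (le_trans (japanese_row _ _)); rewrite japaneseN japanese_hamilton.
      by rewrite ler_wpM2r ?japanese_ge0 // japanese_half.
    by rewrite exprMn -exprD mulrAC.
  have h3 := H3 v gam; rewrite -/U in h3.
  apply: (@le_trans _ _ (L1 * L2 * C2 * jb d ^+ P2 * gauss 4^-1 d *
      (2 ^+ M * jb d ^+ (M + M) * U ^- M) * (C3 * U ^+ P3 * fine (M3 gam)))%R).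
    have q0 : (0 <= L1 * L2 * C2 * jb d ^+ P2 * gauss 4^-1 d)%R.
      by rewrite !mulr_ge0 ?gauss_ge0 ?japaneseX_ge0 // ltW.
    apply: ler_pM h3; [exact: ltW|exact: ltW|exact: (ler_wpM2l q0 hW)].
  rewrite le_eqVlt; apply/orP; left; apply/eqP.
  have eM : (U ^+ M = U ^+ P3 * U ^+ D0)%R by rewrite /M exprD.
  rewrite (exprD (jb d) P2) eM /K; apply: mul_weights_collect; exact: exprn_gt0.
apply: (@le_trans _ _ (\int[mu (k + k)]_v ((K * Cg * japanese_mass R k) * jb (v - gam) ^- D0)%:E)).
  apply: le_integral_nm => v.
    apply: integral_ge0 => d _; apply: integral_ge0 => x _.
    rewrite lee_fin !mulr_ge0 ?invr_ge0 ?gauss_ge0 ?japaneseX_ge0 ?a1p ?a2p //.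
  apply: (@le_trans _ _ (\int[mu k]_d (K * jb (v - gam) ^- D0 * (jb d ^+ (P2 + (M + M)) * gauss 4^-1 d))%:E)).
    apply: le_integral_nm => d; last exact: inner.
    apply: integral_ge0 => x _.
    rewrite lee_fin !mulr_ge0 ?invr_ge0 ?gauss_ge0 ?japaneseX_ge0 ?a1p ?a2p //.
  rewrite [X in _ <= X](_ : _ = ((K * jb (v - gam) ^- D0 * Cg) * japanese_mass R k)%:E); last first.
    by congr (_%:E); move: (jb (v - gam) ^- D0)%R => u; ring.
  have q0 : (0 <= K * jb (v - gam) ^- D0)%R by rewrite mulr_ge0 ?invr_ge0 ?japaneseX_ge0.
  apply: integral_decay_le => d; first by rewrite mulr_ge0 // mulr_ge0 ?gauss_ge0 ?japaneseX_ge0.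
  rewrite mulrCA; apply: (ler_wpM2l q0); apply: le_trans (HCg d).
  by rewrite mulrA -exprD addnC.
have q0 : (0 <= K * Cg * japanese_mass R k)%R := mulr_ge0 (mulr_ge0 K0 Cg0) (japanese_mass_ge0 R k).
rewrite (integral_rV_translate (- gam)%R (f := fun v => (K * Cg * japanese_mass R k * jb v ^- D0)%:E)).
- rewrite [X in _ <= X](_ : _ = (K * Cg * japanese_mass R k * japanese_mass R (k + k))%:E); last by congr (_%:E); rewrite /K; ring.
  apply: integral_decay_le => v; first by rewrite mulr_ge0 ?invr_ge0 ?japaneseX_ge0.
  by rewrite mulrCA divff ?mulr1 // gt_eqF ?japaneseX_gt0.
- apply/measurable_EFinP; apply: measurable_funM; first exact: measurable_cst.
  by apply: measurable_japaneseVX; meas.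
- by move=> v; rewrite lee_fin mulr_ge0 // invr_ge0 japaneseX_ge0.
Qed.

End weight.
End phase_space.

(** * Extension of the composition *)
Section extension.
Variable R : realType.
Local Notation N := (@Normc.normc R).
Local Notation jb := (@japanese R _).
Local Notation mu := (lebesgue_rV R).
Variable n : nat.
Local Notation k := (n + n)%N.
Local Notation K := (k + k)%N.
Local Notation g := (@gauss_window R k).
Local Notation J := (@hamilton R n).

Lemma cintegral_tensor a b (f : 'rV[R]_a -> R[i]) (h : 'rV[R]_b -> R[i]) :
  is_schwartz f -> is_schwartz h ->
  cintegral (fun Z : 'rV[R]_(a + b) => f (lsubmx Z) * h (rsubmx Z)) = cintegral f * cintegral h.
Proof.
move=> sf sh; have [C1 H1] := schwartz_bound (a + a) sf; have [C2 H2] := schwartz_bound (b + b) sh.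
rewrite (@cfubini _ _ _ (fun x t => f x * h t) (C1 * C2)).
- rewrite mulrC -cintegralZ; last exact: schwartz_cintegrable.
  apply: eq_cintegral => x; rewrite cintegralZ 1?mulrC //; exact: schwartz_cintegrable.
- apply: cmeasM; first by apply: (cmeas_comp (schwartz_cmeas sf)); meas.
  by apply: (cmeas_comp (schwartz_cmeas sh)); meas.
- move=> x t; rewrite Normc.normcM mulrACA; apply: ler_pM (H1 x) (H2 t);
    exact: mulr_ge0 (japaneseX_ge0 _ _) (normc_ge0 _).
Qed.

Definition pt1 (z : 'rV[R]_(K + K)) : 'rV[R]_K := row_mx (lsubmx (lsubmx z)) (- lsubmx (rsubmx z)).
Definition pt2 (z : 'rV[R]_(K + K)) : 'rV[R]_K := row_mx (rsubmx (lsubmx z)) (- rsubmx (rsubmx z)).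

(** The extension: the coefficients of the factors are integrated against the
    composition of the corresponding atoms. *)
Definition compose (a b : schwartz R k -> R[i]) (f : schwartz R k) : R[i] :=
  ((atom_const R K)^-1)%:C * cintegral (fun z => coef a (pt1 z) * coef b (pt2 z) * coef (weyl_dual f) z).

Lemma measurable_pt1 : measurable_fun setT pt1. Proof. by rewrite /pt1; meas. Qed.
Lemma measurable_pt2 : measurable_fun setT pt2. Proof. by rewrite /pt2; meas. Qed.

Let q1 (z : 'rV[R]_(K + K)) := lsubmx (lsubmx z) + 2^-1 *: J (- rsubmx (rsubmx z)).
Let q2 (z : 'rV[R]_(K + K)) := rsubmx (lsubmx z) - 2^-1 *: J (- lsubmx (rsubmx z)).
(** Difference and midpoint of the two shifted positions: up to a phase, the atoms
    at pt1 z and pt2 z compose to exp(- |sep z|^2 / 4) times the atom at ctr z. *)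
Definition sep z := q1 z - q2 z.
Definition ctr (z : 'rV[R]_(K + K)) : 'rV[R]_K := row_mx (2^-1 *: (q1 z + q2 z))
  (- lsubmx (rsubmx z) - rsubmx (rsubmx z) + J (q1 z - q2 z)).

Lemma normc_coef_weyl_dual f z : is_schwartz f ->
  N (coef (weyl_dual f) z) = N (weyl_const R n) * gauss 4^-1 (sep z) * N (stftz g f (ctr z)).
Proof.
move=> sf.
have e : z = row_mx (row_mx (lsubmx (lsubmx z)) (rsubmx (lsubmx z)))
    (- row_mx (- lsubmx (rsubmx z)) (- rsubmx (rsubmx z))).
  by rewrite (opp_row_mx (- lsubmx (rsubmx z)) (- rsubmx (rsubmx z))) !opprK !hsubmxK.
rewrite {1}e coef_weyl_dual // /stftz /ctr row_mxKl row_mxKr /sep.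
rewrite (Normc.normcM (_ * _)) (Normc.normcM (weyl_const R n * _)) (Normc.normcM (weyl_const R n)).
by rewrite normc_expi mulr1 normcR (ger0_norm (gauss_ge0 _ _)).
Qed.

Section weights.
Variables m1 m2 : 'rV[R]_K -> R.
Variables (C1 C2 : R) (P1 P2 : nat).
Hypothesis C1_ge0 : (0 <= C1)%R.
Hypothesis C2_ge0 : (0 <= C2)%R.
Hypothesis mod1 : moderate C1 P1 m1.
Hypothesis mod2 : moderate C2 P2 m2.
Hypothesis m3_fin : exists w, (m3 m1 m2 w < +oo)%E.
Local Notation M3 := (fun w => fine (m3 m1 m2 w)).

Lemma compose_estimate : exists C M, 0 <= C /\ forall a b L1 L2 gam h D,
  tempered a -> tempered b -> 0 < L1 -> 0 < L2 ->
  (forall z, N (coef a z) <= L1 * m1 z) -> (forall z, N (coef b z) <= L2 * m2 z) ->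
  cmeas h -> 0 <= D -> (forall z, N (h z) <= D * (gauss 4^-1 (sep z) * jb (ctr z - gam) ^- M)) ->
  cintegrable (fun z => coef a (pt1 z) * coef b (pt2 z) * h z) /\
  N (cintegral (fun z => coef a (pt1 z) * coef b (pt2 z) * h z)) <= 2 * (D * (C * L1 * L2 * M3 gam)).
Proof.
have [C [M [C0 H]]] := composition_weight C1_ge0 C2_ge0 mod1 mod2 m3_fin.
exists C, M; split=> // a b L1 L2 gam h D ta tb L10 L20 ha hb mh D0 hh.
have ma := cmeas_coef ta; have mb := cmeas_coef tb.
pose u z := N (coef a (pt1 z)) * N (coef b (pt2 z)) * gauss 4^-1 (sep z) * jb (ctr z - gam) ^- M.
have mu_ : measurable_fun setT u.
  apply: measurable_funM; last by apply: measurable_japaneseVX; rewrite /ctr /q1 /q2; meas.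
  apply: measurable_funM; last by rewrite /sep /q1 /q2; meas.
  apply: measurable_funM; apply: measurable_normc.
    exact: (cmeas_comp ma measurable_pt1).
  exact: (cmeas_comp mb measurable_pt2).
have u0 z : 0 <= u z by rewrite /u !mulr_ge0 ?invr_ge0 ?normc_ge0 ?gauss_ge0 ?japaneseX_ge0.
have Iu : (\int[mu (K + K)]_z (u z)%:E <= (C * L1 * L2 * M3 gam)%:E)%E.
  apply: (H (fun z => N (coef a z)) (fun z => N (coef b z)) L1 L2 gam) => //.
  - exact: measurable_normc.
  - exact: measurable_normc.
  - by move=> z; rewrite normc_ge0 ha.
  - by move=> z; rewrite normc_ge0 hb.
have IDu : (\int[mu (K + K)]_z (D * u z)%:E <= (D * (C * L1 * L2 * M3 gam))%:E)%E.
  under eq_integral do rewrite EFinM.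
  rewrite ge0_integralZl_EFin //=.
  - by rewrite [X in (_ <= X)%E]EFinM; apply: lee_wpmul2l => //; rewrite lee_fin.
  - by move=> z _; rewrite lee_fin.
  - exact/measurable_EFinP.
have mf : cmeas (fun z => coef a (pt1 z) * coef b (pt2 z) * h z).
  apply: cmeasM => //; apply: cmeasM.
    exact: (cmeas_comp ma measurable_pt1).
  exact: (cmeas_comp mb measurable_pt2).
have bf z : N (coef a (pt1 z) * coef b (pt2 z) * h z) <= D * u z.
  rewrite (Normc.normcM (_ * _)) (Normc.normcM (coef a _)) /u.
  apply: (le_trans (ler_wpM2l (mulr_ge0 (normc_ge0 _) (normc_ge0 _)) (hh z))).
  by rewrite le_eqVlt; apply/orP; left; apply/eqP; ring.
split; last exact: (normc_cintegral_le mf bf IDu).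
by apply: (cintegrable_le mf bf); apply: (le_lt_trans IDu); exact: ltry.
Qed.

Lemma compose_bound_schwartz : exists C q, 0 <= C /\ forall a b L1 L2 f,
  tempered a -> tempered b -> 0 < L1 -> 0 < L2 ->
  (forall z, N (coef a z) <= L1 * m1 z) -> (forall z, N (coef b z) <= L2 * m2 z) ->
  is_schwartz f ->
  cintegrable (fun z => coef a (pt1 z) * coef b (pt2 z) * coef (weyl_dual f) z) /\
  N (cintegral (fun z => coef a (pt1 z) * coef b (pt2 z) * coef (weyl_dual f) z))
  <= C * L1 * L2 * schwartz_norm q f.
Proof.
have [C [M [C0 H]]] := compose_estimate.
have [D [q [D0 HD]]] := stftz_bound M (schwartz_gauss_window R k).
have M30 : 0 <= M3 0 by rewrite fine_ge0 // ltW // (m3_gt0 C1_ge0 C2_ge0 mod1 mod2).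
exists (2 * (N (weyl_const R n) * D * (C * M3 0))), q; split; first by rewrite !mulr_ge0 ?normc_ge0.
move=> a b L1 L2 f ta tb L10 L20 ha hb sf.
have S0 := schwartz_norm_ge0 q sf.
have Q0 : 0 <= N (weyl_const R n) * (D * schwartz_norm q f) by rewrite !mulr_ge0 ?normc_ge0.
have [|I B] := H a b L1 L2 0 (coef (weyl_dual f)) _ ta tb L10 L20 ha hb (cmeas_coef (tempered_weyl_dual sf)) Q0.
  move=> z; rewrite normc_coef_weyl_dual // subr0 mulrACA [_ * gauss _ _]mulrC mulrACA.
  rewrite [leRHS](_ : _ = gauss 4^-1 (sep z) * N (weyl_const R n) * (D * schwartz_norm q f * jb (ctr z) ^- M)); last by ring.
  apply: ler_wpM2l; first by rewrite mulr_ge0 ?gauss_ge0 ?normc_ge0.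
  by rewrite ler_pdivlMr ?japaneseX_gt0 // mulrC; exact: HD.
split=> //; apply: (le_trans B); rewrite le_eqVlt; apply/orP; left; apply/eqP; ring.
Qed.

End weights.

Lemma weyl_dual_linr (F : 'rV[R]_K -> R[i]) c (f h : 'rV[R]_k -> R[i]) : is_schwartz f -> is_schwartz h -> is_schwartz F ->
  cintegral (fun X => weyl_map F X * (c * f X + h X)) =
  c * cintegral (fun X => weyl_map F X * f X) + cintegral (fun X => weyl_map F X * h X).
Proof.
move=> sf sh sF; have sW := schwartz_weyl_map sF.
have s1 := schwartz_mul sW sf; have s2 := schwartz_mul sW sh.
rewrite -cintegralZ; last exact: schwartz_cintegrable.
rewrite -cintegralD; [|exact/cintegrableZ/schwartz_cintegrable|exact: schwartz_cintegrable].
by apply: eq_cintegral => X; rewrite mulrDr mulrCA.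
Qed.

Lemma coef_weyl_dual_lin c (f h : schwartz R k) z :
  coef (weyl_dual (c *: f + h)) z = c * coef (weyl_dual f) z + coef (weyl_dual h) z.
Proof.
have sf := is_schwartz_val f; have sh := is_schwartz_val h.
have [sm e] := to_schwartz_lin c sf sh; rewrite !to_schwartz_val in e.
rewrite /coef /weyl_dual -e (to_schwartzE sm); apply: weyl_dual_linr => //.
exact: is_schwartz_val.
Qed.

Lemma coef_lin c (a b : schwartz R k -> R[i]) z : coef (c *: a + b) z = c * coef a z + coef b z.
Proof. by []. Qed.

Lemma coef_distr (f : schwartz R k) p xi : coef (distr_of f) (row_mx p (- xi)) = stft g f p xi.
Proof.
rewrite /coef row_mxKl row_mxKr opprK /distr_of to_schwartzE //.
exact/schwartz_atom/schwartz_gauss_window.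
Qed.

(** The product of the transforms of f and h is the transform of their tensor
    product, and tempered_coef applies to the latter and to weyl_dual. *)
Lemma compose_schwartz (f h : schwartz R k) : is_schwartz (weyl_comp f h) /\
  compose (distr_of f) (distr_of h) = distr_of (weyl_comp f h).
Proof.
have sf := is_schwartz_val f; have sh := is_schwartz_val h.
have sT := schwartz_tensor sf sh; have sg := schwartz_gauss_window R k.
have sW := schwartz_weyl_map sT.
split; first exact: sW.
apply/funext => w; have sw := is_schwartz_val w.
have i0 := atom_const_gt0 R K.
have := tempered_coef (tempered_weyl_dual sw) sT.
rewrite {2}/weyl_dual (to_schwartzE sT) => e.
rewrite /compose (_ : cintegral _ = (atom_const R K)%:C * distr_of (weyl_comp f h) w).
  by rewrite mulrA -rmorphM mulVf ?gt_eqF // mul1r.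
rewrite -[RHS]e; apply: eq_cintegral => z; congr (_ * _).
rewrite /pt1 /pt2 !coef_distr /stft.
rewrite -(cintegral_tensor (schwartz_mul_atom _ _ (schwartz_multiplier sg) sf)
  (schwartz_mul_atom _ _ (schwartz_multiplier sg) sh)).
apply: eq_cintegral => Y; rewrite [LHS]mulrACA; congr (_ * _).
rewrite /atom mulrACA -expiD; congr (expi _ * _).
  by rewrite [RHS]dotv_split.
rewrite /gauss_window -rmorphM; congr (_%:C).
rewrite -(gauss_row 1) -(linearB lsubmx) -(linearB rsubmx).
by rewrite hsubmxK.
Qed.

End extension.

(** * Norms of the symbol space *)
Section symbol_norm.
Variable R : realType.
Local Notation N := (@Normc.normc R).
Local Notation jb := (@japanese R _).

Lemma le_small (x y c : R) : (forall e, 0 < e -> e <= 1 -> x <= y + c * e) -> x <= y.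
Proof.
move=> H; have [//|xy] := leP x y; pose d := x - y; have d0 : 0 < d by rewrite subr_gt0.
have c1 : 0 < 2 * (`|c| + d) by rewrite mulr_gt0 // ltr_wpDl.
pose e := d / (2 * (`|c| + d)).
have e0 : 0 < e by rewrite divr_gt0.
have e1 : e <= 1.
  rewrite ler_pdivrMr // mul1r; have := normr_ge0 c; lra.
have := H e e0 e1; have : c * e <= d / 2.
  apply: (le_trans (ler_wpM2r (ltW e0) (ler_norm c))).
  rewrite /e mulrA ler_pdivrMr // [leRHS](_ : _ = (`|c| + d) * d); last by field.
  by rewrite ler_wpM2r ?(ltW d0) // lerDl ltW.
by rewrite /d; move: (c * e) => ce; lra.
Qed.

Variables (k : nat) (G : set 'rV[R]_(k + k)) (chi : 'rV[R]_(k + k) -> R[i]).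
Variable m : 'rV[R]_(k + k) -> R.
Hypothesis G0 : G 0.
Hypothesis m_gt0 : forall w, 0 < m w.

Lemma Stilde_bound_ge0 a L : Stilde_bound G chi m a L -> 0 <= L.
Proof.
move=> /(_ 0 G0) h; have : (0 <= (L * m 0)%:E)%E by apply: le_trans h; exact: Lnorm_ge0.
by rewrite lee_fin pmulr_lge0.
Qed.

Lemma Stilde_bound_le a L L' : Stilde_bound G chi m a L -> L <= L' -> Stilde_bound G chi m a L'.
Proof.
by move=> h LL g /h{}h; apply: (le_trans h); rewrite lee_fin ler_wpM2r // ltW.
Qed.

(** Any number above the infimum is a bound, since the weight is positive. *)
Lemma Stilde_norm_bound a e : (exists L, Stilde_bound G chi m a L) -> 0 < e ->
  Stilde_bound G chi m a (Stilde_norm G chi m a + e).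
Proof.
move=> [L hL] e0.
have hi : has_inf [set M | Stilde_bound G chi m a M].
  by split; [exists L|exists 0 => x; exact: Stilde_bound_ge0].
have [M hM Me] := inf_adherent e0 hi.
by apply: Stilde_bound_le hM _; exact: ltW.
Qed.

Lemma Stilde_norm_ge0 a : (exists L, Stilde_bound G chi m a L) -> 0 <= Stilde_norm G chi m a.
Proof.
move=> [L hL]; apply: lb_le_inf; first by exists L.
by move=> x; exact: Stilde_bound_ge0.
Qed.

Lemma Stilde_norm_le a L : Stilde_bound G chi m a L -> Stilde_norm G chi m a <= L.
Proof.
move=> hL; apply: ge_inf => //; exists 0 => x; exact: Stilde_bound_ge0.
Qed.

End symbol_norm.

Section main_estimate.
Variable R : realType.

Local Notation N := (@Normc.normc R).
Local Notation jb := (@japanese R _).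
Local Notation mu := (lebesgue_rV R).
Variable n : nat.
Local Notation k := (n + n)%N.
Local Notation K := (k + k)%N.

Variables (G : set 'rV[R]_K) (chi : 'rV[R]_K -> R[i]) (B : 'M[R]_K).
Hypothesis B_free : row_free B.
Hypothesis GE : G = [set v | exists z : 'rV[int]_K, v = map_mx intr z *m B].
Hypothesis chi_schwartz : is_schwartz chi.
Hypothesis chi_sum : forall rho, has_sum G (fun g => chi (rho - g)) 1.

Lemma coef_Stilde C P (m : 'rV[R]_K -> R) : 0 <= C -> moderate C P m ->
  exists2 C', 0 < C' & forall a L, tempered a -> 0 < L -> Stilde_bound G chi m a L ->
  forall z, N (coef a z) <= C' * L * m z.
Proof.
move=> C0 mm; have hs := chi_sum; rewrite GE in hs.
have [C' C'0 H] := coef_bound B_free chi_schwartz hs C0 mm.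
exists (C' + 1); first by rewrite ltr_wpDl.
move=> a L ta L0 hL z; have hv v : (L2norm (weyl_quant (fun rho => chi (rho - latpt B v)) a) <= (L * m (latpt B v))%:E)%E.
  by apply: hL; rewrite GE; exists v.
apply: (le_trans (H a L ta L0 hv z)); rewrite ler_wpM2r ?(ltW (mm.1 z)) //.
by rewrite ler_wpM2r ?(ltW L0) // lerDl.
Qed.

Section weights.
Variables m1 m2 : 'rV[R]_K -> R.
Variables (C1 C2 : R) (P1 P2 : nat).
Hypothesis C1_ge0 : (0 <= C1)%R.
Hypothesis C2_ge0 : (0 <= C2)%R.
Hypothesis mod1 : moderate C1 P1 m1.
Hypothesis mod2 : moderate C2 P2 m2.
Hypothesis m3_fin : exists w, (m3 m1 m2 w < +oo)%E.
Local Notation M3 := (fun w => fine (m3 m1 m2 w)).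

Lemma M3_gt0 w : 0 < M3 w.
Proof. by have [C [P [_ [h _]]]] := m3_moderate C1_ge0 C2_ge0 mod1 mod2 m3_fin; exact: h. Qed.

(** By weyl_quant_coef the localized composition is an integral of weyl_atom against
    the coefficients, which coef_bound bounds by m1 and m2; weyl_atom_bound and
    composition_weight then leave a decaying factor that is square integrable. *)
Lemma compose_Stilde : exists2 C, 0 <= C & forall a b L1 L2, tempered a -> tempered b ->
  0 < L1 -> 0 < L2 -> Stilde_bound G chi m1 a L1 -> Stilde_bound G chi m2 b L2 ->
  Stilde_bound G chi M3 (compose a b) (C * L1 * L2).
Proof.
have [A1 A10 H1] := coef_Stilde C1_ge0 mod1; have [A2 A20 H2] := coef_Stilde C2_ge0 mod2.
have [C [M [C0 H]]] := compose_estimate C1_ge0 C2_ge0 mod1 mod2 m3_fin.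
have [D D0 HD] := weyl_atom_bound (M + (k + k)) chi_schwartz.
have i0 := atom_const_gt0 R K.
pose w := N (weyl_const R n).
have w0 : 0 <= w by exact: normc_ge0.
pose E := (atom_const R K)^-1 * (2 * (w * D * (C * A1 * A2))).
have E0 : 0 <= E by rewrite !mulr_ge0 ?invr_ge0 // ltW.
exists (E * (japanese_mass R k + 1)); first by rewrite mulr_ge0 // addr_ge0 ?japanese_mass_ge0.
move=> a b L1 L2 ta tb L10 L20 ha hb gam Ggam.
pose b0 rho := chi (rho - gam).
have sb : is_schwartz b0 by exact: schwartz_shift.
pose X := E * L1 * L2 * M3 gam.
have X0 : 0 <= X := mulr_ge0 (mulr_ge0 (mulr_ge0 E0 (ltW L10)) (ltW L20)) (ltW (M3_gt0 gam)).
have pt x : N (weyl_quant b0 (compose a b) x) <= X * jb (x - lsubmx gam) ^- (k + k).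
  have sx := schwartz_weyl_kernel x sb.
  rewrite /weyl_quant -/(to_schwartz _) /compose Normc.normcM normcR ger0_norm ?invr_ge0 ?(ltW i0) //.
  set D' := w * D * jb (x - lsubmx gam) ^- (k + k).
  have D'0 : 0 <= D' by rewrite !mulr_ge0 ?invr_ge0 ?japaneseX_ge0.
  have bh z : N (coef (weyl_dual (to_schwartz (weyl_kernel b0 x))) z) <=
      D' * (gauss 4^-1 (sep z) * jb (ctr z - gam) ^- M).
    rewrite (to_schwartzE sx) normc_coef_weyl_dual // /D' -/w.
    apply: (ler_mul_quotient w0 (gauss_ge0 _ _) (normc_ge0 _) (japaneseX_gt0 _ _) (japaneseX_gt0 _ _) _ _ (HD gam x (ctr z))).
      by apply: japanese_leX; exact: leq_addl.
    by apply: japanese_leX; exact: leq_addr.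
  have [_ B1] := H a b (A1 * L1) (A2 * L2) gam _ D' ta tb (mulr_gt0 A10 L10) (mulr_gt0 A20 L20)
    (H1 a L1 ta L10 ha) (H2 b L2 tb L20 hb) (cmeas_coef (tempered_weyl_dual (is_schwartz_val _))) D'0 bh.
  apply: (le_trans (ler_wpM2l _ B1)); first by rewrite invr_ge0 ltW.
  rewrite le_eqVlt; apply/orP; left; apply/eqP; rewrite /X /E /D'.
  by move: (jb _ ^- _) => u; ring.
have J1 : 0 <= japanese_mass R k + 1 by rewrite addr_ge0 ?japanese_mass_ge0.
apply: (@le_trans _ _ (X * (japanese_mass R k + 1))%:E); last first.
  by rewrite lee_fin le_eqVlt; apply/orP; left; apply/eqP; rewrite /X; ring.
apply: L2norm_le; first exact: mulr_ge0.
apply: (@le_trans _ _ (\int[mu k]_x ((fun y => X ^+ 2 * jb y ^- (k + k)) (x - lsubmx gam))%:E)%E).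
  apply: le_integral_nonneg => x; rewrite sqr_ge0 /=.
  have h := pt x; apply: (@le_trans _ _ ((X * jb (x - lsubmx gam) ^- (k + k)) ^+ 2)).
    by rewrite lerXn2r // ?nnegrE ?normc_ge0 // mulr_ge0 // invr_ge0 japaneseX_ge0.
  rewrite exprMn; apply: ler_wpM2l; first exact: sqr_ge0.
  rewrite expr2 ler_piMr ?invr_ge0 ?japaneseX_ge0 // invf_le1 ?japaneseX_ge1 ?japaneseX_gt0 //.
rewrite (integral_rV_translate (- lsubmx gam) (f := fun y => (X ^+ 2 * jb y ^- (k + k))%:E)).
- apply: (@le_trans _ _ (X ^+ 2 * japanese_mass R k)%:E).
    apply: integral_decay_le => y; first by rewrite mulr_ge0 ?sqr_ge0 // invr_ge0 japaneseX_ge0.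
    by rewrite mulrCA divff ?mulr1 // gt_eqF ?japaneseX_gt0.
  rewrite lee_fin (exprMn 2 X (japanese_mass R k + 1)); apply: ler_wpM2l; first exact: sqr_ge0.
  have := japanese_mass_ge0 R k; move: (japanese_mass R k) => j j0; nra.
- apply/measurable_EFinP; apply: measurable_funM; first exact: measurable_cst.
  by apply: measurable_japaneseVX; meas.
- by move=> y; rewrite lee_fin mulr_ge0 ?sqr_ge0 // invr_ge0 japaneseX_ge0.
Qed.

Lemma compose_integrable a b f : Stilde G chi m1 a -> Stilde G chi m2 b -> is_schwartz f ->
  G 0 -> cintegrable (fun z => coef a (pt1 z) * coef b (pt2 z) * coef (weyl_dual f) z).
Proof.
move=> [ta [L1 h1]] [tb [L2 h2]] sf G0.
have [A1 A10 H1] := coef_Stilde C1_ge0 mod1; have [A2 A20 H2] := coef_Stilde C2_ge0 mod2.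
have [C [q [C0 H]]] := compose_bound_schwartz C1_ge0 C2_ge0 mod1 mod2 m3_fin.
have l1 : 0 < `|L1| + 1 by rewrite ltr_wpDl.
have l2 : 0 < `|L2| + 1 by rewrite ltr_wpDl.
have e1 (L : R) : L <= `|L| + 1 by apply: (le_trans (ler_norm L)); rewrite lerDl.
have b1 := Stilde_bound_le mod1.1 h1 (e1 L1); have b2 := Stilde_bound_le mod2.1 h2 (e1 L2).
by have [] := H a b _ _ f ta tb (mulr_gt0 A10 l1) (mulr_gt0 A20 l2) (H1 a _ ta l1 b1) (H2 b _ tb l2 b2) sf.
Qed.

Lemma tempered_compose a b : G 0 -> Stilde G chi m1 a -> Stilde G chi m2 b ->
  tempered (compose a b).
Proof.
move=> G0 Sa Sb; have [ta [L1 h1]] := Sa; have [tb [L2 h2]] := Sb; split.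
  move=> c f h; have sf := is_schwartz_val f; have sh := is_schwartz_val h.
  have I1 := compose_integrable Sa Sb sf G0; have I2 := compose_integrable Sa Sb sh G0.
  rewrite /compose mulrCA -mulrDr; congr (_ * _).
  rewrite -cintegralZ // -cintegralD //; last exact: cintegrableZ.
  apply: eq_cintegral => z; rewrite coef_weyl_dual_lin; ring.
have [A1 A10 H1] := coef_Stilde C1_ge0 mod1; have [A2 A20 H2] := coef_Stilde C2_ge0 mod2.
have [C [q [C0 H]]] := compose_bound_schwartz C1_ge0 C2_ge0 mod1 mod2 m3_fin.
have l1 : 0 < `|L1| + 1 by rewrite ltr_wpDl.
have l2 : 0 < `|L2| + 1 by rewrite ltr_wpDl.
have e1 (L : R) : L <= `|L| + 1 by apply: (le_trans (ler_norm L)); rewrite lerDl.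
have b1 := Stilde_bound_le mod1.1 h1 (e1 L1); have b2 := Stilde_bound_le mod2.1 h2 (e1 L2).
exists q, (N ((atom_const R K)^-1)%:C * (C * (A1 * (`|L1| + 1)) * (A2 * (`|L2| + 1)))) => f.
rewrite /compose Normc.normcM -(mulrA (N _)); apply: ler_wpM2l; first exact: normc_ge0.
by have [] := H a b _ _ f ta tb (mulr_gt0 A10 l1) (mulr_gt0 A20 l2) (H1 a _ ta l1 b1) (H2 b _ tb l2 b2)
  (is_schwartz_val f).
Qed.

End weights.
End main_estimate.

Theorem theorem4p2 (R : realType) (n : nat)
    (G : set 'rV[R]_((n + n) + (n + n)))
    (chi : schwartz R ((n + n) + (n + n)))
    (m1 m2 : 'rV[R]_((n + n) + (n + n)) -> R)
    (G_lattice : is_lattice G)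
    (chi_sum1 : forall rho, has_sum G (fun g => chi (rho - g)) 1)
    (m1_order : order_function m1) (m2_order : order_function m2)
    (m3_finite : exists w, (m3 m1 m2 w < +oo)%E) :
  (forall w, (m3 m1 m2 w < +oo)%E) /\
  order_function (fun w => fine (m3 m1 m2 w)) /\
  exists B : (schwartz R (n + n) -> R[i]) -> (schwartz R (n + n) -> R[i]) ->
      (schwartz R (n + n) -> R[i]),
    [/\ forall (c : R[i]) a a' b, Stilde G chi m1 a -> Stilde G chi m1 a' ->
          Stilde G chi m2 b -> B (c *: a + a') b = c *: B a b + B a' b,
        forall (c : R[i]) a b b', Stilde G chi m1 a -> Stilde G chi m2 b ->
          Stilde G chi m2 b' -> B a (c *: b + b') = c *: B a b + B a b',
        forall f g : schwartz R (n + n), is_schwartz (weyl_comp f g) /\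
          B (distr_of f) (distr_of g) = distr_of (weyl_comp f g),
        forall a b, Stilde G chi m1 a -> Stilde G chi m2 b ->
          Stilde G chi (fun w => fine (m3 m1 m2 w)) (B a b)
      & exists M : R, forall a b, Stilde G chi m1 a -> Stilde G chi m2 b ->
          Stilde_norm G chi (fun w => fine (m3 m1 m2 w)) (B a b) <=
          M * Stilde_norm G chi m1 a * Stilde_norm G chi m2 b].
Proof.
have [C1 [P1 [C10 mod1]]] := order_moderate m1_order.
have [C2 [P2 [C20 mod2]]] := order_moderate m2_order.
have [B0 fB GE] := G_lattice; have sc := is_schwartz_val chi.
have G0 : G 0.
  rewrite GE; exists 0; rewrite (_ : map_mx _ _ = 0) ?mul0mx //.
  by apply/matrixP => i j; rewrite !mxE.
split; first by move=> w; exact: (m3_lty C10 C20 mod1 mod2 m3_finite).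
split; first exact: (m3_order C10 C20 mod1 mod2 m3_finite).
have M30 := M3_gt0 C10 C20 mod1 mod2 m3_finite.
have I := @compose_integrable R n G chi B0 fB GE sc chi_sum1 m1 m2 C1 C2 P1 P2 C10 C20 mod1 mod2 m3_finite.
have [C C0 H] := @compose_Stilde R n G chi B0 fB GE sc chi_sum1 m1 m2 C1 C2 P1 P2 C10 C20 mod1 mod2 m3_finite.
exists (@compose R n); split.
- move=> c a a' b Sa Sa' Sb; apply/funext => f; have sf := is_schwartz_val f.
  have I1 := I a b f Sa Sb sf G0; have I2 := I a' b f Sa' Sb sf G0.
  rewrite -[RHS]/(c * compose a b f + compose a' b f) /compose mulrCA -mulrDr; congr (_ * _).
  rewrite -cintegralZ // -cintegralD //; last exact: cintegrableZ.
  by apply: eq_cintegral => z; rewrite coef_lin; ring.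
- move=> c a b b' Sa Sb Sb'; apply/funext => f; have sf := is_schwartz_val f.
  have I1 := I a b f Sa Sb sf G0; have I2 := I a b' f Sa Sb' sf G0.
  rewrite -[RHS]/(c * compose a b f + compose a b' f) /compose mulrCA -mulrDr; congr (_ * _).
  rewrite -cintegralZ // -cintegralD //; last exact: cintegrableZ.
  by apply: eq_cintegral => z; rewrite coef_lin; ring.
- exact: compose_schwartz.
- move=> a b Sa Sb; split.
    exact: (@tempered_compose R n G chi B0 fB GE sc chi_sum1 m1 m2 C1 C2 P1 P2 C10 C20 mod1 mod2 m3_finite).
  have [ta ha] := Sa; have [tb hb] := Sb.
  exists (C * (Stilde_norm G chi m1 a + 1) * (Stilde_norm G chi m2 b + 1)).
  apply: H => //.
  + by rewrite ltr_wpDl // (Stilde_norm_ge0 G0 mod1.1).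
  + by rewrite ltr_wpDl // (Stilde_norm_ge0 G0 mod2.1).
  + exact: (Stilde_norm_bound G0 mod1.1).
  + exact: (Stilde_norm_bound G0 mod2.1).
- exists C => a b [ta ha] [tb hb].
  set x := Stilde_norm G chi m1 a; set y := Stilde_norm G chi m2 b.
  have x0 : 0 <= x by exact: (Stilde_norm_ge0 G0 mod1.1).
  have y0 : 0 <= y by exact: (Stilde_norm_ge0 G0 mod2.1).
  apply: (@le_small _ _ _ (C * (x + y + 1))) => e e0 e1.
  have hx := Stilde_norm_bound G0 mod1.1 ha e0; have hy := Stilde_norm_bound G0 mod2.1 hb e0.
  have := H a b (x + e) (y + e) ta tb (ltr_wpDl x0 e0) (ltr_wpDl y0 e0) hx hy.
  move/(Stilde_norm_le G0 M30) => h; apply: (le_trans h).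
  rewrite -!mulrA -mulrDr; apply: ler_wpM2l => //.
  have e2 : e * e <= 1 * e by rewrite ler_wpM2r // ltW.
  by move: e2; rewrite mulrDl !mulrDr mul1r; move: (x * y) (e * e) => p r; lra.
Qed.
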